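(* Let $d\ge 2$ and let $\Omega$ be $\mathbb{T}^d$ or $\mathbb{R}^d$. Let $T>0$, $p\ge 3$, $\theta\in(0,\frac13)$, $\beta\in(0,1)$, and let $v\in L^{p}((0,T);B^\theta_{3,\infty}(\Omega))\cap L^{2p/3}((0,T);B^\beta_{2,\infty}(\Omega))$ be a weak solution of the incompressible Euler equations on $\Omega\times(0,T)$. Suppose that there exists a closed set of times $S_T\subset(0,T)$ with upper Minkowski dimension $\overline{\dim}_{\mathcal M}S_T=\gamma<1$ such that $v$ is conservative on $S_T^c\times\Omega$. Then $v$ conserves the kinetic energy if $$\frac{2\beta}{1-3\theta+2\beta}>1-\frac{p-3}{p}(1-\gamma).$$
   Context: The incompressible Euler equations are $\partial_t v+\operatorname{div}(v\otimes v)+\nabla \pi=0$, $\operatorname{div} v=0$ on $\Omega\times(0,T)$, with $v$ the velocity and $\pi$ the scalar pressure; a weak solution is a solution in the sense of distributions. For $q\in[1,\infty]$ and $\theta\in(0,1)$, $B^\theta_{q,\infty}(\Omega)=\{f\in L^q(\Omega): [f]_{B^\theta_{q,\infty}(\Omega)}<\infty\}$ with $[f]_{B^\theta_{q,\infty}(\Omega)}=\sup_{h\neq0}\frac{\|f(\cdot+h)-f(\cdot)\|_{L^q(\Omega)}}{|h|^\theta}$ and norm $\|f\|_{B^\theta_{q,\infty}}=\|f\|_{L^q}+[f]_{B^\theta_{q,\infty}}$. The kinetic energy is $e_v(t)=\frac12\int_\Omega|v(x,t)|^2\,dx$. ''$v$ conserves the kinetic energy'' (is a conservative solution) means $e_v'\equiv0$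 in $\mathcal{D}'((0,T))$, i.e. $\langle e_v',\varphi\rangle=0$ for all $\varphi\in C_c^\infty((0,T))$. ''$v$ is conservative on $S_T^c\times\Omega$'' means that $\langle e_v',\varphi\rangle=0$ for all $\varphi\in C^\infty_c((0,T)\setminus S_T)$, i.e. the distribution $e_v'$ is supported in $S_T$. For a bounded set $S\subset\mathbb{R}$, the upper Minkowski dimension is $\overline{\dim}_{\mathcal M}S=\inf\{s\ge0:\limsup_{\delta\to0^+}\delta^{s-1}\mathcal{H}^1(\{t\in\mathbb{R}:\operatorname{dist}(t,S)\le\delta\})=0\}$, where $\mathcal{H}^1$ is one-dimensional Hausdorff (Lebesgue) measure. *)

(* Defs.v *)
From HB Require Import structures.
From mathcomp Require Import all_boot all_order all_algebra.
From mathcomp Require Import all_classical all_reals all_analysis.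
From mathcomp Require Import measurable_realfun.

Set Implicit Arguments.
Unset Strict Implicit.
Unset Printing Implicit Defensive.

Import Order.TTheory GRing.Theory Num.Theory.
Import numFieldNormedType.Exports.

Local Open Scope classical_set_scope.
Local Open Scope ring_scope.

Definition measure_rV_display : measure_display -> measure_display.
Proof. exact. Qed.

(** The sigma-algebra generated by the coordinates, as for [n.-tuple T]. *)
Section measurable_rV.
Context {d} {T : measurableType d}.
Variable n : nat.

Let coors : 'I_n -> 'rV[T]_n -> T := fun i x => x ord0 i.

Let rV_set0 : g_sigma_preimage coors set0.
Proof. exact: sigma_algebra0. Qed.

Let rV_setC A : g_sigma_preimage coors A -> g_sigma_preimage coors (~` A).
Proof. exact: sigma_algebraC. Qed.

Let rV_bigcup (F : _^nat) : (forall i, g_sigma_preimage coors (F i)) ->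
  g_sigma_preimage coors (\bigcup_i (F i)).
Proof. exact: sigma_algebra_bigcup. Qed.

HB.instance Definition _ := @isMeasurable.Build (measure_rV_display d)
  ('rV[T]_n) (g_sigma_preimage coors) rV_set0 rV_setC rV_bigcup.

End measurable_rV.

Section measurable_rV_lemmas.
Context d1 d2 (T1 : measurableType d1) (T2 : measurableType d2) (n : nat).

Lemma measurable_coord (i : 'I_n) :
  measurable_fun [set: 'rV[T2]_n] (fun x : 'rV[T2]_n => x ord0 i).
Proof.
move=> _ Y mY; rewrite setTI; apply: sub_sigma_algebra => /=.
rewrite -bigcup_seq/=; exists i => /=; first by rewrite mem_index_enum.
by exists Y => //; rewrite setTI.
Qed.

Lemma measurable_fun_rVP (f : T1 -> 'rV[T2]_n) :
  (forall i, measurable_fun setT (fun x => f x ord0 i)) ->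
  measurable_fun setT f.
Proof.
move=> mf _ Y mY.
have : <<s \big[setU/set0]_(i < n) preimage_set_system setT
    (fun x : 'rV[T2]_n => x ord0 i) measurable >> Y by exact: mY.
suff H : <<s \big[setU/set0]_(i < n) preimage_set_system setT
    (fun x : 'rV[T2]_n => x ord0 i) measurable >> `<=`
    [set A | measurable (f @^-1` A)] by move=> /H; rewrite setTI.
apply: smallest_sub.
  split => /=.
  - by rewrite preimage_set0.
  - by move=> A mA; rewrite setTD -preimage_setC; exact: measurableC.
  - by move=> F mF; rewrite preimage_bigcup; exact: bigcup_measurable.
move=> A; rewrite -bigcup_seq/= => -[i _ [B mB <-]].
by rewrite setTI /= -[_ @^-1` _]setTI; exact: (mf i).
Qed.

End measurable_rV_lemmas.

Section lebesgue_rV.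
Context {R : realType}.

Definition cons_rV n (z : R * 'rV[R]_n) : 'rV[R]_n.+1 :=
  row_mx (const_mx z.1 : 'rV_1) z.2.

Definition uncons_rV n (x : 'rV[R]_n.+1) : R * 'rV[R]_n :=
  (x ord0 ord0, rsubmx (x : 'rV_(1 + n))).

Lemma cons_rVK n : cancel (@cons_rV n) (@uncons_rV n).
Proof.
move=> [a x]; rewrite /uncons_rV /cons_rV row_mxKr; congr pair => /=.
rewrite mxE; case: splitP => j //=; first by rewrite mxE.
Qed.

Lemma measurable_cons_rV n : measurable_fun setT (@cons_rV n).
Proof.
apply: measurable_fun_rVP => i.
rewrite (_ : (fun _ => _) = fun z : R * 'rV[R]_n =>
    match fintype.split (i : 'I_(1 + n)) with inl j => z.1 | inr j => z.2 ord0 j end).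
  case: (fintype.split _) => j; first exact: measurable_fst.
  exact: (measurableT_comp (measurable_coord j) measurable_snd).
apply/funext => z; rewrite mxE; case: (fintype.split _) => j //.
by rewrite mxE.
Qed.

Lemma measurable_uncons_rV n : measurable_fun setT (@uncons_rV n).
Proof.
apply: measurable_fun_pair; first exact: measurable_coord.
apply: measurable_fun_rVP => i.
rewrite (_ : (fun _ => _) = fun x : 'rV[R]_n.+1 => x ord0 (rshift 1 i)).
  exact: measurable_coord.
by apply/funext => x; rewrite mxE.
Qed.

Section step.
Context n (mu : {sigma_finite_measure set 'rV[R]_n -> \bar R}).

Definition lebesgue_rVS : set 'rV[R]_n.+1 -> \bar R :=
  pushforward ((@lebesgue_measure R) \x mu)%E (@cons_rV n).

Let m := lebesgue_rVS.

Let m0 : m set0 = 0%E.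
Proof. by rewrite /m /lebesgue_rVS /pushforward preimage_set0 measure0. Qed.

Let m_ge0 A : (0 <= m A)%E.
Proof. by rewrite /m /lebesgue_rVS /pushforward measure_ge0. Qed.

Let m_sigma_additive : semi_sigma_additive m.
Proof.
have mf A : measurable A -> measurable (@cons_rV n @^-1` A).
  by move=> mA; rewrite -[_ @^-1` _]setTI; exact: measurable_cons_rV.
move=> F mF tF mUF; rewrite /m /lebesgue_rVS /pushforward preimage_bigcup.
apply: measure_semi_sigma_additive.
- by move=> i; exact: mf.
- apply/trivIsetP => i j _ _ ij; rewrite -preimage_setI.
  by move/trivIsetP : tF => /(_ _ _ _ _ ij) ->//; rewrite preimage_set0.
- by rewrite -preimage_bigcup; exact: mf.
Qed.

HB.instance Definition _ := isMeasure.Build _ _ _ lebesgue_rVS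
  m0 m_ge0 m_sigma_additive.

Let m_sigma_finite : sigma_finite setT m.
Proof.
have /sigma_finiteP[F [FT ndF Foo]] := sigma_finiteT (@lebesgue_measure R).
have /sigma_finiteP[G [GT ndG Goo]] := sigma_finiteT mu.
exists (fun i => @uncons_rV n @^-1` (F i `*` G i)).
  apply/esym; rewrite -subTset => x _.
  have [i _ Fi] : (\bigcup_i F i) (uncons_rV x).1 by rewrite -FT.
  have [j _ Gj] : (\bigcup_i G i) (uncons_rV x).2 by rewrite -GT.
  exists (maxn i j) => //; split => /=.
  - by move: Fi; exact/subsetPset/ndF/leq_maxl.
  - by move: Gj; exact/subsetPset/ndG/leq_maxr.
move=> i; have [mF Fi] := Foo i; have [mG Gi] := Goo i; split.
  rewrite -[_ @^-1` _]setTI.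
  by apply: measurable_uncons_rV => //; exact: measurableX.
rewrite /m /lebesgue_rVS /pushforward.
rewrite (_ : _ @^-1` _ = F i `*` G i).
  by rewrite product_measure1E// lte_mul_pinfty// ge0_fin_numE.
by apply/funext => z; exact: (congr1 (F i `*` G i) (cons_rVK z)).
Qed.

HB.instance Definition _ := Measure_isSigmaFinite.Build _ _ _ lebesgue_rVS
  m_sigma_finite.

End step.

Fixpoint lebesgue_rV n : {sigma_finite_measure set 'rV[R]_n -> \bar R} :=
  match n with
  | 0%N => dirac (0 : 'rV[R]_0)
  | n'.+1 => lebesgue_rVS (lebesgue_rV n')
  end.

Lemma measurable_box n (A : 'I_n -> set R) : (forall i, measurable (A i)) ->
  measurable [set x : 'rV[R]_n | forall i, A i (x ord0 i)].
Proof.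
move=> mA.
rewrite (_ : mkset _ = \bigcap_(i in [set: 'I_n])
    ((fun x : 'rV[R]_n => x ord0 i) @^-1` A i)); last first.
  by apply/seteqP; split => x /= Ax i => [_|]; exact: Ax.
apply: fin_bigcap_measurable => // i _.
by rewrite -[_ @^-1` _]setTI; exact: measurable_coord.
Qed.

Lemma lebesgue_rV_box n (A : 'I_n -> set R) : (forall i, measurable (A i)) ->
  lebesgue_rV n [set x | forall i, A i (x ord0 i)] =
  (\prod_(i < n) lebesgue_measure (A i))%E.
Proof.
elim: n A => [A _|n IH A mA].
  by rewrite big_ord0 /= diracE mem_set //= => -[].
rewrite big_ord_recl /= /lebesgue_rVS /pushforward -IH; last by move=> i.
rewrite -product_measure1E; [|exact: mA|]; last first.
  by apply: (@measurable_box n (fun i => A (lift ord0 i))) => i.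
have congr_pm (X Y : set (R * 'rV[R]_n)) : X = Y ->
    (lebesgue_measure \x lebesgue_rV n)%E X =
    (lebesgue_measure \x lebesgue_rV n)%E Y by move->.
apply: congr_pm.
apply/seteqP; split => [z Az|z [/= A0 Az] i].
  split => /= [|i].
    by have := Az ord0; rewrite mxE; case: splitP => // j _; rewrite mxE.
  have := Az (lift ord0 i); rewrite mxE; case: splitP => j /=.
    by rewrite ord1.
  by move/eqP; rewrite eqSS => /eqP/val_inj ->.
rewrite mxE; case: splitP => j ij.
  by rewrite mxE (_ : i = ord0)//; apply: val_inj; rewrite /= ij ord1.
rewrite (_ : i = lift ord0 j); first exact: Az.
exact: val_inj.
Qed.

End lebesgue_rV.

(** The torus is [R^d / Z^d]: functions on it are 1-periodic functions on
    ['rV[R]_d], integrated over the unit cell. *)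
Variant spatial_domain := Torus | WholeSpace.

Section domain.
Context {R : realType} {d : nat}.
Implicit Types (Omega : spatial_domain).

Definition cell Omega : set 'rV[R]_d :=
  match Omega with
  | Torus => [set x | forall i, 0 <= x ord0 i < 1]
  | WholeSpace => setT
  end.

Definition function_on Omega (T : Type) (f : 'rV[R]_d -> T) :=
  Omega = Torus -> forall x i, f (x + delta_mx ord0 i) = f x.

(** The norm that the library puts on ['rV[R]_d] is the sup norm. *)
Definition euclid (x : 'rV[R]_d) : R := Num.sqrt (\sum_i (x ord0 i) ^+ 2).

Definition Lq_norm Omega (q : \bar R) (f : 'rV[R]_d -> 'rV[R]_d) : \bar R :=
  Lnorm (lebesgue_rV d) q ((fun x => (euclid (f x))%:E) \_ (cell Omega)).

Definition besov_seminorm Omega (theta : R) (q : \bar R)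
    (f : 'rV[R]_d -> 'rV[R]_d) : \bar R :=
  ereal_sup [set (Lq_norm Omega q (fun x => (f (x + h) - f x)%R) *
                  ((euclid h `^ theta)^-1)%:E)%E
            | h in [set h : 'rV[R]_d | h != 0]].

Definition besov_norm Omega theta q f : \bar R :=
  (Lq_norm Omega q f + besov_seminorm Omega theta q f)%E.

(** Membership in [L^p((0,T); B^theta_{q,oo}(Omega))]. As [B^theta_{q,oo}] is
    not separable, [v] is only required to be jointly measurable in [(t,x)],
    not strongly measurable as a map into the Besov space. *)
Definition Lp_besov Omega (T : R) (p : \bar R) (theta : R) (q : \bar R)
    (v : R -> 'rV[R]_d -> 'rV[R]_d) : Prop :=
  [/\ forall t, 0 < t < T -> function_on Omega (v t),
      measurable_fun (`]0, T[ `*` setT)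
        (fun z : R * 'rV[R]_d => v z.1 z.2 : 'rV[R]_d),
      measurable_fun `]0, T[
        ((fun t => besov_norm Omega theta q (v t)) : R -> \bar R) &
      (Lnorm (@lebesgue_measure R) p
         ((fun t => besov_norm Omega theta q (v t)) \_ `]0%R, T[) < +oo)%E].

End domain.

Section smooth.
Context {R : realType} {V : normedModType R}.

Fixpoint iter_derive (s : seq V) (f : V -> R) : V -> R :=
  if s is u :: s' then fun x => 'D_u (iter_derive s' f) x else f.

Definition smooth (f : V -> R) : Prop := forall s : seq V,
  continuous (iter_derive s f) /\
  forall x u, derivable (iter_derive s f) x u.

(** Distributions are total maps on [V -> R]; only their values on test
    functions are meaningful. *)
Definition distr_deriv (u : V) (F : (V -> R) -> R) : (V -> R) -> R :=
  fun phi => - F (fun x => 'D_u phi x).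

End smooth.

Section spacetime.
Context {R : realType} {d : nat}.
Implicit Types (Omega : spatial_domain) (phi : R * 'rV[R]_d -> R).

(** A compact subset of [Omega x (0,T)] is contained in some [slab Omega a b M]
    with [0 < a] and [b < T]. *)
Definition slab Omega (a b M : R) : set (R * 'rV[R]_d) :=
  [set z | a <= z.1 <= b /\ (Omega = WholeSpace -> `|z.2| <= M)].

Definition test_in Omega (a b M : R) phi : Prop :=
  [/\ smooth phi,
      forall t, function_on Omega (fun x => phi (t, x)) &
      forall z, ~ slab Omega a b M z -> phi z = 0].

Definition test_function Omega (T : R) phi : Prop :=
  exists a b M, [/\ 0 < a, b < T & test_in Omega a b M phi].

Definition distribution_on Omega (T : R) (F : (R * 'rV[R]_d -> R) -> R) :=
  (forall (c : R) phi psi, test_function Omega T phi ->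
     test_function Omega T psi ->
     F (fun z => c * phi z + psi z) = c * F phi + F psi) /\
  (forall a b M : R, 0 < a -> b < T -> exists (C : R) (N : nat),
     forall phi, test_in Omega a b M phi ->
     forall A : R,
       (forall s : seq (R * 'rV[R]_d), (size s <= N)%N ->
          (forall u, u \in s -> `|u| <= 1) ->
          forall z, `|iter_derive s phi z| <= A) ->
       `|F phi| <= C * A).

Definition distr_of Omega (T : R) (f : R * 'rV[R]_d -> R)
    : (R * 'rV[R]_d -> R) -> R := fun phi =>
  \int[(@lebesgue_measure R \x lebesgue_rV d)%E]_(z in `]0, T[ `*` cell Omega)
    (f z * phi z).

Definition dir_t : R * 'rV[R]_d := (1, 0).
Definition dir_x (i : 'I_d) : R * 'rV[R]_d := (0, delta_mx ord0 i).

(** The momentum equation is [d_t v_i + sum_j d_j (v_i v_j) + d_i pi = 0] for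
    every [i]; the pressure [pi] is an arbitrary distribution. *)
Definition weak_euler Omega (T : R) (v : R -> 'rV[R]_d -> 'rV[R]_d) : Prop :=
  let vc i := fun z : R * 'rV[R]_d => v z.1 z.2 ord0 i in
  (exists2 pi, distribution_on Omega T pi &
     forall i phi, test_function Omega T phi ->
       distr_deriv dir_t (distr_of Omega T (vc i)) phi
       + \sum_j distr_deriv (dir_x j)
                  (distr_of Omega T (fun z => vc i z * vc j z)) phi
       + distr_deriv (dir_x i) pi phi = 0) /\
  (forall phi, test_function Omega T phi ->
     \sum_j distr_deriv (dir_x j) (distr_of Omega T (vc j)) phi = 0).

Definition kinetic_energy Omega (v : R -> 'rV[R]_d -> 'rV[R]_d) (t : R) : R :=
  2^-1 * \int[lebesgue_rV d]_(x in cell Omega) (euclid (v t x) ^+ 2).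

Definition test_function_line (U : set R) (phi : R -> R) : Prop :=
  smooth phi /\
  exists K, [/\ compact K, K `<=` U & forall t, ~ K t -> phi t = 0].

(** [e_v' = 0] in [D'(U)]; meaningful for open subsets [U] of [(0,T)]. *)
Definition conservative_on Omega (T : R) (U : set R)
    (v : R -> 'rV[R]_d -> 'rV[R]_d) : Prop :=
  forall phi : R -> R, test_function_line U phi ->
    distr_deriv (1 : R) (fun psi =>
      \int[@lebesgue_measure R]_(t in `]0, T[)
        (kinetic_energy Omega v t * psi t)) phi = 0.

Definition conserves_kinetic_energy Omega (T : R)
    (v : R -> 'rV[R]_d -> 'rV[R]_d) : Prop :=
  conservative_on Omega T `]0, T[ v.

End spacetime.

(** [edist_inf set0 t] is [+oo], so that the empty set has dimension [0]. *)
Definition upper_minkowski_dim {R : realType} (S : set R) : \bar R :=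
  ereal_inf [set s%:E | s in [set s : R | 0 <= s /\
    limf_esup (fun delta : R => (delta `^ (s - 1))%:E *
      lebesgue_measure [set t : R | edist_inf S t <= delta%:E])%E 0^'+ = 0%E]].

(* Main.v *)
(* Let K_eps be smooth radial kernels at scale eps, of mass bounded below, and
   E_eps(t) = 1/2 iint K_eps(h) u(x + h).u(x) dx dh.  Its difference with the
   kinetic energy times the mass of K_eps is a second-order increment,
   O(eps^(2 beta) [u]^2_{B^beta_2}).
   The kernel K_eps - K_L is - div N for a field N with symmetric Jacobian, and
   M_ij = delta_ij (K_eps - K_L) + d_j N_i is divergence free in i; using M to
   mollify the equation removes the pressure, while M * u = (K_eps - K_L) * u
   because N has a symmetric Jacobian and u is divergence free.  Hence
   d/dt (E_eps - E_L) is a cubic flux of increments,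
   O(eps^(3 theta - 1) [u]^3_{B^theta_3}), and E_L contributes nothing in the
   limit of large L.
   For a test function phi, let chi be a cutoff to the delta-neighbourhood of S:
   by hypothesis the energy derivative vanishes on phi (1 - chi), and on phi chi
   Hoelder's inequality in time with |S_delta| <= delta^(1 - s), s in ]gamma, 1[,
   combined with the choice eps = delta^(1 / (1 - 3 theta + 2 beta)), bounds it
   by a positive power of delta. *)

From HB Require Import structures.
Require Import Defs.
From mathcomp Require Import all_boot all_order all_algebra.
From mathcomp Require Import all_classical all_reals all_analysis.
From mathcomp Require Import measurable_realfun.
From mathcomp Require Import ring lra zify.

Set Implicit Arguments.
Unset Strict Implicit.
Unset Printing Implicit Defensive.

Import Order.TTheory GRing.Theory Num.Theory.
Import numFieldNormedType.Exports.

Local Open Scope classical_set_scope.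
Local Open Scope ring_scope.

(** * Smooth functions *)

(** The obstacle is time: [u] is merely measurable in [t], so the equation cannot be multiplied by
    [u] and E_eps has no evident derivative. Only linear quantities are accessible: at almost every
    point a mollified velocity is a constant plus a primitive in time. For the quadratic E_eps,
    evenness of the kernel writes E(t') - E(t) as half the pairing of the mollified increment with
    u(t) + u(t'): an integral over r in ]t, t'] of a flux whose velocity is frozen at t or t'.
    Unfreezing it costs C (A(t') - A(t))^2, with A a primitive of the squared L^2 norm, and
    bisection shows that such errors sum to nothing. The second scale L is forced by the pressure:
    being an arbitrary distribution, it is avoided only by divergence-free fields, hence by kernels
    - div N with N compactly supported, whose mass is zero. The potential field of one radial kernel
    is h/|h|^d far away, the same for all scales, so differences qualify. As L grows, E_L tends to 0
    on the whole space; on the torus it approaches a quantity constant in time, given by the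
    conserved mean velocity, which the derivative of a test function does not see. *)

Section smooth_closure0.
Context {R : realType} {V : normedModType R}.
Implicit Types f g : V -> R.

Lemma smooth_continuous f : smooth f -> continuous f.
Proof. by move=> /(_ [::])[]. Qed.

Lemma smooth_derivable f x u : smooth f -> derivable f x u.
Proof. by move=> /(_ [::])[_ /(_ x u)]. Qed.

Lemma smooth_derive f u : smooth f -> smooth (fun x => 'D_u f x).
Proof.
move=> sf s.
suff -> : iter_derive s (fun x => 'D_u f x) = iter_derive (rcons s u) f.
  exact: sf.
by elim: s => //= w s ->.
Qed.

End smooth_closure0.

Section smooth_closure.
Context {R : realType} {V : normedModType R}.
Implicit Types f g : V -> R.

Lemma derive_line f x u :
  'D_u f x = 'D_1 (fun h : R => f (h *: u + x)) (0 : R).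
Proof.
rewrite /derive; set g1 := fun h => h^-1 *: _; set g2 := fun h => h^-1 *: _.
suff -> : g1 = g2 by [].
by rewrite funeqE /g1 /g2 => h /=; rewrite addr0 scale0r add0r [_%:A]mulr1.
Qed.

Lemma is_derive_line f x u l : is_derive x u f l <->
  is_derive (0 : R) (1 : R) (fun h : R => f (h *: u + x)) l.
Proof.
split=> -[df dfl].
  by split; [exact: (derivable1P f x u).1 | rewrite -derive_line].
by split; [exact: (derivable1P f x u).2 | rewrite derive_line].
Qed.

Lemma is_derive_comp (g : R -> R) f x u dg df :
  is_derive (f x) (1 : R) g dg -> is_derive x u f df ->
  is_derive x u (fun y => g (f y)) (dg * df).
Proof.
move=> dgx dfx; apply/is_derive_line.
have H : is_derive (0 : R) (1 : R) (fun h : R => f (h *: u + x)) df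
  by apply/is_derive_line.
have := @is_derive1_comp R g (fun h : R => f (h *: u + x)) 0 dg df.
by rewrite scale0r add0r => /(_ dgx H).
Qed.

(* [smooth] is checked on iterated derivatives; it is stable under the
   operations below because the class they generate is stable under
   derivation and consists of continuous functions. *)
Inductive smooth_alg : (V -> R) -> Prop :=
| sm_base f of smooth f : smooth_alg f
| sm_add f g of smooth_alg f & smooth_alg g : smooth_alg (fun x => f x + g x)
| sm_mul f g of smooth_alg f & smooth_alg g : smooth_alg (fun x => f x * g x)
| sm_powR f (a : R) of (forall x, 0 < f x) & smooth_alg f :
    smooth_alg (fun x => f x `^ a)
| sm_comp (g : R -> R) f of smooth g & smooth_alg f :
    smooth_alg (fun x => g (f x)).

Lemma smooth_cst (a : R) : smooth (fun _ : V => a).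
Proof.
move=> s; suff [b ->] : exists b : R, iter_derive s (fun _ : V => a) = cst b.
  by split=> [|x u]; [exact: cst_continuous | exact: derivable_cst].
elim: s => [|u s [b /= ->]]; first by exists a.
by exists 0; apply/funext => x; exact: derive_cst.
Qed.

(** The induction must return a derivative that lies again in the class, since existence alone would
    not iterate. For powers, positivity of [f] makes the real power differentiable at [f x], and its
    exponent [a - 1] stays within the same constructor. *)
Lemma smooth_alg_derive f : smooth_alg f -> continuous f /\
  forall u, exists2 df, smooth_alg df & forall x, is_derive x u f (df x).
Proof.
elim=> {f} [f sf|f g sf [cf df] sg [cg dg]|f g sf [cf df] sg [cg dg]
  |f a f0 sf [cf df]|g f sg sf [cf df]].
- split=> [|u]; first exact: smooth_continuous.
  exists (fun x => 'D_u f x); first exact/sm_base/smooth_derive.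
  by move=> x; exact/derivableP/smooth_derivable.
- split=> [x|u]; first by apply: cvgD; [exact: cf | exact: cg].
  have [f' sf' Df] := df u; have [g' sg' Dg] := dg u.
  exists (fun x => f' x + g' x); first exact: sm_add.
  by move=> x; exact: is_deriveD.
- split=> [x|u]; first by apply: cvgM; [exact: cf | exact: cg].
  have [f' sf' Df] := df u; have [g' sg' Dg] := dg u.
  exists (fun x => f x * g' x + g x * f' x).
    by apply: sm_add; exact: sm_mul.
  by move=> x; exact: is_deriveM.
- have D1 (y : R) : 0 < y -> is_derive y (1 : R) (fun y : R => y `^ a) (a * y `^ (a - 1)).
    by move=> y0; exact: is_derive1_powR.
  split=> [x|u].
    apply: (@continuous_comp _ _ _ f (fun y : R => y `^ a)); first exact: cf.
    apply/differentiable_continuous/derivable1_diffP.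
    by have := D1 _ (f0 x); case.
  have [f' sf' Df] := df u.
  exists (fun x => (a * f x `^ (a - 1)) * f' x).
    apply: sm_mul => //; apply: sm_mul; first exact/sm_base/smooth_cst.
    exact: sm_powR.
  by move=> x; exact: (is_derive_comp (D1 _ (f0 x)) (Df x)).
- split=> [x|u].
    apply: (@continuous_comp _ _ _ f g); first exact: cf.
    exact: smooth_continuous.
  have [f' sf' Df] := df u.
  exists (fun x => 'D_(1 : R) g (f x) * f' x).
    by apply: sm_mul => //; exact: (sm_comp (smooth_derive (1 : R) sg) sf).
  move=> x; apply: is_derive_comp => //.
  exact/derivableP/smooth_derivable.
Qed.

Lemma smooth_alg_smooth f : smooth_alg f -> smooth f.
Proof.
move=> sf s; suff H : smooth_alg (iter_derive s f).
  have [cf df] := smooth_alg_derive H; split => // x u.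
  by have [g _ /(_ x)[]] := df u.
elim: s => //= u s IH; have [_ /(_ u)[g sg dg]] := smooth_alg_derive IH.
rewrite (_ : (fun _ => _) = g)//.
by apply/funext => x; have [_] := dg x.
Qed.

Lemma smoothD f g : smooth f -> smooth g -> smooth (fun x => f x + g x).
Proof. by move=> sf sg; apply/smooth_alg_smooth/sm_add; exact: sm_base. Qed.

Lemma smoothM f g : smooth f -> smooth g -> smooth (fun x => f x * g x).
Proof. by move=> sf sg; apply/smooth_alg_smooth/sm_mul; exact: sm_base. Qed.

Lemma smooth_powR f (a : R) : (forall x, 0 < f x) -> smooth f ->
  smooth (fun x => f x `^ a).
Proof. by move=> f0 sf; apply/smooth_alg_smooth/sm_powR/sm_base. Qed.

Lemma smooth_comp (g : R -> R) f : smooth g -> smooth f ->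
  smooth (fun x => g (f x)).
Proof. by move=> sg sf; apply/smooth_alg_smooth/sm_comp/sm_base. Qed.

Lemma smoothZ (a : R) f : smooth f -> smooth (fun x => a * f x).
Proof. by move=> sf; exact: (smoothM (smooth_cst a) sf). Qed.

Lemma smoothN f : smooth f -> smooth (fun x => - f x).
Proof.
move=> sf; suff -> : (fun x => - f x) = (fun x => -1 * f x) by exact: smoothZ.
by apply/funext => x; exact: (esym (mulN1r (f x))).
Qed.

Lemma smoothB f g : smooth f -> smooth g -> smooth (fun x => f x - g x).
Proof. by move=> sf sg; exact: (smoothD sf (smoothN sg)). Qed.

Lemma smooth_sum (I : Type) (r : seq I) (P : pred I) (F : I -> V -> R) :
  (forall i, P i -> smooth (F i)) -> smooth (fun x => \sum_(i <- r | P i) F i x).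
Proof.
move=> sF; elim: r => [|i r IH].
  suff -> : (fun x => \sum_(i <- [::] | P i) F i x) = (fun=> 0).
    exact: smooth_cst.
  by apply/funext => x; rewrite big_nil.
have [Pi|Pi] := boolP (P i).
  suff -> : (fun x => \sum_(j <- i :: r | P j) F j x) =
      (fun x => F i x + \sum_(j <- r | P j) F j x) by exact: (smoothD (sF i Pi) IH).
  by apply/funext => x; rewrite big_cons Pi.
suff -> : (fun x => \sum_(j <- i :: r | P j) F j x) =
    (fun x => \sum_(j <- r | P j) F j x) by [].
by apply/funext => x; rewrite big_cons (negbTE Pi).
Qed.

Lemma smooth_linear (f : V -> R) : continuous f -> linear f -> smooth f.
Proof.
move=> cf lf.
have df u x : is_derive x u f (f u).
  apply/is_derive_line.
  rewrite (_ : (fun _ => _) = (fun h : R => h) * cst (f u) + cst (f x)).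
    apply: is_derive_eq => /=.
    by rewrite addr0 scaler0 add0r -[LHS]/(_ * _) mulr1.
  by apply/funext => h; rewrite lf.
(* The last direction of the list is the innermost one in [iter_derive]: it already turns [f] into a
   constant, and the remaining directions act on that constant. *)
move=> s; case: (lastP s) => [|{}s u].
  by split=> // x u; have [] := df u x.
have -> : iter_derive (rcons s u) f = iter_derive s (cst (f u)).
  elim: s => [|w s /= ->//].
  by apply/funext => x /=; have [_] := df u x.
exact: smooth_cst.
Qed.

End smooth_closure.

Section smooth_precomp.
Context {R : realType} {V W : normedModType R}.

Lemma is_derive_precomp (l : V -> W) (f : W -> R) (b : W) x u df : linear l ->
  is_derive (l x + b) (l u) f df -> is_derive x u (fun y => f (l y + b)) df.
Proof.
move=> ll /is_derive_line fdf; apply/is_derive_line.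
by under eq_fun do rewrite ll -addrA.
Qed.

Lemma iter_derive_precomp (l : V -> W) (b : W) (f : W -> R) s : linear l ->
  smooth f ->
  iter_derive s (fun y => f (l y + b)) =
  fun y => iter_derive (map l s) f (l y + b).
Proof.
move=> ll sf; elim: s => //= u s ->; apply/funext => x.
have [_ /(_ (l x + b) (l u))/derivableP H] := sf (map l s).
by have [_ ->] := is_derive_precomp ll H.
Qed.

Lemma smooth_precomp (l : V -> W) (b : W) (f : W -> R) : continuous l ->
  linear l -> smooth f -> smooth (fun y => f (l y + b)).
Proof.
move=> cl ll sf s; rewrite iter_derive_precomp//.
have [c d] := sf (map l s); split => [x|x u].
  apply: (@continuous_comp _ _ _ (fun y => l y + b)); last exact: c.
  by apply: cvgD; [exact: cl | exact: cvg_cst].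
by have [] := is_derive_precomp ll (derivableP (d (l x + b) (l u))).
Qed.

End smooth_precomp.

(** * Symmetry of second derivatives *)

Section schwarz.
Context {R : realType} {V : normedModType R}.
Implicit Types f : V -> R.

Lemma is_derive_smooth f x u : smooth f -> is_derive x u f ('D_u f x).
Proof. by move=> sf; apply: derivableP; exact: (smooth_derivable sf). Qed.

Lemma derive_segment f x u s : smooth f ->
  is_derive (s : R) (1 : R) (fun s : R => f (s *: u + x)) ('D_u f (s *: u + x)).
Proof.
move=> sf.
have /is_derive_line H := is_derive_smooth (s *: u + x) u sf.
apply/is_derive_line; rewrite [X in is_derive _ _ X _](_ : _ =
  (fun h : R => f (h *: u + (s *: u + x))))//.
by apply/funext => h; rewrite scalerDl [_%:A]mulr1 addrA.
Qed.

Lemma MVT_segment_smooth f x u (h : R) : smooth f -> 0 < h ->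
  exists2 s, 0 <= s <= h & f (h *: u + x) - f x = h * 'D_u f (s *: u + x).
Proof.
move=> sf h0.
have [||s sh] := @MVT R (fun s : R => f (s *: u + x))
  (fun s => 'D_u f (s *: u + x)) 0 h h0.
- by move=> s _; exact: derive_segment.
- apply: derivable_within_continuous => s _.
  by have [] := derive_segment x u s sf.
rewrite scale0r add0r subr0 mulrC => E; exists s => //.
by move: sh; rewrite in_itv/= => /andP[/ltW-> /ltW->].
Qed.

(** The mean value theorem is applied twice: in direction [u] to the increment [g] of [f] along
    [h *: v], then in direction [v] to the derivative of [f] along [u]. *)
Lemma mixed_difference f x u v (h : R) : smooth f -> 0 < h ->
  exists s t : R, [/\ 0 <= s <= h, 0 <= t <= h &
  f (h *: u + (h *: v + x)) - f (h *: v + x) - (f (h *: u + x) - f x) =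
  h ^+ 2 * 'D_v (fun y => 'D_u f y) (t *: v + (s *: u + x))].
Proof.
move=> sf h0; pose g y := f (h *: v + y) - f y.
have sg : smooth g.
  apply: (smoothB _ sf); under eq_fun do rewrite addrC.
  by apply: (@smooth_precomp _ _ _ (fun y : V => y)) => // y; exact: cvg_id.
have [s s0h E1] := MVT_segment_smooth x u sg h0.
have [t t0h E2] := MVT_segment_smooth (s *: u + x) v (smooth_derive u sf) h0.
exists s, t; split => //; rewrite expr2 -mulrA -E2.
have -> : f (h *: u + (h *: v + x)) - f (h *: v + x) - (f (h *: u + x) - f x) =
    g (h *: u + x) - g x.
  by rewrite /g (addrCA (h *: v)) opprB !opprD !opprK !addrA; ring.
rewrite E1; congr (_ * _).
have H1 : is_derive (s *: u + x) u (fun y => f (h *: v + y))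
    ('D_u f (h *: v + (s *: u + x))).
  have := @is_derive_precomp R V V (fun y => y) f (h *: v) (s *: u + x) u
    ('D_u f (h *: v + (s *: u + x))) (fun _ _ _ => erefl).
  under eq_fun do rewrite addrC; apply; rewrite addrC.
  exact: is_derive_smooth.
have H2 : is_derive (s *: u + x) u f ('D_u f (s *: u + x)).
  exact: is_derive_smooth.
by have [_] := is_deriveB H1 H2.
Qed.

Let dist_le2 (a b p e : R) : `|a - p| < e -> `|b - p| < e -> `|a - b| <= e + e.
Proof.
move=> ap bp; rewrite (_ : a - b = (a - p) - (b - p)); last by ring.
by apply: le_trans (ler_normB _ _) _; apply: ltW; exact: ltrD.
Qed.

Let cancel_mixed (a b c d n p q : R) : 0 < n ->
  a - b - (c - d) = n * p -> a - c - (b - d) = n * q -> p = q.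
Proof. by move=> n0 E E'; apply: (mulfI (lt0r_neq0 n0)); rewrite -E -E'; ring. Qed.

(** The second difference is symmetric in [u] and [v]. Computed in the two orders, it gives the two
    mixed derivatives at two points close to [x]; continuity of both then identifies their values at
    [x]. *)
Lemma derive_comm f u v x : smooth f ->
  'D_v (fun y => 'D_u f y) x = 'D_u (fun y => 'D_v f y) x.
Proof.
move=> sf.
have cvg_mixed a b : forall e : R, 0 < e -> \forall h \near (0 : R)^'+,
    forall s t : R, 0 <= s <= h -> 0 <= t <= h ->
    `|'D_b (fun y => 'D_a f y) x - 'D_b (fun y => 'D_a f y) (t *: b + (s *: a + x))|
      < e.
  move=> e e0.
  have cF := smooth_continuous (smooth_derive b (smooth_derive a sf)).
  have /cvgrPdist_lt /(_ _ e0) /nbhs_ballP[r /= r0 rF] := cF x.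
  (* [h * C] bounds the displacement [t *: b + s *: a]; the summand 1 keeps [C] positive when both
     directions vanish. *)
  pose C := `|a| + `|b| + 1; have C0 : 0 < C by rewrite ltr_wpDl// addr_ge0.
  near=> h => s t /andP[s0 sh] /andP[t0 th]; apply: rF.
  rewrite -ball_normE /ball_ /= addrA opprD addrCA subrr addr0 normrN.
  apply: le_lt_trans (ler_normD _ _) _; rewrite !normrZ !ger0_norm//.
  have hr : h < r / C.
    by near: h; apply: nbhs_right_lt; rewrite divr_gt0.
  apply: (@le_lt_trans _ _ (h * C)); last by rewrite -ltr_pdivlMr.
  have h0 : 0 <= h := le_trans s0 sh.
  have H1 : t * `|b| <= h * `|b| by rewrite ler_wpM2r.
  have H2 : s * `|a| <= h * `|a| by rewrite ler_wpM2r.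
  rewrite /C !mulrDr mulr1; apply: (le_trans (lerD H1 H2)).
  by rewrite addrC lerDl.
pose A : R := 'D_v (fun y => 'D_u f y) x; pose B : R := 'D_u (fun y => 'D_v f y) x.
suff H (e : R) : 0 < e -> `|A - B| <= 0 + (e + e).
  apply: (@subr0_eq R A B); apply/eqP; rewrite -normr_le0.
  apply/ler_addgt0Pr => e e0; rewrite (splitr e).
  by apply: H; rewrite divr_gt0.
move=> e0; rewrite add0r.
have [h [h0 [H1 H2]]] : exists h : R, 0 < h /\
   ((forall s t : R, 0 <= s <= h -> 0 <= t <= h ->
    `|A - 'D_v (fun y => 'D_u f y) (t *: v + (s *: u + x))| < e) /\
   (forall s t : R, 0 <= s <= h -> 0 <= t <= h ->
    `|B - 'D_u (fun y => 'D_v f y) (t *: u + (s *: v + x))| < e)).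
  have F := filterI (cvg_mixed u v e e0) (cvg_mixed v u e e0).
  have PF : Filter (at_right (0 : R)) by exact: _.
  have [h [h0 Hh]] := filter_ex (filterI (nbhs_right_gt (0 : R)) (F PF)).
  by exists h.
have [s [t [sh th E]]] := mixed_difference x u v sf h0.
have [s' [t' [sh' th' E']]] := mixed_difference x v u sf h0.
have EE : 'D_v (fun y => 'D_u f y) (t *: v + (s *: u + x)) =
    'D_u (fun y => 'D_v f y) (t' *: u + (s' *: v + x)).
  by apply: (cancel_mixed _ E); [exact: exprn_gt0 | rewrite -E' addrCA].
have K2 := H2 _ _ sh' th'; rewrite -EE in K2.
exact: (dist_le2 (H1 _ _ sh th) K2).
Unshelve. all: by end_near. Qed.

End schwarz.

Section smooth_projections.
Context {R : realType} {d : nat}.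

Lemma smooth_coord (i : 'I_d) : smooth (fun x : 'rV[R]_d => x ord0 i).
Proof.
apply: smooth_linear; last by move=> a x y; rewrite !mxE.
by move=> x; exact: coord_continuous.
Qed.

Lemma smooth_fst (V : normedModType R) (f : R -> R) :
  smooth f -> smooth (fun z : R * V => f z.1).
Proof.
move=> sf; under eq_fun do rewrite -[_.1]addr0.
by apply: (@smooth_precomp _ _ _ fst) => // x; exact: cvg_fst.
Qed.

Lemma smooth_snd (V : normedModType R) (f : V -> R) :
  smooth f -> smooth (fun z : R * V => f z.2).
Proof.
move=> sf; under eq_fun do rewrite -[_.2]addr0.
by apply: (@smooth_precomp _ _ _ snd) => // x; exact: cvg_snd.
Qed.

Lemma smooth_id : smooth (fun x : R => x).
Proof. by apply: smooth_linear => // x; exact: cvg_id. Qed.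

Lemma smooth_scale (a : R) (b : R) (f : R -> R) :
  smooth f -> smooth (fun x => f (a * x + b)).
Proof.
move=> sf; apply: (@smooth_precomp _ _ _ (fun x : R => a * x)) => //.
  exact: mulrl_continuous.
by move=> c x y; rewrite mulrDr /= mulrCA.
Qed.

Lemma smooth_shift (b : 'rV[R]_d) (f : 'rV[R]_d -> R) :
  smooth f -> smooth (fun x => f (x + b)).
Proof.
by move=> sf; apply: (@smooth_precomp _ _ _ (fun x : 'rV[R]_d => x)) => // x; exact: cvg_id.
Qed.

Definition sqn (x : 'rV[R]_d) : R := \sum_i x ord0 i ^+ 2.

Lemma smooth_sqn : smooth sqn.
Proof.
apply: smooth_sum => i _; rewrite [X in smooth X](_ : _ =
  (fun x : 'rV[R]_d => x ord0 i * x ord0 i)).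
  by apply: smoothM; exact: smooth_coord.
by apply/funext => x; rewrite expr2.
Qed.

End smooth_projections.

(** * A smooth transition function *)

Section bump.
Context {R : realType}.

Lemma derive_scale (a b : R) (f : R -> R) x : derivable f (a * x + b) 1 ->
  is_derive x (1 : R) (fun x => f (a * x + b)) (a * 'D_1 f (a * x + b)).
Proof.
move=> df; rewrite mulrC; apply: (@is_derive_comp _ R f (fun x => a * x + b)).
  exact/derivableP.
rewrite (_ : (fun x => a * x + b) = (fun x => x) * cst a + cst b); last first.
  by apply/funext => y; rewrite /= mulrC.
apply: is_derive_eq => /=.
by rewrite scaler0 add0r addr0 -[LHS]/(a * 1) mulr1.
Qed.

(* [exp_inv p] is [p(1/x) exp(-1/x)] for [x > 0] and [0] elsewhere; the family
   is stable under derivation. *)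
Definition exp_inv (p : {poly R}) (x : R) : R :=
  if 0 < x then p.[x^-1] * expR (- x^-1) else 0.

(** The inequality [1 + x <= expR x] at x = y / n, raised to the power n. *)
Lemma expr_le_expR (n : nat) (y : R) : 0 <= y -> y ^+ n <= n%:R ^+ n * expR y.
Proof.
move=> y0; case: n => [|n]; first by rewrite !expr0 mul1r -expR0 ler_expR.
have n0 : 0 < n.+1%:R :> R by rewrite ltr0n.
rewrite -{2}(divfK (lt0r_neq0 n0) y) mulrC [_ * n.+1%:R]mulrC expRM_natl.
rewrite -ler_pdivrMr ?exprn_gt0// -expr_div_n.
apply: lerXn2r; rewrite ?nnegrE ?expR_ge0 ?divr_ge0// ?ltW//.
by apply: lt_le_trans (expR_ge1Dx _); rewrite ltrDr.
Qed.

(** Polynomials in 1/x are dominated by exp(1/x). Two powers of [x] are extracted so that one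
    remains after division by [x] in the difference quotient at 0; multiplying [p] by X^2 absorbs
    them. *)
Lemma exp_inv_bound (p : {poly R}) : exists2 C : R, 0 < C &
  forall x, 0 < x -> `|p.[x^-1]| * expR (- x^-1) <= C * x ^+ 2.
Proof.
set q := 'X^2 * p.
pose C := \sum_(i < size q) `|q`_i| * i%:R ^+ i.
have C0 : 0 <= C by apply: sumr_ge0 => i _; rewrite mulr_ge0 ?exprn_ge0.
exists (C + 1) => [|x x0]; first by rewrite ltr_wpDl.
suff H : `|q.[x^-1]| <= C * expR x^-1.
  rewrite expRN ler_pdivrMr ?expR_gt0// mulrAC -ler_pdivrMr ?exprn_gt0//.
  have -> : `|p.[x^-1]| / x ^+ 2 = `|q.[x^-1]|.
    by rewrite /q hornerM hornerXn normrM normrX gtr0_norm ?invr_gt0// exprVn mulrC.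
  by apply: le_trans H _; rewrite ler_wpM2r ?expR_ge0// lerDl.
rewrite horner_coef; apply: le_trans (ler_norm_sum _ _ _) _.
rewrite /C mulr_suml; apply: ler_sum => i _.
rewrite normrM normrX (gtr0_norm (_ : 0 < x^-1)) ?invr_gt0//.
by rewrite -mulrA ler_wpM2l// expr_le_expR// invr_ge0 ltW.
Qed.

(** For x > 0 the product rule gives x^-2 (p - p')(1/x) exp(-1/x), again of the form [exp_inv]; for
    x < 0 the function is locally zero; at 0 the difference quotient tends to 0 by
    [exp_inv_bound]. *)
Lemma exp_inv_derive p x :
  is_derive x (1 : R) (exp_inv p) (exp_inv ('X^2 * (p - p^`())) x).
Proof.
have [x0|x0|->] := ltgtP x 0.
- have -> : exp_inv ('X^2 * (p - p^`())) x = 0 by rewrite /exp_inv ltNge ltW.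
  apply: (@near_eq_is_derive _ _ _ (cst 0)).
  near=> y; rewrite /exp_inv ltNge ltW//.
  by near: y; exact: lt_nbhsl.
- have xn0 : x != 0 by rewrite gt_eqF.
  have dV : is_derive x (1 : R) (fun y : R => y^-1) (- x ^- 2).
    have H := derivableV xn0 (@derivable_id _ _ x 1).
    split; first exact: H.
    rewrite (deriveV xn0 (@derivable_id _ _ x 1)) derive_id.
    by rewrite -[LHS]/(_ * _) mulr1.
  have dp : is_derive x (1 : R) (fun y : R => p.[y^-1]) (p^`().[x^-1] * (- x ^- 2)).
    exact: is_derive_comp.
  have de : is_derive x (1 : R) (fun y : R => expR (- y^-1)) (expR (- x^-1) * (x ^- 2)).
    have dn := is_deriveN dV; rewrite opprK in dn.
    exact: (@is_derive_comp R R expR (fun y => - y^-1) x 1 _ _ (is_derive_expR _) dn).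
  have Hd := is_deriveM dp de.
  rewrite /exp_inv x0.
  have Hn : \forall y \near x, ((fun y => p.[y^-1]) * (fun y => expR (- y^-1))) y =
      exp_inv p y.
    near=> y; rewrite /exp_inv ifT//.
    by near: y; exact: lt_nbhsr.
  apply: is_derive_eq (near_eq_is_derive Hn Hd) _.
  rewrite -![_ *: _]/(_ * _) hornerM hornerXn hornerD hornerN exprVn.
  by ring.
- have -> : exp_inv ('X^2 * (p - p^`())) 0 = 0 by rewrite /exp_inv ltxx.
  have [C C0 HC] := exp_inv_bound p.
  have cv : (fun h : R => h^-1 *: (((exp_inv p) \o shift 0) (h *: (1 : R)) - exp_inv p 0))
      @ 0^' --> (0 : R).
    apply/cvgrPdist_le => e e0; near=> h.
    have h0 : h != 0 by near: h; exact: nbhs_dnbhs_neq.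
    rewrite sub0r normrN /= addr0 [h%:A]mulr1 {2}/exp_inv ltxx subr0.
    rewrite -[_ *: _]/(_ * _) normrM /exp_inv; case: ifPn => hp; last first.
      by rewrite normr0 mulr0 ltW.
    rewrite normrM (gtr0_norm (expR_gt0 _)) gtr0_norm ?invr_gt0//.
    rewrite ler_pdivrMl//; apply: le_trans (HC _ hp) _.
    rewrite (_ : C * h ^+ 2 = h * (C * h)); last by ring.
    apply: (ler_wpM2l (ltW hp)); rewrite -ler_pdivlMl//.
    have : `|h| <= C^-1 * e.
      near: h; apply: dnbhs0_le; by rewrite mulr_gt0// invr_gt0.
    by rewrite gtr0_norm.
  by split; [apply/cvg_ex; exists 0 | exact: cvg_lim cv].
Unshelve. all: by end_near. Qed.

Lemma smooth_exp_inv p : smooth (exp_inv p).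
Proof.
move=> s; suff [q ->] : exists q, iter_derive s (exp_inv p) = exp_inv q.
  have dq x u : derivable (exp_inv q) x u.
    have [H _] := exp_inv_derive q x.
    by apply: diff_derivable; exact/derivable1_diffP.
  split=> // x; apply: differentiable_continuous.
  by apply/derivable1_diffP.
elim: s => [|u s [q /= ->]]; first by exists p.
(* A direction of the line is a scalar, and only multiplies the polynomial. *)
exists (u%:P * ('X^2 * (q - q^`()))); apply/funext => x.
have /derivable1_diffP H : derivable (exp_inv q) x 1 by have [] := exp_inv_derive q x.
have := @deriveE _ _ _ _ _ u H; rewrite deriv1E; last exact/derivable1_diffP.
move=> ->; rewrite derive1E; have [_ ->] := exp_inv_derive q x.
rewrite /exp_inv; case: ifP => _; last by rewrite scaler0.
by rewrite (hornerM u%:P) hornerC -[LHS]/(_ * _) mulrA.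
Qed.

Let e := exp_inv 1.

Let e_ge0 x : 0 <= e x.
Proof. by rewrite /e /exp_inv; case: ifP => // _; rewrite hornerC mul1r expR_ge0. Qed.

Let e_gt0 x : 0 < x -> 0 < e x.
Proof. by rewrite /e /exp_inv => ->; rewrite hornerC mul1r expR_gt0. Qed.

Let e_eq0 x : x <= 0 -> e x = 0.
Proof. by rewrite /e /exp_inv ltNge => ->. Qed.

Let e_homo x y : x <= y -> e x <= e y.
Proof.
move=> xy; have [x0|x0] := leP x 0; first by rewrite e_eq0.
have y0 := lt_le_trans x0 xy.
by rewrite /e /exp_inv x0 y0 !hornerC !mul1r ler_expR lerN2 lef_pV2.
Qed.

Let den_gt0 x : 0 < e x + e (1 - x).
Proof.
have [x0|x0] := leP x 0; last by rewrite ltr_pwDl// e_gt0.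
by rewrite ltr_wpDl// e_gt0// subr_gt0 (le_lt_trans x0).
Qed.

(** The usual transition e(x) / (e(x) + e(1 - x)) from 0 on ]-oo, 0] to 1 on [1, +oo[. The quotient
    is written as a power of exponent -1 so that [smooth_powR] applies to it. *)
Definition step (x : R) : R := e x * (e x + e (1 - x)) `^ (-1).

Lemma stepE x : step x = e x / (e x + e (1 - x)).
Proof. by rewrite /step powR_inv1// ltW. Qed.

Lemma smooth_step : smooth step.
Proof.
apply: (smoothM (smooth_exp_inv 1)); apply: (smooth_powR (-1) den_gt0).
apply: (smoothD (smooth_exp_inv 1)).
have := smooth_scale (-1) 1 (smooth_exp_inv 1).
by under eq_fun do rewrite mulN1r addrC.
Qed.

Lemma step_le0 x : x <= 0 -> step x = 0.
Proof. by move=> x0; rewrite /step e_eq0// mul0r. Qed.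

Lemma step_ge1 x : 1 <= x -> step x = 1.
Proof.
move=> x1; rewrite stepE (@e_eq0 (1 - x)) ?subr_le0// addr0 divff//.
by rewrite gt_eqF// e_gt0// (lt_le_trans _ x1).
Qed.

Lemma step_homo x y : x <= y -> step x <= step y.
Proof.
move=> xy; rewrite !stepE ler_pdivrMr// mulrAC ler_pdivlMr// !mulrDr.
rewrite (mulrC (e x) (e y)) lerD2l ler_pM// e_homo//.
by rewrite lerD2l lerN2.
Qed.

Lemma step_ge0 x : 0 <= step x.
Proof. by rewrite stepE divr_ge0// ltW. Qed.

Lemma step_le1 x : step x <= 1.
Proof. by rewrite stepE ler_pdivrMr// mul1r lerDl. Qed.

Definition dstep (x : R) : R := 'D_1 step x.

Lemma smooth_dstep : smooth dstep.
Proof. exact: (smooth_derive (1 : R) smooth_step). Qed.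

Lemma is_derive_step x : is_derive x (1 : R) step (dstep x).
Proof. by split; first exact: (smooth_derivable smooth_step).
Qed.

Lemma dstep_ge0 x : 0 <= dstep x.
Proof.
have [dx _] := is_derive_step x; apply: limr_ge; first exact: dx.
near=> h; rewrite /= -[_ *: _]/(_ * _) [h%:A]mulr1.
have [h0|h0] := leP 0 h.
  by rewrite mulr_ge0 ?invr_ge0// subr_ge0 step_homo// lerDr.
by rewrite mulr_le0 ?invr_le0 ?(ltW h0)// subr_le0 step_homo// gerDr ltW.
Unshelve. all: by end_near. Qed.

(** At such points [step] attains its minimum 0 or its maximum 1, so its derivative vanishes; this
    covers the end points 0 and 1. *)
Lemma dstep_eq0 x : x <= 0 \/ 1 <= x -> dstep x = 0.
Proof.
have x1 : x - 1 <= x + 1 by lra.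
have xI : x \in `](x - 1), (x + 1)[%R by rewrite in_itv/=; lra.
have dx t : t \in `](x - 1), (x + 1)[%R -> derivable step t 1.
  by move=> _; have [] := is_derive_step t.
case=> x0.
- rewrite /dstep; have [|_ ->//] := derive1_at_min x1 dx xI.
  by move=> t _; rewrite (step_le0 x0) step_ge0.
- rewrite /dstep; have [|_ ->//] := derive1_at_max x1 dx xI.
  by move=> t _; rewrite (step_ge1 x0) step_le1.
Qed.

Lemma dstep_bounded : exists2 C : R, 0 < C & forall x, dstep x <= C.
Proof.
have := @EVT_max R dstep 0 1 ler01.
have cd : {within `[0, 1], continuous dstep}.
  by apply: continuous_subspaceT => x; exact: (smooth_continuous smooth_dstep).
move=> /(_ cd)[c _ Hc]; exists (`|dstep c| + 1) => [|x].
  by rewrite ltr_wpDl.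
have [x0|x0] := leP x 0; first by rewrite dstep_eq0 ?addr_ge0//; left.
have [x1|x1] := leP 1 x; first by rewrite dstep_eq0 ?addr_ge0//; right.
apply: (@le_trans _ _ (dstep c)); first by apply: Hc; rewrite in_itv/= !ltW.
by rewrite (le_trans (ler_norm _))// lerDl.
Qed.

Lemma dstep_gt0 : exists2 x, 0 < x < 1 & 0 < dstep x.
Proof.
have [||c c01] := @MVT R step dstep 0 1 ltr01.
- by move=> x _; exact: is_derive_step.
- by apply: continuous_subspaceT => x; exact: (smooth_continuous smooth_step).
rewrite step_ge1// step_le0// !subr0 mulr1 => c1.
by exists c; [move: c01; rewrite in_itv | rewrite -c1].
Qed.

End bump.

(** * Measure and integration on row vectors *)

Section real_fubini.
Context d1 d2 (T1 : measurableType d1) (T2 : measurableType d2) (R : realType).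
Variable m1 : {sigma_finite_measure set T1 -> \bar R}.
Variable m2 : {sigma_finite_measure set T2 -> \bar R}.

(** Iterated real integrals apply [fine] to inner integrals that may be infinite on a null set of
    parameters; neither integrability nor the value is affected. *)
Lemma ae_fineK d (T : measurableType d) (mu : {measure set T -> \bar R})
    (g : T -> \bar R) : mu.-integrable setT g ->
  mu.-integrable setT (fun x => (fine (g x))%:E) /\
  (\int[mu]_x (fine (g x))%:E = \int[mu]_x g x)%E.
Proof.
move=> ig; have mg := measurable_int _ ig.
have mfg : measurable_fun setT (fun x => (fine (g x))%:E).
  by apply/measurable_EFinP; exact: measurableT_comp.
split.
  apply: le_integrable ig => // x _.
  by case: (g x) => //=; rewrite normr0 leey.
apply: ae_eq_integral => //.
apply: filterS (integrable_ae measurableT ig) => x /= + _ => /(_ I).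
by move=> /fineK.
Qed.

Variable f : T1 * T2 -> R.
Hypothesis intf : (m1 \x m2)%E.-integrable setT (EFin \o f).

Lemma Rintegral12 :
  \int[m1]_x (\int[m2]_y f (x, y)) = \int[(m1 \x m2)%E]_z f z.
Proof.
rewrite /Rintegral; have [_ ->] := ae_fineK (integrable_fubini_F intf).
by rewrite integral12_prod_meas1.
Qed.

Let integrable_G : m2.-integrable setT (fubini_G m1 (EFin \o f)).
Proof.
have mf := measurable_int _ intf.
apply/integrableP; split; first exact: (measurable_fubini_G intf).
apply: le_lt_trans ((integrable21ltyP m1 m2 mf).1 intf).
apply: ge0_le_integral => //.
- by apply: measurableT_comp => //; exact: (measurable_fubini_G intf).
- apply: (measurable_fun_fubini_tonelli_G (abse \o (EFin \o f))) => //=.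
  exact: measurableT_comp.
- move=> y _; apply: le_abse_integral => //.
  exact: (measurableT_comp mf (measurable_pair2 y)).
Qed.

Lemma Rintegral21 :
  \int[m2]_y (\int[m1]_x f (x, y)) = \int[(m1 \x m2)%E]_z f z.
Proof.
rewrite /Rintegral; have [_ ->] := ae_fineK (integrable_G).
by rewrite integral21_prod_meas1.
Qed.

Lemma integrable_Rintegral1 :
  m1.-integrable setT (EFin \o (fun x => \int[m2]_y f (x, y))).
Proof. by have [] := ae_fineK (integrable_fubini_F intf). Qed.

Lemma integrable_Rintegral2 :
  m2.-integrable setT (EFin \o (fun y => \int[m1]_x f (x, y))).
Proof. by have [] := ae_fineK (integrable_G). Qed.

Lemma integrable_prod (a : T1 -> R) (k : T2 -> R) :
  m1.-integrable setT (EFin \o a) -> m2.-integrable setT (EFin \o k) ->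
  (m1 \x m2)%E.-integrable setT (EFin \o (fun z : T1 * T2 => a z.1 * k z.2)).
Proof.
move=> ia ik; have /measurable_EFinP ma := measurable_int _ ia.
have /measurable_EFinP mk := measurable_int _ ik.
have mak : measurable_fun setT (EFin \o (fun z : T1 * T2 => a z.1 * k z.2)).
  by apply/measurable_EFinP; apply: measurable_funM; exact: measurableT_comp.
apply/(integrable12ltyP _ _ mak).
have -> : (\int[m1]_x \int[m2]_y `|(EFin \o (fun z : T1 * T2 => a z.1 * k z.2)%R) (x, y)| =
    \int[m1]_x (`|(a x)%:E| * \int[m2]_y `|(k y)%:E|))%E.
  apply: eq_integral => x _; rewrite -ge0_integralZl//; last first.
    by apply: measurableT_comp => //; exact/measurable_EFinP.
  by apply: eq_integral => y _; rewrite /= normrM EFinM.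
rewrite ge0_integralZr//; last 2 first.
- by apply: measurableT_comp => //; exact/measurable_EFinP.
- exact: integral_ge0.
have /integrableP[_ H1] := ia; have /integrableP[_ H2] := ik.
by apply: lte_mul_pinfty => //; [exact: integral_ge0 | rewrite ge0_fin_numE// integral_ge0].
Qed.

End real_fubini.

Section rV_measurable.
Context {R : realType} {d : nat}.

Lemma measurable_shift_rV d1 (T : measurableType d1) (f g : T -> 'rV[R]_d) :
  measurable_fun setT f -> measurable_fun setT g ->
  measurable_fun setT (fun x => f x + g x).
Proof.
move=> mf mg; apply: measurable_fun_rVP => i.
under eq_fun do rewrite mxE.
by apply: measurable_funD; exact: (measurableT_comp (measurable_coord i)).
Qed.

Lemma measurable_opp_rV d1 (T : measurableType d1) (f : T -> 'rV[R]_d) :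
  measurable_fun setT f -> measurable_fun setT (fun x => - f x).
Proof.
move=> mf; apply: measurable_fun_rVP => i.
under eq_fun do rewrite mxE.
by apply: measurableT_comp => //; exact: (measurableT_comp (measurable_coord i)).
Qed.

(** The sigma-algebra comes from the coordinates and the topology from the sup norm. They are
    reconciled by writing an open set as a countable union of boxes with rational centre and
    half-width 1/(k+1). *)
Lemma open_measurable_rV (U : set 'rV[R]_d) : open U -> measurable U.
Proof.
move=> oU.
pose B (k : 'rV[rat]_d * nat) := [set x : 'rV[R]_d | forall i,
  `](ratr (k.1 ord0 i) - k.2.+1%:R^-1), (ratr (k.1 ord0 i) + k.2.+1%:R^-1)[%classic
  (x ord0 i)].
have mB k : measurable (B k).
  by apply: (@measurable_box R d (fun i =>
    `](ratr (k.1 ord0 i) - k.2.+1%:R^-1), (ratr (k.1 ord0 i) + k.2.+1%:R^-1)[%classic)).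
have -> : U = \bigcup_k (if `[< B k `<=` U >] then B k else set0).
  apply/seteqP; split => [x Ux|x [k _]]; last by case: asboolP => // + Bx; exact.
  have /nbhs_ballP[e /= e0 xeU] : nbhs x U by exact: open_nbhs_nbhs.
  (* Twice 1/(k+1) is needed: the rational centre is within 1/(k+1) of [x], and the points of the
     box are within 1/(k+1) of the centre. *)
  have [k ke] : exists k : nat, k.+1%:R^-1 + k.+1%:R^-1 < e.
    have [k _ H] := near_infty_natSinv_lt (PosNum (divr_gt0 e0 (ltr0n _ 2))).
    exists k; rewrite [ltRHS]splitr; have := H k (leqnn k).
    by move=> /= H1; exact: ltrD.
  have k0 : 0 < k.+1%:R^-1 :> R by rewrite invr_gt0.
  have Q i : exists q : rat, ratr q \in `](x ord0 i - k.+1%:R^-1), (x ord0 i + k.+1%:R^-1)[.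
    have /rat_in_itvoo[q xq] : x ord0 i - k.+1%:R^-1 < x ord0 i + k.+1%:R^-1.
      by rewrite ltrBlDr -addrA ltrDl addr_gt0.
    by exists q.
  have [q Hq] := choice Q.
  have BU : B (\row_i q i, k) `<=` U.
    move=> y By; apply: xeU; split => // i j; rewrite (ord1 i) /ball /=.
    have := By j; have := Hq j; rewrite mxE !in_itv /= ltr_norml; move: ke.
    move=> H0 /andP[H1 H2]; rewrite in_itv/= => /andP[H3 H4].
    suff : - e < x ord0 j - y ord0 j < e by [].
    move: (k.+1%:R^-1 : R) (x ord0 j) (y ord0 j) (ratr (q j) : R) H0 H1 H2 H3 H4.
    by move=> *; apply/andP; split; lra.
  exists (\row_i q i, k) => //; rewrite asboolT// => i; rewrite mxE.
  have := Hq i; rewrite /= !in_itv /= => /andP[].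
  by move: (k.+1%:R^-1 : R) (x ord0 i) (ratr (q i) : R) => *; apply/andP; split; lra.
apply: countable_bigcupT_measurable => [|k]; first exact: countableP.
by case: ifP.
Qed.

Lemma continuous_measurable_rV (f : 'rV[R]_d -> R) :
  continuous f -> measurable_fun setT f.
Proof.
move=> /continuousP cf; apply: (measurability _ (RGenOpens.measurableE R)).
move=> _ [_ [a [b ->] <-]]; rewrite setTI.
by apply: open_measurable_rV; exact/cf/interval_open.
Qed.

Lemma coord_le_norm (x : 'rV[R]_d) i : `|x ord0 i| <= `|x|.
Proof.
have /mapP[j Hj ->] : `|x ord0 i| \in [seq `|x x0.1 x0.2| | x0 : 'I_1 * 'I_d].
  by apply/mapP; exists (ord0, i) => //=; rewrite mem_enum.
by rewrite [leRHS]/Num.norm /= mx_normrE; apply/bigmax_geP; right => /=; exists j.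
Qed.

Lemma norm_rV_le (x : 'rV[R]_d) (r : R) : 0 <= r ->
  (forall i, `|x ord0 i| <= r) -> `|x| <= r.
Proof.
move=> r0 xr; rewrite [leLHS]/Num.norm /= mx_normrE; apply/bigmax_leP; split => //.
by move=> -[i j] _ /=; rewrite (ord1 i).
Qed.

End rV_measurable.

Section restriction.
Local Open Scope ereal_scope.
Context d (T : measurableType d) (R : realType).
Variables (mu : {sigma_finite_measure set T -> \bar R}) (D : set T)
  (mD : measurable D).

(* [mrestr] itself only has a sigma-finite instance for finite [mu] *)
Definition restr_fun : set T -> \bar R := mrestr mu mD.

HB.instance Definition _ := Measure.copy restr_fun (mrestr mu mD).

Let sigma_finite_restr_fun : sigma_finite setT restr_fun.
Proof.
have [F FT Foo] := sigma_finiteT mu.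
exists F => // i; have [mF Fi] := Foo i; split => //.
by apply: le_lt_trans Fi; apply: le_measure; rewrite ?inE//; exact: measurableI.
Qed.

HB.instance Definition _ := Measure_isSigmaFinite.Build _ _ _ restr_fun
  sigma_finite_restr_fun.

Definition restr_measure : {sigma_finite_measure set T -> \bar R} := restr_fun.

Lemma ge0_integral_mrestr (f : T -> \bar R) : measurable_fun setT f ->
  (forall x, 0 <= f x) ->
  \int[restr_measure]_x f x = \int[mu]_(x in D) f x.
Proof.
move=> mf f0; have mDC : measurable (~` D) by exact: measurableC.
rewrite -(setUv D) ge0_integral_setU//=; last 2 first.
- by rewrite setUv.
- exact/disj_setPCl.
rewrite [X in _ + X](_ : _ = 0) ?adde0; last first.
  apply/eqP; rewrite eq_le integral_ge0// andbT.
  rewrite -(@integral_measure_zero _ _ R (~` D) f).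
  rewrite (@eq_measure_integral _ _ _ _ mzero)//.
  move=> A mA AD; rewrite /restr_measure /= /restr_fun /mrestr /mzero.
  by rewrite (_ : A `&` D = set0) ?measure0//; apply/disjoints_subset.
apply: eq_measure_integral => A mA AD; rewrite /restr_measure /= /restr_fun /mrestr.
by rewrite setIidl.
Qed.

Lemma integral_mrestr (f : T -> \bar R) : measurable_fun setT f ->
  \int[restr_measure]_x f x = \int[mu]_(x in D) f x.
Proof.
move=> mf; rewrite integralE [RHS]integralE !ge0_integral_mrestr//.
- exact: measurable_funeneg.
- exact: measurable_funepos.
Qed.

End restriction.

(** * Translation invariance, on the line and on the cell *)

Section translation.
Local Open Scope ereal_scope.
Context {R : realType}.
Notation leb := (@lebesgue_measure R).

Lemma lebesgue_measure_shift (h : R) (A : set R) : measurable A ->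
  pushforward leb ((fun x => x + h)%R : _ -> measurableTypeR R) A = leb A.
Proof.
move=> mA; apply: esym; apply: lebesgue_measure_unique => //.
  exact: measurable_funD.
move=> ? _ [[a b]] _ <-.
rewrite -[RHS]/(leb ((fun x => x + h)%R @^-1` `]a, b])) /=.
rewrite (_ : _ @^-1` _ = `](a - h)%R, (b - h)%R]%classic).
  rewrite !lebesgue_measure_itv/= !lte_fin ltrD2r.
  by case: ifPn => // _; rewrite -!EFinB; congr EFin; ring.
by apply/seteqP; split => x /=; rewrite !in_itv /=; lra.
Qed.

Lemma ge0_integral_shift (h : R) (f : R -> \bar R) : measurable_fun setT f ->
  (forall x, 0 <= f x) -> \int[leb]_x f (x + h)%R = \int[leb]_x f x.
Proof.
move=> mf f0; rewrite [RHS](eq_measure_integral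
  (pushforward leb ((fun x => x + h)%R : _ -> measurableTypeR R))); last first.
  by move=> ? A mA _; exact: (esym (lebesgue_measure_shift h mA)).
  by move=> ?; rewrite ge0_integral_pushforward.
exact: measurable_funD.
Qed.

Lemma ge0_integral_opp (f : R -> \bar R) : measurable_fun setT f ->
  (forall x, 0 <= f x) -> \int[leb]_x f (- x)%R = \int[leb]_x f x.
Proof.
move=> mf f0; rewrite [RHS](eq_measure_integral
  (pushforward leb (-%R : _ -> measurableTypeR R))); last first.
  by move=> A mA _; exact: (esym (lebesgue_measureN mA)).
by rewrite ge0_integral_pushforward.
Qed.

Lemma ge0_integral_shift_itv (h a b : R) (f : R -> \bar R) :
  measurable_fun setT f -> (forall x, 0 <= f x) ->
  \int[leb]_(x in `[a, b[) f (x + h)%R = \int[leb]_(x in `[(a + h)%R, (b + h)%R[) f x.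
Proof.
move=> mf f0; rewrite integral_mkcond [RHS]integral_mkcond.
rewrite -[RHS](ge0_integral_shift h).
- apply: eq_integral => x _; rewrite !patchE !mem_setE.
  by rewrite !in_itv/= lerD2r ltrD2r.
- by apply/(measurable_restrictT _ _).1 => //; exact: measurable_funTS.
- by move=> x; rewrite patchE; case: ifP.
Qed.

(** By periodicity the shift may be replaced by its fractional part r. The interval [r, 1 + r[ is
    cut at 1, and its second piece is moved back by one period onto [0, r[. *)
Lemma ge0_integral_shift_periodic (h : R) (f : R -> \bar R) :
  measurable_fun setT f -> (forall x, 0 <= f x) ->
  (forall x, f (x + 1)%R = f x) ->
  \int[leb]_(x in `[0%R, 1%R[) f (x + h)%R = \int[leb]_(x in `[0%R, 1%R[) f x.
Proof.
move=> mf f0 f1.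
have fn (n : nat) x : f (x + n%:R)%R = f x.
  by elim: n x => [x|n IH x]; rewrite ?addr0// -natr1 addrA f1.
have fz (z : int) x : f (x + z%:~R)%R = f x.
  case: z => n; first exact: fn.
  by rewrite NegzE -[LHS](fn n.+1) rmorphN /= -addrA addNr addr0.
pose r := (h - (Num.floor h)%:~R)%R.
have r0 : (0 <= r)%R by rewrite subr_ge0 ge_floor.
have r1 : (r < 1)%R by rewrite ltrBlDl -intrD1 floorD1_gt.
transitivity (\int[leb]_(x in `[0%R, 1%R[) f (x + r)%R).
  by apply: eq_integral => x _; rewrite /r addrA -(fz (Num.floor h) (_ - _)%R) subrK.
rewrite ge0_integral_shift_itv// add0r.
have mS (E : set R) : measurable E -> measurable_fun E f.
  by move=> _; exact: measurable_funTS.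
have -> : `[r, (1 + r)%R[%classic = `[r, 1%R[ `|` `[1%R, (1 + r)%R[ :> set R.
  apply/seteqP; split => x /=; rewrite !in_itv /=; last by move=> [|]; lra.
  by move=> /andP[? ?]; have [?|?] := ltP x 1%R; [left|right]; lra.
have -> : `[0%R, 1%R[%classic = `[0%R, r[ `|` `[r, 1%R[ :> set R.
  apply/seteqP; split => x /=; rewrite !in_itv /=; last by move=> [|]; lra.
  by move=> /andP[? ?]; have [?|?] := ltP x r; [left|right]; lra.
rewrite !ge0_integral_setU//; last 4 first.
- exact: measurable_funTS.
- by apply/disj_setPS => x /=; rewrite !in_itv /= => -[/andP[? ?] /andP[? ?]]; lra.
- exact: measurable_funTS.
- by apply/disj_setPS => x /=; rewrite !in_itv /= => -[/andP[? ?] /andP[? ?]]; lra.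
rewrite addeC; congr (_ + _).
have := @ge0_integral_shift_itv 1 0 r f mf f0; rewrite add0r (addrC r) => <-.
by apply: eq_integral => x _; rewrite f1.
Qed.

End translation.

Section rV_integral.
Local Open Scope ereal_scope.
Context {R : realType}.
Notation leb := (@lebesgue_measure R).
Notation mu n := (@lebesgue_rV R n).

Lemma measurable_cell n Omega : measurable (@cell R n Omega).
Proof.
case: Omega => //=.
rewrite [X in measurable X](_ : _ =
    [set x : 'rV[R]_n | forall i, `[0%R, 1%R[%classic (x ord0 i)]).
  by apply: (@measurable_box R n (fun=> `[0%R, 1%R[%classic)) => i; exact: measurable_itv.
by apply/seteqP; split => x /= + i => /(_ i); rewrite in_itv.
Qed.

(** Packaged as a sigma-finite measure on all of ['rV[R]_n], so that the Fubini lemmas, stated for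
    integrals over whole spaces, apply to the cell. *)
Definition cell_measure n Omega : {sigma_finite_measure set 'rV[R]_n -> \bar R} :=
  restr_measure (mu n) (@measurable_cell n Omega).
Notation mc n Omega := (@cell_measure n Omega).

Lemma ge0_integral_rVS n (f : 'rV[R]_n.+1 -> \bar R) :
  measurable_fun setT f -> (forall x, 0 <= f x) ->
  \int[mu n.+1]_x f x = \int[leb]_a \int[mu n]_x f (cons_rV (a, x)).
Proof.
move=> mf f0.
have := @ge0_integral_pushforward _ _ (measurableTypeR R * 'rV[R]_n)%type _ R _
  (@measurable_cons_rV R n) (leb \x mu n) setT f measurableT mf (fun x _ => f0 x).
have mfc : measurable_fun setT (fun z : measurableTypeR R * 'rV[R]_n => f (cons_rV z)).
  exact: (measurableT_comp mf (@measurable_cons_rV R n)).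
have H := @fubini_tonelli1 _ _ _ _ R leb (mu n) _ mfc (fun z => f0 _).
by rewrite preimage_setT H.
Qed.

Definition cell1 Omega : set R :=
  match Omega with Torus => `[0%R, 1%R[%classic | WholeSpace => setT end.

Lemma cell_cons n Omega (a : R) (x : 'rV[R]_n) :
  (cons_rV (a, x) \in cell Omega) = (a \in cell1 Omega) && (x \in cell Omega).
Proof.
case: Omega; last by rewrite !in_setT.
apply/idP/andP => [|[]]; rewrite !inE.
  move=> H; split.
    by have := H ord0; rewrite mxE; case: splitP => // j _; rewrite mxE /= in_itv.
  move=> i; have := H (lift ord0 i); rewrite mxE; case: splitP => j /=.
    by rewrite ord1.
  by move/eqP; rewrite eqSS => /eqP/val_inj ->.
rewrite /= in_itv/= => a01 x01 i.
rewrite mxE; case: splitP => j ij; first by rewrite mxE.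
exact: x01.
Qed.

Lemma ge0_integral_cellE n Omega (f : 'rV[R]_n -> \bar R) :
  measurable_fun setT f -> (forall x, 0 <= f x) ->
  \int[mc n Omega]_x f x = \int[mu n]_(x in cell Omega) f x.
Proof. by move=> mf f0; rewrite ge0_integral_mrestr. Qed.

Lemma ge0_integral_cellS n Omega (f : 'rV[R]_n.+1 -> \bar R) :
  measurable_fun setT f -> (forall x, 0 <= f x) ->
  \int[mc n.+1 Omega]_x f x =
  \int[leb]_(a in cell1 Omega) \int[mc n Omega]_x f (cons_rV (a, x)).
Proof.
move=> mf f0; have mr : measurable_fun setT (f \_ (cell Omega)).
  apply/(measurable_restrictT f (@measurable_cell n.+1 Omega)).
  exact: measurable_funTS.
have r0 x : 0 <= (f \_ (cell Omega)) x by rewrite patchE; case: ifP.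
rewrite ge0_integral_cellE// integral_mkcond (ge0_integral_rVS mr r0).
rewrite [RHS]integral_mkcond; apply: eq_integral => a _.
rewrite patchE; case: ifPn => [aC|aC]; last first.
  rewrite integral0_eq// => x _; rewrite patchE cell_cons (negbTE aC)//.
rewrite ge0_integral_cellE//; last first.
  apply: (measurableT_comp mf).
  exact: (measurableT_comp (@measurable_cons_rV R n) (measurable_pair1 a)).
rewrite [RHS]integral_mkcond; apply: eq_integral => x _.
by rewrite !patchE cell_cons aC.
Qed.

Lemma cons_rVD n (a b : R) (x y : 'rV[R]_n) :
  (cons_rV (a, x) + cons_rV (b, y))%R = cons_rV ((a + b)%R, (x + y)%R).
Proof.
apply/rowP => i; rewrite !mxE; case: splitP => j _; by rewrite !mxE.
Qed.

Lemma cons_rV_delta0 n : cons_rV (1%R : R, 0%R : 'rV[R]_n) = delta_mx ord0 ord0.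
Proof.
apply/rowP => i; rewrite !mxE eqxx /=; case: splitP => j ij; rewrite !mxE.
  by rewrite (_ : i = ord0)//; apply: val_inj; rewrite /= ij ord1.
by rewrite (_ : (i == ord0) = false)//; apply/eqP => /(congr1 val); rewrite /= ij.
Qed.

Lemma cons_rV_deltaS n (i : 'I_n) :
  cons_rV (0%R : R, delta_mx ord0 i) = delta_mx ord0 (lift ord0 i).
Proof.
apply/rowP => k; rewrite !mxE; case: splitP => j kj; rewrite !mxE eqxx /=.
  rewrite (_ : (k == _) = false)//; apply/eqP => /(congr1 val).
  by rewrite /= kj ord1.
by congr ((_ : bool)%:R); rewrite -!val_eqE /= kj.
Qed.

Lemma uncons_rVK n : cancel (@uncons_rV R n) (@cons_rV R n).
Proof.
move=> x; rewrite /uncons_rV /cons_rV /=; apply/rowP => i; rewrite mxE.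
case: splitP => j ij; rewrite mxE.
  by congr (x _ _); apply: val_inj; rewrite /= ij ord1.
by congr (x _ _); apply: val_inj; rewrite /= ij.
Qed.

Let measurable_cell_inner n Omega (f : 'rV[R]_n.+1 -> \bar R) :
  measurable_fun setT f -> (forall x, 0 <= f x) ->
  measurable_fun setT (fun a => \int[mc n Omega]_x f (cons_rV (a, x))).
Proof.
move=> mf f0.
have mfc : measurable_fun setT (fun z : measurableTypeR R * 'rV[R]_n => f (cons_rV z)).
  exact: (measurableT_comp mf (@measurable_cons_rV R n)).
exact: (@measurable_fun_fubini_tonelli_F _ _ _ _ R (mc n Omega) _ mfc (fun z => f0 _)).
Qed.

(** Induction on the dimension: the induction hypothesis shifts the last n coordinates for each
    value of the first one, and the first one is then shifted on the line or over a period. *)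
Lemma ge0_integral_cell_shift n Omega (h : 'rV[R]_n) (f : 'rV[R]_n -> \bar R) :
  measurable_fun setT f -> (forall x, 0 <= f x) -> function_on Omega f ->
  \int[mc n Omega]_x f (x + h)%R = \int[mc n Omega]_x f x.
Proof.
elim: n h f => [|n IH] h f mf f0 pf.
  by apply: eq_integral => x _; congr f; apply/rowP => -[].
have mfh (k : 'rV[R]_n.+1) : measurable_fun setT (fun x : 'rV[R]_n.+1 => f (x + k)%R).
  by apply: (measurableT_comp mf); apply: measurable_shift_rV.
rewrite (ge0_integral_cellS Omega (mfh h) (fun x => f0 _)) (ge0_integral_cellS Omega mf f0).
have hE := uncons_rVK h; set h0 := (uncons_rV h).1; set h' := (uncons_rV h).2.
have {}hE : h = cons_rV (h0, h') by rewrite -hE; congr cons_rV; case: (uncons_rV h).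
pose G a := \int[mc n Omega]_x f (cons_rV (a, x)).
have mG : measurable_fun setT G by exact: measurable_cell_inner.
have G0 a : 0 <= G a by exact: integral_ge0.
transitivity (\int[leb]_(a in cell1 Omega) G (a + h0)%R).
  apply: eq_integral => a _; rewrite /G -(IH h' (fun x => f (cons_rV ((a + h0)%R, x))))//.
  - by apply: eq_integral => x _; rewrite hE cons_rVD.
  - apply: (measurableT_comp mf).
    exact: (measurableT_comp (@measurable_cons_rV R n) (measurable_pair1 _)).
  - move=> OT x i; have := pf OT (cons_rV ((a + h0)%R, x)) (lift ord0 i).
    by rewrite -cons_rV_deltaS cons_rVD addr0.
clear IH; case: Omega pf @G mG G0 => [pf|pf] G mG G0 /=.
  rewrite ge0_integral_shift_periodic// => a; apply: eq_integral => x _.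
  have := pf erefl (cons_rV (a, x)) ord0.
  by rewrite -cons_rV_delta0 cons_rVD addr0.
by rewrite ge0_integral_shift.
Qed.

Lemma ge0_integral_rV_opp n (f : 'rV[R]_n -> \bar R) :
  measurable_fun setT f -> (forall x, 0 <= f x) ->
  \int[mu n]_x f (- x)%R = \int[mu n]_x f x.
Proof.
elim: n f => [|n IH] f mf f0.
  by apply: eq_integral => x _; congr f; apply/rowP => -[].
have mfN : measurable_fun setT (fun x : 'rV[R]_n.+1 => f (- x)%R).
  by apply: (measurableT_comp mf); exact: measurable_opp_rV.
rewrite (ge0_integral_rVS mf f0) (ge0_integral_rVS mfN (fun x => f0 _)).
pose G a := \int[mu n]_x f (cons_rV (a, x)).
have mG : measurable_fun setT G.
  have mfc : measurable_fun setT (fun z : measurableTypeR R * 'rV[R]_n => f (cons_rV z)).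
    exact: (measurableT_comp mf (@measurable_cons_rV R n)).
  exact: (@measurable_fun_fubini_tonelli_F _ _ _ _ R (mu n) _ mfc (fun z => f0 _)).
have G0 a : 0 <= G a by exact: integral_ge0.
transitivity (\int[leb]_a G (- a)%R); last by rewrite ge0_integral_opp.
apply: eq_integral => a _; rewrite /G -(IH (fun x => f (cons_rV ((- a)%R, x))))//.
- apply: eq_integral => x _; congr f; apply/rowP => i; rewrite !mxE.
  by case: splitP => j _; rewrite !mxE.
- apply: (measurableT_comp mf).
  exact: (measurableT_comp (@measurable_cons_rV R n) (measurable_pair1 _)).
Qed.

End rV_integral.

(** * Changes of variables for a point and an increment *)

Section pair_integral.
Local Open Scope ereal_scope.
Context {R : realType} {d : nat} (Omega : spatial_domain).
Notation rV := 'rV[R]_d.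
Notation mu := (@lebesgue_rV R d).
Notation mc := (@cell_measure R d Omega).
Implicit Types F : rV * rV -> R.

(** For fixed [h] the point is translated by [h], and then [h] is reflected. The substitution
    exchanges the two ends x and x + h of the increment. *)
Let ge0_swap (F : rV * rV -> \bar R) : measurable_fun setT F ->
  (forall z, 0 <= F z) -> (forall h, function_on Omega (fun x => F (x, h))) ->
  \int[mc \x mu]_z F ((z.1 + z.2)%R, (- z.2)%R) = \int[mc \x mu]_z F z.
Proof.
move=> mF F0 pF.
have mT : measurable_fun setT (fun z : rV * rV => F ((z.1 + z.2)%R, (- z.2)%R)).
  apply: (measurableT_comp mF); apply: measurable_fun_pair.
    by apply: measurable_shift_rV.
  by apply: measurable_opp_rV.
rewrite (fubini_tonelli2 _ mT (fun z => F0 _)) (fubini_tonelli2 _ mF F0) /fubini_G /=.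
have mG : measurable_fun setT (fun h => \int[mc]_x F (x, h)).
  exact: (measurable_fun_fubini_tonelli_G F).
rewrite -[RHS](ge0_integral_rV_opp mG (fun h => integral_ge0 _ (fun x _ => F0 (x, h)))).
apply: eq_integral => h _.
rewrite -[RHS](ge0_integral_cell_shift h)//.
exact: (measurableT_comp mF (measurable_pair2 _)).
Qed.

Let ge0_shift (F : rV * rV -> \bar R) : measurable_fun setT F ->
  (forall z, 0 <= F z) -> (forall h, function_on Omega (fun x => F (x, h))) ->
  \int[mc \x mu]_z F ((z.1 + z.2)%R, z.2) = \int[mc \x mu]_z F z.
Proof.
move=> mF F0 pF.
have mT : measurable_fun setT (fun z : rV * rV => F ((z.1 + z.2)%R, z.2)).
  apply: (measurableT_comp mF); apply: measurable_fun_pair => //.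
  by apply: measurable_shift_rV.
rewrite (fubini_tonelli2 _ mT (fun z => F0 _)) (fubini_tonelli2 _ mF F0) /fubini_G /=.
apply: eq_integral => h _.
rewrite -[RHS](ge0_integral_cell_shift h)//.
exact: (measurableT_comp mF (measurable_pair2 _)).
Qed.

(** A substitution valid for nonnegative functions acts separately on positive and negative parts,
    so that the identity of real integrals follows without integrability. *)
Let signed (phi : rV * rV -> rV * rV) :
  (forall F : rV * rV -> \bar R, measurable_fun setT F ->
    (forall z, 0 <= F z) -> (forall h, function_on Omega (fun x => F (x, h))) ->
    \int[mc \x mu]_z F (phi z) = \int[mc \x mu]_z F z) ->
  measurable_fun setT phi ->
  forall F, measurable_fun setT F ->
    (forall h, function_on Omega (fun x => F (x, h))) ->
  (\int[mc \x mu]_z F (phi z) = \int[mc \x mu]_z F z)%R /\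
  ((mc \x mu).-integrable setT (EFin \o F) ->
   (mc \x mu).-integrable setT (EFin \o (fun z => F (phi z)))).
Proof.
move=> H mphi F mF pF; have mEF : measurable_fun setT (EFin \o F) by exact/measurable_EFinP.
split.
  have Hp := H (EFin \o F)^\+ (measurable_funepos mEF).
  have Hn := H (EFin \o F)^\- (measurable_funeneg mEF).
  rewrite /Rintegral integralE [in RHS]integralE; congr (fine (_ - _)).
    have Ep : (EFin \o (fun z => F (phi z)))^\+ = (EFin \o F)^\+ \o phi.
      exact: (funepos_comp (EFin \o F) phi).
    rewrite Ep; apply: Hp => // h OT x i.
    by rewrite !funeposE /= (pF h OT).
  have En : (EFin \o (fun z => F (phi z)))^\- = (EFin \o F)^\- \o phi.
    exact: (funeneg_comp (EFin \o F) phi).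
  rewrite En; apply: Hn => // h OT x i.
  by rewrite !funenegE /= (pF h OT).
move=> /integrableP[_ iF]; apply/integrableP; split.
  exact: (measurableT_comp mEF mphi).
rewrite -[ltLHS]/(\int[mc \x mu]_z (abse \o (EFin \o F)) (phi z)) H//.
- exact: measurableT_comp.
- by move=> z; exact: abse_ge0.
- by move=> h OT x i; rewrite /= (pF h OT).
Qed.

Let mswap : measurable_fun setT (fun z : rV * rV => ((z.1 + z.2)%R, (- z.2)%R)).
Proof.
apply: measurable_fun_pair; first by apply: measurable_shift_rV.
by apply: measurable_opp_rV.
Qed.

Let mshift : measurable_fun setT (fun z : rV * rV => ((z.1 + z.2)%R, z.2)).
Proof. by apply: measurable_fun_pair => //; apply: measurable_shift_rV. Qed.

Lemma Rintegral_pair_swap F : measurable_fun setT F ->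
  (forall h, function_on Omega (fun x => F (x, h))) ->
  (\int[mc \x mu]_z F ((z.1 + z.2), (- z.2)) = \int[mc \x mu]_z F z)%R.
Proof. by move=> mF pF; have [] := signed ge0_swap mswap mF pF. Qed.

Lemma Rintegral_pair_shift F : measurable_fun setT F ->
  (forall h, function_on Omega (fun x => F (x, h))) ->
  (\int[mc \x mu]_z F ((z.1 + z.2), z.2) = \int[mc \x mu]_z F z)%R.
Proof. by move=> mF pF; have [] := signed ge0_shift mshift mF pF. Qed.

Lemma integrable_pair_shift F : (forall h, function_on Omega (fun x => F (x, h))) ->
  (mc \x mu).-integrable setT (EFin \o F) ->
  (mc \x mu).-integrable setT (EFin \o (fun z => F ((z.1 + z.2)%R, z.2))).
Proof.
move=> pF iF; have /measurable_EFinP mF := measurable_int _ iF.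
by have [_] := signed ge0_shift mshift mF pF; apply.
Qed.

End pair_integral.

(** * Real-valued integrals *)

Section real_integrals.
Context d (T : measurableType d) (R : realType) (mu : {measure set T -> \bar R}).
Implicit Types f g : T -> R.

Lemma integrable_dom f g : measurable_fun setT f ->
  (forall x, `|f x| <= g x) -> mu.-integrable setT (EFin \o g) ->
  mu.-integrable setT (EFin \o f).
Proof.
move=> mf fg ig; apply: le_integrable ig => //; first exact/measurable_EFinP.
by move=> x _ /=; rewrite lee_fin (le_trans (fg x))// ler_norm.
Qed.

Lemma integrable_mble f : mu.-integrable setT (EFin \o f) -> measurable_fun setT f.
Proof. by move=> /measurable_int/measurable_EFinP. Qed.

Lemma integrable_addR f g : mu.-integrable setT (EFin \o f) ->
  mu.-integrable setT (EFin \o g) ->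
  mu.-integrable setT (EFin \o (fun x => f x + g x)).
Proof. by move=> fi gi; exact: (integrableD measurableT fi gi). Qed.

Lemma integrable_subR f g : mu.-integrable setT (EFin \o f) ->
  mu.-integrable setT (EFin \o g) ->
  mu.-integrable setT (EFin \o (fun x => f x - g x)).
Proof. by move=> fi gi; exact: (integrableB measurableT fi gi). Qed.

Lemma integrable_scaleR (c : R) f : mu.-integrable setT (EFin \o f) ->
  mu.-integrable setT (EFin \o (fun x => c * f x)).
Proof. by move=> fi; exact: (integrableZl measurableT c fi). Qed.

Lemma integrable_sumR (I : Type) (r : seq I) (F : I -> T -> R) :
  (forall i, mu.-integrable setT (EFin \o F i)) ->
  mu.-integrable setT (EFin \o (fun x => \sum_(i <- r) F i x)).
Proof.
move=> iF; rewrite (_ : _ \o _ = fun x => (\sum_(i <- r) (EFin \o F i) x)%E).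
  by apply: integrable_sum => // i _; exact: iF.
by apply/funext => x /=; rewrite sumEFin.
Qed.

Lemma Rintegral_sum (I : Type) (r : seq I) (F : I -> T -> R) :
  (forall i, mu.-integrable setT (EFin \o F i)) ->
  \int[mu]_x (\sum_(i <- r) F i x) = \sum_(i <- r) \int[mu]_x F i x.
Proof.
move=> iF; elim: r => [|i r IH].
  rewrite big_nil; under eq_Rintegral do rewrite big_nil.
  by rewrite Rintegral_cst// mul0r.
rewrite big_cons -IH -RintegralD//; last exact: integrable_sumR.
by apply: eq_Rintegral => x _; rewrite big_cons.
Qed.

Lemma Rintegral0 : \int[mu]_x (0 : R) = 0.
Proof. by rewrite Rintegral_cst// mul0r. Qed.

Lemma RintegralN f : mu.-integrable setT (EFin \o f) ->
  \int[mu]_x (- f x) = - \int[mu]_x f x.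
Proof.
move=> fi; rewrite -mulN1r -RintegralZl//.
by apply: eq_Rintegral => x _; rewrite mulN1r.
Qed.

Lemma le_norm_Rintegral f g : measurable_fun setT f ->
  (forall x, `|f x| <= g x) -> mu.-integrable setT (EFin \o g) ->
  `|\int[mu]_x f x| <= \int[mu]_x g x.
Proof.
move=> mf fg ig; have fi := integrable_dom mf fg ig.
apply: le_trans (le_normr_Rintegral measurableT fi) _.
by apply: le_Rintegral => //; exact: integrable_norm.
Qed.

Lemma ae_eq_Rintegral f g : measurable_fun setT f -> measurable_fun setT g ->
  {ae mu, forall x, f x = g x} -> \int[mu]_x f x = \int[mu]_x g x.
Proof.
move=> mf mg fg; congr fine; apply: ae_eq_integral => //.
- exact/measurable_EFinP.
- exact/measurable_EFinP.
- by apply: filterS fg => x /= -> _.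
Qed.

Lemma Rintegral_dominated (f_ : nat -> T -> R) f g :
  (forall n, measurable_fun setT (f_ n)) ->
  (forall x, f_ ^~ x @ \oo --> f x) -> mu.-integrable setT (EFin \o g) ->
  (forall n x, `|f_ n x| <= g x) ->
  (\int[mu]_x f_ n x) @[n --> \oo] --> \int[mu]_x f x.
Proof.
move=> mf cf ig fg.
have fi n : mu.-integrable setT (EFin \o f_ n) by exact: integrable_dom (fg n) ig.
have mf_ n : measurable_fun setT (EFin \o f_ n) by exact/measurable_EFinP.
have mfl : measurable_fun setT f.
  by apply: (measurable_fun_cvg mf) => x _; exact: cf.
have [] := @dominated_convergence _ _ _ mu setT measurableT (fun n => EFin \o f_ n)
  (EFin \o f) (EFin \o g) mf_.
- exact/measurable_EFinP.
- by apply/aeW => x _; apply/fine_cvgP; split; [exact: nearW | exact: cf].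
- exact: ig.
- by apply/aeW => x n _; rewrite /= lee_fin.
move=> fint _ cv.
by apply: fine_cvg; rewrite fineK//; exact: integrable_fin_num.
Qed.

End real_integrals.

(** * The fundamental lemma of the calculus of variations *)

Section dubois_reymond.
Context {R : realType}.
Notation leb := (@lebesgue_measure R).
Implicit Types f g : R -> R.

Lemma integrable_domR g f : measurable_fun setT f ->
  (forall x, `|f x| <= g x) -> leb.-integrable setT (EFin \o g) ->
  leb.-integrable setT (EFin \o f).
Proof.
by move=> mf fg ig; exact: (@integrable_dom _ (measurableTypeR R) R leb f g mf fg ig).
Qed.

(* smooth approximation of the Dirac mass to the right of [a] *)
Let w (n : nat) (a t : R) : R := n.+1%:R * dstep (n.+1%:R * t + (- n.+1%:R * a)).

Let is_derive_ramp n a t : is_derive t (1 : R)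
  (fun t => step (n.+1%:R * t + (- n.+1%:R * a))) (w n a t).
Proof. by apply: derive_scale; have [] := is_derive_step (n.+1%:R * t + (- n.+1%:R * a)). Qed.

Let smooth_ramp n a : smooth (fun t : R => step (n.+1%:R * t + (- n.+1%:R * a))).
Proof. exact: (smooth_scale _ _ smooth_step). Qed.

Let smooth_w n a : smooth (w n a).
Proof. exact: (smoothZ _ (smooth_scale _ _ smooth_dstep)). Qed.

Let mw n a : measurable_fun setT (w n a).
Proof. exact: continuous_measurable_fun (smooth_continuous (smooth_w n a)). Qed.

Let w_ge0 n a t : 0 <= w n a t.
Proof. by rewrite mulr_ge0// dstep_ge0. Qed.

Let w_eq0 n a t : t <= a \/ a + n.+1%:R^-1 <= t -> w n a t = 0.
Proof.
move=> H; rewrite /w dstep_eq0 ?mulr0//; case: H => ta; [left|right].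
  by rewrite mulNr -mulrBr pmulr_rle0// subr_le0.
by rewrite mulNr -mulrBr -ler_pdivrMl// mulr1 lerBrDl.
Qed.

Let int_w n a : leb.-integrable setT (EFin \o w n a) /\ \int[leb]_t w n a t = 1.
Proof.
pose b := a + n.+1%:R^-1.
have ab : a < b by rewrite ltrDl invr_gt0.
have wE : w n a = (w n a) \_ `[a, b].
  apply/funext => t; rewrite patchE; case: ifPn => // /negP tab.
  apply: w_eq0; have [ta|ta] := leP t a; first by left.
  have [tb|tb] := leP b t; first by right.
  by exfalso; apply: tab; rewrite mem_setE in_itv /= !ltW.
have cw : {within `[a, b], continuous (w n a)}.
  by apply: continuous_subspaceT; exact: smooth_continuous.
have iw : leb.-integrable `[a, b] (EFin \o w n a).
  by apply: continuous_compact_integrable => //; exact: segment_compact.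
split.
  rewrite wE; have := (@integrable_mkcond _ (measurableTypeR R) R leb `[a, b] (EFin \o w n a) (measurable_itv `[a, b])).1 iw.
  by congr (_.-integrable _ _); apply/funext => t; rewrite /= !patchE; case: ifP.
rewrite wE -Rintegral_mkcond /Rintegral.
rewrite (@continuous_FTC2 R (w n a) (fun t => step (n.+1%:R * t + (- n.+1%:R * a))) a b)//.
- have -> : n.+1%:R * b + (- n.+1%:R * a) = 1.
    by rewrite /b mulrDr mulfV ?pnatr_eq0// mulNr addrAC subrr add0r.
  by rewrite mulNr subrr (step_ge1 (lexx 1)) (step_le0 (lexx 0)) sube0.
- split.
  + by move=> t _; have [] := is_derive_ramp n a t.
  + by apply: cvg_at_right_filter; exact: (smooth_continuous (smooth_ramp n a)).
  + by apply: cvg_at_left_filter; exact: (smooth_continuous (smooth_ramp n a)).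
- by move=> t _; rewrite derive1E; have [_ ->] := is_derive_ramp n a t.
Qed.

Let w_le : exists2 C : R, 0 < C & forall n a t, w n a t <= C * n.+1%:R.
Proof.
have [C C0 HC] := @dstep_bounded R; exists C => // n a t.
by rewrite /w mulrC ler_wpM2r.
Qed.

Let int_fw n a f : leb.-integrable setT (EFin \o f) ->
  leb.-integrable setT (EFin \o (fun t => f t * w n a t)).
Proof.
move=> fi; have [C C0 HC] := w_le.
apply: (@integrable_domR (fun t => (C * n.+1%:R) * `|f t|)).
- by apply: measurable_funM => //; exact: integrable_mble fi.
- move=> t; rewrite normrM mulrC ler_wpM2r// ger0_norm// HC.
- by apply: integrable_scaleR; exact: integrable_norm.
Qed.

(** [w n a] has mass 1, height at most [C * n.+1] and support in the ball of radius 1/(n+1) about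
    [a]. The error is thus at most a constant times the mean of |f - f a| over that ball, which
    tends to 0 at a Lebesgue point. *)
Let cvg_w f a : leb.-integrable setT (EFin \o f) -> lebesgue_pt f a ->
  (\int[leb]_t (f t * w n a t)) @[n --> \oo] --> f a.
Proof.
move=> fi pa; have [C C0 HC] := w_le; have mf := integrable_mble fi.
apply/cvgrPdist_le => e e0.
(* The factor 2 is that of the length 2 s of the ball of radius s, against a height C / s. *)
have e1 : 0 < e / (2 * C) by rewrite divr_gt0// mulr_gt0.
have [r r0 Hr] : exists2 r : R, 0 < r & forall s, 0 < s < r -> (davg f a s <= (e / (2 * C))%:E)%E.
  have /fine_cvgP[fin /cvgrPdist_lt /(_ _ e1) cv] := pa.
  have [r /= r0 Hr] := (nbhs_ballP _ _).1 (filterI fin cv).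
  exists r => // s /andP[s0 sr].
  have [|fs] := Hr s _ s0; first by rewrite /ball /= sub0r normrN gtr0_norm.
  rewrite sub0r normrN => lt; rewrite -(fineK fs) lee_fin; apply: ltW.
  exact: le_lt_trans (ler_norm _) lt.
have [N _ HN] := near_infty_natSinv_lt (PosNum r0).
exists N => // n /HN /= nr; pose s : R := n.+1%:R^-1.
have s0 : 0 < s by rewrite invr_gt0.
have {}Hr := Hr s; rewrite s0 nr in Hr; have {}Hr := Hr isT.
have [iw w1] := int_w n a.
pose X := (\int[leb]_(t in ball a s) `|(f t - f a)%:E|)%E.
have leX : (X <= (e / C * s)%:E)%E.
  have -> : e / C * s = (s *+ 2) * (e / (2 * C)).
    by rewrite -mulr_natl; field; rewrite ?gt_eqF.
  rewrite EFinM -lee_pdivrMl ?pmulrn_lgt0//.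
  have s2 : s *+ 2 != 0 by rewrite gt_eqF// pmulrn_lgt0.
  move: Hr; rewrite /davg /iavg lebesgue_measure_ball ?(ltW s0)// inver (negPf s2).
  exact: le_trans.
have mB : measurable (ball a s) by exact: measurable_ball.
have mfa : measurable_fun setT (fun t => `|f t - f a|).
  by apply: measurableT_comp => //; exact: measurable_funB.
have iB : leb.-integrable (ball a s) (EFin \o (fun t => `|f t - f a|)).
  apply/integrableP; split.
    by apply/measurable_EFinP; exact: measurable_funTS.
  apply: le_lt_trans (ltry (e / C * s)); apply: le_trans leX.
  by rewrite le_eqVlt; apply/orP; left; apply/eqP/eq_integral => t _; rewrite /= normr_id.
have -> : f a - \int[leb]_t (f t * w n a t) = \int[leb]_t ((f a - f t) * w n a t).
  rewrite -[f a]mulr1 -[in LHS]w1 -RintegralZl// -RintegralB//; last 2 first.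
  - exact: integrable_scaleR.
  - exact: int_fw.
  by apply: eq_Rintegral => t _; rewrite mulr1 mulrBl.
pose G t := C * n.+1%:R * ((fun t => `|f t - f a|) \_ (ball a s)) t.
have iG : leb.-integrable setT (EFin \o ((fun t => `|f t - f a|) \_ (ball a s))).
  by rewrite -restrict_EFin; exact: (@integrable_mkcond _ (measurableTypeR R) R leb _ _ mB).1.
apply: (@le_trans _ _ (\int[leb]_t G t)).
  apply: (@le_norm_Rintegral _ (measurableTypeR R) R leb _ G).
  - apply: measurable_funM; last exact: mw.
    exact: measurable_funB.
  - move=> t; rewrite /G normrM (ger0_norm (w_ge0 n a t)) patchE; case: ifPn => [tB|/negP tB].
      by rewrite mulrC distrC ler_wpM2r.
    rewrite w_eq0 ?mulr0 ?normr0//; have [ta|ta] := leP t a; first by left.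
    right; rewrite leNgt; apply/negP => tb; apply: tB.
    by rewrite inE /ball /= distrC gtr0_norm ?subr_gt0// ltrBlDl.
  - exact: (@integrable_scaleR _ (measurableTypeR R) R leb).
rewrite RintegralZl// -Rintegral_mkcond.
have -> : e = C * n.+1%:R * (e / C * s).
  by rewrite /s; field; rewrite ?gt_eqF// ?pnatr_eq0.
rewrite ler_wpM2l//; first by rewrite mulr_ge0// ltW.
rewrite -lee_fin /Rintegral fineK; last exact: integrable_fin_num.
exact: leX.
Qed.

(** For [a] in ]0, T[ and large [n], [w n a] is a test function; the vanishing integrals converge to
    [g a] at every Lebesgue point, hence almost everywhere. *)
Lemma FLCV (T : R) g : leb.-integrable setT (EFin \o g) ->
  (forall psi, test_function_line `]0, T[ psi -> \int[leb]_t (g t * psi t) = 0) ->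
  {ae leb, forall t, 0 < t < T -> g t = 0}.
Proof.
move=> ig H; have := lebesgue_differentiation (open_integrable_locally openT ig).
case=> A [mA A0 sub]; exists A; split => // a aN; apply: sub => pa; apply: aN => /andP[a0 aT].
have cv := cvg_w ig pa; apply/esym.
suff cv0 : (\int[leb]_t (g t * w n a t)) @[n --> \oo] --> (0 : R).
  by apply: cvg_unique cv0 cv; exact: Rhausdorff.
have Ta : 0 < T - a by rewrite subr_gt0.
have [N _ HN] := near_infty_natSinv_lt (PosNum Ta).
apply: cvg_near_cst; exists N => // n /HN /= nr; apply: H.
split; first exact: smooth_w.
exists [set` `[a, a + n.+1%:R^-1]]; split.
- exact: segment_compact.
- move=> t /=; rewrite !in_itv /= => /andP[l1 l2].
  rewrite (lt_le_trans a0 l1) (le_lt_trans l2)//.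
  by rewrite -ltrBrDl.
- move=> t /negP; rewrite in_itv /= negb_and -!ltNge => /orP[ta|ta]; apply: w_eq0.
    by left; exact: ltW.
  by right; exact: ltW.
Qed.

(** The test function is a ramp at [a] minus a ramp at [b]. Its derivative approximates the
    difference of two Dirac masses, while the function itself converges boundedly to the indicator
    of ]a, b]. *)
Lemma dubois_reymond (T : R) f g : leb.-integrable setT (EFin \o f) ->
  leb.-integrable setT (EFin \o g) ->
  (forall psi, test_function_line `]0, T[ psi ->
     \int[leb]_t (f t * 'D_1 psi t) = - \int[leb]_t (g t * psi t)) ->
  forall a b, 0 < a -> a < b -> b < T -> lebesgue_pt f a -> lebesgue_pt f b ->
  f b - f a = \int[leb]_t (g t * \1_`]a, b] t).
Proof.
move=> fi gi H a b a0 ab bT pa pb.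
pose r n a t : R := step (n.+1%:R * t + (- n.+1%:R * a)).
have cf : (\int[leb]_t (f t * w n a t) - \int[leb]_t (f t * w n b t)) @[n --> \oo]
    --> f a - f b by apply: cvgB; exact: cvg_w.
have mr n c : measurable_fun setT (r n c).
  exact: continuous_measurable_fun (smooth_continuous (smooth_ramp n c)).
(* The ramp is 0 at [c] itself, so the limit is the indicator of the open half-line; this is what
   produces the half-open interval ]a, b]. *)
have rn c t : r n c t @[n --> \oo] --> (\1_`]c, +oo[ t : R).
  rewrite indicE mem_setE in_itv /= andbT; case: (leP t c) => tc.
    apply: cvg_near_cst; apply: nearW => n; rewrite /r step_le0//.
    by rewrite mulNr -mulrBr pmulr_rle0// subr_le0.
  have tc0 : 0 < t - c by rewrite subr_gt0.
  have [N _ HN] := near_infty_natSinv_lt (PosNum tc0).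
  apply: cvg_near_cst; exists N => // n /HN /= nr; rewrite /r step_ge1//.
  by rewrite mulNr -mulrBr -ler_pdivrMl// mulr1 ltW.
have cg : (\int[leb]_t (g t * (r n a t - r n b t))) @[n --> \oo]
    --> \int[leb]_t (g t * (\1_`]a, +oo[ t - \1_`]b, +oo[ t)).
  apply: (@Rintegral_dominated _ _ R leb _ _ (fun t => `|g t|)).
  - by move=> n; apply: measurable_funM; [exact: (@integrable_mble _ (measurableTypeR R) R leb) | exact: (measurable_funB (mr n a) (mr n b))].
  - by move=> t; apply: cvgM; [exact: cvg_cst | apply: cvgB; exact: rn].
  - exact: integrable_norm.
  - move=> n t; rewrite normrM ler_piMr// ler_norml.
    have := step_ge0 (n.+1%:R * t + (- n.+1%:R * a)).
    have := step_le1 (n.+1%:R * t + (- n.+1%:R * a)).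
    have := step_ge0 (n.+1%:R * t + (- n.+1%:R * b)).
    have := step_le1 (n.+1%:R * t + (- n.+1%:R * b)).
    rewrite /r; move: (step _) (step _) => x y; lra.
have cN : (- \int[leb]_t (g t * (r n a t - r n b t))) @[n --> \oo] --> f a - f b.
  have Tb : 0 < T - b by rewrite subr_gt0.
  have [N _ HN] := near_infty_natSinv_lt (PosNum Tb).
  apply: cvg_trans cf; apply: near_eq_cvg; exists N => // n /HN /= nr.
  rewrite -H.
    rewrite -RintegralB//; [|exact: int_fw|exact: int_fw].
    apply: eq_Rintegral => t _; rewrite -mulrBr; congr (_ * _).
    by have [_] := is_deriveB (is_derive_ramp n a t) (is_derive_ramp n b t).
  split; first exact: (smoothB (smooth_ramp n a) (smooth_ramp n b)).
  exists [set` `[a, b + n.+1%:R^-1]]; split.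
  - exact: segment_compact.
  - move=> t /=; rewrite !in_itv /= => /andP[l1 l2].
    rewrite (lt_le_trans a0 l1) (le_lt_trans l2)//.
    by rewrite -ltrBrDl.
  - move=> t /negP; rewrite in_itv /= negb_and -!ltNge /r => /orP[ta|ta].
      by rewrite !step_le0 ?subr0// mulNr -mulrBr pmulr_rle0// subr_le0; lra.
    have n0 : 0 < n.+1%:R^-1 :> R by rewrite invr_gt0.
    have [tb ta'] : n.+1%:R^-1 <= t - b /\ n.+1%:R^-1 <= t - a.
      have tb : n.+1%:R^-1 <= t - b by rewrite lerBrDl ltW.
      by split=> //; apply: le_trans tb _; rewrite lerD2l lerN2 ltW.
    by rewrite !step_ge1 ?subrr// mulNr -mulrBr -ler_pdivrMl// mulr1.
have := cvg_unique _ cN (cvgN cg) => /(_ (@Rhausdorff R)) E.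
rewrite -opprB E opprK; apply: eq_Rintegral => t _; congr (_ * _).
rewrite !indicE !mem_setE !in_itv /= !andbT.
case: (ltP a t) => at'; case: (ltP b t) => bt'; rewrite ?subr0 ?subrr//.
by exfalso; lra.
Qed.

End dubois_reymond.

(** * Integrals depending on a parameter *)

Lemma measurable_comp_pair d0 d1 d2 d3 (X : measurableType d0)
    (Y : measurableType d1) (Z : measurableType d2) (W : measurableType d3)
    (f : Y -> Z -> W) (a : X -> Y) (b : X -> Z) :
  measurable_fun setT (fun z : Y * Z => f z.1 z.2) ->
  measurable_fun setT a -> measurable_fun setT b ->
  measurable_fun setT (fun x => f (a x) (b x)).
Proof.
move=> mf ma mb.
exact: (measurableT_comp (f := fun z : Y * Z => f z.1 z.2)
  (g := fun x => (a x, b x)) mf (measurable_fun_pair ma mb)).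
Qed.

Section parametric.
Context d1 d2 (T1 : measurableType d1) (T2 : measurableType d2) (R : realType).
Variables (m1 : {sigma_finite_measure set T1 -> \bar R})
  (m2 : {sigma_finite_measure set T2 -> \bar R}).

(** The integrals of the positive and negative parts are measurable as extended reals, and so is
    [fine]; hence no integrability of the slices is required. *)
Lemma measurable_Rintegral (f : T1 * T2 -> R) : measurable_fun setT f ->
  measurable_fun setT (fun x => \int[m2]_y f (x, y)).
Proof.
move=> mf; apply: (measurableT_comp (fine_measurable measurableT)).
have mF : measurable_fun setT (EFin \o f) by exact/measurable_EFinP.
rewrite (_ : (fun _ => _) = fun x =>
  (\int[m2]_y ((EFin \o f)^\+ (x, y)) - \int[m2]_y ((EFin \o f)^\- (x, y)))%E).
  apply: emeasurable_funB.
    apply: (@measurable_fun_fubini_tonelli_F _ _ _ _ R m2 _ (measurable_funepos mF)).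
    by move=> z; exact: funepos_ge0.
  apply: (@measurable_fun_fubini_tonelli_F _ _ _ _ R m2 _ (measurable_funeneg mF)).
  by move=> z; exact: funeneg_ge0.
apply/funext => x; rewrite integralE.
by congr (_ - _)%E; apply: eq_integral => y _; rewrite ?funeposE ?funenegE.
Qed.

(** The hypothesis makes every section of the bad set at fixed [y] null, so the bad set is null for
    the product measure; almost all of its sections at fixed [x] are then null as well. *)
Lemma ae_ae_swap (P : T1 -> T2 -> Prop) :
  measurable [set z : T1 * T2 | P z.1 z.2] ->
  (forall y, {ae m1, forall x, P x y}) ->
  {ae m1, forall x, {ae m2, forall y, P x y}}.
Proof.
move=> mP H; pose A := ~` [set z : T1 * T2 | P z.1 z.2].
have mA : measurable A by exact: measurableC.
have A0 : ((m1 \x m2) A = 0)%E.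
  rewrite (@product_measure_unique _ _ _ _ R m1 m2 (m1 \x^ m2)%E _ A mA); last first.
    by move=> B C mB mC; exact: product_measure2E.
  rewrite /product_measure2; transitivity (\int[m2]_y (cst 0%E y))%E; last by rewrite integral0.
  apply: eq_integral => y _ /=; apply/negligibleP; first exact: measurable_ysection.
  have := H y; rewrite ysectionE; case=> N [mN N0 sub]; exists N; split => // x Ax; exact: sub.
have /(ae_eq_integral_abs m1 measurableT) : (\int[m1]_(x in setT) `|m2 (xsection A x)| = 0)%E.
  by rewrite -[RHS]A0; apply: eq_integral => x _; rewrite gee0_abs.
move=> /(_ (measurable_fun_xsection m2 mA)) [N [mN N0 sub]]; exists N; split => // x Px.
apply: sub => x0; apply: Px; have /negligibleP : (m2 (xsection A x) = 0)%E by exact: x0.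
move=> /(_ (measurable_xsection x mA)) [M [mM M0 sub']]; exists M; split => // y Py; apply: sub'.
by rewrite xsectionE.
Qed.

End parametric.

(** * Weak ordinary differential equations, with a parameter *)

Section weak_ode.
Context {R : realType}.
Notation leb := (@lebesgue_measure R).

(** Written with an indicator over the whole line, so that it is a parametric integral over a fixed
    domain; it is 0 for t <= 0. *)
Definition prim (g : R -> R) (t : R) : R := \int[leb]_s (g s * \1_`]0, t] s).

Lemma integrable_indicR (g : R -> R) (A : set R) : measurable A ->
  leb.-integrable setT (EFin \o g) ->
  leb.-integrable setT (EFin \o (fun t => g t * \1_A t)).
Proof.
move=> mA ig; apply: (@integrable_domR _ (fun t => `|g t|)).
- apply: measurable_funM; last exact: measurable_indic.
  exact: (@integrable_mble _ (measurableTypeR R) R leb).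
- by move=> t; rewrite normrM ler_piMr// indicE; case: (t \in A); rewrite ?normr1 ?normr0.
- exact: integrable_norm.
Qed.

Lemma prim_split (g : R -> R) a b : leb.-integrable setT (EFin \o g) ->
  0 <= a -> a <= b ->
  prim g b - prim g a = \int[leb]_s (g s * \1_`]a, b] s).
Proof.
move=> ig a0 ab; rewrite /prim -RintegralB//; last 2 first.
- by apply: integrable_indicR.
- by apply: integrable_indicR.
apply: eq_Rintegral => t _; rewrite -mulrBr; congr (_ * _).
rewrite !indicE !mem_setE !in_itv /=.
case: (ltP 0 t) => t0 /=; last by rewrite ltNge (le_trans t0 a0) /= subrr.
case: (leP t a) => ta /=; last by rewrite subr0.
by rewrite (le_trans ta ab) subrr.
Qed.

Lemma weak_ode (T : R) (f g : R -> R) : leb.-integrable setT (EFin \o f) ->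
  leb.-integrable setT (EFin \o g) ->
  (forall psi, test_function_line `]0, T[ psi ->
     \int[leb]_t (f t * 'D_1 psi t) = - \int[leb]_t (g t * psi t)) ->
  exists c, {ae leb, forall t, 0 < t < T -> f t = c + prim g t}.
Proof.
move=> fi gi H.
(* A Lebesgue point serves as base point. If ]0, T[ contained none, the conclusion would hold at
   every Lebesgue point of the line for want of a time to check, hence almost everywhere. *)
have [[a /andP[a0 aT] pa]|no] := pselect (exists2 a, 0 < a < T & lebesgue_pt f a); last first.
  exists 0; case: (lebesgue_differentiation (open_integrable_locally openT fi)) => A [mA A0 sub].
  exists A; split => // t tA; apply: sub => pt; apply: tA => tT.
  by exfalso; apply: no; exists t.
exists (f a - prim g a).
case: (lebesgue_differentiation (open_integrable_locally openT fi)) => A [mA A0 sub].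
exists A; split => // t tA; apply: sub => pt; apply: tA => /andP[t0 tT].
have [ta|at'|->] := ltgtP t a; last by rewrite subrK.
  have := dubois_reymond fi gi H t0 ta aT pt pa.
  by rewrite -prim_split// ?ltW//; move: (f a) (f t) (prim g a) (prim g t) => *; lra.
have := dubois_reymond fi gi H a0 at' tT pa pt.
by rewrite -prim_split// ?ltW//; move: (f a) (f t) (prim g a) (prim g t) => *; lra.
Qed.

Lemma Rintegral_indic_itv (T : R) : 0 < T ->
  \int[leb]_t (\1_`]0, T[ t : R) = T /\
  leb.-integrable setT (EFin \o (\1_`]0, T[ : R -> R)).
Proof.
move=> T0.
have L : (leb [set` `]0%R, T[] = T%:E)%E.
  by rewrite lebesgue_measure_itv /= lte_fin T0 sube0.
have I : (\int[leb]_t ((\1_`]0%R, T[ t)%:E : \bar R) = T%:E)%E.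
  by rewrite (@integral_indic _ (measurableTypeR R) R leb setT)// setIT.
split; first by rewrite /Rintegral I.
apply/integrableP; split; first exact/measurable_EFinP/measurable_indic.
apply: le_lt_trans (ltry T); rewrite -I le_eqVlt; apply/orP; left; apply/eqP.
apply: eq_integral => t _.
by rewrite /= ger0_norm// indicE; case: (_ \in _).
Qed.

Section param.
Context d (Y : measurableType d) (m : {sigma_finite_measure set Y -> \bar R}).

Lemma measurable_prim (g : R -> Y -> R) :
  measurable_fun setT (fun z : measurableTypeR R * Y => g z.1 z.2) ->
  measurable_fun setT (fun z : measurableTypeR R * Y => prim (g^~ z.2) z.1).
Proof.
move=> mg; apply: (@measurable_Rintegral _ _ (measurableTypeR R * Y)%type
  (measurableTypeR R) R leb (fun z => g z.2 z.1.2 * \1_`]0, z.1.1] z.2)).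
apply: measurable_funM.
  apply: (@measurable_comp_pair _ _ _ _ _ (measurableTypeR R) Y _ g) => //.
  by apply: measurableT_comp measurable_fst; exact: measurable_snd.
pose B (z : (measurableTypeR R * Y) * measurableTypeR R) := (0 < z.2) && (z.2 <= z.1.1).
have mB : measurable_fun setT B.
  have m1 : measurable_fun setT
      (fun z : (measurableTypeR R * Y) * measurableTypeR R => z.1.1 : R).
    by apply: measurableT_comp measurable_fst; exact: measurable_fst.
  apply: measurable_and; first exact: measurable_fun_ltr.
  exact: measurable_fun_ler.
rewrite (_ : (fun _ => _) = \1_[set z | B z]).
  by apply: measurable_indic; rewrite -[X in measurable X]setTI; exact: (mB measurableT [set true]).
apply: funext => z; rewrite !indicE; congr (nat_of_bool _)%:R; apply/idP/idP.
all: by rewrite !inE /= in_itv.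
Qed.

(** For each [y], [weak_ode] provides a null set of times that depends on [y]. Exchanging the
    quantifiers needs a bad set measurable in (t, y), so the constant is not chosen for each [y] but
    recovered as the mean over ]0, T[ of [f - prim g], which is measurable in [y]. *)
Lemma weak_ode_param (T : R) (f g : R -> Y -> R) : 0 < T ->
  measurable_fun setT (fun z : measurableTypeR R * Y => f z.1 z.2) ->
  measurable_fun setT (fun z : measurableTypeR R * Y => g z.1 z.2) ->
  (forall y, leb.-integrable setT (EFin \o (f^~ y))) ->
  (forall y, leb.-integrable setT (EFin \o (g^~ y))) ->
  (forall y psi, test_function_line `]0, T[ psi ->
     \int[leb]_t (f t y * 'D_1 psi t) = - \int[leb]_t (g t y * psi t)) ->
  exists c : Y -> R, {ae leb, forall t, 0 < t < T ->
    {ae m, forall y, f t y = c y + prim (g^~ y) t}}.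
Proof.
move=> T0 mf mg fi gi H.
pose q (y : Y) (t : R) : R := f t y - prim (g^~ y) t.
have mq : measurable_fun setT (fun z : measurableTypeR R * Y => q z.2 z.1).
  by apply: measurable_funB => //; exact: measurable_prim.
pose c y := T^-1 * \int[leb]_t (q y t * \1_`]0, T[ t).
have mi : measurable_fun setT (\1_`]0, T[ : measurableTypeR R -> R) by exact: measurable_indic.
have mc : measurable_fun setT c.
  apply: measurable_funM => //.
  apply: (@measurable_Rintegral _ _ Y (measurableTypeR R) R leb
    (fun z => q z.1 z.2 * \1_`]0, T[ z.2)).
  apply: measurable_funM; first exact: (@measurable_comp_pair _ _ _ _ _ (measurableTypeR R) Y _ (fun t y => q y t)).
  exact: (measurableT_comp mi measurable_snd).
exists c.
pose P (t : R) (y : Y) := \1_`]0, T[ t * (q y t - c y) = 0.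
have mP : measurable [set z : measurableTypeR R * Y | P z.1 z.2].
  rewrite -[X in measurable X]setTI.
  suff mh : measurable_fun setT (fun z : measurableTypeR R * Y =>
    \1_`]0, T[ z.1 * (q z.2 z.1 - c z.2)) by exact: (mh measurableT _ (measurable_set1 (0 : R))).
  apply: measurable_funM; first exact: (measurableT_comp mi measurable_fst).
  exact: (measurable_funB mq (measurableT_comp mc measurable_snd)).
have HP y : {ae leb, forall t, P t y}.
  have [c' Hc] := weak_ode (fi y) (gi y) (H y).
  have [I1 I2] := Rintegral_indic_itv T0.
  have cE : c y = c'.
    rewrite /c (@ae_eq_Rintegral _ (measurableTypeR R) R leb _ (fun t => c' * \1_`]0, T[ t)).
    - by rewrite RintegralZl// I1 mulrCA mulVf ?mulr1// gt_eqF.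
    - apply: measurable_funM => //.
      exact: (measurableT_comp mq (pair2_measurable y)).
    - exact: measurable_funM.
    - case: Hc => A [mA A0 sub]; exists A; split => // t tA; apply: sub => Ht; apply: tA.
      rewrite /= indicE mem_setE in_itv /=; case: (boolP (0 < t < T)) => /= tT; rewrite ?mulr0// !mulr1.
      by rewrite /q Ht// addrK.
  case: Hc => A [mA A0 sub]; exists A; split => // t tA; apply: sub => Ht; apply: tA.
  rewrite /= /P indicE mem_setE in_itv /=; case: (boolP (0 < t < T)) => /= tT; rewrite ?mul0r// mul1r.
  by rewrite /q Ht// cE addrK subrr.
have := @ae_ae_swap _ _ (measurableTypeR R) Y R leb m P mP HP.
case=> A [mA A0 sub]; exists A; split => // t tA; apply: sub => Ht; apply: tA => tT.
case: Ht => B [mB B0 sub']; exists B; split => // y yB; apply: sub' => Py; apply: yB.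
move: Py; rewrite /P indicE mem_setE in_itv /= tT mul1r /q => /eqP.
by rewrite subr_eq0 subr_eq => /eqP.
Qed.

End param.
End weak_ode.

(** * Radial kernels *)

Section kernel.
Context {R : realType} {d : nat}.
Notation rV := 'rV[R]_d.
Notation e_ i := (delta_mx ord0 i : rV).
Implicit Types (h u x : rV) (s : R).

Definition dotp h u : R := \sum_i h ord0 i * u ord0 i.

Lemma is_derive_coord i h u : is_derive h u (fun x : rV => x ord0 i) (u ord0 i).
Proof.
have lin : linear (fun x : rV => x ord0 i) by move=> a x y; rewrite !mxE.
have := @is_derive_precomp R rV R (fun x : rV => x ord0 i) id 0 h u (u ord0 i) lin
  (is_derive_id _ _).
by congr is_derive; apply/funext => x; rewrite addr0.
Qed.

Lemma is_derive_sqn h u : is_derive h u (@sqn R d) (2 * dotp h u).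
Proof.
have := @is_derive_sum R rV R d (fun i x => x ord0 i * x ord0 i) h u
  (fun i => h ord0 i *: u ord0 i + h ord0 i *: u ord0 i)
  (fun i => is_deriveM (is_derive_coord i h u) (is_derive_coord i h u)).
congr is_derive.
  by apply/funext => x; rewrite /sqn fct_sumE; apply: eq_bigr => i _; rewrite expr2.
rewrite /dotp mulr_sumr; apply: eq_bigr => i _.
by rewrite mulr2n mulrDl !mul1r.
Qed.

Lemma dotp_e h j : dotp h (e_ j) = h ord0 j.
Proof.
rewrite /dotp (bigD1 j)//= big1 ?addr0 ?mxE ?eqxx ?mulr1//.
by move=> i ij; rewrite mxE eqxx (negPf ij) mulr0.
Qed.

Lemma sqnN h : sqn (- h) = sqn h.
Proof. by apply: eq_bigr => i _; rewrite mxE sqrrN. Qed.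

Lemma sqn_ge0 h : 0 <= sqn h.
Proof. by apply: sumr_ge0 => i _; exact: sqr_ge0. Qed.

Lemma coord_sqn h i (r : R) : 0 <= r -> sqn h <= r ^+ 2 -> `|h ord0 i| <= r.
Proof.
move=> r0 hr; rewrite -(ler_pXn2r (n := 2))// ?nnegrE//.
rewrite real_normK ?num_real//; apply: le_trans hr.
by rewrite /sqn (bigD1 i)//= lerDl sumr_ge0// => j _; exact: sqr_ge0.
Qed.

Lemma norm_sqn h (r : R) : 0 <= r -> sqn h <= r ^+ 2 -> `|h| <= r.
Proof. by move=> r0 hr; apply: norm_rV_le => // i; exact: coord_sqn. Qed.

(* [wt] is positive everywhere and is the identity on [1/2, +oo[ *)
Definition wt s : R := s * step (4 * s - 1) + (1 - step (4 * s - 1)).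
Definition wtp s : R := wt s `^ (- (d%:R / 2)).
(** As a function of s = |h|^2, the profile of the field h / |h|^d, the gradient of the Newtonian
    potential up to a constant, with its singularity cut off: zero for s <= 1/2 and s^(-d/2) for s
    >= 1. [k0] is the profile of the divergence of the truncated field. *)
Definition g0 s : R := step (2 * s - 1) * wtp s.
Definition k0 s : R := 4 * s * dstep (2 * s - 1) * wtp s.

Lemma wt_gt0 s : 0 < wt s.
Proof.
rewrite /wt; have [s4|s4] := leP (4 * s) 1.
  by rewrite step_le0 ?subr_le0// mulr0 add0r subr0.
have s0 : 0 < s by lra.
have := step_ge0 (4 * s - 1); have := step_le1 (4 * s - 1).
rewrite le_eqVlt => /orP[/eqP ->|lt1 _].
  by move=> _; rewrite mulr1 subrr addr0.
by rewrite ltr_wpDl ?subr_gt0// mulr_ge0 ?step_ge0// ltW.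
Qed.

Lemma wt_id s : 1 / 2 <= s -> wt s = s.
Proof. by move=> s2; rewrite /wt step_ge1 ?mulr1 ?subrr ?addr0//; lra. Qed.

Let smooth_affine (f : R -> R) (a b : R) : smooth f -> smooth (fun s : R => f (a * s - b)).
Proof. exact: smooth_scale. Qed.

Lemma smooth_wtp : smooth wtp.
Proof.
apply: smooth_powR; first exact: wt_gt0.
apply: smoothD; first by apply: smoothM; [exact: smooth_id | exact: smooth_affine smooth_step].
by apply: smoothB; [exact: smooth_cst | exact: smooth_affine smooth_step].
Qed.

Lemma smooth_g0 : smooth g0.
Proof. by apply: smoothM; [exact: smooth_affine smooth_step | exact: smooth_wtp]. Qed.

Lemma smooth_k0 : smooth k0.
Proof.
apply: smoothM; last exact: smooth_wtp.
by apply: smoothM; [exact: (smoothZ 4 smooth_id) | exact: smooth_affine smooth_dstep].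
Qed.

Lemma wtp_gt0 s : 0 < wtp s.
Proof. by rewrite powR_gt0// wt_gt0. Qed.

Lemma k0_ge0 s : 0 <= s -> 0 <= k0 s.
Proof. by move=> s0; rewrite !mulr_ge0 ?dstep_ge0// ltW// wtp_gt0. Qed.

Lemma k0_eq0 s : 1 <= s -> k0 s = 0.
Proof. by move=> s1; rewrite /k0 dstep_eq0 ?mulr0 ?mul0r//; right; lra. Qed.

Lemma k0_gt0 : exists2 s, 0 < s & 0 < k0 s.
Proof.
have [x /andP[x0 x1] dx] := @dstep_gt0 R.
exists ((x + 1) / 2); first by lra.
rewrite /k0 (_ : 2 * ((x + 1) / 2) - 1 = x); last by lra.
by rewrite !mulr_gt0 ?wtp_gt0//; lra.
Qed.

Lemma derive_wtp s : 1 / 2 < s -> is_derive s (1 : R) wtp (- (d%:R / 2) * s `^ (- (d%:R / 2) - 1)).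
Proof.
move=> s2; have s0 : 0 < s by lra.
have e : \forall t \near s, t `^ (- (d%:R / 2)) = wtp t.
  exists (s - 1 / 2) => /=; first by rewrite subr_gt0.
  move=> t /=; rewrite /ball/= ltr_norml => /andP[_ st].
  by rewrite /wtp wt_id//; lra.
have [dp ep] := is_derive1_powR (- (d%:R / 2)) s0.
split; first exact: (near_eq_derivable e dp).
by rewrite -(near_eq_derive _ e).
Qed.

(** The left-hand side is the divergence of h g0(|h|^2). Since s^(-d/2) satisfies d g + 2 s g' = 0,
    only the derivative of the cutoff survives, which also makes the result nonnegative for s >=
    0. *)
Lemma radial_divergence s : d%:R * g0 s + 2 * s * 'D_1 g0 s = k0 s.
Proof.
have D : 'D_1 g0 s = step (2 * s - 1) * 'D_1 wtp s + wtp s * (2 * dstep (2 * s - 1)).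
  have ds : is_derive s (1 : R) (fun s => step (2 * s - 1)) (2 * dstep (2 * s - 1)).
    by apply: derive_scale; have [] := is_derive_step (2 * s - 1).
  by have [_] := is_deriveM ds (is_derive_smooth s (1 : R) smooth_wtp).
rewrite D /g0 /k0; have [s2|s2] := leP s (1 / 2).
  by rewrite step_le0 ?dstep_eq0; [lra | left; lra | lra].
have s0 : 0 < s by lra.
have [_ ->] := derive_wtp s2.
rewrite /wtp wt_id; last by lra.
have -> : s `^ (- (d%:R / 2)) = s * s `^ (- (d%:R / 2) - 1).
  rewrite -{2}(powRr1 (ltW s0)) -powRD ?(gt_eqF s0) ?implybT//.
  by congr (_ `^ _); lra.
by lra.
Qed.

Definition Gr (r s : R) : R := r ^- d * g0 (r ^- 2 * s).
Definition dg0 s : R := 'D_(1 : R) g0 s.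
Definition dGr (r s : R) : R := 'D_(1 : R) (Gr r) s.
Definition Kr (r : R) h : R := r ^- d * k0 (r ^- 2 * sqn h).
(* The radial field with [Kr a - Kr b = - div (Nf a b)]; being radial, it has a
   symmetric Jacobian. *)
Definition Nf (a b : R) i h : R := - (h ord0 i * (Gr a (sqn h) - Gr b (sqn h))).

Lemma smooth_Gr r : smooth (Gr r).
Proof.
apply: smoothZ; rewrite (_ : (fun _ => _) = fun s => g0 (r ^- 2 * s + 0)).
  exact: smooth_scale smooth_g0.
by apply/funext => s; rewrite addr0.
Qed.

Lemma smooth_Kr r : smooth (Kr r).
Proof. exact: smoothZ (smooth_comp smooth_k0 (smoothZ _ smooth_sqn)). Qed.

Lemma smooth_Nf a b i : smooth (Nf a b i).
Proof.
apply: smoothN; apply: smoothM; first exact: smooth_coord.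
by apply: smoothB; apply: smooth_comp smooth_sqn; exact: smooth_Gr.
Qed.

(** The homogeneity of s^(-d/2) cancels the factor [r ^- d]. This independence of the scale is what
    gives [Nf a b] a bounded support. *)
Lemma Gr_far r s : 0 < r -> r ^+ 2 <= s -> Gr r s = s `^ (- (d%:R / 2)).
Proof.
move=> r0 rs; have r2 : 0 < r ^+ 2 by rewrite exprn_gt0.
have s1 : 1 <= r ^- 2 * s by rewrite ler_pdivlMl// mulr1.
rewrite /Gr /g0 step_ge1 ?mul1r; last by lra.
rewrite /wtp wt_id; last by lra.
rewrite powRM ?invr_ge0 ?(ltW r2)// ?(le_trans (ltW r2) rs)//.
rewrite mulrA; suff -> : r ^- d * (r ^- 2) `^ (- (d%:R / 2)) = 1 by rewrite mul1r.
rewrite -(powR_inv1 (ltW r2)) -powRrM mulN1r opprK -(powR_mulrn 2 (ltW r0)) -powRrM.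
rewrite mulrCA mulfV// mulr1 powR_mulrn ?ltW// mulVf//.
by rewrite expf_neq0// gt_eqF.
Qed.

Lemma derive_Nf a b i h u : 'D_u (Nf a b i) h =
  - (u ord0 i * (Gr a (sqn h) - Gr b (sqn h)) +
     h ord0 i * (2 * dotp h u * (dGr a (sqn h) - dGr b (sqn h)))).
Proof.
have dG r : is_derive h u (fun x => Gr r (sqn x)) (dGr r (sqn h) * (2 * dotp h u)).
  apply: is_derive_comp; last exact: is_derive_sqn.
  exact: is_derive_smooth (smooth_Gr r).
have [_ ->] := is_deriveN (is_deriveM (is_derive_coord i h u) (is_deriveB (dG a) (dG b))).
rewrite /GRing.scale /= !fctE.
move: (Gr a (sqn h)) (Gr b (sqn h)) (dGr a (sqn h)) (dGr b (sqn h)).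
by move: (dotp h u) (h ord0 i) (u ord0 i) => *; ring.
Qed.

Lemma derive_Gr r s : dGr r s = r ^- d * (r ^- 2 * dg0 (r ^- 2 * s)).
Proof.
have H : is_derive s (1 : R) (fun s => g0 (r ^- 2 * s + 0)) (r ^- 2 * dg0 (r ^- 2 * s + 0)).
  by apply: derive_scale; exact: smooth_derivable smooth_g0.
have E : is_derive s (1 : R) (Gr r) (r ^- d * (r ^- 2 * dg0 (r ^- 2 * s + 0))).
  rewrite (_ : Gr r = fun s => r ^- d * g0 (r ^- 2 * s + 0)); first exact: is_deriveZ.
  by apply/funext => t; rewrite /Gr addr0.
by case: E => _; rewrite addr0.
Qed.

Lemma Nf_sym a b i j h : 'D_(e_ j) (Nf a b i) h = 'D_(e_ i) (Nf a b j) h.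
Proof.
rewrite !derive_Nf !dotp_e !mxE !eqxx /= [i == j]eq_sym.
move: (Gr a (sqn h)) (Gr b (sqn h)) (dGr a (sqn h)) (dGr b (sqn h)).
by move: (h ord0 i) (h ord0 j) ((j == i)%:R : R) => *; ring.
Qed.

Lemma Nf_div a b h : \sum_i 'D_(e_ i) (Nf a b i) h = - (Kr a h - Kr b h).
Proof.
under eq_bigr => i _ do rewrite derive_Nf dotp_e mxE !eqxx /= mul1r.
rewrite sumrN big_split /= sumr_const card_ord -[_ *+ d]mulr_natl.
have -> (X : R) : \sum_(i < d) h ord0 i * (2 * h ord0 i * X) = 2 * sqn h * X.
  rewrite /sqn mulr_sumr mulr_suml; apply: eq_bigr => i _; rewrite expr2; ring.
have KrE r : Kr r h = d%:R * Gr r (sqn h) + 2 * sqn h * dGr r (sqn h).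
  rewrite derive_Gr /Kr -radial_divergence -/(dg0 _) /Gr.
  move: (g0 (r ^- 2 * sqn h)) (dg0 (r ^- 2 * sqn h)) => x y.
  move: (r ^- d) (r ^- 2) (sqn h) (d%:R : R) => *; ring.
rewrite (KrE a) (KrE b).
move: (Gr a (sqn h)) (Gr b (sqn h)) (dGr a (sqn h)) (dGr b (sqn h)).
by move: (sqn h) => *; ring.
Qed.

Lemma Nf_supp a b i h : 0 < a -> a <= b -> b < `|h| -> Nf a b i h = 0.
Proof.
move=> a0 ab bh; have b0 := lt_le_trans a0 ab.
have bs : b ^+ 2 <= sqn h.
  by rewrite leNgt; apply/negP => /ltW/(norm_sqn (ltW b0)); rewrite leNgt bh.
have as_ : a ^+ 2 <= sqn h by apply: le_trans bs; rewrite ler_pXn2r// nnegrE ltW.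
by rewrite /Nf !Gr_far// subrr mulr0 oppr0.
Qed.

Lemma KrN r h : Kr r (- h) = Kr r h. Proof. by rewrite /Kr sqnN. Qed.

Lemma Kr_supp r h : 0 < r -> r < `|h| -> Kr r h = 0.
Proof.
move=> r0 rh; have rs : r ^+ 2 <= sqn h.
  by rewrite leNgt; apply/negP => /ltW/(norm_sqn (ltW r0)); rewrite leNgt rh.
by rewrite /Kr k0_eq0 ?mulr0// ler_pdivlMl ?exprn_gt0// mulr1.
Qed.

Lemma Kr_ge0 r h : 0 < r -> 0 <= Kr r h.
Proof.
move=> r0; apply: mulr_ge0; first by rewrite invr_ge0 exprn_ge0// ltW.
by apply: k0_ge0; rewrite mulr_ge0 ?sqn_ge0// invr_ge0 exprn_ge0// ltW.
Qed.

Let bounded01 (f : R -> R) : continuous f -> exists2 C : R, 0 < C &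
  forall s, 0 <= s <= 1 -> `|f s| <= C.
Proof.
move=> cf; have cn : {within `[0, 1], continuous (fun s => `|f s|)}.
  apply: continuous_subspaceT => s; exact: (cvg_norm (cf s)).
have [c _ Hc] := EVT_max (ler01 : 0 <= 1 :> R) cn.
exists (`|f c| + 1); first by rewrite ltr_wpDl.
move=> s s01; apply: le_trans (Hc s _) _; first by rewrite in_itv.
by rewrite lerDl.
Qed.

Lemma Kr_bound : exists2 C : R, 0 < C & forall r h, 0 < r -> Kr r h <= C * r ^- d.
Proof.
have [C C0 HC] := bounded01 (smooth_continuous smooth_k0); exists C => // r h r0.
rewrite /Kr mulrC ler_wpM2r//; first by rewrite invr_ge0 exprn_ge0// ltW.
have s0 : 0 <= r ^- 2 * sqn h by rewrite mulr_ge0 ?sqn_ge0// invr_ge0 exprn_ge0 ?ltW.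
have [s1|s1] := leP (r ^- 2 * sqn h) 1; last by rewrite (k0_eq0 (ltW s1)) ltW.
by apply: le_trans (ler_norm _) (HC _ _); rewrite s0 s1.
Qed.

Lemma derive_Kr r h u : 'D_u (Kr r) h =
  r ^- d * ('D_1 k0 (r ^- 2 * sqn h) * (r ^- 2 * (2 * dotp h u))).
Proof.
have dk := @is_derive_comp _ _ k0 (fun x => r ^- 2 * sqn x) h u _ _
  (is_derive_smooth (r ^- 2 * sqn h) (1 : R) smooth_k0)
  (is_deriveZ (r ^- 2) (is_derive_sqn h u)).
by have [_] := is_deriveZ (r ^- d) dk.
Qed.

Lemma dKr_bound : exists2 C : R, 0 < C & forall r h u, 0 < r ->
  `|'D_u (Kr r) h| <= C * r ^- d.+1 * `|u|.
Proof.
have [C C0 HC] := bounded01 (smooth_continuous (smooth_derive (1 : R) smooth_k0)).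
(* The bound for |h . u| carries [d.+1] rather than [d], so that the constant remains positive in
   dimension 0. *)
exists (C * (2 * d.+1%:R)); first by rewrite !mulr_gt0.
move=> r h u r0; rewrite derive_Kr.
have rd : 0 < r ^- d by rewrite invr_gt0 exprn_gt0.
have r2 : 0 < r ^- 2 by rewrite invr_gt0 exprn_gt0.
have s0 : 0 <= r ^- 2 * sqn h by rewrite mulr_ge0 ?sqn_ge0// ltW.
have [s1|s1] := leP (r ^- 2 * sqn h) 1; last first.
  have -> : 'D_1 k0 (r ^- 2 * sqn h) = 0.
    have e : \forall t \near r ^- 2 * sqn h, k0 t = cst 0 t.
      exists (r ^- 2 * sqn h - 1) => /=; first by rewrite subr_gt0.
      move=> t /=; rewrite /ball/= ltr_norml => /andP[_ st].
      by rewrite k0_eq0//; move: st; move: (_ * _) => y; lra.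
    by rewrite (near_eq_derive _ e) derive_cst.
  rewrite mul0r mulr0 normr0 !mulr_ge0// ?invr_ge0 ?exprn_ge0 ?ltW//.
have hr : sqn h <= r ^+ 2.
  by move: s1; rewrite ler_pdivrMl ?exprn_gt0// mulr1.
have dh : `|dotp h u| <= d.+1%:R * (r * `|u|).
  apply: le_trans (ler_norm_sum _ _ _) _.
  apply: (@le_trans _ _ (\sum_(i < d) r * `|u|)).
    apply: ler_sum => i _; rewrite normrM ler_pM//; last exact: coord_le_norm.
    by apply: coord_sqn => //; exact: ltW.
  rewrite sumr_const card_ord -[X in X <= _]mulr_natl; apply: ler_wpM2r.
    by rewrite mulr_ge0// ltW.
  by rewrite ler_nat.
rewrite !normrM !(gtr0_norm rd) !(gtr0_norm r2) (ger0_norm (ler0n _ 2)).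
have -> : C * (2 * d.+1%:R) * r ^- d.+1 * `|u| =
    r ^- d * (C * (r ^- 2 * (2 * (d.+1%:R * (r * `|u|))))).
  rewrite exprS; have rd0 : r ^+ d != 0 by rewrite expf_neq0// gt_eqF.
  by field; rewrite rd0 gt_eqF.
rewrite ler_wpM2l ?(ltW rd)// ler_pM//.
  by rewrite !mulr_ge0// ltW.
  by apply: HC; rewrite s0 s1.
by rewrite !ler_wpM2l// ltW.
Qed.

Lemma dKr_supp r h u : 0 < r -> r < `|h| -> 'D_u (Kr r) h = 0.
Proof.
move=> r0 rh.
have e : \forall x \near h, Kr r x = cst 0 x.
  have op : open [set x : rV | r < `|x|].
    rewrite (_ : [set x | _] = Num.norm @^-1` [set y | r < y])//.
    by apply: open_comp; [move=> x _; exact: norm_continuous | exact: open_gt].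
  apply: filterS (open_nbhs_nbhs (conj op rh)) => x /= rx.
  by rewrite Kr_supp.
have [->|u0] := eqVneq u 0; first by rewrite derive_Kr /dotp big1 ?mulr0// => i _; rewrite mxE mulr0.
by rewrite (near_eq_derive _ e) derive_cst.
Qed.

End kernel.

Section smooth_local.
Context {R : realType} {V : normedModType R}.

Lemma near_iter_derive (s : seq V) (f g : V -> R) x :
  (\forall y \near (x : V), f y = g y) ->
  \forall y \near (x : V), iter_derive s f y = iter_derive s g y.
Proof.
move=> fg; elim: s => [|u s IH] //=.
move: (near_join IH); apply: filterS => y; exact: near_eq_derive.
Qed.

(** Meant for periodizations, which near any point coincide with a finite sum that depends on the
    point. *)
Lemma smooth_local (f : V -> R) :
  (forall x, exists2 g, smooth g & \forall y \near (x : V), f y = g y) -> smooth f.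
Proof.
move=> H s; split=> x; have [g sg fg] := H x; have fgs := near_iter_derive s fg.
  have cg := (sg s).1 x; rewrite /continuous_at (nbhs_singleton fgs).
  by apply: cvg_trans cg; apply: near_eq_cvg; apply: filterS fgs => y ->.
move=> u; have dg := (sg s).2 x u; apply: near_eq_derivable dg.
by apply: filterS fgs => y ->.
Qed.

End smooth_local.

(** * Periodization *)

Section periodization.
Context {R : realType} {d : nat}.
Notation rV := 'rV[R]_d.
Notation e_ i := (delta_mx ord0 i : rV).
Notation zV := 'rV[int]_d.
Notation mu := (@lebesgue_rV R d).
Notation mc := (@cell_measure R d Torus).
Implicit Types (Phi : rV -> R) (x y h : rV) (n : zV) (k : nat).

Definition ivec n : rV := map_mx intr n.

Lemma ivecD n m : ivec (n + m) = ivec n + ivec m.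
Proof. by apply/rowP => i; rewrite !mxE intrD. Qed.

Lemma ivec_delta i : ivec (delta_mx ord0 i) = e_ i.
Proof. by apply/rowP => j; rewrite !mxE; case: (_ && _). Qed.

Definition box k : seq zV :=
  [seq \row_i ((f i)%:Z - k%:Z) | f : {ffun 'I_d -> 'I_(2 * k).+1}].

Lemma box_uniq k : uniq (box k).
Proof.
rewrite map_inj_uniq ?enum_uniq// => f g /rowP fg; apply/ffunP => i.
have := fg i; rewrite !mxE => /addIr [] /eqP.
by move=> /eqP/ord_inj.
Qed.

Lemma box_mem k n : (n \in box k) = [forall i, `|n ord0 i| <= k%:Z].
Proof.
apply/mapP/forallP => [[f _ ->] i|H].
  rewrite mxE ler_norml; have := ltn_ord (f i); move: (nat_of_ord _) => a ak.
  by apply/andP; split; lia.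
exists [ffun i => inord (absz (n ord0 i + k%:Z))]; first by rewrite mem_enum.
apply/rowP => i; rewrite !mxE ffunE inordK.
  have -> : n 0 i = n ord0 i by congr (n _ _); exact: val_inj.
  by have := H i; move: (n ord0 i) => z; rewrite ler_norml => /andP[n1 n2]; rewrite gez0_abs; lia.
by have := H i; rewrite ler_norml => /andP[n1 n2]; lia.
Qed.

Lemma box_far k n : n \notin box k -> k%:R + 1 <= `|ivec n|.
Proof.
rewrite box_mem => /forallPn[i]; rewrite -ltNge -lezD1 => ki.
apply: le_trans (coord_le_norm _ i); rewrite mxE -intr_norm.
by rewrite -(ler_int R) intrD in ki; exact: ki.
Qed.

Lemma supp_shift Phi (M rho : R) k x n : (forall x, M < `|x| -> Phi x = 0) ->
  M + rho <= k%:R -> `|x| <= rho -> n \notin box k -> Phi (x + ivec n) = 0.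
Proof.
move=> PM Mk xr /box_far nk; apply: PM.
have := ler_normB (x + ivec n) x; rewrite addrC addKr => H.
by have := le_trans nk H; lra.
Qed.

(** A sum with finite support, meaningful when [Phi] has bounded support; [perE] then computes it on
    a whole ball as the sum over one fixed box of translates. *)
Definition periodize Phi x : R := \sum_(n \in [set: zV]) Phi (x + ivec n).

Lemma perE Phi (M rho : R) k x : (forall x, M < `|x| -> Phi x = 0) ->
  M + rho <= k%:R -> `|x| <= rho ->
  periodize Phi x = \sum_(n <- box k) Phi (x + ivec n).
Proof.
move=> PM Mk xr; rewrite fsbig_seq ?box_uniq//; apply/esym/fsbig_widen => //.
by move=> n [_ /= /negP nk]; exact: supp_shift PM Mk xr nk.
Qed.

Lemma per_periodic Phi : function_on Torus (periodize Phi).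
Proof.
move=> _ x i; rewrite /periodize; pose s n : zV := n + delta_mx ord0 i.
have bs : bijective s by exists (fun n => n - delta_mx ord0 i) => n; rewrite /s ?addrK ?subrK.
rewrite [RHS](reindex_fsbigT s)//; apply: eq_fsbigr => n _.
by rewrite /s ivecD ivec_delta -addrA [e_ i + _]addrC.
Qed.

Lemma near_per Phi (M rho : R) k x : (forall x, M < `|x| -> Phi x = 0) ->
  M + rho <= k%:R -> `|x| < rho ->
  \forall y \near (x : rV), periodize Phi y = \sum_(n <- box k) Phi (y + ivec n).
Proof.
move=> PM Mk xr; apply/nbhs_ballP; exists (rho - `|x|) => /=; first by rewrite subr_gt0.
move=> y; rewrite -ball_normE /= => xy; apply: perE PM Mk _.
have := ler_normD (y - x) x; rewrite subrK distrC => H.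
by apply: le_trans H _; move: xy; lra.
Qed.

Lemma smooth_box Phi k : smooth Phi -> smooth (fun x => \sum_(n <- box k) Phi (x + ivec n)).
Proof. by move=> sP; apply: smooth_sum => n _; exact: smooth_shift. Qed.

Lemma smooth_per Phi M : smooth Phi -> (forall x, M < `|x| -> Phi x = 0) ->
  smooth (periodize Phi).
Proof.
move=> sP PM; apply: smooth_local => x.
pose k := Num.bound `|M + (`|x| + 1)%R|.
exists (fun x => \sum_(n <- box k) Phi (x + ivec n)); first exact: smooth_box.
apply: near_per PM _ (_ : `|x| < `|x| + 1); last by rewrite ltrDl.
by apply: le_trans (ler_norm _) _; apply: ltW; exact: archi_boundP.
Qed.

Lemma derive_shift Phi u x y : smooth Phi ->
  'D_u (fun x => Phi (x + y)) x = 'D_u Phi (x + y).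
Proof.
move=> sP; have lid : linear (@id rV) by [].
have [_] := is_derive_precomp lid (is_derive_smooth (x + y) u sP).
exact.
Qed.

Lemma derive_per Phi (M rho : R) k x u : smooth Phi ->
  (forall x, M < `|x| -> Phi x = 0) -> M + rho <= k%:R -> `|x| < rho ->
  'D_u (periodize Phi) x = \sum_(n <- box k) 'D_u Phi (x + ivec n).
Proof.
move=> sP PM Mk xr; rewrite (near_eq_derive _ (near_per PM Mk xr)).
elim: (box k) => [|n s IH].
  by rewrite big_nil; under eq_fun do rewrite big_nil; rewrite derive_cst.
rewrite big_cons -IH -derive_shift//.
have ss : smooth (fun x => \sum_(n <- s) Phi (x + ivec n)).
  by apply: smooth_sum => m _; exact: smooth_shift.
rewrite -(@deriveD _ _ _ (fun x => Phi (x + ivec n))).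
- by congr ('D_u _ x); apply/funext => y; rewrite big_cons.
- exact: smooth_derivable (smooth_shift _ sP).
- exact: smooth_derivable ss.
Qed.

Lemma ge0_integral_shift_rV h (f : rV -> \bar R) : measurable_fun setT f ->
  (forall x, 0 <= f x)%E -> (\int[mu]_x f (x + h)%R = \int[mu]_x f x)%E.
Proof.
move=> mf f0; have pf : function_on WholeSpace f by [].
have := ge0_integral_cell_shift h mf f0 pf.
rewrite (@ge0_integral_cellE _ d WholeSpace f mf f0).
rewrite (@ge0_integral_cellE _ d WholeSpace (fun x => f (x + h)))//.
by apply: measurableT_comp => //; exact: measurable_shift_rV.
Qed.

Lemma cell_floor x n : (x - ivec n) \in @cell R d Torus <-> n = \row_i Num.floor (x ord0 i).
Proof.
rewrite inE; split => [H|-> i].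
  apply/rowP => i; rewrite mxE; apply/esym/floor_def.
  by have := H i; rewrite !mxE intrD => /andP[h1 h2]; apply/andP; split; lra.
by have := floor_itv (x ord0 i); rewrite !mxE intrD => /andP[h1 h2]; apply/andP; split; lra.
Qed.

(** Each point lies in exactly one integer translate of the cell, the one given by the floors of its
    coordinates, so the indicators of the translates add up to 1. A point and its floor vector are
    within distance 1, whence [M + 1]. *)
Lemma ge0_tile (F : rV -> R) (M : R) k : measurable_fun setT F ->
  (forall x, 0 <= F x) -> (forall x, M < `|x| -> F x = 0) -> M + 1 <= k%:R ->
  (\int[mu]_x (F x)%:E = \sum_(n <- box k) \int[mc]_x (F (x + ivec n))%:E)%E.
Proof.
move=> mF F0 FM Mk; pose c := \1_(@cell R d Torus) : rV -> R.
have mc1 : measurable_fun setT c by apply: measurable_indic; exact: measurable_cell.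
have c0 x : 0 <= c x by rewrite /c indicE.
have ms (f : rV -> R) y : measurable_fun setT f -> measurable_fun setT (fun x => f (x + y)).
  by move=> mf; apply: measurableT_comp => //; exact: measurable_shift_rV.
have E x : F x = \sum_(n <- box k) F x * c (x - ivec n).
  pose m : zV := \row_i Num.floor (x ord0 i).
  have cE n : c (x - ivec n) = (n == m)%:R.
    rewrite /c indicE; congr (nat_of_bool _)%:R; apply/idP/eqP => /cell_floor //.
  under eq_bigr => n _ do rewrite cE.
  have [mk|mk] := boolP (m \in box k).
    rewrite (bigD1_seq m)//= ?box_uniq// eqxx mulr1 big1 ?addr0// => n /negPf ->.
    by rewrite mulr0.
  rewrite big_seq big1; last first.
    by move=> n nk; case: eqP nk mk => [->->|] //; rewrite mulr0.
  have := box_far mk => km; apply: FM.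
  have := ler_normB x (x - ivec m); rewrite opprB addrC subrK => H.
  have : `|x - ivec m| <= 1.
    apply: norm_rV_le => // i.
    have := floor_itv (x ord0 i); rewrite !mxE intrD => /andP[h1 h2].
    by rewrite ger0_norm; lra.
  by have := le_trans km H; move: `|x| `|x - _| (k%:R : R) Mk => *; lra.
under eq_integral => x _ do rewrite E -sumEFin.
rewrite ge0_integral_sum//; last 2 first.
- move=> n; apply/measurable_EFinP; apply: measurable_funM => //.
  exact: (ms c).
- by move=> n x _; rewrite lee_fin mulr_ge0.
apply: eq_bigr => n _.
rewrite -(ge0_integral_shift_rV (ivec n)); last 2 first.
- apply/measurable_EFinP; apply: measurable_funM => //.
  exact: (ms c).
- by move=> x; rewrite lee_fin mulr_ge0.
rewrite ge0_integral_cellE; last 2 first.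
- by apply/measurable_EFinP; exact: ms.
- by move=> x; rewrite lee_fin.
rewrite [RHS]integral_mkcond; apply: eq_integral => x _.
rewrite addrK patchE /c indicE; case: (_ \in _); rewrite ?mulr1 ?mulr0//.
Qed.

Lemma tile (f : rV -> R) (M : R) k : mu.-integrable setT (EFin \o f) ->
  (forall x, M < `|x| -> f x = 0) -> M + 1 <= k%:R ->
  (forall n, n \in box k -> mc.-integrable setT (EFin \o (fun x => f (x + ivec n)))) /\
  \int[mu]_x f x = \sum_(n <- box k) \int[mc]_x f (x + ivec n).
Proof.
move=> fi fM Mk; have mf := integrable_mble fi.
have nf : mu.-integrable setT (EFin \o (fun x => `|f x|)) := integrable_norm fi.
have ms (g : rV -> R) y : measurable_fun setT g -> measurable_fun setT (fun x => g (x + y)).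
  by move=> mg; apply: measurableT_comp => //; exact: measurable_shift_rV.
(* Stated for any nonnegative function below |f|, so as to serve for both the positive and the
   negative part. *)
have key (g : rV -> R) : measurable_fun setT g -> (forall x, 0 <= g x <= `|f x|) ->
  (forall n, n \in box k -> mc.-integrable setT (EFin \o (fun x => g (x + ivec n)))) /\
  \int[mu]_x g x = \sum_(n <- box k) \int[mc]_x g (x + ivec n).
  move=> mg gf.
  have g0 x : 0 <= g x by case/andP: (gf x).
  have gM x : M < `|x| -> g x = 0.
    by move=> /fM fx; have := gf x; rewrite fx normr0 => /andP[h1 h2]; apply/eqP; rewrite eq_le h1 h2.
  have gi : mu.-integrable setT (EFin \o g).
    apply: (integrable_dom mg _ nf) => x.
    by rewrite ger0_norm//; case/andP: (gf x).
  have E := ge0_tile mg g0 gM Mk.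
  have gin n : n \in box k -> mc.-integrable setT (EFin \o (fun x => g (x + ivec n))).
    move=> nk; apply/integrableP; split; first by apply/measurable_EFinP; exact: ms.
    have /integrableP[_] := gi.
    under eq_integral => x _ do rewrite /= ger0_norm//.
    rewrite E => Elt; apply: le_lt_trans Elt.
    have -> : (\int[mc]_x `|(EFin \o (fun x => g (x + ivec n)%R)) x| =
        \int[mc]_x (g (x + ivec n))%:E)%E.
      by apply: eq_integral => x _; rewrite /= ger0_norm.
    rewrite (bigD1_seq n)//= ?box_uniq// leeDl//.
    by apply: sume_ge0 => m _; apply: integral_ge0 => x _; rewrite lee_fin.
  split => //; rewrite /Rintegral E big_seq [RHS]big_seq sum_fine//.
  by move=> n nk; apply: integrable_fin_num => //; exact: gin.
have mp : measurable_fun setT (fun x => Num.max (f x) 0) by apply: measurable_maxr.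
have mq : measurable_fun setT (fun x => Num.max (- f x) 0).
  by apply: measurable_maxr => //; exact: measurableT_comp.
have [pi pE] : (forall n, n \in box k -> mc.-integrable setT (EFin \o (fun x => Num.max (f (x + ivec n)) 0))) /\
    \int[mu]_x Num.max (f x) 0 = \sum_(n <- box k) \int[mc]_x Num.max (f (x + ivec n)) 0.
  apply: (key _ mp) => x; rewrite le_max lexx orbT /= ge_max ler_norm normr_ge0//.
have [qi qE] : (forall n, n \in box k -> mc.-integrable setT (EFin \o (fun x => Num.max (- f (x + ivec n)) 0))) /\
    \int[mu]_x Num.max (- f x) 0 = \sum_(n <- box k) \int[mc]_x Num.max (- f (x + ivec n)) 0.
  apply: (key _ mq) => x; rewrite le_max lexx orbT /= ge_max -normrN ler_norm normr_ge0//.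
have fE x : f x = Num.max (f x) 0 - Num.max (- f x) 0.
  by rewrite !maxEle; case: ifP => h1; case: ifP => h2; lra.
split.
  move=> n nk; rewrite (_ : EFin \o _ = EFin \o (fun x => Num.max (f (x + ivec n)) 0 -
      Num.max (- f (x + ivec n)) 0)); last by apply/funext => x /=; rewrite -fE.
  by apply: integrable_subR; [exact: pi | exact: qi].
have ip : mu.-integrable setT (EFin \o (fun x => Num.max (f x) 0)).
  by apply: (integrable_dom mp _ nf) => x; rewrite ger0_norm ?le_max ?lexx ?orbT// ge_max ler_norm normr_ge0.
have iq : mu.-integrable setT (EFin \o (fun x => Num.max (- f x) 0)).
  by apply: (integrable_dom mq _ nf) => x; rewrite ger0_norm ?le_max ?lexx ?orbT// ge_max -normrN ler_norm normr_ge0.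
under eq_Rintegral => x _ do rewrite fE.
rewrite RintegralB// pE qE -sumrB big_seq [RHS]big_seq; apply: eq_bigr => n nk.
rewrite -RintegralB//; [|exact: pi|exact: qi].
by apply: eq_Rintegral => x _; rewrite -fE.
Qed.

End periodization.

(** On the torus a ball is covered by a fixed number of translates of the cell, each carrying the
    same integral of the periodic [f]; on the whole space the cell is everything. The constant does
    not depend on the centre [y]. *)
Lemma local_bound (R : realType) (d : nat) (Omega : spatial_domain) (M : R) :
  exists2 C : R, 0 < C & forall f : 'rV[R]_d -> R, measurable_fun setT f ->
    (forall x, 0 <= f x) -> function_on Omega f -> forall y : 'rV[R]_d,
    (\int[@lebesgue_rV R d]_h (f (y + h)%R * \1_[set h | `|h| <= M]%R h)%:E <=
    C%:E * \int[@cell_measure R d Omega]_x (f x)%:E)%E.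
Proof.
have mB : measurable [set h : 'rV[R]_d | `|h| <= M].
  have := continuous_measurable_rV (@norm_continuous R 'rV[R]_d).
  by move=> /(_ measurableT [set` `]-oo, M]] (measurable_itv _)); rewrite setTI; congr measurable;
    apply/seteqP; split => h /=; rewrite in_itv.
have mi : measurable_fun setT (\1_[set h : 'rV[R]_d | `|h| <= M] : _ -> R).
  exact: measurable_indic.
have i0 h : 0 <= \1_[set h : 'rV[R]_d | `|h| <= M] h :> R by rewrite indicE.
have i1 h : \1_[set h : 'rV[R]_d | `|h| <= M] h <= 1 :> R by rewrite indicE; case: (_ \in _).
have ms (f : 'rV[R]_d -> R) y : measurable_fun setT f ->
    measurable_fun setT (fun x : 'rV[R]_d => f (y + x)).
  by move=> mg; apply: measurableT_comp => //; exact: measurable_shift_rV.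
case: Omega; last first.
  exists 1 => // f mf f0 pf y; rewrite mul1e ge0_integral_cellE//; last exact/measurable_EFinP.
  apply: (@le_trans _ _ (\int[@lebesgue_rV R d]_h (f (h + y))%:E)%E); last first.
    have mf' : measurable_fun setT (EFin \o f) by exact/measurable_EFinP.
    by rewrite (ge0_integral_shift_rV y mf')// => x; rewrite lee_fin.
  apply: ge0_le_integral => //.
  - by move=> x _; rewrite lee_fin mulr_ge0.
  - by apply/measurable_EFinP; apply: measurable_funM => //; exact: ms.
  - by apply/measurable_EFinP; apply: measurableT_comp => //; exact: measurable_shift_rV.
  - by move=> x _; rewrite lee_fin addrC ler_piMr.
pose k := Num.bound `|M + 1|.
have Mk : M + 1 <= k%:R by apply: le_trans (ler_norm _) _; apply: ltW; exact: archi_boundP.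
exists ((size (@box d k)).+1%:R) => // f mf f0 pf y.
have mF : measurable_fun setT (fun h => f (y + h) * \1_[set h | `|h| <= M] h).
  by apply: measurable_funM => //; exact: ms.
have pfn n : function_on Torus (fun x => f (y + x)).
  by move=> _ x i; rewrite addrA pf.
rewrite (@ge0_tile _ _ _ M k)//; last 2 first.
- by move=> x; rewrite mulr_ge0.
- by move=> x Mx; rewrite indicE memNset ?mulr0//= leNgt Mx.
have le1 n : (\int[@cell_measure R d Torus]_(x in [set: 'rV[R]_d])
    (f (y + (x + ivec n)) * \1_[set h | `|h| <= M] (x + ivec n))%:E <=
    \int[@cell_measure R d Torus]_x (f x)%:E)%E.
  have mf' : measurable_fun setT (EFin \o f) by exact/measurable_EFinP.
  rewrite -(ge0_integral_cell_shift (y + ivec n) mf')//; last by move=> OT x i /=; rewrite pf.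
  apply: ge0_le_integral => //.
  - by move=> x _; rewrite lee_fin mulr_ge0.
  - apply/measurable_EFinP.
    by apply: (measurableT_comp mF); exact: measurable_shift_rV.
  - by apply: (measurableT_comp mf'); exact: measurable_shift_rV.
  - by move=> x _; rewrite lee_fin addrCA ler_piMr.
apply: (@le_trans _ _ (\sum_(n <- box k) \int[@cell_measure R d Torus]_x (f x)%:E)%E).
  by apply: lee_sum => n _; exact: le1.
have I0 : (0 <= \int[@cell_measure R d Torus]_x (f x)%:E)%E.
  by apply: integral_ge0 => x _; rewrite lee_fin.
move: (\int[_]_x _)%E I0 => I I0; elim: (box k) => [|n s IH].
  by rewrite big_nil mule_ge0// lee_fin.
rewrite big_cons; apply: le_trans (leeD2l _ IH) _.
by rewrite -[size (n :: s)]/(size s).+1 -[in leRHS]natr1 EFinD ge0_muleDl// mul1e addeC.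
Qed.

(** * Convolutions and pairings *)

Section kern.
Context {R : realType} {d : nat}.
Notation rV := 'rV[R]_d.
Notation e_ i := (delta_mx ord0 i : rV).
Notation mu := (@lebesgue_rV R d).
Implicit Types (Phi k a : rV -> R).

Definition cball (L : R) : set rV := [set h | `|h| <= L].

Lemma measurable_cball L : measurable (cball L).
Proof.
have := continuous_measurable_rV (@norm_continuous R rV).
move=> /(_ measurableT [set` `]-oo, L]] (measurable_itv _)); by rewrite setTI; congr measurable;
  apply/seteqP; split => h /=; rewrite in_itv.
Qed.

Lemma compact_cball L : compact (cball L).
Proof.
apply: bounded_closed_compact.
  by exists L; split; [exact: num_real | move=> M LM h /= hL; apply: le_trans hL _; exact: ltW].
rewrite (_ : cball L = Num.norm @^-1` [set y | y <= L])//.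
by apply: closed_comp; [move=> x _; exact: norm_continuous | exact: closed_le].
Qed.

Lemma lebesgue_cball L : 0 <= L -> (mu (cball L) <= ((2 * L) ^+ d)%:E)%E.
Proof.
move=> L0; have := @lebesgue_rV_box R d (fun=> [set` `[- L, L]]) (fun=> measurable_itv _).
have -> : (\prod_(i < d) lebesgue_measure [set` `[(- L)%R, L%R]] = ((2 * L) ^+ d)%:E :> \bar R)%E.
  have -> : (lebesgue_measure [set` `[(- L)%R, L%R]] = (2 * L)%:E :> \bar R)%E.
    rewrite lebesgue_measure_itv /= lte_fin; case: ltP => L1; first by congr EFin; ring.
    by rewrite (_ : L = 0) ?mulr0//; lra.
  by rewrite prodEFin prodr_const card_ord.
move=> <-; apply: le_measure.
- by rewrite inE; exact: measurable_cball.
- by rewrite inE; apply: (@measurable_box R d (fun=> [set` `[- L, L]])) => i; exact: measurable_itv.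
- move=> h hL i /=; rewrite in_itv /= -ler_norml; exact: le_trans (coord_le_norm _ _) hL.
Qed.

Lemma integrable_cball L : mu.-integrable setT (EFin \o (\1_(cball L) : rV -> R)).
Proof.
apply/integrableP; split.
  by apply/measurable_EFinP/measurable_indic; exact: measurable_cball.
have -> : (\int[mu]_x `|(EFin \o (\1_(cball L) : rV -> R)) x| = mu (cball L))%E.
  have := @integral_indic _ _ R mu setT measurableT (cball L) (measurable_cball L).
  rewrite setIT => <-.
  by apply: eq_integral => x _; rewrite /= ger0_norm// indicE.
have [L0|L0] := leP 0 L; first exact: le_lt_trans (lebesgue_cball L0) (ltry _).
rewrite (_ : cball L = set0) ?measure0//.
by apply/seteqP; split => // h /= hL; have := le_lt_trans hL L0; rewrite normr_lt0.
Qed.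

Definition kern k : Prop := measurable_fun setT k /\
  exists L C, forall h, `|k h| <= C * \1_(cball L) h.

Lemma kern_integrable k : kern k -> mu.-integrable setT (EFin \o k).
Proof.
move=> [mk [L [C kC]]]; apply: integrable_dom mk kC _.
exact: integrable_scaleR (integrable_cball L).
Qed.

Definition csmooth Phi : Prop := smooth Phi /\ exists M, forall x, M < `|x| -> Phi x = 0.

Lemma kern_csmooth Phi : csmooth Phi -> kern Phi.
Proof.
move=> [sP [M PM]]; split; first exact: continuous_measurable_rV (smooth_continuous sP).
exists `|M|.
have ne : cball `|M| !=set0 by exists 0; rewrite /cball /= normr0.
have cn : {within cball `|M|, continuous (fun x => `|Phi x|)}.
  apply: continuous_subspaceT => x; apply: (@continuous_comp _ _ _ Phi Num.norm).
    exact: (smooth_continuous sP).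
  exact: norm_continuous.
have [c _ Hc] := compact_EVT_max ne (@compact_cball `|M|) cn.
exists `|Phi c| => h; rewrite indicE; case: (boolP (h \in cball `|M|)) => hM.
  by rewrite mulr1; exact: Hc.
rewrite PM ?normr0 ?mulr0//; apply: le_lt_trans (ler_norm M) _.
by rewrite ltNge; apply/negP => hM'; move/negP: hM; apply; rewrite inE.
Qed.

Lemma csmooth_derive u Phi : csmooth Phi -> csmooth (fun x => 'D_u Phi x).
Proof.
move=> [sP [M PM]]; split; first exact: smooth_derive.
exists M => x Mx.
have e : \forall y \near x, Phi y = cst 0 y.
  have op : open [set x : rV | M < `|x|].
    rewrite (_ : [set x | _] = Num.norm @^-1` [set y | M < y])//.
    by apply: open_comp; [move=> z _; exact: norm_continuous | exact: open_gt].
  by apply: filterS (open_nbhs_nbhs (conj op Mx)) => y /= My; rewrite PM.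
by rewrite (near_eq_derive _ e) derive_cst.
Qed.

Lemma csmoothD f g : csmooth f -> csmooth g -> csmooth (fun x => f x + g x).
Proof.
move=> [sf [M fM]] [sg [N gN]]; split; first exact: smoothD.
by exists (Num.max M N) => x; rewrite gt_max => /andP[Mx Nx]; rewrite fM// gN// addr0.
Qed.

Lemma csmoothZ (c : R) f : csmooth f -> csmooth (fun x => c * f x).
Proof.
move=> [sf [M fM]]; split; first exact: smoothZ.
by exists M => x Mx; rewrite fM// mulr0.
Qed.

Lemma csmoothN f : csmooth f -> csmooth (fun x => - f x).
Proof.
by move=> bf; rewrite (_ : (fun _ => _) = fun x => -1 * f x);
  [exact: csmoothZ | apply/funext => x; rewrite mulN1r].
Qed.

Lemma csmooth_shift y f : csmooth f -> csmooth (fun x => f (x + y)).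
Proof.
move=> [sf [M fM]]; split; first exact: smooth_shift.
exists (M + `|y|) => x Mx; apply: fM.
by have := ler_normB (x + y) y; rewrite addrK; lra.
Qed.

Lemma csmooth_opp f : csmooth f -> csmooth (fun x => f (- x)).
Proof.
move=> [sf [M fM]]; split; last by exists M => x Mx; rewrite fM// normrN.
rewrite (_ : (fun _ => _) = fun x => f (- x + 0)); last by apply/funext => x; rewrite addr0.
apply: smooth_precomp sf; first exact: opp_continuous.
by move=> a x y; rewrite opprD scalerN.
Qed.

Lemma derive_opp (f : rV -> R) (u x : rV) : smooth f ->
  'D_u (fun x => f (- x)) x = - 'D_u f (- x).
Proof.
move=> sf; pose phi (h : R) := f (h *: u + (- x)).
have dphi : derivable phi (-1 * 0 + 0) (1 : R).
  rewrite mulr0 addr0.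
  by have /is_derive_line[] := is_derive_smooth (- x) u sf.
have [_] := derive_scale dphi; rewrite mulr0 addr0 mulN1r => E.
rewrite derive_line [in RHS]derive_line -E; congr ('D_1 _ (0 : R)).
by apply/funext => h; rewrite /phi mulN1r addr0 scaleNr opprD.
Qed.

End kern.

Lemma Rintegral_shift_rV (R : realType) (d : nat) (h : 'rV[R]_d) (f : 'rV[R]_d -> R) :
  measurable_fun setT f ->
  \int[@lebesgue_rV R d]_x f (x + h) = \int[@lebesgue_rV R d]_x f x.
Proof.
move=> mf; have mE : measurable_fun setT (EFin \o f) by exact/measurable_EFinP.
rewrite /Rintegral integralE [in RHS]integralE; congr (fine (_ - _)).
  have -> : (fun x => (f (x + h))%:E)^\+%E = (fun x => (EFin \o f)^\+%E (x + h)).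
    exact: (funepos_comp (EFin \o f) (fun x => x + h)).
  apply: ge0_integral_shift_rV; first exact: measurable_funepos.
  by move=> x; exact: funepos_ge0.
have -> : (fun x => (f (x + h))%:E)^\-%E = (fun x => (EFin \o f)^\-%E (x + h)).
  exact: (funeneg_comp (EFin \o f) (fun x => x + h)).
apply: ge0_integral_shift_rV; first exact: measurable_funeneg.
by move=> x; exact: funeneg_ge0.
Qed.

Section conv.
Context {R : realType} {d : nat} (Omega : spatial_domain).
Notation rV := 'rV[R]_d.
Notation mu := (@lebesgue_rV R d).
Notation mc := (@cell_measure R d Omega).
Notation per f := (@function_on R d Omega _ f).
Implicit Types (a b A B k : rV -> R).

(** The convolution of [a] with the reflected kernel; equivalently, [a] tested against the translate
    of [k] to [y], as in [cv_shift]. *)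
Definition cv k a (y : rV) : R := \int[mu]_h (a (y + h) * k h).

Lemma measurable_addl a (y : rV) : measurable_fun setT a ->
  measurable_fun setT (fun h : rV => a (y + h)).
Proof. by move=> ma; apply: measurableT_comp => //; exact: measurable_shift_rV. Qed.

Lemma measurable_add2 a : measurable_fun setT a ->
  measurable_fun setT (fun z : rV * rV => a (z.1 + z.2)).
Proof. by move=> ma; apply: measurableT_comp => //; exact: measurable_shift_rV. Qed.

(** The additive constant [c] accommodates |u_i| <= 1 + |u|^2 on the whole space, where constants
    are not integrable: it is integrated only against the boundedly supported kernel, the rest being
    controlled by [local_bound]. *)
Lemma cv_bound k : kern k -> exists2 C : R, 0 <= C & forall a A (c : R),
  measurable_fun setT a -> 0 <= c -> (forall x, 0 <= A x) -> per A ->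
  mc.-integrable setT (EFin \o A) -> (forall x, `|a x| <= c + A x) -> forall y,
  mu.-integrable setT (EFin \o (fun h => a (y + h) * k h)) /\
  `|cv k a y| <= C * (c + \int[mc]_x A x).
Proof.
move=> [mk [L [C0 kC]]]; have [C1 C10 HC1] := @local_bound R d Omega L.
pose C2 := \int[mu]_h (\1_(cball L) h : R).
have C20 : 0 <= C2 by apply: Rintegral_ge0 => h _; rewrite indicE.
exists (`|C0| * (C1 + C2)); first by rewrite mulr_ge0// addr_ge0// ltW.
move=> a A c ma c0 A0 pA iA aA y; have mA := integrable_mble iA.
have mi : measurable_fun setT (\1_(cball L) : rV -> R).
  by apply: measurable_indic; exact: measurable_cball.
have A1fin : (\int[mu]_h (A (y + h) * \1_(cball L) h)%:E <= (C1 * \int[mc]_x A x)%:E)%E.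
  apply: le_trans (HC1 A mA A0 pA y) _.
  by rewrite EFinM /Rintegral fineK//; exact: integrable_fin_num.
have mA1 : measurable_fun setT (fun h => A (y + h) * \1_(cball L) h).
  by apply: measurable_funM => //; exact: measurable_addl.
have iA1 : mu.-integrable setT (EFin \o (fun h => A (y + h) * \1_(cball L) h)).
  apply/integrableP; split; first exact/measurable_EFinP.
  apply: le_lt_trans (ltry (C1 * \int[mc]_x A x)); apply: le_trans A1fin.
  by rewrite le_eqVlt; apply/orP; left; apply/eqP/eq_integral => h _; rewrite /= ger0_norm// mulr_ge0// indicE.
pose G h := `|C0| * (c * \1_(cball L) h + A (y + h) * \1_(cball L) h).
have iG : mu.-integrable setT (EFin \o G).
  apply: integrable_scaleR; apply: integrable_addR => //.
  exact: integrable_scaleR (integrable_cball L).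
have aG h : `|a (y + h) * k h| <= G h.
  rewrite normrM /G -mulrDl mulrA [`|C0| * _]mulrC -mulrA; apply: ler_pM => //.
  apply: le_trans (kC h) _; rewrite ler_wpM2r ?ler_norm// indicE//.
have mak : measurable_fun setT (fun h => a (y + h) * k h).
  by apply: measurable_funM => //; exact: measurable_addl.
split; first exact: integrable_dom mak aG iG.
apply: le_trans (le_norm_Rintegral mak aG iG) _.
rewrite /G RintegralZl//; last first.
  by apply: integrable_addR => //; exact: integrable_scaleR (integrable_cball L).
rewrite RintegralD//; last exact: integrable_scaleR (integrable_cball L).
rewrite RintegralZl//; last exact: integrable_cball.
rewrite -mulrA ler_wpM2l// -/C2.
have : \int[mu]_h (A (y + h) * \1_(cball L) h) <= C1 * \int[mc]_x A x.
  by rewrite -lee_fin /Rintegral fineK//; exact: integrable_fin_num.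
have : 0 <= \int[mc]_x A x by apply: Rintegral_ge0.
move: (\int[_]_x _) (\int[_]_x _) => X Y X0 YX.
rewrite mulrDl !mulrDr [c * C2]mulrC.
have := mulr_ge0 (ltW C10) c0; have := mulr_ge0 C20 X0.
move: (C1 * X) (C1 * c) (C2 * X) (C2 * c) YX => *; lra.
Qed.

Lemma measurable_cv (a : R -> rV -> R) k : measurable_fun setT k ->
  measurable_fun setT (fun z : measurableTypeR R * rV => a z.1 z.2) ->
  measurable_fun setT (fun z : measurableTypeR R * rV => cv k (a z.1) z.2).
Proof.
move=> mk ma; apply: (@measurable_Rintegral _ _ (measurableTypeR R * rV)%type
  rV R mu (fun z => a z.1.1 (z.1.2 + z.2) * k z.2)).
apply: measurable_funM; last exact: (measurableT_comp mk measurable_snd).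
apply: (@measurable_comp_pair _ _ _ _ _ (measurableTypeR R) rV _ a) => //.
  exact: (measurableT_comp measurable_fst measurable_fst).
apply: measurable_shift_rV; last exact: measurable_snd.
exact: (measurableT_comp measurable_snd measurable_fst).
Qed.

(** The integrals of A(x + h) and of A(x) over the cell agree for every [h], so each of the two
    terms factors into an integral in space and the mass of [k]. *)
Lemma pair_bound k A B (G : rV * rV -> R) : mu.-integrable setT (EFin \o k) ->
  (forall h, 0 <= k h) -> per A ->
  mc.-integrable setT (EFin \o A) -> mc.-integrable setT (EFin \o B) ->
  measurable_fun setT G -> (forall z, `|G z| <= (A (z.1 + z.2) + B z.1) * k z.2) ->
  (mc \x mu)%E.-integrable setT (EFin \o G) /\
  `|\int[(mc \x mu)%E]_z G z| <= (\int[mc]_x A x + \int[mc]_x B x) * \int[mu]_h k h.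
Proof.
move=> ik k0 pA iA iB mG GAB.
have iAk := integrable_prod iA ik; have iBk := integrable_prod iB ik.
have pF h : per (fun x => A x * k h) by move=> OT x i; rewrite pA.
have iAs := integrable_pair_shift (F := fun z => A z.1 * k z.2) pF iAk.
have iS : (mc \x mu)%E.-integrable setT
    (EFin \o (fun z : rV * rV => A (z.1 + z.2) * k z.2 + B z.1 * k z.2)).
  exact: integrable_addR.
have GS z : `|G z| <= A (z.1 + z.2) * k z.2 + B z.1 * k z.2 by rewrite -mulrDl.
split; first exact: integrable_dom mG GS iS.
apply: le_trans (le_norm_Rintegral mG GS iS) _.
rewrite RintegralD//.
rewrite (@Rintegral_pair_shift _ _ _ (fun z => A z.1 * k z.2) (integrable_mble iAk) pF).
have pr D : mc.-integrable setT (EFin \o D) ->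
    (mc \x mu)%E.-integrable setT (EFin \o (fun z : rV * rV => D z.1 * k z.2)) ->
    \int[(mc \x mu)%E]_z (D z.1 * k z.2) = \int[mc]_x D x * \int[mu]_h k h.
  move=> iD iDk; rewrite -(Rintegral12 iDk) /=.
  under eq_Rintegral => x _ do rewrite RintegralZl//.
  by rewrite RintegralZr.
by rewrite !pr// mulrDl.
Qed.

(** Young's inequality in L^1, with [a] replaced by a periodic integrable majorant. *)
Lemma cv_L1 k A a : kern k -> per A -> mc.-integrable setT (EFin \o A) ->
  measurable_fun setT a -> (forall x, `|a x| <= A x) ->
  (forall y, mu.-integrable setT (EFin \o (fun h => a (y + h) * k h))) ->
  mc.-integrable setT (EFin \o cv k a) /\
  \int[mc]_x `|cv k a x| <= (\int[mc]_x A x) * \int[mu]_h `|k h|.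
Proof.
move=> kk pA iA ma aA iak; have mk : measurable_fun setT k by case: kk.
have mG : measurable_fun setT (fun z : rV * rV => a (z.1 + z.2) * k z.2).
  by apply: measurable_funM; [exact: measurable_add2 | exact: (measurableT_comp mk measurable_snd)].
have GA (z : rV * rV) : `|a (z.1 + z.2) * k z.2| <= (A (z.1 + z.2) + 0) * `|k z.2|.
  by rewrite normrM addr0 ler_wpM2r.
have i0 : mc.-integrable setT (EFin \o (fun _ : rV => 0 : R)) by exact: integrable0.
have ik : mu.-integrable setT (EFin \o (fun h => `|k h|)) := integrable_norm (kern_integrable kk).
have [iG _] := pair_bound ik (fun h => normr_ge0 _) pA iA i0 mG GA.
have mN : measurable_fun setT (fun z : rV * rV => `|a (z.1 + z.2) * k z.2|).
  exact: measurableT_comp.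
have NA (z : rV * rV) : `| `|a (z.1 + z.2) * k z.2| | <= (A (z.1 + z.2) + 0) * `|k z.2|.
  by rewrite normr_id GA.
have [iN bN] := pair_bound ik (fun h => normr_ge0 _) pA iA i0 mN NA.
split; first exact: (integrable_Rintegral1 iG).
move: bN; rewrite Rintegral0 addr0; apply: le_trans; apply: le_trans (ler_norm _).
rewrite -(Rintegral12 iN) /=; apply: le_Rintegral => //.
- exact: (integrable_norm (integrable_Rintegral1 iG)).
- exact: (integrable_Rintegral1 iN).
- by move=> x _; exact: le_normr_Rintegral (iak x).
Qed.

(** Kept as an integral over pairs, on which reflection and translation of increments act; [pp_cv]
    gives the iterated form. *)
Definition pairing k a b : R := \int[(mc \x mu)%E]_z (a (z.1 + z.2) * b z.1 * k z.2).

Notation pp := pairing.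

Section pairing.
Variables (k a b A B : rV -> R).
Hypotheses (kk : kern k) (ma : measurable_fun setT a) (mb : measurable_fun setT b).
Hypotheses (iA : mc.-integrable setT (EFin \o A)) (iB : mc.-integrable setT (EFin \o B)).
Hypotheses (pA : per A) (abAB : forall x y, `|a x| * `|b y| <= A x + B y).

Let mk : measurable_fun setT k. Proof. by case: kk. Qed.

Let mG : measurable_fun setT (fun z : rV * rV => a (z.1 + z.2) * b z.1 * k z.2).
Proof.
apply: measurable_funM; last exact: (measurableT_comp mk measurable_snd).
by apply: measurable_funM; [exact: measurable_add2 | exact: (measurableT_comp mb measurable_fst)].
Qed.

Let bound := @pair_bound (fun h => `|k h|) A B (fun z => a (z.1 + z.2) * b z.1 * k z.2)
  (integrable_norm (kern_integrable kk)) (fun h => normr_ge0 _) pA iA iB mG.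

Let GAB z : `|a (z.1 + z.2) * b z.1 * k z.2| <= (A (z.1 + z.2) + B z.1) * `|k z.2|.
Proof. by rewrite !normrM ler_wpM2r. Qed.

Lemma integrable_pp :
  (mc \x mu)%E.-integrable setT (EFin \o (fun z => a (z.1 + z.2) * b z.1 * k z.2)).
Proof. by have [] := bound GAB. Qed.

Lemma pp_bound :
  `|pp k a b| <= (\int[mc]_x A x + \int[mc]_x B x) * \int[mu]_h `|k h|.
Proof. by have [] := bound GAB. Qed.

Lemma pp_cv : (forall y, mu.-integrable setT (EFin \o (fun h => a (y + h) * k h))) ->
  mc.-integrable setT (EFin \o (fun x => cv k a x * b x)) /\
  pp k a b = \int[mc]_x (cv k a x * b x).
Proof.
move=> iak; have E x : \int[mu]_h (a (x + h) * b x * k h) = cv k a x * b x.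
  by rewrite /cv -RintegralZr//; apply: eq_Rintegral => h _; rewrite mulrAC.
rewrite /pp -(Rintegral12 integrable_pp); have := integrable_Rintegral1 integrable_pp.
rewrite (_ : EFin \o _ = EFin \o (fun x => cv k a x * b x)).
  by move=> H; split => //; apply: eq_Rintegral => x _; rewrite E.
by apply/funext => x /=; rewrite E.
Qed.

(** The substitution (x, h) -> (x + h, -h) exchanges the two functions and reflects the kernel. *)
Lemma pp_swap : per a -> per b -> pp k a b = pp (fun h => k (- h)) b a.
Proof.
move=> pa pb; pose F (z : rV * rV) := b (z.1 + z.2) * a z.1 * k (- z.2).
have mF : measurable_fun setT F.
  apply: measurable_funM; last first.
    apply: (measurableT_comp mk); apply: measurable_opp_rV; exact: measurable_snd.
  by apply: measurable_funM; [exact: measurable_add2 | exact: (measurableT_comp ma measurable_fst)].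
have pF h : per (fun x => F (x, h)).
  by move=> OT x i; rewrite /F /= pa// addrAC pb.
rewrite /pp -[RHS](Rintegral_pair_swap mF pF); apply: eq_Rintegral => z _.
by rewrite /F /= addrK opprK [b _ * _]mulrC.
Qed.

End pairing.

End conv.

Lemma ae_ord d (T : measurableType d) (R : realType) (m : {measure set T -> \bar R})
    (I : finType) (P : I -> T -> Prop) :
  (forall i, {ae m, forall x, P i x}) -> {ae m, forall x, forall i, P i x}.
Proof.
move=> H; have /ae_foralln : forall n : nat, {ae m, forall x, forall i, enum_rank i = n :> nat -> P i x}.
  move=> n; have [nI|nI] := ltnP n #|I|; last first.
    by apply: aeW => x i E; move: (ltn_ord (enum_rank i)); rewrite E ltnNge nI.
  case: (H (enum_val (Ordinal nI))) => A [mA A0 sub]; exists A; split => // x xA.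
  apply: sub => Px; apply: xA => i E.
  suff -> : i = enum_val (Ordinal nI) by [].
  by apply: enum_rank_inj; rewrite enum_valK; exact: val_inj.
case=> A [mA A0 sub]; exists A; split => // x xA; apply: sub => H'; apply: xA => i.
exact: (H' (enum_rank i)).
Qed.

HB.lock Definition dx {R : realType} {d : nat} (k : 'I_d) (f : 'rV[R]_d -> R)
  (x : 'rV[R]_d) : R := 'D_(delta_mx ord0 k) f x.

Section dx.
Context {R : realType} {d : nat}.
Notation rV := 'rV[R]_d.
Implicit Types (f g : rV -> R) (x y : rV) (k : 'I_d).

Lemma dxE k f x : dx k f x = 'D_(delta_mx ord0 k) f x.
Proof. by rewrite unlock. Qed.

Lemma dx_fun k f : dx k f = fun x => 'D_(delta_mx ord0 k) f x.
Proof. by apply/funext => x; rewrite dxE. Qed.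

Lemma csmooth_dx k f : csmooth f -> csmooth (dx k f).
Proof. by move=> bf; rewrite dx_fun; exact: csmooth_derive. Qed.

Lemma dx_is k f x : csmooth f -> is_derive x (delta_mx ord0 k : rV) f (dx k f x).
Proof. by case=> sf _; rewrite dxE; exact: is_derive_smooth. Qed.

Lemma dx_comm i j f x : csmooth f -> dx i (dx j f) x = dx j (dx i f) x.
Proof. by case=> sf _; rewrite !dxE !dx_fun; exact: derive_comm. Qed.

Lemma dx_shift k f x y : csmooth f -> dx k (fun x => f (x + y)) x = dx k f (x + y).
Proof. by case=> sf _; rewrite !dxE; exact: derive_shift. Qed.

Lemma dxD k f g x : csmooth f -> csmooth g -> dx k (fun x => f x + g x) x = dx k f x + dx k g x.
Proof.
move=> bf bg; rewrite dxE.
by have [_] := is_deriveD (dx_is k x bf) (dx_is k x bg).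
Qed.

Lemma dxZ k f (c : R) x : csmooth f -> dx k (fun x => c * f x) x = c * dx k f x.
Proof. by move=> bf; rewrite dxE; have [_] := is_deriveZ c (dx_is k x bf). Qed.

Lemma dxN k f x : csmooth f -> dx k (fun x => - f x) x = - dx k f x.
Proof. by move=> bf; rewrite dxE; have [_] := is_deriveN (dx_is k x bf). Qed.

Lemma dx_opp k f x : csmooth f -> dx k (fun x => f (- x)) x = - dx k f (- x).
Proof. by case=> sf _; rewrite !dxE; exact: derive_opp. Qed.

Lemma csmooth_cst0 : csmooth (fun _ : rV => 0).
Proof. by split; [exact: smooth_cst | exists 0]. Qed.

Lemma csmooth_sum (I : Type) (s : seq I) (F : I -> rV -> R) : (forall i, csmooth (F i)) ->
  csmooth (fun x => \sum_(i <- s) F i x).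
Proof.
move=> bF; elim: s => [|i s IH].
  rewrite (_ : (fun _ => _) = fun=> 0); first exact: csmooth_cst0.
  by apply/funext => x; rewrite big_nil.
rewrite (_ : (fun _ => _) = fun x => F i x + \sum_(i <- s) F i x); first exact: csmoothD.
by apply/funext => x; rewrite big_cons.
Qed.

Lemma dx_sum (I : Type) (s : seq I) (F : I -> rV -> R) k x : (forall i, csmooth (F i)) ->
  dx k (fun x => \sum_(i <- s) F i x) x = \sum_(i <- s) dx k (F i) x.
Proof.
move=> bF; elim: s => [|i s IH].
  rewrite big_nil dxE (_ : (fun _ => _) = cst 0) ?derive_cst//.
  by apply/funext => y; rewrite big_nil.
rewrite big_cons -IH -dxD//; last exact: csmooth_sum.
by congr (dx k _ x); apply/funext => y; rewrite big_cons.
Qed.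

End dx.

(** * Mollified weak formulation *)

Section flow.
Context {R : realType} {d : nat} (Omega : spatial_domain) (T : R).
Variable u : R -> 'rV[R]_d -> 'rV[R]_d.
Notation rV := 'rV[R]_d.
Notation e_ i := (delta_mx ord0 i : rV).
Notation mu := (@lebesgue_rV R d).
Notation mc := (@cell_measure R d Omega).
Notation leb := (@lebesgue_measure R).
Notation per f := (@function_on R d Omega _ f).

Definition vel (i : 'I_d) (t : R) (x : rV) : R := u t x ord0 i.
Definition velM (i k : 'I_d) (t : R) (x : rV) : R := vel i t x * vel k t x.
Definition nrm2 t : R := \int[mc]_x sqn (u t x).
Definition nrm3 t : R := \int[mc]_x euclid (u t x) ^+ 3.

Notation U := vel.
Notation UU := velM.
Notation n2 := nrm2.
Notation n3 := nrm3.

(* Solutions normalised so as to be defined at every time: [u] vanishes outside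
   ]0, T[ (and, in the application, on a null set of bad times).  The pressure
   has disappeared, as [fl_W] only tests with divergence-free fields. *)
Record flow : Prop := Flow {
  fl_T : 0 < T;
  fl_m : forall i, measurable_fun setT (fun z : measurableTypeR R * rV => U i z.1 z.2);
  fl_0 : forall t, ~~ (0 < t < T) -> u t = fun=> 0;
  fl_p : forall t, per (u t);
  fl_2 : forall t, mc.-integrable setT (EFin \o (fun x => sqn (u t x)));
  fl_3 : forall t, mc.-integrable setT (EFin \o (fun x => euclid (u t x) ^+ 3));
  fl_i2 : leb.-integrable setT (EFin \o n2);
  fl_i3 : leb.-integrable setT (EFin \o n3);
  fl_W : forall Phi : 'I_d -> rV -> R, (forall i, csmooth (Phi i)) ->
    (forall x, \sum_i dx i (Phi i) x = 0) ->
    forall psi, test_function_line `]0, T[ psi ->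
    \int[leb]_t ((\sum_i \int[mu]_x (U i t x * Phi i x)) * 'D_1 psi t) =
    - \int[leb]_t ((\sum_i \sum_k \int[mu]_x (UU i k t x * dx k (Phi i) x)) * psi t);
  fl_D : forall Phi : rV -> R, csmooth Phi ->
    forall psi, test_function_line `]0, T[ psi ->
    \int[leb]_t ((\sum_k \int[mu]_x (U k t x * dx k Phi x)) * psi t) = 0 }.

Hypothesis fl : flow.

Lemma mU i t : measurable_fun setT (U i t).
Proof.
exact: (measurableT_comp (fl_m fl i) (measurable_pair1 t)).
Qed.

Lemma mUUz i k : measurable_fun setT (fun z : measurableTypeR R * rV => UU i k z.1 z.2).
Proof. by apply: measurable_funM; exact: fl_m. Qed.

Lemma mUU i k t : measurable_fun setT (UU i k t).
Proof. by apply: measurable_funM; exact: mU. Qed.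

Lemma pU i t : per (U i t).
Proof. by move=> OT x j; rewrite /U (fl_p fl). Qed.

Lemma pUU i k t : per (UU i k t).
Proof. by move=> OT x j; rewrite /UU !pU. Qed.

Lemma psqn t : per (fun x => sqn (u t x)).
Proof. by move=> OT x j; rewrite (fl_p fl). Qed.

Lemma pcub t : per (fun x => euclid (u t x) ^+ 3).
Proof. by move=> OT x j; rewrite (fl_p fl). Qed.

Lemma sqU_le i t x : U i t x ^+ 2 <= sqn (u t x).
Proof. by rewrite /sqn (bigD1 i)//= lerDl sumr_ge0// => j _; exact: sqr_ge0. Qed.

Lemma U_le i t x : `|U i t x| <= 1 + sqn (u t x).
Proof.
have := sqU_le i t x; rewrite -[U i t x ^+ 2]real_normK ?num_real//.
by move: (`|_|) (normr_ge0 (U i t x)) => y y0 yq; nra.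
Qed.

Lemma UU_sq i k t s x y : `|U i t x| * `|U k s y| <= sqn (u t x) + sqn (u s y).
Proof.
have := sqU_le i t x; have := sqU_le k s y.
rewrite -[U i t x ^+ 2]real_normK ?num_real// -[U k s y ^+ 2]real_normK ?num_real//.
by move: (`|U i t x|) (`|U k s y|) (normr_ge0 (U i t x)) (normr_ge0 (U k s y)) => a b a0 b0 *; nra.
Qed.

Lemma UU_le i k t x : `|UU i k t x| <= sqn (u t x).
Proof.
rewrite normrM; have := sqU_le i t x; have := sqU_le k t x.
rewrite -[U i t x ^+ 2]real_normK ?num_real// -[U k t x ^+ 2]real_normK ?num_real//.
by move: (`|U i t x|) (`|U k t x|) (normr_ge0 (U i t x)) (normr_ge0 (U k t x)) => a b a0 b0 *; nra.
Qed.

Lemma euclid_ge0 (x : rV) : 0 <= euclid x. Proof. exact: sqrtr_ge0. Qed.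

Lemma euclid2 (x : rV) : euclid x ^+ 2 = sqn x.
Proof. by rewrite /euclid sqr_sqrtr// sumr_ge0// => i _; exact: sqr_ge0. Qed.

Lemma coord_euclid (x : rV) i : `|x ord0 i| <= euclid x.
Proof. by apply: coord_sqn; rewrite ?euclid2// euclid_ge0. Qed.

(** With A and B the two norms, the product is at most A^2 B, hence at most the cube of the larger
    one. The bound is a sum of a function of [x] and a function of [y], the form that [pair_bound]
    accepts. *)
Lemma UUU_le i j k t s x y :
  `|UU i k t x| * `|U j s y| <= euclid (u t x) ^+ 3 + euclid (u s y) ^+ 3.
Proof.
rewrite normrM; have := coord_euclid (u t x) i; have := coord_euclid (u t x) k.
have := coord_euclid (u s y) j.
have := normr_ge0 (U i t x); have := normr_ge0 (U k t x); have := normr_ge0 (U j s y).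
rewrite -!/(U _ _ _).
move: (`|U i t x|) (`|U k t x|) (`|U j s y|) (euclid _) (euclid _) => a b c A B c0 b0 a0 cB bA aA.
have A0 : 0 <= A by lra.
have B0 : 0 <= B by lra.
apply: (@le_trans _ _ (A ^+ 2 * B)); first by rewrite expr2 !ler_pM// ?mulr_ge0.
have [AB|/ltW BA] := leP A B.
  apply: (@le_trans _ _ (B ^+ 3)); last by rewrite lerDr exprn_ge0.
  by rewrite [B ^+ 3]exprSr ler_wpM2r// ler_pXn2r ?nnegrE.
apply: (@le_trans _ _ (A ^+ 3)); last by rewrite lerDl exprn_ge0.
by rewrite [A ^+ 3]exprSr ler_wpM2l// exprn_ge0.
Qed.

Lemma n2_ge0 t : 0 <= n2 t.
Proof. by apply: Rintegral_ge0 => x _; exact: sqn_ge0. Qed.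

Lemma cvU_bound k : kern k -> exists2 C : R, 0 <= C & forall i t y,
  mu.-integrable setT (EFin \o (fun h => U i t (y + h) * k h)) /\
  `|cv k (U i t) y| <= C * (1 + n2 t).
Proof.
move=> /(@cv_bound _ _ Omega)[C C0 HC]; exists C => // i t y.
exact: (HC _ (fun x => sqn (u t x)) 1 (mU i t) ler01 (fun x => sqn_ge0 _) (@psqn t) (fl_2 fl t) (U_le i t)).
Qed.

Lemma cvUU_bound k : kern k -> exists2 C : R, 0 <= C & forall i j t y,
  mu.-integrable setT (EFin \o (fun h => UU i j t (y + h) * k h)) /\
  `|cv k (UU i j t) y| <= C * n2 t.
Proof.
move=> /(@cv_bound _ _ Omega)[C C0 HC]; exists C => // i j t y.
have UU0 x : `|UU i j t x| <= 0 + sqn (u t x) by rewrite add0r UU_le.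
have := HC _ (fun x => sqn (u t x)) 0 (mUU i j t) (lexx 0) (fun x => sqn_ge0 _) (@psqn t) (fl_2 fl t) UU0 y.
by rewrite add0r.
Qed.

Lemma U_out i t x : ~~ (0 < t < T) -> U i t x = 0.
Proof. by move=> tT; rewrite /U (fl_0 fl tT) mxE. Qed.

Lemma cv0 (k a : rV -> R) (y : rV) : (forall x, a x = 0) -> cv k a y = 0.
Proof.
move=> a0; rewrite /cv; under eq_Rintegral => h _ do rewrite a0 mul0r.
exact: Rintegral0.
Qed.

Lemma mcvU k i : kern k -> measurable_fun setT (fun z : measurableTypeR R * rV => cv k (U i z.1) z.2).
Proof. by move=> [mk _]; apply: measurable_cv => //; exact: fl_m. Qed.

Lemma mcvUU k i j : kern k -> measurable_fun setT (fun z : measurableTypeR R * rV => cv k (UU i j z.1) z.2).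
Proof. by move=> [mk _]; apply: measurable_cv => //; exact: mUUz. Qed.

Lemma int_cvU k i y : kern k -> leb.-integrable setT (EFin \o (fun t => cv k (U i t) y)).
Proof.
move=> kk; have [C C0 HC] := cvU_bound kk; have [_ iT] := Rintegral_indic_itv (fl_T fl).
have iG : leb.-integrable setT (EFin \o (fun t => C * (\1_`]0, T[ t + n2 t))).
  apply: (@integrable_scaleR _ (measurableTypeR R) R leb).
  exact: (@integrable_addR _ (measurableTypeR R) R leb _ _ iT (fl_i2 fl)).
apply: integrable_domR iG; first exact: (measurableT_comp (mcvU i kk) (measurable_pair2 y)).
move=> t; rewrite indicE mem_setE in_itv /=; case: (boolP (0 < t < T)) => tT.
  by have [] := HC i t y.
by rewrite cv0 ?normr0 ?add0r ?mulr_ge0 ?n2_ge0// => x; exact: U_out.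
Qed.

Lemma int_cvUU k i j y : kern k -> leb.-integrable setT (EFin \o (fun t => cv k (UU i j t) y)).
Proof.
move=> kk; have [C C0 HC] := cvUU_bound kk.
have iG : leb.-integrable setT (EFin \o (fun t => C * n2 t)).
  exact: (@integrable_scaleR _ (measurableTypeR R) R leb _ _ (fl_i2 fl)).
apply: integrable_domR iG; first exact: (measurableT_comp (mcvUU i j kk) (measurable_pair2 y)).
by move=> t; have [] := HC i j t y.
Qed.

Lemma cv_shift (k a : rV -> R) (y : rV) : measurable_fun setT a -> measurable_fun setT k ->
  \int[mu]_x (a x * k (x - y)) = cv k a y.
Proof.
move=> ma mk; rewrite -(Rintegral_shift_rV y).
  by apply: eq_Rintegral => h _; rewrite addrK addrC.
by apply: measurable_funM => //; apply: measurableT_comp => //; exact: measurable_shift_rV.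
Qed.

(** Up to sign, the divergence in [x] of the mollified velocity, with the derivatives moved to the
    kernel. *)
Definition dv (Phi : rV -> R) t x : R := \sum_k cv (dx k Phi) (U k t) x.

Lemma dv_weak (Phi : rV -> R) (x : rV) psi : csmooth Phi -> test_function_line `]0, T[ psi ->
  \int[leb]_t (dv Phi t x * psi t) = 0.
Proof.
move=> bP tp; rewrite -[RHS](fl_D fl (csmooth_shift (- x) bP) tp).
apply: eq_Rintegral => t _; congr (_ * _); apply: eq_bigr => k _.
rewrite -cv_shift; [|exact: mU|by case: (kern_csmooth (csmooth_dx k bP))].
by apply: eq_Rintegral => z _; rewrite dx_shift.
Qed.

(** At each fixed [x] the quantity vanishes for almost every time by [FLCV]; [ae_ae_swap] then fixes
    the time and lets [x] vary. *)
Lemma dv_ae (Phi : rV -> R) : csmooth Phi -> {ae leb, forall t, {ae mc, forall x, dv Phi t x = 0}}.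
Proof.
move=> bP; have kk k := kern_csmooth (csmooth_dx k bP).
have mz : measurable_fun setT (fun z : measurableTypeR R * rV => dv Phi z.1 z.2).
  by apply: measurable_sum => k; exact: mcvU.
apply: (@ae_ae_swap _ _ (measurableTypeR R) rV R leb mc (fun t x => dv Phi t x = 0)).
  rewrite -[X in measurable X]setTI; exact: (mz measurableT _ (measurable_set1 (0 : R))).
move=> x; have iG : leb.-integrable setT (EFin \o (fun t => dv Phi t x)).
  apply: (@integrable_sumR _ (measurableTypeR R) R leb) => k; exact: int_cvU.
have := FLCV iG (fun psi tp => dv_weak x bP tp).
case=> A [mA A0 sub]; exists A; split => // t tA; apply: sub => H; apply: tA => /=.
have [tT|tT] := boolP (0 < t < T); first exact: H.
by rewrite /dv big1// => k _; apply: cv0 => y; exact: U_out.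
Qed.

Section ode.
Variable N : 'I_d -> rV -> R.
Hypothesis bN : forall i, csmooth (N i).
Hypothesis sN : forall i j x, dx j (N i) x = dx i (N j) x.

Definition Kd (x : rV) : R := - \sum_i dx i (N i) x.
(* For each [j] this is divergence free in [i], so that the weak form can be
   tested with it without seeing the pressure. *)
Definition Mf i j (x : rV) : R := (i == j)%:R * Kd x + dx j (N i) x.
(** The time derivative that the weak equation prescribes for [cv Kd (U j t) y], as established in
    [ode]. *)
Definition gg j t y : R := \sum_i \sum_k cv (dx k (Mf i j)) (UU i k t) y.

Lemma csmooth_Kd : csmooth Kd.
Proof. by apply: csmoothN; apply: csmooth_sum => i; exact: csmooth_dx. Qed.

Lemma csmooth_Mf i j : csmooth (Mf i j).
Proof. by apply: csmoothD; [exact: csmoothZ csmooth_Kd | exact: csmooth_dx]. Qed.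

Lemma dx_Mf i j k (x : rV) : dx k (Mf i j) x = (i == j)%:R * dx k Kd x + dx k (dx j (N i)) x.
Proof. by rewrite dxD ?dxZ//; [exact: csmooth_Kd|exact: csmoothZ csmooth_Kd|exact: csmooth_dx]. Qed.

Lemma dx_Kd k (x : rV) : dx k Kd x = - \sum_i dx k (dx i (N i)) x.
Proof.
rewrite dxN ?dx_sum//; first by move=> i; exact: csmooth_dx.
by apply: csmooth_sum => i; exact: csmooth_dx.
Qed.

(** The diagonal part contributes the j-th derivative of [Kd], that is, minus the sum over i of the
    mixed derivatives of [N i] in directions i and j; the Jacobian part contributes the same sum
    with the opposite sign. *)
Lemma Mf_div j (x : rV) : \sum_i dx i (Mf i j) x = 0.
Proof.
under eq_bigr => i _ do rewrite dx_Mf.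
rewrite big_split /= (bigD1 j)//= eqxx mul1r big1 ?addr0; last first.
  by move=> i /negPf ->; rewrite mul0r.
rewrite dx_Kd -sumrN -big_split big1// => i _ /=.
by rewrite dx_comm// addNr.
Qed.

Lemma gg_bound : exists2 C : R, 0 <= C & forall j t y, `|gg j t y| <= C * n2 t.
Proof.
have H i j k : exists C : R, 0 <= C /\ forall t y,
    `|cv (dx k (Mf i j)) (UU i k t) y| <= C * n2 t.
  have [C C0 HC] := cvUU_bound (kern_csmooth (csmooth_dx k (csmooth_Mf i j))).
  by exists C; split => // t y; have [] := HC i k t y.
have /choice[c Hc] : forall p : 'I_d * 'I_d * 'I_d, exists C : R, 0 <= C /\ forall t y,
    `|cv (dx p.2 (Mf p.1.1 p.1.2)) (UU p.1.1 p.2 t) y| <= C * n2 t.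
  by move=> p; exact: H.
exists (\sum_p c p); first by apply: sumr_ge0 => p _; case: (Hc p).
move=> j t y.
apply: (@le_trans _ _ (\sum_i \sum_k c (i, j, k) * n2 t)).
  apply: le_trans (ler_norm_sum _ _ _) _; apply: ler_sum => i _.
  apply: le_trans (ler_norm_sum _ _ _) _; apply: ler_sum => k _.
  by have [_] := Hc (i, j, k).
under eq_bigr => i _ do rewrite -mulr_suml.
rewrite -mulr_suml ler_wpM2r ?n2_ge0//.
have -> : \sum_p c p = \sum_i \sum_j \sum_k c (i, j, k).
  rewrite (pair_bigA _ (fun i j => \sum_k c (i, j, k))) /=.
  rewrite (pair_bigA _ (fun p k => c (p.1, p.2, k))) /=.
  by apply: eq_bigr => -[[i j'] k].
apply: ler_sum => i _; rewrite [leRHS](bigD1 j)//= lerDl.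
by apply: sumr_ge0 => j' _; apply: sumr_ge0 => k _; case: (Hc (i, j', k)).
Qed.

Lemma mgg j : measurable_fun setT (fun z : measurableTypeR R * rV => gg j z.1 z.2).
Proof.
apply: measurable_sum => i; apply: measurable_sum => k.
by apply: mcvUU; apply: kern_csmooth; apply: csmooth_dx; exact: csmooth_Mf.
Qed.

Lemma int_gg j y : leb.-integrable setT (EFin \o (fun t => gg j t y)).
Proof.
apply: (@integrable_sumR _ (measurableTypeR R) R leb) => i.
apply: (@integrable_sumR _ (measurableTypeR R) R leb) => k.
by apply: int_cvUU; apply: kern_csmooth; apply: csmooth_dx; exact: csmooth_Mf.
Qed.

Lemma test_derive psi : test_function_line `]0, T[ psi -> test_function_line `]0, T[ (fun t : R => 'D_1 psi t).
Proof.
move=> [sp [K [cK KT K0]]]; split; first exact: (smooth_derive (1 : R) sp).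
exists K; split => // t tK.
have cl : closed K by apply: compact_closed => //; exact: Rhausdorff.
have e : \forall s \near t, psi s = cst 0 s.
  have op : open (~` K) by exact: closed_openC.
  by apply: filterS (open_nbhs_nbhs (conj op tK)) => s; exact: K0.
by rewrite (near_eq_derive _ e) derive_cst.
Qed.

Lemma test_bounded psi : 0 < T -> test_function_line `]0, T[ psi -> measurable_fun setT psi /\
  exists2 C : R, 0 <= C & forall t, `|psi t| <= C.
Proof.
move=> T0 [sp [K [cK KT K0]]]; split; first exact: continuous_measurable_fun (smooth_continuous sp).
have cn : {within `[0, T], continuous (fun t => `|psi t|)}.
  apply: continuous_subspaceT => t; apply: (@continuous_comp _ _ _ psi Num.norm).
    exact: (smooth_continuous sp).
  exact: norm_continuous.
have [c _ Hc] := EVT_max (ltW T0) cn.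
exists `|psi c| => // t; have [tT|tT] := boolP (t \in `[0, T]); first exact: Hc.
rewrite K0 ?normr0// => /KT; rewrite /= in_itv /= => /andP[t0 t1].
by move: tT; rewrite in_itv /= !ltW.
Qed.

Lemma int_test g psi : 0 < T -> leb.-integrable setT (EFin \o g) -> test_function_line `]0, T[ psi ->
  leb.-integrable setT (EFin \o (fun t => g t * psi t)).
Proof.
move=> T0 ig tp; have [mp [C C0 HC]] := test_bounded T0 tp.
have mg := @integrable_mble _ (measurableTypeR R) R leb _ ig.
have iG : leb.-integrable setT (EFin \o (fun t => C * `|g t|)).
  exact: (@integrable_scaleR _ (measurableTypeR R) R leb _ _ (integrable_norm ig)).
apply: integrable_domR iG; first exact: measurable_funM.
by move=> t; rewrite normrM mulrC ler_wpM2r.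
Qed.

(** Testing with the field [Mf i j] translated to [y] gives the mollified [U j] plus the sum over i
    of [cv (dx j (N i)) (U i t) y]. By symmetry of the Jacobian this sum is [dv (N j)], which
    vanishes in the weak sense since [u] is divergence free. *)
Lemma ode j : exists c : rV -> R, {ae leb, forall t, 0 < t < T ->
  {ae mc, forall y, cv Kd (U j t) y = c y + prim ((gg j)^~ y) t}}.
Proof.
have kK := kern_csmooth csmooth_Kd.
apply: (@weak_ode_param R _ rV mc T (fun t y => cv Kd (U j t) y) (gg j) (fl_T fl)).
- exact: mcvU.
- exact: mgg.
- by move=> y; exact: int_cvU.
- by move=> y; exact: int_gg.
move=> y psi tp; have tp' := test_derive tp.
have bS i : csmooth (fun x => Mf i j (x - y)) by apply: csmooth_shift; exact: csmooth_Mf.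
have dS x : \sum_i dx i (fun x => Mf i j (x - y)) x = 0.
  rewrite -[RHS](Mf_div j (x - y)); apply: eq_bigr => i _.
  by rewrite dx_shift//; exact: csmooth_Mf.
have := fl_W fl bS dS tp.
have -> : \int[leb]_t ((\sum_i \sum_k \int[mu]_x (UU i k t x *
    dx k (fun x => Mf i j (x - y)) x)) * psi t) = \int[leb]_t (gg j t y * psi t).
  apply: eq_Rintegral => t _; congr (_ * _); apply: eq_bigr => i _; apply: eq_bigr => k _.
  rewrite -cv_shift; [|exact: mUU|by case: (kern_csmooth (csmooth_dx k (csmooth_Mf i j)))].
  by apply: eq_Rintegral => z _; rewrite dx_shift//; exact: csmooth_Mf.
(* The incompressibility condition, tested with the derivative of [psi], supplies the extra term
   that the Jacobian part of [Mf] produces. *)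
move=> <-; apply/esym; rewrite -[RHS]addr0 -[X in _ = _ + X](dv_weak y (bN j) tp').
rewrite -RintegralD//; last 2 first.
- by apply: (int_test (fl_T fl)) => //; exact: int_cvU.
- apply: (int_test (fl_T fl)) => //; apply: (@integrable_sumR _ (measurableTypeR R) R leb) => k.
  by apply: int_cvU; apply: kern_csmooth; exact: csmooth_dx.
apply: eq_Rintegral => t _; rewrite -mulrDl; congr (_ * _).
have E i : \int[mu]_x (U i t x * Mf i j (x - y)) =
    (i == j)%:R * cv Kd (U i t) y + cv (dx i (N j)) (U i t) y.
  rewrite cv_shift; [|exact: mU|by case: (kern_csmooth (csmooth_Mf i j))].
  have [C1 _ /(_ i t y)[i1 _]] := cvU_bound kK.
  have [C2 _ /(_ i t y)[i2 _]] := cvU_bound (kern_csmooth (csmooth_dx i (bN j))).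
  rewrite /cv -RintegralZl// -RintegralD//; last exact: integrable_scaleR.
  apply: eq_Rintegral => h _; rewrite /Mf sN mulrDr; congr (_ + _).
  by rewrite mulrCA.
under eq_bigr => i _ do rewrite E.
rewrite big_split /=; congr (_ + _).
by rewrite (bigD1 j)//= eqxx mul1r big1 ?addr0// => i /negPf ->; rewrite mul0r.
Qed.

End ode.
End flow.

(** Truncating [f] to [-g, g] changes it on a null set only and makes the bound hold at every
    point. *)
Lemma le_norm_Rintegral_ae d (T : measurableType d) (R : realType)
    (m : {measure set T -> \bar R}) (f g : T -> R) : measurable_fun setT f ->
  (forall x, 0 <= g x) -> {ae m, forall x, `|f x| <= g x} ->
  m.-integrable setT (EFin \o g) -> `|\int[m]_x f x| <= \int[m]_x g x.
Proof.
move=> mf g0 fg ig; have mg := integrable_mble ig.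
pose f' x := Num.max (- g x) (Num.min (f x) (g x)).
have mf' : measurable_fun setT f'.
  apply: measurable_maxr; first exact: measurableT_comp.
  exact: measurable_minr.
rewrite (@ae_eq_Rintegral _ _ _ m f f' mf mf').
  apply: le_norm_Rintegral => // x; rewrite ler_norml /f' le_max lexx /=.
  by rewrite ge_max ge_min lexx orbT andbT; have := g0 x; lra.
case: fg => A [mA A0 sub]; exists A; split => // x xA; apply: sub => /= fgx; apply: xA.
move: fgx; rewrite ler_norml => /andP[f1 f2].
by rewrite /= /f' min_l// max_r.
Qed.

(** * Primitives and bisection on an interval *)

Section line.
Context {R : realType}.
Notation leb := (@lebesgue_measure R).

Lemma ae_dense (P : R -> Prop) (a b : R) : {ae leb, forall t, P t} -> a < b ->
  exists2 t, a < t < b & P t.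
Proof.
move=> [A [mA A0 sub]] ab; apply: contrapT => H.
have : (leb [set` `]a, b[] <= leb A)%E.
  apply: le_measure; rewrite ?inE//.
  move=> t /=; rewrite in_itv /= => tab; apply: sub => Pt; apply: H.
  by exists t.
by rewrite A0 lebesgue_measure_itv /= lte_fin ab -EFinB lee_fin leNgt subr_gt0 ab.
Qed.

Lemma prim_continuous (g : R -> R) (T : R) : 0 < T -> leb.-integrable setT (EFin \o g) ->
  {within `[0, T], continuous (prim g)}.
Proof.
move=> T0 ig; have ig' : leb.-integrable `[0, T] (EFin \o g).
  by apply: integrableS ig => //; exact: measurable_itv.
have := parameterized_integral_continuous (ltW T0) ig'.
have E t : t \in `[0, T] -> parameterized_integral leb 0 t g = prim g t.
  rewrite in_itv /= => /andP[t0 tT].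
  transitivity (\int[leb]_(s in [set` `]0, t]]) g s).
    rewrite /parameterized_integral Rintegral_itv_obnd_cbnd//.
    by apply: integrableS ig => //; exact: measurable_itv.
  rewrite Rintegral_mkcond; apply: eq_Rintegral => s _.
  by rewrite patchE indicE; case: (_ \in _); rewrite ?mulr1 ?mulr0.
move=> H; apply: (subspace_eq_continuous _ H) => t tT; apply: E.
by rewrite inE in tT.
Qed.

Lemma prim_le (g : R -> R) a b : leb.-integrable setT (EFin \o g) -> (forall t, 0 <= g t) ->
  0 <= a -> a <= b -> prim g a <= prim g b.
Proof.
move=> ig g0 a0 ab; rewrite -subr_ge0 prim_split//.
by apply: Rintegral_ge0 => t _; rewrite mulr_ge0// indicE.
Qed.

Lemma prim_lip (f g : R -> R) (C : R) a b : leb.-integrable setT (EFin \o f) ->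
  leb.-integrable setT (EFin \o g) -> 0 <= C -> (forall t, `|f t| <= C * g t) ->
  0 <= a -> a <= b -> `|prim f b - prim f a| <= C * (prim g b - prim g a).
Proof.
move=> fi gi C0 fg a0 ab; rewrite !prim_split//.
have ii := integrable_indicR (measurable_itv `]a, b]) gi.
rewrite -RintegralZl//; apply: (@le_norm_Rintegral _ (measurableTypeR R) R leb).
- exact: (@integrable_mble _ (measurableTypeR R) R leb _ (integrable_indicR (measurable_itv `]a, b]) fi)).
- move=> t; rewrite normrM mulrA [`|\1__ _|]ger0_norm ?ler_wpM2r// indicE//.
- exact: (@integrable_scaleR _ (measurableTypeR R) R leb).
Qed.

(* bisecting at a point where [A] has increased by about half divides the
   quadratic bound by a fixed factor *)
Lemma bisect (P : R -> Prop) (F A : R -> R) (C a b : R) : 0 <= C ->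
  {ae leb, forall t, a < t < b -> P t} -> P a -> P b -> a < b ->
  {within `[a, b], continuous A} ->
  (forall s t, a <= s -> s <= t -> t <= b -> A s <= A t) ->
  (forall s t, a <= s -> s < t -> t <= b -> P s -> P t ->
     `|F t - F s| <= C * (A t - A s) ^+ 2) -> F b = F a.
Proof.
move=> C0 aeP Pa Pb ab cA ndA H.
(* When an increase D of [A] is cut into two parts between D/4 and 3D/4, the sum of their squares is
   at most (1/16 + 9/16) D^2, which is below 3/4 D^2. *)
pose r : R := 3 / 4.
(* The exact midpoint in value, given by the intermediate value theorem, need not satisfy [P]; a
   nearby point does, and by continuity of [A] it misses the midpoint by at most a quarter of the
   increase. *)
have split_pt s t : a <= s -> s < t -> t <= b -> A s < A t ->
    exists m, [/\ s < m, m < t, P m & `|A m - (A s + A t) / 2| <= (A t - A s) / 4].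
  move=> as_ st tb Ast.
  have cA' : {within `[s, t], continuous A}.
    apply: continuous_subspaceW cA => x /=; rewrite !in_itv /= => /andP[x1 x2].
    by rewrite (le_trans as_ x1) (le_trans x2 tb).
  have [m0 m0st Am0] : exists2 m, m \in `[s, t] & A m = (A s + A t) / 2.
    apply: IVT => //; first exact: ltW.
    by rewrite (min_l (ltW Ast)) (max_r (ltW Ast)); lra.
  have m0st' : s < m0 < t.
    move: m0st; rewrite in_itv /= !le_eqVlt => /andP[/predU1P[sm|->]].
      by exfalso; move: Am0; rewrite -sm; lra.
    by move=> /predU1P[mt|->//]; exfalso; move: Am0; rewrite mt; lra.
  have cm : {for m0, continuous A}.
    have := (continuous_within_itvP _ st).1 cA'; case=> /(_ m0) + _ _.
    by move=> H1; apply: H1; rewrite in_itv.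
  have e0 : 0 < (A t - A s) / 4 by lra.
  have /cvgrPdist_le /(_ _ e0) N1 := cm.
  have N2 : \forall x \near m0, s < x < t.
    by apply: near_in_itvoo; rewrite in_itv.
  have [e /= ep He] := (nbhs_ballP _ _).1 (filterI N1 N2).
  have me : m0 < m0 + e by rewrite ltrDl.
  have [m /andP[m1 m2] Pm] := ae_dense aeP me.
  have [|Am /andP[sm mt]] := He m.
    by rewrite /ball /= ltr_norml; apply/andP; split; lra.
  exists m; split => //; last by rewrite -Am0 distrC.
  by apply: Pm; rewrite (le_lt_trans as_ sm) (lt_le_trans mt tb).
have step n : forall s t, a <= s -> s < t -> t <= b -> P s -> P t ->
    `|F t - F s| <= C * r ^+ n * (A t - A s) ^+ 2.
  elim: n => [|n IH] s t as_ st tb Ps Pt; first by rewrite expr0 mulr1; exact: H.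
  have [Ast|Ast] := ltP (A s) (A t); last first.
    have := H s t as_ st tb Ps Pt.
    have -> : A t - A s = 0 by have := ndA s t as_ (ltW st) tb; lra.
    by rewrite expr0n /= !mulr0.
  have [m [sm mt Pm Am]] := split_pt s t as_ st tb Ast.
  have am : a <= m by rewrite (le_trans as_)// ltW.
  have mb : m <= b by rewrite (le_trans _ tb)// ltW.
  have I1 := IH s m as_ sm mb Ps Pm; have I2 := IH m t am mt tb Pm Pt.
  have -> : F t - F s = (F t - F m) + (F m - F s) by ring.
  apply: le_trans (ler_normD _ _) _; apply: le_trans (lerD I2 I1) _.
  have rn0 : 0 <= r ^+ n by rewrite exprn_ge0// /r; lra.
  rewrite [r ^+ n.+1]exprS; move: (r ^+ n) rn0 => q q0.
  have -> : C * (r * q) * (A t - A s) ^+ 2 = C * q * (r * (A t - A s) ^+ 2) by ring.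
  rewrite -mulrDr ler_wpM2l ?mulr_ge0//.
  move: Am; rewrite ler_norml /r => /andP[A1 A2].
  by move: (A s) (A t) (A m) Ast A1 A2 => x y z *; nra.
apply/eqP; rewrite -subr_eq0 -normr_eq0 eq_le normr_ge0 andbT.
pose B := C * (A b - A a) ^+ 2.
have r1 : `|r| < 1 by rewrite /r ger0_norm; lra.
have cv : (fun n => B * r ^+ n) @ \oo --> B * 0.
  by apply: cvgM; [exact: cvg_cst | exact: cvg_expr].
rewrite mulr0 in cv.
apply/ler_addgt0Pr => e e0; rewrite add0r.
have /cvgrPdist_lt /(_ _ e0)[n _ Hn] := cv.
apply: le_trans (step n a b (lexx a) ab (lexx b) Pa Pb) _.
have := Hn n (leqnn n); rewrite /= sub0r normrN => Hn'.
apply: le_trans (ltW Hn'); apply: le_trans (ler_norm _).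
by rewrite /B mulrAC.
Qed.

End line.

(** * Test functions and primitives *)

Section test_line.
Context {R : realType} (T : R) (psi : R -> R).
Notation leb := (@lebesgue_measure R).
Hypothesis T0 : 0 < T.
Hypothesis tp : test_function_line `]0, T[ psi.

Lemma test_out t : ~~ (0 < t < T) -> psi t = 0.
Proof. by have [_ [K [_ KT K0]]] := tp => tT; apply: K0 => /KT; rewrite /= in_itv /= (negPf tT). Qed.

Lemma test_integrable : leb.-integrable setT (EFin \o psi).
Proof.
have i0 : leb.-integrable `[0, T] (EFin \o psi).
  apply: continuous_compact_integrable; first exact: segment_compact.
  by apply: continuous_subspaceT; apply: smooth_continuous; case: tp.
have := (@integrable_mkcond _ (measurableTypeR R) R leb `[0, T] (EFin \o psi) (measurable_itv `[0, T])).1 i0.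
congr (_.-integrable _ _); apply/funext => t; rewrite /= patchE; case: ifPn => // /negP tT.
rewrite test_out//; apply/negP => /andP[t0 t1]; apply: tT.
by rewrite mem_setE in_itv /= !ltW.
Qed.

Lemma test_FTC (s : R) : 0 <= s -> s < T ->
  \int[leb]_(t in [set` `[s, T]]) 'D_1 psi t = - psi s.
Proof.
move=> s0 s1; have [sp _] := tp; pose dpsi t := 'D_1 psi t.
have cn : {within `[s, T], continuous dpsi}.
  by apply: continuous_subspaceT; exact: smooth_continuous (smooth_derive (1 : R) sp).
have dL : derivable_oo_LRcontinuous psi s T.
  split.
  - by move=> t _; exact: smooth_derivable sp.
  - by apply: cvg_at_right_filter; exact: (smooth_continuous sp).
  - by apply: cvg_at_left_filter; exact: (smooth_continuous sp).
have dE : {in `]s, T[, derive1 psi =1 dpsi} by move=> t _; rewrite derive1E.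
have := continuous_FTC2 s1 cn dL dE.
rewrite (test_out (t := T)) ?ltxx ?andbF// sub0e => F.
by rewrite /Rintegral F.
Qed.

End test_line.

Lemma test_int0 (R : realType) (T : R) (psi : R -> R) : 0 < T ->
  test_function_line `]0, T[ psi -> \int[@lebesgue_measure R]_t 'D_1 psi t = 0.
Proof.
move=> T0 tp; have tp' := test_derive tp.
have := test_FTC tp (lexx 0) T0; rewrite (test_out tp (t := 0)) ?ltxx// oppr0 => E.
rewrite -[RHS]E [RHS]Rintegral_mkcond; apply: eq_Rintegral => t _.
rewrite patchE mem_setE in_itv /=; case: ifPn => // /negP tT.
by rewrite (test_out tp')//; apply/negP => /andP[t0 t1]; apply: tT; rewrite !ltW.
Qed.

Lemma prim_bound (R : realType) (g : R -> R) t : (@lebesgue_measure R).-integrable setT (EFin \o g) ->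
  `|prim g t| <= \int[@lebesgue_measure R]_s `|g s|.
Proof.
move=> ig; apply: (@le_norm_Rintegral _ (measurableTypeR R) R (@lebesgue_measure R)).
- exact: (@integrable_mble _ (measurableTypeR R) R (@lebesgue_measure R) _ (integrable_indicR (measurable_itv `]0, t]) ig)).
- by move=> s; rewrite normrM ler_piMr// indicE; case: (_ \in _); rewrite ?normr1 ?normr0.
- exact: integrable_norm.
Qed.

Lemma measurable_prim1 (R : realType) (g : R -> R) :
  (@lebesgue_measure R).-integrable setT (EFin \o g) -> measurable_fun setT (prim g).
Proof.
move=> ig; have mB : measurable_fun setT (fun z : measurableTypeR R * unit => g z.1).
  apply: (measurableT_comp _ measurable_fst).
  exact: (@integrable_mble _ (measurableTypeR R) R (@lebesgue_measure R) _ ig).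
have H := @measurable_prim R _ unit (fun t _ => g t) mB.
exact: (measurableT_comp H (measurable_pair2 tt)).
Qed.

(** Fubini on the region 0 < s <= t, followed by the fundamental theorem of calculus on [s, T],
    where [psi] vanishes at [T]. *)
Lemma prim_weak (R : realType) (g psi : R -> R) (T : R) : 0 < T ->
  (@lebesgue_measure R).-integrable setT (EFin \o g) ->
  test_function_line `]0, T[ psi ->
  \int[@lebesgue_measure R]_t (prim g t * 'D_1 psi t) = - \int[@lebesgue_measure R]_t (g t * psi t).
Proof.
set leb := (@lebesgue_measure R); move=> T0 ig tp; have tp' := test_derive tp.
(* [f] and [J] are kept abstract, as unfolding them makes the rewriting slow *)
have [f fE] : exists f : R -> R, f = fun t => 'D_1 psi t by eexists.
have [J JE] : exists J : R -> R -> R, J = fun s t => ((0 < s) && (s <= t))%:R by eexists.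
have J1 s t : `|J s t| <= 1 by rewrite JE; case: (_ && _); rewrite ?normr1 ?normr0.
have mJ : measurable_fun setT (fun z : measurableTypeR R * measurableTypeR R => J z.1 z.2).
  rewrite (_ : (fun _ => _) = \1_[set z : measurableTypeR R * measurableTypeR R | (0 < z.1) && (z.1 <= z.2)]).
    apply: measurable_indic; rewrite -[X in measurable X]setTI.
    have mB : measurable_fun setT (fun z : measurableTypeR R * measurableTypeR R => (0 < z.1) && (z.1 <= z.2)).
      by apply: measurable_and; [exact: measurable_fun_ltr | exact: measurable_fun_ler].
    exact: (mB measurableT [set true]).
  by apply/funext => z; rewrite JE indicE; congr (nat_of_bool _)%:R; apply/idP/idP; rewrite inE.
have fout t : ~~ (0 < t < T) -> f t = 0 by move=> tT; rewrite fE; exact: (test_out tp' tT).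
have jf : leb.-integrable setT (EFin \o f) by rewrite fE; exact: (test_integrable tp').
have ig_psi : leb.-integrable setT (EFin \o (fun t => g t * psi t)) := int_test T0 ig tp.
have FTC s : 0 <= s -> s < T -> \int[leb]_(t in [set` `[s, T]]) f t = - psi s.
  by move=> s0 sT; rewrite fE; exact: (test_FTC tp s0 sT).
have psi_out s : ~~ (0 < s < T) -> psi s = 0 by exact: (test_out tp).
rewrite -[X in _ = - X]/(\int[leb]_t (g t * psi t)).
transitivity (\int[leb]_t (prim g t * f t)); first by rewrite fE.
clear fE tp tp'.
pose H (z : measurableTypeR R * measurableTypeR R) := g z.1 * f z.2 * J z.1 z.2.
have iP := @integrable_prod _ _ (measurableTypeR R) (measurableTypeR R) R leb leb g f ig jf.
have mH : measurable_fun setT H.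
  by apply: measurable_funM => //; exact: integrable_mble iP.
have iH : (leb \x leb)%E.-integrable setT (EFin \o H).
  apply: (integrable_dom mH _ (integrable_norm iP)) => z.
  by rewrite /H [leLHS]normrM ler_piMr.
have := @Rintegral21 _ _ (measurableTypeR R) (measurableTypeR R) R leb leb H iH.
rewrite -(@Rintegral12 _ _ (measurableTypeR R) (measurableTypeR R) R leb leb H iH) => E.
transitivity (\int[leb]_t \int[leb]_s H (s, t)).
  apply: eq_Rintegral => t _; rewrite /prim.
  have ip : leb.-integrable setT (EFin \o (fun s => g s * \1_`]0, t] s)).
    exact: (integrable_indicR (measurable_itv _) ig).
  rewrite -(RintegralZr (f t) measurableT ip).
  apply: eq_Rintegral => s _; rewrite /H indicE mem_setE in_itv /= JE.
  by rewrite mulrAC.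
rewrite E -(RintegralN ig_psi).
apply: eq_Rintegral => s _.
have ifJ : leb.-integrable setT (EFin \o (fun t => f t * J s t)).
  apply: (integrable_domR (g := fun t => `|f t|)); last exact: integrable_norm.
    apply: measurable_funM; first exact: (integrable_mble jf).
    exact: (measurableT_comp mJ (measurable_pair1 s)).
  by move=> t; rewrite normrM ler_piMr.
transitivity (g s * \int[leb]_t (f t * J s t)).
  rewrite -(RintegralZl (g s) measurableT ifJ).
  by apply: eq_Rintegral => t _; rewrite /H mulrA.
rewrite -mulrN; congr (_ * _).
have [sT|sT] := boolP (0 < s < T); last first.
  rewrite (psi_out _ sT) oppr0 -(Rintegral0 leb).
  apply: eq_Rintegral => t _; rewrite JE; case: (ltP 0 s) => s0; last by rewrite mulr0.
  case: (leP s t) => st; last by rewrite mulr0.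
  rewrite fout ?mul0r//; apply/negP => /andP[_ tT].
  by move/negP: sT; apply; rewrite s0 (le_lt_trans st tT).
have /andP[s0 s1] := sT.
rewrite -(FTC s (ltW s0) s1) [RHS]Rintegral_mkcond; apply: eq_Rintegral => t _.
rewrite patchE mem_setE in_itv /= JE s0 /=; case: (leP s t) => st; last by rewrite mulr0.
rewrite mulr1; case: (leP t T) => [//|tT].
by rewrite fout// negb_and -!leNgt (ltW tT) orbT.
Qed.

(** * The mollified energy and its time derivative *)

Section energy.
Context {R : realType} {d : nat} (Omega : spatial_domain) (T : R).
Variable u : R -> 'rV[R]_d -> 'rV[R]_d.
Notation rV := 'rV[R]_d.
Notation mu := (@lebesgue_rV R d).
Notation mc := (@cell_measure R d Omega).
Notation leb := (@lebesgue_measure R).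
Notation per f := (@function_on R d Omega _ f).
Notation U := (vel u).
Notation UU := (velM u).
Notation n2 := (nrm2 Omega u).
Notation n3 := (nrm3 Omega u).
Notation pp := (@pairing R d Omega).
Hypothesis fl : flow Omega T u.

Let mU i t : measurable_fun setT (U i t) := mU fl i t.
Let mUU i k t : measurable_fun setT (UU i k t) := mUU fl i k t.
Let i3 t : mc.-integrable setT (EFin \o (fun x => euclid (u t x) ^+ 3)) := fl_3 fl t.
Let i2 t : mc.-integrable setT (EFin \o (fun x => sqn (u t x))) := fl_2 fl t.

Lemma iU k i s y : kern k -> mu.-integrable setT (EFin \o (fun h => U i s (y + h) * k h)).
Proof. by move=> /(cvU_bound fl)[C _ H]; have [] := H i s y. Qed.

Lemma iUU k i j s y : kern k -> mu.-integrable setT (EFin \o (fun h => UU i j s (y + h) * k h)).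
Proof. by move=> /(cvUU_bound fl)[C _ H]; have [] := H i j s y. Qed.

Let UUUr_le j i k s t x y : `|U j s x| * `|UU i k t y| <= euclid (u s x) ^+ 3 + euclid (u t y) ^+ 3.
Proof. by rewrite mulrC addrC; exact: UUU_le. Qed.

Lemma int_UUU k i l s j t : kern k -> (mc \x mu)%E.-integrable setT
  (EFin \o (fun z : rV * rV => UU i l s (z.1 + z.2) * U j t z.1 * k z.2)).
Proof.
move=> kk; exact: (integrable_pp kk (mUU i l s) (mU j t) (i3 s) (i3 t) (pcub fl s) (fun x y => UUU_le _ _ _ _ _ _ _ _)).
Qed.

Lemma int_UUUr k i l s j t : kern k -> (mc \x mu)%E.-integrable setT
  (EFin \o (fun z : rV * rV => U j t (z.1 + z.2) * UU i l s z.1 * k z.2)).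
Proof.
move=> kk; exact: (integrable_pp kk (mU j t) (mUU i l s) (i3 t) (i3 s) (pcub fl t) (fun x y => UUUr_le _ _ _ _ _ _ _)).
Qed.

Lemma pp_UUU k i l s j t : kern k ->
  mc.-integrable setT (EFin \o (fun x => cv k (UU i l s) x * U j t x)) /\
  pp k (UU i l s) (U j t) = \int[mc]_x (cv k (UU i l s) x * U j t x).
Proof.
move=> kk; exact: (pp_cv kk (mUU i l s) (mU j t) (i3 s) (i3 t) (pcub fl s) (fun x y => UUU_le _ _ _ _ _ _ _ _) (fun y => iUU i l s y kk)).
Qed.

Lemma pp_UUUr k i l s j t : kern k ->
  mc.-integrable setT (EFin \o (fun x => cv k (U j t) x * UU i l s x)) /\
  pp k (U j t) (UU i l s) = \int[mc]_x (cv k (U j t) x * UU i l s x).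
Proof.
move=> kk; exact: (pp_cv kk (mU j t) (mUU i l s) (i3 t) (i3 s) (pcub fl t) (fun x y => UUUr_le _ _ _ _ _ _ _) (fun y => iU j t y kk)).
Qed.

Lemma pp_UU k i s j t : kern k ->
  mc.-integrable setT (EFin \o (fun x => cv k (U i s) x * U j t x)) /\
  pp k (U i s) (U j t) = \int[mc]_x (cv k (U i s) x * U j t x).
Proof.
move=> kk; exact: (pp_cv kk (mU i s) (mU j t) (i2 s) (i2 t) (psqn fl s) (fun x y => UU_sq _ _ _ _ _ _ _) (fun y => iU i s y kk)).
Qed.

Lemma pp_UUU_bound k i l s j t : kern k ->
  `|pp k (U j t) (UU i l s)| <= (n3 t + n3 s) * \int[mu]_h `|k h|.
Proof.
move=> kk; exact: (pp_bound kk (mU j t) (mUU i l s) (i3 t) (i3 s) (pcub fl t) (fun x y => UUUr_le _ _ _ _ _ _ _)).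
Qed.

Lemma swap_UUU k i l s j t : kern k ->
  pp k (UU i l s) (U j t) = pp (fun h => k (- h)) (U j t) (UU i l s).
Proof. by move=> kk; exact: (pp_swap kk (mUU i l s) (mU j t) (pUU fl i l s) (pU fl j t)). Qed.

Lemma swap_UU k i s j t : kern k ->
  pp k (U i s) (U j t) = pp (fun h => k (- h)) (U j t) (U i s).
Proof. by move=> kk; exact: (pp_swap kk (mU i s) (mU j t) (pU fl i s) (pU fl j t)). Qed.

Variable N : 'I_d -> rV -> R.
Hypothesis bN : forall i, csmooth (N i).
Hypothesis sN : forall i j x, dx j (N i) x = dx i (N j) x.
Notation K := (Kd N).
Hypothesis evK : forall x, K (- x) = K x.

Let bK : csmooth K := csmooth_Kd bN.
Let kK : kern K := kern_csmooth bK.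
Let kdK k : kern (dx k K) := kern_csmooth (csmooth_dx k bK).

Let bdN k i : csmooth (dx k (N i)). Proof. exact: csmooth_dx. Qed.
Let sdN k i j x : dx j (dx k (N i)) x = dx i (dx k (N j)) x.
Proof.
rewrite dx_comm// [RHS]dx_comm//; congr (dx k _ x).
by apply/funext => y; exact: sN.
Qed.

Let KdN k x : Kd (fun i => dx k (N i)) x = dx k K x.
Proof.
rewrite dx_Kd//; congr (- _); apply: eq_bigr => i _.
by rewrite dx_comm.
Qed.

Let dKodd k x : dx k K (- x) = - dx k K x.
Proof.
have := dx_opp k x bK; rewrite (_ : (fun x => K (- x)) = K); last by apply/funext.
by move=> ->; rewrite opprK.
Qed.

Notation gK := (gg u N).
Notation gdK k := (gg u (fun i => dx k (N i))).
(** Reflected because it is met after [swap_UUU], which moves the kernel from the momentum flux to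
    the velocity and reflects it. *)
Let Phi i k (h : rV) : R := dx k (N i) (- h).

Let bPhi i k : csmooth (Phi i k). Proof. by apply: csmooth_opp; exact: bdN. Qed.

Definition Ek t : R := 2^-1 * \sum_j pp K (U j t) (U j t).
(** The energy flux with the products u_i u_k at time [s] and the velocity at time [t]. Two times
    occur because an increment of the energy pairs the equation at intermediate times with the
    velocity at the end points. *)
Definition DD s t : R := - \sum_i \sum_k pp (dx k K) (U i t) (UU i k s).

Let cK (j : 'I_d) : rV -> R := projT1 (cid (ode fl bN sN j)).
Let cKP j := projT2 (cid (ode fl bN sN j)).
Let cD (k i : 'I_d) : rV -> R := projT1 (cid (ode fl (bdN k) (sdN k) i)).
Let cDP k i := projT2 (cid (ode fl (bdN k) (sdN k) i)).

(** The exceptional times are gathered once and for all, as the identities that follow compare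
    several times and need every equation at each of them. *)
Definition good t : Prop := [/\ 0 < t < T,
  (forall i k, {ae mc, forall x, dv u (Phi i k) t x = 0}),
  (forall j, {ae mc, forall y, cv K (U j t) y = cK j y + prim ((gK j)^~ y) t}) &
  (forall k i, {ae mc, forall y, cv (dx k K) (U i t) y = cD k i y + prim ((gdK k i)^~ y) t})].

Lemma ae_good : {ae leb, forall t, 0 < t < T -> good t}.
Proof.
have H1 := ae_ord (fun i => ae_ord (fun k => dv_ae fl (bPhi i k))).
have H2 := ae_ord (fun j => cKP j).
have H3 := ae_ord (fun k => ae_ord (fun i => cDP k i)).
case: H1 => A1 [m1 z1 s1]; case: H2 => A2 [m2 z2 s2]; case: H3 => A3 [m3 z3 s3].
exists (A1 `|` A2 `|` A3); split.
- by apply: measurableU => //; exact: measurableU.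
- by rewrite measureU0// ?measureU0//; exact: measurableU.
move=> t; apply: contra_notP => /not_orP[/not_orP[a1 a2] a3] /= tT; split => //.
- by move=> i k; apply: contrapT => H; apply: a1; apply: s1 => /(_ i k).
- by move=> j; apply: contrapT => H; apply: a2; apply: s2 => /(_ j tT).
- move=> k i; apply: contrapT => H; apply: a3; apply: s3 => /(_ k i tT) => H'.
  apply: H; case: H' => B [mB B0 sB]; exists B; split => // y yB; apply: sB => E; apply: yB.
  rewrite /= -E; congr (cv _ _ _); apply/funext => x; exact/esym/KdN.
Qed.

Let A := prim n2.

Let L1g j t : mc.-integrable setT (EFin \o gK j t) /\
  True.
Proof.
split => //.
apply: integrable_sumR => i; apply: integrable_sumR => k.
have kk : kern (dx k (Mf N i j)) by apply: kern_csmooth; apply: csmooth_dx; exact: csmooth_Mf.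
by have [] := cv_L1 kk (psqn fl t) (i2 t) (mUU i k t) (UU_le _ _ _ _) (fun y => iUU i k t y kk).
Qed.

Let L1g_bound : exists2 C : R, 0 <= C & forall j t, \int[mc]_x `|gK j t x| <= C * n2 t.
Proof.
have H j i k t : \int[mc]_x `|cv (dx k (Mf N i j)) (UU i k t) x| <=
    (\int[mu]_h `|dx k (Mf N i j) h|) * n2 t.
  have kk : kern (dx k (Mf N i j)) by apply: kern_csmooth; apply: csmooth_dx; exact: csmooth_Mf.
  rewrite mulrC.
  by have [] := cv_L1 kk (psqn fl t) (i2 t) (mUU i k t) (UU_le _ _ _ _) (fun y => iUU i k t y kk).
exists (\sum_j \sum_i \sum_k \int[mu]_h `|dx k (Mf N i j) h|).
  by do 3! apply: sumr_ge0 => ? _; exact: Rintegral_ge0.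
move=> j t.
have iN i k : mc.-integrable setT (EFin \o (fun x => `|cv (dx k (Mf N i j)) (UU i k t) x|)).
  have kk : kern (dx k (Mf N i j)) by apply: kern_csmooth; apply: csmooth_dx; exact: csmooth_Mf.
  apply: integrable_norm.
  by have [] := cv_L1 kk (psqn fl t) (i2 t) (mUU i k t) (UU_le _ _ _ _) (fun y => iUU i k t y kk).
apply: (@le_trans _ _ (\int[mc]_x \sum_i \sum_k `|cv (dx k (Mf N i j)) (UU i k t) x|)).
  apply: le_Rintegral => //.
  - by apply: integrable_norm; case: (L1g j t).
  - by apply: integrable_sumR => i; apply: integrable_sumR => k; exact: iN.
  - move=> x _; apply: le_trans (ler_norm_sum _ _ _) _; apply: ler_sum => i _.
    exact: ler_norm_sum.
rewrite Rintegral_sum; last by move=> i; apply: integrable_sumR => k; exact: iN.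
apply: (@le_trans _ _ ((\sum_i \sum_k \int[mu]_h `|dx k (Mf N i j) h|) * n2 t)).
  rewrite mulr_suml; apply: ler_sum => i _; rewrite Rintegral_sum; last by move=> k; exact: iN.
  by rewrite mulr_suml; apply: ler_sum => k _; exact: H.
rewrite ler_wpM2r ?n2_ge0//; rewrite [leRHS](bigD1 j)//= lerDl.
by do 3! apply: sumr_ge0 => ? _; exact: Rintegral_ge0.
Qed.

Let good_lt t : good t -> 0 < t < T. Proof. by case. Qed.

(** At almost every point the equation holds at both [t] and [t'] with the same constant, which
    cancels in the difference. Multiplying by the velocity at a fixed time [s] and exchanging the
    integrals in time and space gives the formula. *)
Let increment j t t' s : good t -> good t' -> t < t' ->
  leb.-integrable setT (EFin \o (fun r => (\int[mc]_x (gK j r x * U j s x)) * \1_`]t, t'] r)) /\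
  \int[mc]_x ((cv K (U j t') x - cv K (U j t) x) * U j s x) =
  \int[leb]_r ((\int[mc]_x (gK j r x * U j s x)) * \1_`]t, t'] r).
Proof.
move=> gt gt' tt'; have /andP[t0 _] := good_lt gt.
have [Cg Cg0 HCg] := gg_bound fl bN; have [CL CL0 HCL] := L1g_bound.
pose H (z : measurableTypeR R * rV) := gK j z.1 z.2 * U j s z.2 * \1_`]t, t'] z.1.
have m1 : measurable_fun setT (\1_`]t, t'] : measurableTypeR R -> R).
  by apply: measurable_indic; exact: measurable_itv.
have mH : measurable_fun setT H.
  apply: measurable_funM; last exact: (measurableT_comp m1 measurable_fst).
  apply: measurable_funM; first exact: (mgg fl bN j).
  exact: (measurableT_comp (mU j s) measurable_snd).
have i1 x : 0 <= (\1_`]t, t'] x : R) <= 1 by rewrite indicE; case: (_ \in _); rewrite lexx ler01.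
(* With |U| <= 1 + |u|^2, the term 1 is met by the L^1 bound on [gK] and the term |u|^2 by its
   uniform bound; both are linear in [n2 r], hence integrable in time. *)
have Hb r x : `|H (r, x)| <= `|gK j r x| + Cg * n2 r * sqn (u s x).
  rewrite /H /= !normrM.
  apply: (@le_trans _ _ (`|gK j r x| * `|U j s x|)).
    by rewrite ler_piMr ?mulr_ge0//; have /andP[a b] := i1 r; rewrite ger0_norm.
  apply: (@le_trans _ _ (`|gK j r x| * (1 + sqn (u s x)))); first by rewrite ler_wpM2l ?U_le.
  by rewrite mulrDr mulr1 lerD2l ler_wpM2r ?sqn_ge0// HCg.
have iH : (leb \x mc)%E.-integrable setT (EFin \o H).
  have mEH : measurable_fun setT (EFin \o H) by exact/measurable_EFinP.
  apply/(@integrable12ltyP _ _ (measurableTypeR R) rV R leb mc (EFin \o H) mEH).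
  pose B r := (CL + Cg * n2 s) * n2 r.
  have iB : leb.-integrable setT (EFin \o B).
    exact: (@integrable_scaleR _ (measurableTypeR R) R leb _ _ (fl_i2 fl)).
  apply: (@le_lt_trans _ _ (\int[leb]_r (B r)%:E)%E); last first.
    have := integrable_fin_num measurableT iB.
    by rewrite ge0_fin_numE//; apply: integral_ge0 => r _; rewrite lee_fin mulr_ge0 ?n2_ge0// addr_ge0// mulr_ge0// n2_ge0.
  apply: ge0_le_integral => //.
  - by move=> r _; exact: integral_ge0.
  - apply: (@measurable_fun_fubini_tonelli_F _ _ (measurableTypeR R) rV R mc (fun z => `|(EFin \o H) z|%E)) => //.
    exact: measurableT_comp.
  - by case/integrableP: iB.
  - move=> r _.
    have iD : mc.-integrable setT (EFin \o (fun x => `|gK j r x| + Cg * n2 r * sqn (u s x))).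
      apply: integrable_addR; first by apply: integrable_norm; case: (L1g j r).
      exact: integrable_scaleR (i2 s).
    apply: (@le_trans _ _ (\int[mc]_x (`|gK j r x| + Cg * n2 r * sqn (u s x))%:E)%E).
      apply: ge0_le_integral => //.
      + by apply: measurableT_comp => //; exact: (measurableT_comp mEH (measurable_pair1 r)).
      + by case/integrableP: iD.
      + by move=> x _; rewrite /= lee_fin.
    rewrite -[X in (X <= _)%E]fineK; last exact: integrable_fin_num iD.
    rewrite lee_fin -/(Rintegral _ _ _) RintegralD//; last 2 first.
    + by apply: integrable_norm; case: (L1g j r).
    + exact: integrable_scaleR (i2 s).
    rewrite RintegralZl// -/(n2 s) /B mulrDl; apply: lerD; first exact: HCL.
    by rewrite mulrAC.
have E12 := @Rintegral12 _ _ (measurableTypeR R) rV R leb mc H iH.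
have E21 := @Rintegral21 _ _ (measurableTypeR R) rV R leb mc H iH.
have I1 := @integrable_Rintegral1 _ _ (measurableTypeR R) rV R leb mc H iH.
have HE r : \int[mc]_x H (r, x) = (\int[mc]_x (gK j r x * U j s x)) * \1_`]t, t'] r.
  rewrite /H /=.
  have := i1 r; rewrite indicE; case: (r \in _) => _ /=.
    by rewrite mulr1; apply: eq_Rintegral => x _; rewrite mulr1.
  by rewrite mulr0 -[RHS](Rintegral0 mc); apply: eq_Rintegral => x _; rewrite mulr0.
split.
  rewrite (_ : EFin \o _ = EFin \o (fun r => \int[mc]_x H (r, x)))//.
  by apply/funext => r /=; rewrite HE.
transitivity (\int[leb]_r \int[mc]_x H (r, x)); last by apply: eq_Rintegral => r _; rewrite HE.
rewrite E12 -E21; have [_ _ odt _] := gt; have [_ _ odt' _] := gt'.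
apply: ae_eq_Rintegral.
- apply: measurable_funM; last exact: mU.
  by apply: measurable_funB; apply: (measurableT_comp (mcvU fl j kK) (measurable_pair1 _)).
- exact: integrable_mble (@integrable_Rintegral2 _ _ (measurableTypeR R) rV R leb mc H iH).
case: (odt j) => A1 [mA1 z1 s1]; case: (odt' j) => A2 [mA2 z2 s2].
exists (A1 `|` A2); split; [exact: measurableU | by rewrite measureU0|].
move=> x; apply: contra_notP => /not_orP[a1 a2] /=.
have -> : cv K (U j t') x = cK j x + prim ((gK j)^~ x) t' by apply: contrapT => h; apply: a2; exact: s2.
have -> : cv K (U j t) x = cK j x + prim ((gK j)^~ x) t by apply: contrapT => h; apply: a1; exact: s1.
rewrite opprD addrACA subrr add0r prim_split ?(ltW t0) ?(ltW tt')//; last exact: (int_gg fl bN).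
rewrite -RintegralZr//; last by apply: integrable_indicR; [exact: measurable_itv | exact: (int_gg fl bN)].
by apply: eq_Rintegral => r _; rewrite /H /= mulrAC.
Qed.

Let ppN_UUUr k i l s j t : kern k ->
  pp (fun h => - k h) (U j t) (UU i l s) = - pp k (U j t) (UU i l s).
Proof.
move=> kk; rewrite /pp -(RintegralN (int_UUUr i l s j t kk)).
by apply: eq_Rintegral => z _; rewrite mulrN.
Qed.

(** Only the diagonal part of [Mf] survives. The terms with second derivatives of [N i] add up over
    j to the divergence of a mollified velocity, which vanishes almost everywhere at a good time;
    the sign comes from the oddness of [dx k K]. *)
Let D_good r t : good t -> \sum_j \int[mc]_x (gK j r x * U j t x) = DD r t.
Proof.
move=> gt.
have kM i j k : kern (dx k (Mf N i j)) by apply: kern_csmooth; apply: csmooth_dx; exact: csmooth_Mf.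
have kN i j k : kern (dx k (dx j (N i))) by apply: kern_csmooth; apply: csmooth_dx; exact: csmooth_dx.
have kP i j k : kern (dx j (Phi i k)) by apply: kern_csmooth; exact: csmooth_dx.
have E1 j : \int[mc]_x (gK j r x * U j t x) =
    \sum_i \sum_k pp (dx k (Mf N i j)) (UU i k r) (U j t).
  have iS i k : mc.-integrable setT (EFin \o (fun x => cv (dx k (Mf N i j)) (UU i k r) x * U j t x)).
    by have [] := pp_UUU i k r j t (kM i j k).
  transitivity (\int[mc]_x \sum_i \sum_k (cv (dx k (Mf N i j)) (UU i k r) x * U j t x)).
    apply: eq_Rintegral => x _; rewrite mulr_suml; apply: eq_bigr => i _.
    by rewrite mulr_suml.
  rewrite Rintegral_sum; last by move=> i; apply: integrable_sumR => k; exact: iS.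
  apply: eq_bigr => i _; rewrite Rintegral_sum//; apply: eq_bigr => k _.
  by have [_ ->] := pp_UUU i k r j t (kM i j k).
have E2 i j k : pp (dx k (Mf N i j)) (UU i k r) (U j t) =
    (i == j)%:R * pp (dx k K) (UU i k r) (U j t) + pp (dx k (dx j (N i))) (UU i k r) (U j t).
  rewrite /pp -RintegralZl//; last exact: int_UUU.
  rewrite -RintegralD//; [|apply: integrable_scaleR; exact: int_UUU|exact: int_UUU].
  apply: eq_Rintegral => z _; rewrite dx_Mf// mulrDr; congr (_ + _).
  by rewrite mulrCA.
have E3 i k : \sum_j pp (dx k (dx j (N i))) (UU i k r) (U j t) = 0.
  have [_ /(_ i k) dv0 _ _] := gt.
  have -> : \sum_j pp (dx k (dx j (N i))) (UU i k r) (U j t) =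
      - \sum_j \int[mc]_x (cv (dx j (Phi i k)) (U j t) x * UU i k r x).
    rewrite -sumrN; apply: eq_bigr => j _; rewrite swap_UUU//.
    have [_ <-] := pp_UUUr i k r j t (kP i j k).
    rewrite -ppN_UUUr//; congr (pp _ _ _); apply/funext => h.
    by rewrite dx_opp// opprK dx_comm.
  rewrite -Rintegral_sum; last by move=> j; have [] := pp_UUUr i k r j t (kP i j k).
  apply/eqP; rewrite oppr_eq0; apply/eqP; rewrite -[RHS](Rintegral0 mc).
  have iS : mc.-integrable setT (EFin \o (fun x => \sum_j cv (dx j (Phi i k)) (U j t) x * UU i k r x)).
    by apply: integrable_sumR => j; have [] := pp_UUUr i k r j t (kP i j k).
  apply: ae_eq_Rintegral => //; first exact: integrable_mble iS.
  case: dv0 => B [mB B0 sB]; exists B; split => // x xB; apply: sB => d0; apply: xB => /=.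
  by rewrite -mulr_suml -/(dv u (Phi i k) t x) d0 mul0r.
under eq_bigr => j _ do rewrite E1.
rewrite exchange_big /= /DD -sumrN; apply: eq_bigr => i _.
rewrite exchange_big /= -sumrN; apply: eq_bigr => k _.
under eq_bigr => j _ do rewrite E2.
rewrite big_split /= E3 addr0 (bigD1 i)//= eqxx mul1r big1 ?addr0; last first.
  by move=> j; rewrite eq_sym => /negPf ->; rewrite mul0r.
rewrite swap_UUU// -ppN_UUUr//; congr (pp _ _ _); apply/funext => h.
by rewrite dKodd.
Qed.

Let DDcv s t : DD s t = - \sum_i \sum_k \int[mc]_x (cv (dx k K) (U i t) x * UU i k s x).
Proof.
congr (- _); apply: eq_bigr => i _; apply: eq_bigr => k _.
by have [_] := pp_UUUr i k s i t (kdK k).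
Qed.

Let A_mono a b : 0 <= a -> a <= b -> A a <= A b.
Proof. by move=> a0 ab; apply: prim_le => //; [exact: (fl_i2 fl) | exact: n2_ge0]. Qed.

Let A_sub r t : 0 < r -> 0 < t -> `|A t - A r| = A (Num.max r t) - A (Num.min r t).
Proof.
move=> r0 t0; have [rt|/ltW tr] := leP r t.
  by rewrite ger0_norm// subr_ge0; exact: A_mono (ltW r0) rt.
by rewrite distrC ger0_norm// subr_ge0; exact: A_mono (ltW t0) tr.
Qed.

(** [ode] applied to the fields [dx k (N i)] shows that the velocity mollified by [dx k K] moves
    between two good times by at most a multiple of the increment of [A], uniformly in space. It is
    then integrated against |u(r)|^2. *)
Let DD_close : exists2 C : R, 0 <= C & forall r t, good r -> good t ->
  `|DD r t - DD r r| <= C * n2 r * `|A t - A r|.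
Proof.
have /choice[c Hc] k : exists C : R, 0 <= C /\ forall i t y, `|gdK k i t y| <= C * n2 t.
  by have [C C0 HC] := gg_bound fl (bdN k); exists C; split.
exists (\sum_(i < d) \sum_k c k); first by do 2! apply: sumr_ge0 => ? _; exact: (Hc _).1.
move=> r t gr gt; rewrite !DDcv -opprB opprK addrC -sumrB.
have /andP[r0 _] := good_lt gr; have /andP[t0 _] := good_lt gt.
rewrite normrN; apply: le_trans (ler_norm_sum _ _ _) _; rewrite -mulrA mulr_suml; apply: ler_sum => i _.
rewrite -sumrB; apply: le_trans (ler_norm_sum _ _ _) _; rewrite mulr_suml; apply: ler_sum => k _.
have [[i1 _] [i2' _]] := (pp_UUUr i k r i r (kdK k), pp_UUUr i k r i t (kdK k)).
rewrite -RintegralB//.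
have [c0 Hck] := Hc k.
have -> : c k * (n2 r * `|A t - A r|) = \int[mc]_x (c k * `|A t - A r| * sqn (u r x)).
  by rewrite RintegralZl ?[n2 r * _]mulrC ?mulrA//; exact: i2.
apply: le_norm_Rintegral_ae.
- by apply: measurable_funB; [exact: integrable_mble i2' | exact: integrable_mble i1].
- by move=> x; rewrite !mulr_ge0// sqn_ge0.
- have [_ _ _ /(_ k i) or] := gr; have [_ _ _ /(_ k i) ot] := gt.
  case: or => A1 [mA1 z1 s1]; case: ot => A2 [mA2 z2 s2].
  exists (A1 `|` A2); split; [exact: measurableU | by rewrite measureU0|].
  move=> x; apply: contra_notP => /not_orP[a1 a2] /=.
  have -> : cv (dx k K) (U i r) x = cD k i x + prim ((gdK k i)^~ x) r by apply: contrapT => h; apply: a1; exact: s1.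
  have -> : cv (dx k K) (U i t) x = cD k i x + prim ((gdK k i)^~ x) t by apply: contrapT => h; apply: a2; exact: s2.
  rewrite -mulrBl opprD addrACA subrr add0r normrM; apply: ler_pM => //; last exact: UU_le.
  have ig := int_gg fl (bdN k) i x.
  have L a b : 0 < a -> a <= b -> `|prim ((gdK k i)^~ x) b - prim ((gdK k i)^~ x) a| <= c k * (A b - A a).
    by move=> a0 ab; exact: (prim_lip ig (fl_i2 fl) c0 (fun t => Hck i t x) (ltW a0) ab).
  rewrite A_sub//; have [rt|/ltW tr] := leP r t; first exact: L.
  by rewrite distrC; exact: L.
- by apply: integrable_scaleR; exact: i2.
Qed.

Definition Bk t := DD t t.

Lemma int_Bk : leb.-integrable setT (EFin \o Bk).
Proof.
have mB : measurable_fun setT Bk.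
  rewrite (_ : Bk = fun t => - \sum_i \sum_k \int[mc]_x (cv (dx k K) (U i t) x * UU i k t x)).
    apply: measurableT_comp => //; apply: measurable_sum => i; apply: measurable_sum => k.
    apply: (@measurable_Rintegral _ _ (measurableTypeR R) rV R mc
      (fun z => cv (dx k K) (U i z.1) z.2 * UU i k z.1 z.2)).
    by apply: measurable_funM; [exact: (mcvU fl i (kdK k)) | exact: (mUUz fl)].
  by apply/funext => t; exact: DDcv.
pose C := \sum_(i < d) \sum_k (2 * \int[mu]_h `|dx k K h|).
have iG : leb.-integrable setT (EFin \o (fun t => C * n3 t)).
  exact: (@integrable_scaleR _ (measurableTypeR R) R leb _ _ (fl_i3 fl)).
apply: integrable_domR iG => // t.
rewrite /Bk /DD normrN; apply: le_trans (ler_norm_sum _ _ _) _; rewrite mulr_suml; apply: ler_sum => i _.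
apply: le_trans (ler_norm_sum _ _ _) _; rewrite mulr_suml; apply: ler_sum => k _.
apply: le_trans (pp_UUU_bound i k t i t (kdK k)) _.
by rewrite -mulr2n -[_ *+ 2]mulr_natl mulrAC.
Qed.

Let Ekcv t : Ek t = 2^-1 * \sum_j \int[mc]_x (cv K (U j t) x * U j t x).
Proof.
congr (_ * _); apply: eq_bigr => j _.
by have [_] := pp_UU j t j t kK.
Qed.

(** For a symmetric form, <K b, b> - <K a, a> = <K (b - a), a> + <K (b - a), b>. Evenness of [K]
    provides the symmetry, and each term is an increment with the velocity frozen at one end. *)
Let Ek_diff t t' : good t -> good t' -> t < t' ->
  Ek t' - Ek t = 2^-1 * \int[leb]_r ((DD r t + DD r t') * \1_`]t, t'] r) /\
  leb.-integrable setT (EFin \o (fun r => (DD r t + DD r t') * \1_`]t, t'] r)).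
Proof.
move=> gt gt' tt'.
have I j s := (increment j s gt gt' tt').1; have E j s := (increment j s gt gt' tt').2.
have DE r : (DD r t + DD r t') * \1_`]t, t'] r =
    \sum_j ((\int[mc]_x (gK j r x * U j t x)) * \1_`]t, t'] r + (\int[mc]_x (gK j r x * U j t' x)) * \1_`]t, t'] r).
  by rewrite big_split /= -!mulr_suml !D_good// mulrDl.
have IS j : leb.-integrable setT (EFin \o (fun r => (\int[mc]_x (gK j r x * U j t x)) * \1_`]t, t'] r
    + (\int[mc]_x (gK j r x * U j t' x)) * \1_`]t, t'] r)).
  exact: (@integrable_addR _ (measurableTypeR R) R leb).
split; last first.
  rewrite (_ : EFin \o _ = EFin \o (fun r => \sum_j ((\int[mc]_x (gK j r x * U j t x)) * \1_`]t, t'] r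
    + (\int[mc]_x (gK j r x * U j t' x)) * \1_`]t, t'] r))); last by apply/funext => r /=; rewrite DE.
  exact: (@integrable_sumR _ (measurableTypeR R) R leb).
under eq_Rintegral => r _ do rewrite DE.
rewrite (@Rintegral_sum _ (measurableTypeR R) R leb)// !Ekcv -mulrBr -sumrB; congr (_ * _).
apply: eq_bigr => j _; rewrite RintegralD// -!E.
have [iaa _] := pp_UU j t j t kK; have [ibb _] := pp_UU j t' j t' kK.
have [iab Eab] := pp_UU j t j t' kK; have [iba Eba] := pp_UU j t' j t kK.
have sym : \int[mc]_x (cv K (U j t) x * U j t' x) = \int[mc]_x (cv K (U j t') x * U j t x).
  rewrite -Eab -Eba swap_UU//; congr (pp _ _ _); apply/funext => h; exact: evK.
have i1 : mc.-integrable setT (EFin \o (fun x => (cv K (U j t') x - cv K (U j t) x) * U j t x)).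
  under [X in _ \o X]eq_fun do rewrite mulrBl; exact: integrable_subR.
have ib : mc.-integrable setT (EFin \o (fun x => (cv K (U j t') x - cv K (U j t) x) * U j t' x)).
  under [X in _ \o X]eq_fun do rewrite mulrBl; exact: integrable_subR.
have -> : \int[mc]_x ((cv K (U j t') x - cv K (U j t) x) * U j t x) =
    \int[mc]_x (cv K (U j t') x * U j t x) - \int[mc]_x (cv K (U j t) x * U j t x).
  by rewrite -RintegralB//; apply: eq_Rintegral => x _; rewrite mulrBl.
have -> : \int[mc]_x ((cv K (U j t') x - cv K (U j t) x) * U j t' x) =
    \int[mc]_x (cv K (U j t') x * U j t' x) - \int[mc]_x (cv K (U j t) x * U j t' x).
  by rewrite -RintegralB//; apply: eq_Rintegral => x _; rewrite mulrBl.
rewrite sym; have eqn (a b c : R) : b - a = c - a + (b - c) by ring.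
exact: eqn.
Qed.

Let Ek_step : exists2 C : R, 0 <= C & forall t t', good t -> good t' -> t < t' ->
  `|(Ek t' - prim Bk t') - (Ek t - prim Bk t)| <= C * (A t' - A t) ^+ 2.
Proof.
have [C C0 HC] := DD_close; exists C => // t t' gt gt' tt'.
have /andP[t0 tT] := good_lt gt.
have [E iE] := Ek_diff gt gt' tt'.
have iB : leb.-integrable setT (EFin \o (fun r => Bk r * \1_`]t, t'] r)).
  by apply: integrable_indicR; [exact: measurable_itv | exact: int_Bk].
have A0 : 0 <= A t' - A t.
  by rewrite subr_ge0; exact: A_mono (ltW t0) (ltW tt').
have -> : (Ek t' - prim Bk t') - (Ek t - prim Bk t) =
    \int[leb]_r (2^-1 * ((DD r t + DD r t') * \1_`]t, t'] r) - Bk r * \1_`]t, t'] r).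
  rewrite RintegralB//; last exact: (@integrable_scaleR _ (measurableTypeR R) R leb).
  rewrite RintegralZl// -E -prim_split ?ltW//; last exact: int_Bk.
  have eqn (a b c e : R) : (a - b) - (c - e) = (a - c) - (b - e) by ring.
  exact: eqn.
have in2 := integrable_indicR (measurable_itv `]t, t']) (fl_i2 fl).
have -> : C * (A t' - A t) ^+ 2 = \int[leb]_r ((C * (A t' - A t)) * (n2 r * \1_`]t, t'] r)).
  rewrite RintegralZl// -prim_split ?ltW//; last exact: (fl_i2 fl).
  by rewrite expr2 mulrA.
apply: (@le_norm_Rintegral_ae _ (measurableTypeR R) R leb).
- apply: measurable_funB; last exact: (@integrable_mble _ (measurableTypeR R) R leb).
  apply: measurable_funM => //; exact: (@integrable_mble _ (measurableTypeR R) R leb _ iE).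
- by move=> r; rewrite !mulr_ge0 ?n2_ge0// indicE.
- case: ae_good => G [mG G0 sG]; exists G; split => // r rG; apply: sG => gr; apply: rG => /=.
  rewrite indicE mem_setE in_itv /=.
  have [/andP[tr rt']|_] := boolP (t < r <= t'); last by rewrite !mulr0 subrr normr0.
  rewrite !mulr1.
  have gr' : good r by apply: gr; rewrite (lt_trans t0 tr) (le_lt_trans rt')//; case/andP: (good_lt gt').
  have /andP[r0 _] := good_lt gr'.
  have H1 := HC r t gr' gt; have H2 := HC r t' gr' gt'.
  have M1 : `|A t - A r| <= A t' - A t.
    rewrite distrC ger0_norm ?subr_ge0; last exact: A_mono (ltW t0) (ltW tr).
    by rewrite lerD2r; exact: A_mono (ltW r0) rt'.
  have M2 : `|A t' - A r| <= A t' - A t.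
    rewrite ger0_norm ?subr_ge0; last exact: A_mono (ltW r0) rt'.
    by rewrite lerD2l lerN2; exact: A_mono (ltW t0) (ltW tr).
  have Cn : 0 <= C * n2 r by rewrite mulr_ge0// n2_ge0.
  have H3 := le_trans H1 (ler_wpM2l Cn M1); have H4 := le_trans H2 (ler_wpM2l Cn M2).
  rewrite /Bk; have -> : C * (A t' - A t) * n2 r = C * n2 r * (A t' - A t) by rewrite mulrAC.
  move: H3 H4; move: (DD r t) (DD r t') (DD r r) (C * n2 r * (A t' - A t)) => a b c e.
  rewrite !ler_norml => /andP[? ?] /andP[? ?]; apply/andP; split; lra.
- exact: (@integrable_scaleR _ (measurableTypeR R) R leb).
Qed.

(** The difference between [Ek] and the primitive of its flux has increments quadratic in those of
    the continuous monotone [A], so [bisect] makes it constant on the good times. *)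
Lemma Ek_ac : exists c, {ae leb, forall t, 0 < t < T -> Ek t = c + prim Bk t}.
Proof.
have [C C0 HC] := Ek_step; have T0 := fl_T fl.
have [a aT ga] : exists2 a, 0 < a < T & good a.
  have [t tT gt] := ae_dense ae_good T0; exists t => //; exact: gt.
exists (Ek a - prim Bk a).
have key t t' : good t -> good t' -> t < t' -> Ek t' - prim Bk t' = Ek t - prim Bk t.
  move=> gt gt' tt'; have /andP[t0 _] := good_lt gt; have /andP[_ tT'] := good_lt gt'.
  apply: (@bisect R good (fun t => Ek t - prim Bk t) A C t t') => //.
  - case: ae_good => G [mG G0 sG]; exists G; split => // r rG; apply: sG => gr; apply: rG.
    by move=> /andP[tr rt]; apply: gr; rewrite (lt_trans t0 tr) (lt_trans rt tT').
  - apply: continuous_subspaceW (prim_continuous T0 (fl_i2 fl)) => x /=.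
    rewrite !in_itv /= => /andP[x1 x2].
    by rewrite (le_trans (ltW t0) x1) (le_trans x2 (ltW tT')).
  - move=> r s tr rs st'; apply: prim_le => //; [exact: (fl_i2 fl) | exact: n2_ge0 |].
    exact: le_trans (ltW t0) tr.
  - by move=> r s _ rs _ gr gs; exact: HC.
case: ae_good => G [mG G0 sG]; exists G; split => // r rG; apply: sG => gr; apply: rG => rT.
have {}gr := gr rT; have [ra|ar|->] := ltgtP r a; last by rewrite subrK.
  by rewrite (key r a)// subrK.
by rewrite -(key a r)// subrK.
Qed.

Lemma mEk : measurable_fun setT Ek.
Proof.
rewrite (_ : Ek = fun t => 2^-1 * \sum_j \int[mc]_x (cv K (U j t) x * U j t x)).
  apply: measurable_funM => //; apply: measurable_sum => j.
  apply: (@measurable_Rintegral _ _ (measurableTypeR R) rV R mc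
    (fun z => cv K (U j z.1) z.2 * U j z.1 z.2)).
  by apply: measurable_funM; [exact: (mcvU fl j kK) | exact: (fl_m fl j)].
by apply/funext => t; exact: Ekcv.
Qed.

Lemma energy_weak psi : test_function_line `]0, T[ psi ->
  \int[leb]_t (Ek t * 'D_1 psi t) = - \int[leb]_t (Bk t * psi t).
Proof.
move=> tp; have T0 := fl_T fl; have tp' := test_derive tp.
have [mp _] := test_bounded T0 tp'.
have [c Hc] := Ek_ac; rewrite -(prim_weak T0 int_Bk tp).
have mP := measurable_prim1 int_Bk.
have id := test_integrable tp'.
have ip : leb.-integrable setT (EFin \o (fun t => prim Bk t * 'D_1 psi t)).
  apply: (integrable_domR (g := fun t => (\int[leb]_s `|Bk s|) * `|'D_1 psi t|)).
  - exact: measurable_funM.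
  - by move=> t; rewrite normrM ler_wpM2r// prim_bound//; exact: int_Bk.
  - by apply: (@integrable_scaleR _ (measurableTypeR R) R leb); exact: integrable_norm.
transitivity (\int[leb]_t (c * 'D_1 psi t + prim Bk t * 'D_1 psi t)).
  apply: (@ae_eq_Rintegral _ (measurableTypeR R) R leb).
  - by apply: measurable_funM => //; exact: mEk.
  - by apply: measurable_funD; exact: measurable_funM.
  - case: Hc => G [mG G0 sG]; exists G; split => // r rG; apply: sG => gr; apply: rG => /=.
    have [rT|rT] := boolP (0 < r < T); first by rewrite gr// mulrDl.
    by rewrite (test_out tp' rT) !mulr0 addr0.
rewrite RintegralD//; last exact: (@integrable_scaleR _ (measurableTypeR R) R leb).
by rewrite RintegralZl// (test_int0 T0 tp) mulr0 add0r.
Qed.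

End energy.

(** * The energy flux as a cubic increment *)

Section flux.
Context {R : realType} {d : nat} (Omega : spatial_domain) (T : R).
Variable u : R -> 'rV[R]_d -> 'rV[R]_d.
Notation rV := 'rV[R]_d.
Notation mu := (@lebesgue_rV R d).
Notation mc := (@cell_measure R d Omega).
Notation leb := (@lebesgue_measure R).
Notation per f := (@function_on R d Omega _ f).
Notation U := (vel u).
Notation UU := (velM u).
Notation n2 := (nrm2 Omega u).
Notation n3 := (nrm3 Omega u).
Notation pp := (@pairing R d Omega).
Hypothesis fl : flow Omega T u.

Let i3 t : mc.-integrable setT (EFin \o (fun x => euclid (u t x) ^+ 3)) := fl_3 fl t.
Let i2 t : mc.-integrable setT (EFin \o (fun x => sqn (u t x))) := fl_2 fl t.

Definition incr (t : R) (z : rV * rV) : rV := u t (z.1 + z.2) - u t z.1.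

Notation dl := incr.

Lemma dlE t z i : dl t z ord0 i = U i t (z.1 + z.2) - U i t z.1.
Proof. by rewrite !mxE. Qed.

Let mUs i t : measurable_fun setT (fun z : rV * rV => U i t (z.1 + z.2)).
Proof. by apply: measurable_add2; exact: (mU fl). Qed.

Let mU1 i t : measurable_fun setT (fun z : rV * rV => U i t z.1).
Proof. exact: (measurableT_comp (mU fl i t) measurable_fst). Qed.

Lemma mdl i t : measurable_fun setT (fun z => dl t z ord0 i).
Proof. by under eq_fun do rewrite dlE; exact: measurable_funB. Qed.

Lemma sqn_dl t z : sqn (dl t z) = \sum_i (U i t (z.1 + z.2) - U i t z.1) ^+ 2.
Proof. by apply: eq_bigr => i _; rewrite dlE. Qed.

(** These are the terms of an expanded increment in which all factors sit at the same end: by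
    translation invariance they factor into the integral of [a] and the mass of [k]. *)
Lemma pp_shift_prod (k a A : rV -> R) : kern k -> measurable_fun setT a -> per a ->
  mc.-integrable setT (EFin \o A) -> (forall x, `|a x| <= A x) ->
  [/\ (mc \x mu)%E.-integrable setT (EFin \o (fun z => a (z.1 + z.2) * k z.2)),
      (mc \x mu)%E.-integrable setT (EFin \o (fun z => a z.1 * k z.2)),
      \int[(mc \x mu)%E]_z (a (z.1 + z.2) * k z.2) = (\int[mc]_x a x) * \int[mu]_h k h &
      \int[(mc \x mu)%E]_z (a z.1 * k z.2) = (\int[mc]_x a x) * \int[mu]_h k h].
Proof.
move=> kk ma pa iA aA; have ia := integrable_dom ma aA iA; have ik := kern_integrable kk.
have iak := integrable_prod ia ik.
have pF h : per (fun x => a x * k h) by move=> OT x i; rewrite pa.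
have E : \int[(mc \x mu)%E]_z (a z.1 * k z.2) = (\int[mc]_x a x) * \int[mu]_h k h.
  rewrite -(Rintegral12 iak) /=.
  under eq_Rintegral => x _ do rewrite RintegralZl//.
  by rewrite RintegralZr.
split => //; first exact: (integrable_pair_shift (F := fun z => a z.1 * k z.2) pF iak).
by rewrite (@Rintegral_pair_shift _ _ _ (fun z => a z.1 * k z.2) (integrable_mble iak) pF).
Qed.

Lemma kern_odd_int (k : rV -> R) : kern k -> (forall h, k (- h) = - k h) -> \int[mu]_h k h = 0.
Proof.
move=> kk ko; have ik := kern_integrable kk.
have mE : measurable_fun setT (EFin \o k) := measurable_int _ ik.
have E : \int[mu]_h k (- h) = \int[mu]_h k h.
  rewrite /Rintegral integralE [in RHS]integralE; congr (fine (_ - _)).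
    have -> : (fun x => (k (- x))%:E)^\+%E = (fun x => (EFin \o k)^\+%E (- x)).
      exact: (funepos_comp (EFin \o k) (fun x => - x)).
    apply: ge0_integral_rV_opp; first exact: measurable_funepos.
    by move=> x; exact: funepos_ge0.
  have -> : (fun x => (k (- x))%:E)^\-%E = (fun x => (EFin \o k)^\-%E (- x)).
    exact: (funeneg_comp (EFin \o k) (fun x => - x)).
  apply: ge0_integral_rV_opp; first exact: measurable_funeneg.
  by move=> x; exact: funeneg_ge0.
move: E; under [X in X = _]eq_Rintegral => h _ do rewrite ko.
rewrite RintegralN// => /eqP; rewrite -subr_eq0 -opprD oppr_eq0 -mulr2n mulrn_eq0 /=.
by move/eqP.
Qed.

(* the four mixed terms of the cubic expansion collapse, by the reflection
   (x, h) -> (x + h, -h) and because the kernel is odd *)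
Lemma cubic_term t (k : rV -> R) i l : kern k -> (forall h, k (- h) = - k h) ->
  let G z := k z.2 * ((U l t (z.1 + z.2) - U l t z.1) * (U i t (z.1 + z.2) - U i t z.1) ^+ 2) in
  (mc \x mu)%E.-integrable setT (EFin \o G) /\
  \int[(mc \x mu)%E]_z G z = 4 * pp k (U i t) (UU i l t) + 2 * pp k (U l t) (UU i i t).
Proof.
move=> kk ko G.
pose a x := U l t x * UU i i t x.
have ma : measurable_fun setT a by apply: measurable_funM; [exact: (mU fl) | exact: (mUU fl)].
have pa : per a by move=> OT x j; rewrite /a (pU fl)// (pUU fl).
have iA : mc.-integrable setT (EFin \o (fun x => euclid (u t x) ^+ 3 + euclid (u t x) ^+ 3)).
  exact: integrable_addR.
have aA x : `|a x| <= euclid (u t x) ^+ 3 + euclid (u t x) ^+ 3.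
  by rewrite normrM mulrC; exact: UUU_le.
have [I1 I6 E1 E6] := pp_shift_prod kk ma pa iA aA.
have k0 := kern_odd_int kk ko.
have X := int_UUU fl i l t i t kk; have Y := int_UUUr fl i l t i t kk.
have V := int_UUU fl i i t l t kk; have W := int_UUUr fl i i t l t kk.
have sX : pp k (UU i l t) (U i t) = - pp k (U i t) (UU i l t).
  rewrite (swap_UUU fl)// -[RHS]mulN1r /pp -RintegralZl//; apply: eq_Rintegral => z _.
  by rewrite ko mulrN mulN1r.
have sV : pp k (UU i i t) (U l t) = - pp k (U l t) (UU i i t).
  rewrite (swap_UUU fl)// -[RHS]mulN1r /pp -RintegralZl//; apply: eq_Rintegral => z _.
  by rewrite ko mulrN mulN1r.
pose f1 z := a (z.1 + z.2) * k z.2.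
pose f2 z := UU i l t (z.1 + z.2) * U i t z.1 * k z.2.
pose f3 z := U l t (z.1 + z.2) * UU i i t z.1 * k z.2.
pose f4 z := UU i i t (z.1 + z.2) * U l t z.1 * k z.2.
pose f5 z := U i t (z.1 + z.2) * UU i l t z.1 * k z.2.
pose f6 z := a z.1 * k z.2.
have GE z : G z = f1 z - 2 * f2 z + (f3 z - f4 z) + (2 * f5 z - f6 z).
  rewrite /G /f1 /f2 /f3 /f4 /f5 /f6 /a /velM.
  move: (U l t (z.1 + z.2)) (U l t z.1) (U i t (z.1 + z.2)) (U i t z.1) (k z.2) => *.
  ring.
have J2 : (mc \x mu)%E.-integrable setT (EFin \o (fun z => 2 * f2 z)) by exact: integrable_scaleR.
have J5 : (mc \x mu)%E.-integrable setT (EFin \o (fun z => 2 * f5 z)) by exact: integrable_scaleR.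
have J12 : (mc \x mu)%E.-integrable setT (EFin \o (fun z => f1 z - 2 * f2 z)) by exact: integrable_subR.
have J34 : (mc \x mu)%E.-integrable setT (EFin \o (fun z => f3 z - f4 z)) by exact: integrable_subR.
have J56 : (mc \x mu)%E.-integrable setT (EFin \o (fun z => 2 * f5 z - f6 z)) by exact: integrable_subR.
have J14 : (mc \x mu)%E.-integrable setT (EFin \o (fun z => f1 z - 2 * f2 z + (f3 z - f4 z))) by exact: integrable_addR.
split.
  by rewrite (_ : G = fun z => f1 z - 2 * f2 z + (f3 z - f4 z) + (2 * f5 z - f6 z));
    [exact: integrable_addR | apply/funext => z; exact: GE].
under eq_Rintegral => z _ do rewrite GE.
rewrite (RintegralD _ J14 J56)// (RintegralD _ J12 J34)// (RintegralB _ I1 J2)//.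
rewrite (RintegralB _ W V)// (RintegralB _ J5 I6)// !RintegralZl//.
rewrite /f1 /f6 E1 E6 k0 !mulr0.
rewrite -!/(pp _ _ _) sX sV.
move: (pp k (U i t) (UU i l t)) (pp k (U l t) (UU i i t)) => x y.
by ring.
Qed.

Lemma square_term t (k : rV -> R) i : kern k ->
  let G z := k z.2 * (U i t (z.1 + z.2) - U i t z.1) ^+ 2 in
  (mc \x mu)%E.-integrable setT (EFin \o G) /\
  \int[(mc \x mu)%E]_z G z =
    2 * ((\int[mu]_h k h) * \int[mc]_x (U i t x ^+ 2) - pp k (U i t) (U i t)).
Proof.
move=> kk G; pose a x := U i t x ^+ 2.
have ma : measurable_fun setT a by apply: measurable_funX; exact: (mU fl).
have pa : per a by move=> OT x j; rewrite /a (pU fl).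
have aA x : `|a x| <= sqn (u t x) by rewrite ger0_norm ?sqr_ge0// sqU_le.
have [I1 I6 E1 E6] := pp_shift_prod kk ma pa (i2 t) aA.
have X := integrable_pp kk (mU fl i t) (mU fl i t) (i2 t) (i2 t) (psqn fl t) (fun x y => UU_sq _ _ _ _ _ _ _).
pose f1 z := a (z.1 + z.2) * k z.2.
pose f2 z := U i t (z.1 + z.2) * U i t z.1 * k z.2.
pose f3 z := a z.1 * k z.2.
have GE z : G z = (f1 z - 2 * f2 z) + f3 z.
  rewrite /G /f1 /f2 /f3 /a; move: (U i t (z.1 + z.2)) (U i t z.1) (k z.2) => *; ring.
have J2 : (mc \x mu)%E.-integrable setT (EFin \o (fun z => 2 * f2 z)) by exact: integrable_scaleR.
have J12 : (mc \x mu)%E.-integrable setT (EFin \o (fun z => f1 z - 2 * f2 z)) by exact: integrable_subR.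
split.
  by rewrite (_ : G = fun z => f1 z - 2 * f2 z + f3 z);
    [exact: integrable_addR | apply/funext => z; exact: GE].
under eq_Rintegral => z _ do rewrite GE.
rewrite (RintegralD _ J12 I6)// (RintegralB _ I1 J2)// RintegralZl//.
rewrite /f1 /f3 E1 E6 -/(pp _ _ _).
move: (pp k (U i t) (U i t)) (\int[mu]_h k h) (\int[mc]_x a x) => x y z; ring.
Qed.

(** Fubini with the increment outside, since the Besov information bounds the integral in space for
    each fixed [h]. *)
Lemma incr_bound t (k w : rV -> R) (g : rV -> R) (b : R) : kern k -> (forall h, 0 <= w h) ->
  measurable_fun setT w ->
  0 <= b -> (forall x, 0 <= g x) ->
  measurable_fun setT (fun z => g (dl t z)) ->
  (forall h, mc.-integrable setT (EFin \o (fun x => g (dl t (x, h)))) /\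
             \int[mc]_x g (dl t (x, h)) <= b * w h) ->
  mu.-integrable setT (EFin \o (fun h => `|k h| * w h)) ->
  (mc \x mu)%E.-integrable setT (EFin \o (fun z => `|k z.2| * g (dl t z))) ->
  \int[(mc \x mu)%E]_z (`|k z.2| * g (dl t z)) <= b * \int[mu]_h (`|k h| * w h).
Proof.
move=> kk w0 mw b0 g0 mg H ikw iG.
rewrite -(Rintegral21 iG) /= -RintegralZl//; apply: le_Rintegral => //.
- exact: (integrable_Rintegral2 iG).
- exact: integrable_scaleR.
- move=> h _; have [ig gb] := H h; rewrite RintegralZl//.
  by rewrite mulrCA ler_wpM2l.
Qed.

End flux.

(** * Moment and increment bounds *)

Section moments.
Context {R : realType} {d : nat}.
Notation rV := 'rV[R]_d.
Notation mu := (@lebesgue_rV R d).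

Lemma measurable_euclid d1 (X : measurableType d1) (f : X -> rV) :
  (forall i, measurable_fun setT (fun x => f x ord0 i)) ->
  measurable_fun setT (fun x => euclid (f x)).
Proof.
move=> mf; have mq : measurable_fun setT (fun x => \sum_i f x ord0 i ^+ 2).
  by apply: measurable_sum => i; apply: measurable_funX; exact: mf.
exact: (measurableT_comp (continuous_measurable_fun (@sqrt_continuous R)) mq).
Qed.

(** The larger of the two norms, doubled, bounds the norm of the difference; 8 is the cube of 2. *)
Lemma euclid_sub_le (a b : rV) : euclid (a - b) ^+ 3 <= 8 * (euclid a ^+ 3 + euclid b ^+ 3).
Proof.
have H : euclid (a - b) ^+ 2 <= 2 * euclid a ^+ 2 + 2 * euclid b ^+ 2.
  rewrite !euclid2 /sqn !mulr_sumr -big_split; apply: ler_sum => i _ /=; rewrite !mxE.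
  by move: (a ord0 i) (b ord0 i) => x y; have := sqr_ge0 (x + y); nra.
have := euclid_ge0 (a - b); have := euclid_ge0 a; have := euclid_ge0 b.
move: (euclid (a - b)) (euclid a) (euclid b) H => z x y H y0 x0 z0.
wlog xy : x y H x0 y0 / x <= y.
  move=> W; have [xy|/ltW yx] := leP x y; first exact: W.
  by rewrite [x ^+ 3 + _]addrC; apply: W => //; rewrite addrC.
have z2 : z <= 2 * y by rewrite -(ler_pXn2r (n := 2))// ?nnegrE; nra.
have : z ^+ 3 <= (2 * y) ^+ 3 by rewrite ler_pXn2r ?nnegrE//; lra.
have := exprn_ge0 3 x0; rewrite exprMn; move: (x ^+ 3) (y ^+ 3) (z ^+ 3) => *; lra.
Qed.

Lemma sqn_sub_le (a b : rV) : sqn (a - b) <= 2 * (sqn a + sqn b).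
Proof.
rewrite mulrDr /sqn !mulr_sumr -big_split; apply: ler_sum => i _ /=; rewrite !mxE.
by move: (a ord0 i) (b ord0 i) => x y; have := sqr_ge0 (x + y); nra.
Qed.

Lemma euclid_norm (h : rV) (r : R) : `|h| <= r -> euclid h <= d.+1%:R * r.
Proof.
move=> hr; have r0 : 0 <= r by exact: le_trans hr.
rewrite -(ler_pXn2r (n := 2))// ?nnegrE ?euclid_ge0 ?mulr_ge0// euclid2.
apply: (@le_trans _ _ (\sum_(i < d) r ^+ 2)).
  apply: ler_sum => i _; rewrite -real_normK ?num_real// ler_pXn2r ?nnegrE//.
  exact: le_trans (coord_le_norm _ _) hr.
rewrite sumr_const card_ord -[X in X <= _]mulr_natl exprMn ler_wpM2r ?sqr_ge0//.
by rewrite -natrX ler_nat; nia.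
Qed.

Lemma norm_delta_le (k : 'I_d) : `|delta_mx ord0 k : rV| <= 1.
Proof. by apply: norm_rV_le => // i; rewrite mxE; case: (_ && _); rewrite ?normr1 ?normr0. Qed.

Lemma ball_moment (f : rV -> R) (M q r : R) : 0 <= q -> 0 < r -> 0 <= M ->
  measurable_fun setT f -> (forall h, `|f h| <= M) -> (forall h, r < `|h| -> f h = 0) ->
  mu.-integrable setT (EFin \o (fun h => `|f h| * (euclid h `^ q))) /\
  \int[mu]_h (`|f h| * (euclid h `^ q)) <= M * (2 ^+ d * d.+1%:R `^ q) * (r ^+ d * r `^ q).
Proof.
move=> q0 r0 M0 mf fM fr.
pose G (h : rV) : R := M * (d.+1%:R * r) `^ q * \1_(cball r) h.
have iG : mu.-integrable setT (EFin \o G).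
  by apply: integrable_scaleR; exact: integrable_cball.
have mF : measurable_fun setT (fun h => `|f h| * (euclid h `^ q)).
  apply: measurable_funM; first exact: measurableT_comp.
  apply: (measurableT_comp (measurable_powR q)); apply: measurable_euclid => i.
  exact: measurable_coord.
have FG h : `| `|f h| * (euclid h `^ q) | <= G h.
  rewrite ger0_norm ?mulr_ge0 ?powR_ge0// /G indicE.
  have [hr|hr] := boolP (h \in cball r); last first.
    rewrite fr ?normr0 ?mul0r ?mulr0// ltNge; apply/negP => hr'; move/negP: hr; apply.
    by rewrite inE.
  rewrite mulr1 ler_pM ?powR_ge0//; apply: ge0_ler_powR; rewrite ?nnegrE ?euclid_ge0//.
    by rewrite mulr_ge0// ltW.
  by apply: euclid_norm; move: hr; rewrite inE.
split; first exact: integrable_dom mF FG iG.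
apply: (@le_trans _ _ (\int[mu]_h G h)).
  by apply: le_trans (ler_norm _) _; exact: le_norm_Rintegral.
rewrite RintegralZl//; last exact: integrable_cball.
have I : \int[mu]_h (\1_(cball r) h : R) <= (2 * r) ^+ d.
  have E : (\int[mu]_h ((\1_(cball r) h : R)%:E) = mu (cball r))%E.
    by have := @integral_indic _ _ R mu setT measurableT (cball r) (measurable_cball r); rewrite setIT.
  have L := @lebesgue_cball R d r (ltW r0).
  rewrite /Rintegral E -lee_fin fineK// ge0_fin_numE//.
  exact: le_lt_trans L (ltry _).
apply: (@le_trans _ _ (M * (d.+1%:R * r) `^ q * (2 * r) ^+ d)).
  by rewrite ler_wpM2l// mulr_ge0// powR_ge0.
rewrite powRM ?(ltW r0)// exprMn.
by move: (_ `^ _) (r `^ q) (2 ^+ d) (r ^+ d) => *; rewrite le_eqVlt; apply/orP; left; apply/eqP; ring.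
Qed.

Lemma csmooth_Kr (r : R) : 0 < r -> csmooth (@Kr R d r).
Proof. by move=> r0; split; [exact: smooth_Kr | exists r => x; exact: Kr_supp]. Qed.

Lemma csmooth_Nf (a b : R) i : 0 < a -> a <= b -> csmooth (@Nf R d a b i).
Proof. by move=> a0 ab; split; [exact: smooth_Nf | exists b => x; exact: Nf_supp]. Qed.

Lemma sym_Nf (a b : R) i j (x : rV) : dx j (Nf a b i) x = dx i (Nf a b j) x.
Proof. by rewrite !dxE; exact: Nf_sym. Qed.

Lemma Kd_Nf (a b : R) : Kd (@Nf R d a b) = fun x => Kr a x - Kr b x.
Proof.
apply/funext => x; rewrite /Kd; under eq_bigr => i _ do rewrite dxE.
by rewrite Nf_div opprK.
Qed.

Lemma Kr_moment (q : R) : 0 <= q -> exists2 C : R, 0 <= C & forall r : R, 0 < r ->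
  mu.-integrable setT (EFin \o (fun h => `|Kr r h| * (euclid h `^ q))) /\
  \int[mu]_h (`|Kr r h| * (euclid h `^ q)) <= C * r `^ q.
Proof.
move=> q0; have [C C0 HC] := @Kr_bound R d.
exists (C * (2 ^+ d * d.+1%:R `^ q)); first by rewrite !mulr_ge0 ?powR_ge0// ltW.
move=> r r0; have rd : 0 < r ^+ d by rewrite exprn_gt0.
have M0 : 0 <= C * r ^- d by rewrite mulr_ge0 ?invr_ge0// ltW.
have mK : measurable_fun setT (@Kr R d r) by case: (kern_csmooth (csmooth_Kr r0)).
have b1 (h : rV) : `|Kr r h| <= C * r ^- d by rewrite (ger0_norm (Kr_ge0 _ r0)); exact: (HC r h r0).
have [I B] := ball_moment q0 r0 M0 mK b1 (fun h => @Kr_supp R d r h r0).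
split => //; apply: le_trans B _.
rewrite le_eqVlt; apply/orP; left; apply/eqP.
move: (2 ^+ d * _) (r `^ q) => x y.
by field; rewrite gt_eqF.
Qed.

Lemma dKr_moment (q : R) : 0 <= q -> exists2 C : R, 0 <= C & forall r : R, 0 < r -> forall k,
  mu.-integrable setT (EFin \o (fun h => `|dx k (Kr r) h| * (euclid h `^ q))) /\
  \int[mu]_h (`|dx k (Kr r) h| * (euclid h `^ q)) <= C * r `^ (q - 1).
Proof.
move=> q0; have [C C0 HC] := @dKr_bound R d.
exists (C * (2 ^+ d * d.+1%:R `^ q)); first by rewrite !mulr_ge0 ?powR_ge0// ltW.
move=> r r0 k; have rd : 0 < r ^+ d by rewrite exprn_gt0.
have M0 : 0 <= C * r ^- d.+1 by rewrite mulr_ge0 ?invr_ge0 ?exprn_ge0// ltW.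
have mK : measurable_fun setT (dx k (@Kr R d r)) by case: (kern_csmooth (csmooth_dx k (csmooth_Kr r0))).
have b1 (h : rV) : `|dx k (Kr r) h| <= C * r ^- d.+1.
  rewrite dxE; apply: le_trans (HC _ _ _ r0) _.
  by rewrite ler_piMr// norm_delta_le.
have s1 h : r < `|h| -> dx k (Kr r) h = 0 by move=> rh; rewrite dxE; exact: dKr_supp.
have [I B] := ball_moment q0 r0 M0 mK b1 s1.
split => //; apply: le_trans B _.
rewrite powRD; last by rewrite (gt_eqF r0) implybT.
rewrite (powR_inv1 (ltW r0)) exprS.
rewrite le_eqVlt; apply/orP; left; apply/eqP.
move: (2 ^+ d * _) (r `^ q) => x y.
by field; rewrite !gt_eqF.
Qed.

(** The profile is bounded below on a small cube about a point [p] where it is positive. For scale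
    [r] the cube is dilated by [r], and its volume compensates the factor [r ^- d], so the bound
    does not depend on [r]. *)
Lemma Kr_mass : (0 < d)%N -> exists2 m : R, 0 < m & forall r : R, 0 < r ->
  m <= \int[mu]_h Kr r h.
Proof.
move=> d0; have [s s0 ks] := @k0_gt0 R d.
pose p : rV := Num.sqrt s *: delta_mx ord0 (Ordinal d0).
have sp : sqn p = s.
  rewrite /sqn (bigD1 (Ordinal d0))//= big1 ?addr0.
    by rewrite !mxE eqxx mulr1 sqr_sqrtr// ltW.
  by move=> i ip; rewrite !mxE (negPf ip) mulr0 expr0n.
have cf : continuous (fun h : rV => @k0 R d (sqn h)).
  by apply: smooth_continuous; apply: smooth_comp; [exact: smooth_k0 | exact: smooth_sqn].
have k2 : 0 < @k0 R d s / 2 by lra.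
have /cvgrPdist_lt /(_ _ k2) near := cf p.
have [e /= e0 He] := (nbhs_ballP _ _).1 near.
have {}He (h : rV) : (forall i, `|h ord0 i - p ord0 i| < e) -> @k0 R d s / 2 <= @k0 R d (sqn h).
  move=> H; have := He h; rewrite sp => W.
  have half (a b : R) : `|a - b| < a / 2 -> a / 2 <= b.
    by rewrite ltr_norml => /andP[? ?]; lra.
  apply: half; apply: W; split => // i j; rewrite ord1 /ball /= distrC; exact: H.
(* Halving turns the closed cube used for the measure into the strict inequalities required by
   [He]. *)
pose e' := e / 2; have e'0 : 0 < e' by rewrite divr_gt0.
exists (@k0 R d s / 2 * (2 * e') ^+ d); first by rewrite mulr_gt0 ?exprn_gt0// mulr_gt0.
move=> r r0.
pose A i : set R := [set` `[r * p ord0 i - r * e', r * p ord0 i + r * e']].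
have mA i : measurable (A i) by exact: measurable_itv.
pose B := [set x : rV | forall i, A i (x ord0 i)].
have mB : measurable B by exact: measurable_box.
have LB : (mu B = ((r * (2 * e')) ^+ d)%:E)%E.
  rewrite (lebesgue_rV_box mA).
  have -> : (\prod_(i < d) lebesgue_measure (A i) = \prod_(i < d) (r * (2 * e'))%:E :> \bar R)%E.
    apply: eq_bigr => i _; rewrite lebesgue_measure_itv /= lte_fin.
    have re : 0 < r * e' by rewrite mulr_gt0.
    rewrite ifT; last by move: re; move: (r * p _ _) (r * e') => *; lra.
    rewrite -EFinB; congr EFin; ring.
  by rewrite prodEFin prodr_const card_ord.
have iK := kern_integrable (kern_csmooth (csmooth_Kr r0)).
have iB : mu.-integrable setT (EFin \o (\1_B : rV -> R)).
  apply/integrableP; split; first exact/measurable_EFinP/measurable_indic.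
  have -> : (\int[mu]_x `|(EFin \o (\1_B : rV -> R)) x| = mu B)%E.
    have := @integral_indic _ _ R mu setT measurableT B mB; rewrite setIT => <-.
    by apply: eq_integral => x _; rewrite /= ger0_norm// indicE.
  by rewrite LB ltry.
apply: (@le_trans _ _ (\int[mu]_h ((r ^- d * (@k0 R d s / 2)) * \1_B h))).
  rewrite RintegralZl//.
  have -> : \int[mu]_h (\1_B h : R) = (r * (2 * e')) ^+ d.
    have E : (\int[mu]_h (\1_B h : R)%:E = mu B)%E.
      by have := @integral_indic _ _ R mu setT measurableT B mB; rewrite setIT.
    by rewrite /Rintegral E LB.
  rewrite [(r * _) ^+ d]exprMn mulrACA mulVf ?mul1r ?expf_neq0 ?gt_eqF//.
apply: le_Rintegral => //; first exact: integrable_scaleR.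
move=> h _; rewrite indicE; have [hB|hB] := boolP (h \in B); last by rewrite mulr0 Kr_ge0.
rewrite mulr1 /Kr.
have rd : 0 <= r ^- d.
  by rewrite invr_ge0 exprn_ge0// ltW.
apply: (ler_wpM2l rd).
have -> : r ^- 2 * sqn h = sqn (r^-1 *: h).
  by rewrite /sqn mulr_sumr; apply: eq_bigr => i _; rewrite mxE exprMn exprVn.
apply: He => i; rewrite mxE.
move: hB; rewrite inE => /(_ i); rewrite /A /= in_itv /= => /andP[h1 h2].
have -> : r^-1 * h ord0 i - p ord0 i = r^-1 * (h ord0 i - r * p ord0 i).
  by rewrite mulrBr mulKf// gt_eqF.
rewrite normrM gtr0_norm ?invr_gt0// ltr_pdivrMl//.
apply: (@le_lt_trans _ _ (r * e')); last by rewrite ltr_pM2l// /e'; lra.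
by rewrite ler_norml; move: h1 h2; move: (h ord0 i) (r * p _ _) (r * e') => *; apply/andP; split; lra.
Qed.

End moments.

Section increments.
Context {R : realType} {d : nat} (Omega : spatial_domain) (T : R).
Variable u : R -> 'rV[R]_d -> 'rV[R]_d.
Notation rV := 'rV[R]_d.
Notation mu := (@lebesgue_rV R d).
Notation mc := (@cell_measure R d Omega).
Notation leb := (@lebesgue_measure R).
Notation U := (vel u).
Notation UU := (velM u).
Notation n2 := (nrm2 Omega u).
Notation pp := (@pairing R d Omega).
Notation dl := (incr u).
Hypothesis fl : flow Omega T u.
Variables (t b : R) (w : rV -> R).
Hypothesis b0 : 0 <= b.
Hypothesis w0 : forall h, 0 <= w h.
Hypothesis mw : measurable_fun setT w.

Let i3 : mc.-integrable setT (EFin \o (fun x => euclid (u t x) ^+ 3)) := fl_3 fl t.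
Let i2 : mc.-integrable setT (EFin \o (fun x => sqn (u t x))) := fl_2 fl t.

Let m3 : measurable_fun setT (fun z => euclid (dl t z) ^+ 3).
Proof. by apply: measurable_funX; apply: measurable_euclid => i; exact: (mdl fl). Qed.

Let m2 : measurable_fun setT (fun z => sqn (dl t z)).
Proof. by apply: measurable_sum => i; apply: measurable_funX; exact: (mdl fl). Qed.

Let ip (k : rV -> R) (g : rV * rV -> R) (A : rV -> R) (c : R) : kern k -> measurable_fun setT g ->
  @function_on R d Omega _ A -> mc.-integrable setT (EFin \o A) -> 0 <= c ->
  (forall z, 0 <= g z <= c * (A (z.1 + z.2) + A z.1)) ->
  (mc \x mu)%E.-integrable setT (EFin \o (fun z => `|k z.2| * g z)).
Proof.
move=> kk mg pA iA c0 gA; have mk := proj1 kk.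
have ik : mu.-integrable setT (EFin \o (fun h => c * `|k h|)).
  by apply: integrable_scaleR; exact: integrable_norm (kern_integrable kk).
have k0 h : 0 <= c * `|k h| by rewrite mulr_ge0.
have mG : measurable_fun setT (fun z : rV * rV => `|k z.2| * g z).
  apply: measurable_funM => //; apply: measurableT_comp => //.
  exact: (measurableT_comp mk measurable_snd).
have GA z : `| `|k z.2| * g z | <= (A (z.1 + z.2) + A z.1) * (c * `|k z.2|).
  have /andP[g0 gc] := gA z; rewrite ger0_norm ?mulr_ge0//.
  by rewrite mulrA [_ * c]mulrC [_ * `|_|]mulrC ler_wpM2l.
by have [] := pair_bound ik k0 pA iA iA mG GA.
Qed.

Let ik3 (k : rV -> R) : kern k ->
  (mc \x mu)%E.-integrable setT (EFin \o (fun z => `|k z.2| * euclid (dl t z) ^+ 3)).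
Proof.
move=> kk; apply: (ip kk m3 (pcub fl t) i3 (c := 8)) => // z.
by rewrite exprn_ge0 ?euclid_ge0//= euclid_sub_le.
Qed.

Let ik2 (k : rV -> R) : kern k ->
  (mc \x mu)%E.-integrable setT (EFin \o (fun z => `|k z.2| * sqn (dl t z))).
Proof.
move=> kk; apply: (ip kk m2 (psqn fl t) i2 (c := 2)) => // z.
by rewrite sqn_ge0/= sqn_sub_le.
Qed.

(** By [cubic_term], the integral of dK/dh_k times the k-th increment times |increment|^2, summed
    over k, is minus four times the flux plus terms in which the divergence of the mollified
    velocity multiplies |u|^2. The latter vanish, leaving a cubic expression in increments. *)
Lemma flux_bound (N : 'I_d -> rV -> R) : (forall i, csmooth (N i)) ->
  (forall h, Kd N (- h) = Kd N h) ->
  {ae mc, forall x, dv u (Kd N) t x = 0} ->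
  (forall h, mc.-integrable setT (EFin \o (fun x => euclid (dl t (x, h)) ^+ 3)) /\
     \int[mc]_x euclid (dl t (x, h)) ^+ 3 <= b * w h) ->
  (forall k, mu.-integrable setT (EFin \o (fun h => `|dx k (Kd N) h| * w h))) ->
  `|Bk Omega u N t| <= d%:R * b * \sum_k \int[mu]_h (`|dx k (Kd N) h| * w h).
Proof.
move=> bN ev dv0 H iw; have bK := csmooth_Kd bN; have kK k := kern_csmooth (csmooth_dx k bK).
have odd k h : dx k (Kd N) (- h) = - dx k (Kd N) h.
  by have := dx_opp k h bK; rewrite (funext ev) => ->; rewrite opprK.
have CT k i := cubic_term fl t i k (kK k) (odd k).
pose G k i z := dx k (Kd N) z.2 * ((U k t (z.1 + z.2) - U k t z.1) * (U i t (z.1 + z.2) - U i t z.1) ^+ 2).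
(* The sum over k is the integral of [dv] with kernel [Kd N] against the square of [U i]. *)
have Z i : \sum_k pp (dx k (Kd N)) (U k t) (UU i i t) = 0.
  have PP k := pp_UUUr fl i i t k t (kK k).
  under eq_bigr => k _ do rewrite (PP k).2.
  rewrite -Rintegral_sum; last by move=> k; case: (PP k).
  have iS : mc.-integrable setT (EFin \o (fun x => \sum_k cv (dx k (Kd N)) (U k t) x * UU i i t x)).
    by apply: integrable_sumR => k; case: (PP k).
  rewrite -[RHS](Rintegral0 mc); apply: ae_eq_Rintegral => //; first exact: integrable_mble iS.
  case: dv0 => B [mB B0 sB]; exists B; split => // x xB; apply: sB => d0; apply: xB => /=.
  by rewrite -mulr_suml -/(dv u (Kd N) t x) d0 mul0r.
have E : \sum_k \sum_i \int[(mc \x mu)%E]_z G k i z = - (4 * Bk Omega u N t).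
  under eq_bigr => k _ do (under eq_bigr => i _ do rewrite (CT k i).2; rewrite big_split /=).
  rewrite big_split /= [X in _ + X]exchange_big /= [X in _ + X]big1 ?addr0; last first.
    by move=> i _; rewrite -mulr_sumr Z mulr0.
  rewrite /Bk /DD mulrN opprK exchange_big /= mulr_sumr; apply: eq_bigr => i _.
  by rewrite mulr_sumr.
have GB k i : `|\int[(mc \x mu)%E]_z G k i z| <= b * \int[mu]_h (`|dx k (Kd N) h| * w h).
  apply: (@le_trans _ _ (\int[(mc \x mu)%E]_z (`|dx k (Kd N) z.2| * euclid (dl t z) ^+ 3))).
    apply: le_norm_Rintegral; last exact: ik3.
      by apply: integrable_mble; exact: (CT k i).1.
    move=> z; rewrite /G normrM ler_wpM2l// normrM normrX [X in _ <= X]exprS -!dlE.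
    have e0 := euclid_ge0 (dl t z).
    by apply: ler_pM; rewrite ?exprn_ge0 ?coord_euclid// lerXn2r ?nnegrE ?coord_euclid.
  apply: (incr_bound (g := fun x => euclid x ^+ 3)) => //.
  - by move=> x; rewrite exprn_ge0 ?euclid_ge0.
  - exact: ik3.
have B4 : 4 * `|Bk Omega u N t| <= d%:R * b * \sum_k \int[mu]_h (`|dx k (Kd N) h| * w h).
  rewrite -[4]ger0_norm// -normrM -normrN -E.
  apply: le_trans (ler_norm_sum _ _ _) _; rewrite mulr_sumr; apply: ler_sum => k _.
  apply: le_trans (ler_norm_sum _ _ _) _; rewrite -mulrA.
  apply: (@le_trans _ _ (\sum_(i < d) b * \int[mu]_h (`|dx k (Kd N) h| * w h))).
    by apply: ler_sum => i _; exact: GB.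
  by rewrite sumr_const card_ord mulr_natl.
by apply: le_trans B4; rewrite ler_peMl// ler1n.
Qed.

(** By [square_term], twice the left-hand difference is the integral of [k] against the squared
    increment of the velocity. *)
Lemma mass_bound (k : rV -> R) : kern k ->
  (forall h, mc.-integrable setT (EFin \o (fun x => sqn (dl t (x, h)))) /\
     \int[mc]_x sqn (dl t (x, h)) <= b * w h) ->
  mu.-integrable setT (EFin \o (fun h => `|k h| * w h)) ->
  `|(\int[mu]_h k h) * n2 t - \sum_j pp k (U j t) (U j t)| <= b * \int[mu]_h (`|k h| * w h).
Proof.
move=> kk H iw; have ST j := square_term fl t j kk.
have iUj j : mc.-integrable setT (EFin \o (fun x => U j t x ^+ 2)).
  apply: integrable_dom i2; first by apply: measurable_funX; exact: (mU fl).
  by move=> x; rewrite ger0_norm ?sqr_ge0// sqU_le.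
have N2 : n2 t = \sum_j \int[mc]_x (U j t x ^+ 2) by rewrite -Rintegral_sum.
pose G j z := k z.2 * (U j t (z.1 + z.2) - U j t z.1) ^+ 2.
have E : 2 * ((\int[mu]_h k h) * n2 t - \sum_j pp k (U j t) (U j t)) =
    \int[(mc \x mu)%E]_z (\sum_j G j z).
  rewrite Rintegral_sum; last by move=> j; case: (ST j).
  under [RHS]eq_bigr => j _ do rewrite (ST j).2.
  by rewrite N2 -mulr_sumr; congr (2 * _); rewrite mulr_sumr -sumrB.
have B2 : 2 * `|(\int[mu]_h k h) * n2 t - \sum_j pp k (U j t) (U j t)| <=
    b * \int[mu]_h (`|k h| * w h).
  rewrite -[X in X * _](ger0_norm (ler0n R 2)) -normrM E.
  apply: (@le_trans _ _ (\int[(mc \x mu)%E]_z (`|k z.2| * sqn (dl t z)))).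
    have iS : (mc \x mu)%E.-integrable setT (EFin \o (fun z => \sum_j G j z)).
      by apply: integrable_sumR => j; case: (ST j).
    apply: le_norm_Rintegral; [exact: integrable_mble iS| |exact: ik2].
    by move=> z; rewrite /G -mulr_sumr -sqn_dl normrM [X in _ * X <= _]ger0_norm ?sqn_ge0.
  apply: (incr_bound (g := fun x => sqn x)) => //; first exact: sqn_ge0.
  exact: ik2.
by apply: le_trans B2; rewrite ler_peMl// ler1n.
Qed.

End increments.

Lemma integrable_tonelli d1 d2 (T1 : measurableType d1) (T2 : measurableType d2) (R : realType)
    (m1 : {sigma_finite_measure set T1 -> \bar R})
    (m2 : {sigma_finite_measure set T2 -> \bar R}) (f : T1 * T2 -> R) :
  measurable_fun setT f -> (forall z, 0 <= f z) ->
  (forall x, m2.-integrable setT (EFin \o (fun y => f (x, y)))) ->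
  m1.-integrable setT (EFin \o (fun x => \int[m2]_y f (x, y))) ->
  (m1 \x m2)%E.-integrable setT (EFin \o f).
Proof.
move=> mf f0 i2 i1; have mE : measurable_fun setT (EFin \o f) by exact/measurable_EFinP.
apply/(integrable12ltyP _ _ mE).
have /integrableP[_] := i1; congr (_ < _)%E; apply: eq_integral => x _.
have I0 : (0 <= \int[m2]_y (f (x, y))%:E)%E by apply: integral_ge0 => y _; rewrite lee_fin.
rewrite /= ger0_norm; last by apply: Rintegral_ge0.
rewrite /Rintegral fineK; last exact: (integrable_fin_num _ (i2 x)).
by apply: eq_integral => y _; rewrite /= ger0_norm.
Qed.

Lemma integral_mc (R : realType) (d : nat) (Omega : spatial_domain) (f : 'rV[R]_d -> R) :
  measurable_fun setT f ->
  \int[@cell_measure R d Omega]_x f x = \int[@lebesgue_rV R d]_x (f x * \1_(cell Omega) x).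
Proof.
move=> mf; rewrite /Rintegral; congr fine.
have mE : measurable_fun setT (EFin \o f) by exact/measurable_EFinP.
rewrite (integral_mrestr (lebesgue_rV d) (measurable_cell Omega) mE).
rewrite (integral_mkcond (cell Omega)).
by apply: eq_integral => x _; rewrite patchE indicE; case: ifP; rewrite ?mulr1 ?mulr0.
Qed.

(** * Testing the Euler equations *)

Section test_functions.
Context {R : realType} {d : nat} (Omega : spatial_domain) (T : R).
Notation rV := 'rV[R]_d.
Notation mu := (@lebesgue_rV R d).
Notation mc := (@cell_measure R d Omega).
Notation leb := (@lebesgue_measure R).
Notation e_ i := (delta_mx ord0 i : rV).

Lemma test_support (psi : R -> R) : 0 < T -> test_function_line `]0, T[ psi ->
  exists a b, [/\ 0 < a, b < T & forall t, ~~ (a <= t <= b) -> psi t = 0].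
Proof.
move=> T0 [sp [K [cK KT K0]]]; have [KE|/set0P ne] := eqVneq K set0.
  exists (T / 2), (T / 2); split; [lra|lra|move=> t _].
  by apply: K0; rewrite KE.
have cid : {within K, continuous (fun t : R => t)} by apply: continuous_subspaceT => t; exact: cvg_id.
have cneg : {within K, continuous (fun t : R => - t)} by apply: continuous_subspaceT => t; exact: opp_continuous.
have [b /set_mem/KT bT Hb] := compact_EVT_max ne cK cid.
have [a /set_mem/KT aT Ha] := compact_EVT_max ne cK cneg.
exists a, b; move: aT bT; rewrite /= !in_itv /= => /andP[a0 _] /andP[_ b1]; split => // t tab.
apply: K0 => Kt; move/negP: tab; apply; rewrite Hb ?inE// andbT.
by have := Ha t; rewrite inE => /(_ Kt); rewrite lerN2.
Qed.

Definition admissible (Th : rV -> R) : Prop := [/\ smooth Th, function_on Omega Th &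
  exists M, Omega = WholeSpace -> forall x, M < `|x| -> Th x = 0].

Lemma test_prod (psi : R -> R) (Th : rV -> R) : 0 < T -> test_function_line `]0, T[ psi -> admissible Th ->
  test_function Omega T (fun z => psi z.1 * Th z.2).
Proof.
move=> T0 tp [sT pT [M MT]]; have [a [b [a0 b1 ab]]] := test_support T0 tp.
exists a, b, M; split => //; split.
- by apply: smoothM; [apply: smooth_fst; case: tp | exact: smooth_snd].
- by move=> t OT x i /=; rewrite pT.
- move=> z zs; have [zab|zab] := boolP (a <= z.1 <= b); last by rewrite ab// mul0r.
  rewrite [Th _](_ : _ = 0) ?mulr0//; apply: contrapT => Tz; apply: zs; split => // OW.
  by rewrite leNgt; apply/negP => Mz; apply: Tz; exact: MT.
Qed.

Lemma derive_prod_t (psi : R -> R) (Th : rV -> R) z : smooth psi ->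
  'D_dir_t (fun z : R * rV => psi z.1 * Th z.2) z = 'D_1 psi z.1 * Th z.2.
Proof.
move=> sp; rewrite derive_line.
have -> : (fun h : R => psi (h *: (@dir_t R d) + z).1 * Th (h *: (@dir_t R d) + z).2) =
    fun h : R => Th z.2 * psi (h *: (1 : R) + z.1).
  by apply/funext => h; rewrite /= scaler0 add0r mulrC.
have /is_derive_line D := is_derive_smooth z.1 (1 : R) sp.
by have [_ ->] := is_deriveZ (Th z.2) D; rewrite mulrC.
Qed.

Lemma derive_prod_x (psi : R -> R) (Th : rV -> R) i z : smooth Th ->
  'D_(dir_x i) (fun z : R * rV => psi z.1 * Th z.2) z = psi z.1 * 'D_(e_ i) Th z.2.
Proof.
move=> sT; rewrite derive_line.
have -> : (fun h : R => psi (h *: (@dir_x R d i) + z).1 * Th (h *: (@dir_x R d i) + z).2) =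
    fun h : R => psi z.1 * Th (h *: e_ i + z.2).
  by apply/funext => h; rewrite /= scaler0 add0r.
have /is_derive_line D := is_derive_smooth z.2 (e_ i) sT.
by have [_ ->] := is_deriveZ (psi z.1) D.
Qed.

(** Kernels live on R^d for both domains. On the torus a kernel becomes a test function by
    periodization, and [Pe_unfold] carries the integrals back to R^d. *)
Definition to_domain (Phi : rV -> R) : rV -> R :=
  match Omega with Torus => periodize Phi | WholeSpace => Phi end.

Lemma admissible_to_domain (Phi : rV -> R) : csmooth Phi -> admissible (to_domain Phi).
Proof.
rewrite /admissible /to_domain; case: Omega => -[sP [M MP]]; split => //; last by exists M.
- exact: smooth_per MP.
- by move=> _; exact: per_periodic.
- by exists 0.
Qed.

Lemma derive_to_domain (Phi : rV -> R) i x : csmooth Phi -> 'D_(e_ i) (to_domain Phi) x = to_domain (dx i Phi) x.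
Proof.
rewrite /to_domain; case: Omega => bP; last by rewrite dxE.
have [sP [M MP]] := bP; have [_ [M' MP']] := csmooth_dx i bP.
pose N := Num.max M M'; pose k := (Num.truncn (N + (`|x| + 1))).+1.
have Nk : N + (`|x| + 1) <= k%:R by exact/ltW/truncnS_gt.
have HN y : N < `|y| -> Phi y = 0 by rewrite gt_max => /andP[? _]; exact: MP.
have HN' y : N < `|y| -> dx i Phi y = 0 by rewrite gt_max => /andP[_ ?]; exact: MP'.
rewrite (derive_per (e_ i) sP HN Nk); last by rewrite ltrDl.
rewrite (perE HN' Nk) ?lerDl//.
by apply: eq_bigr => n _; rewrite dxE.
Qed.

Lemma function_on_ivec (a : rV -> R) (n : 'rV[int]_d) x : Omega = Torus -> function_on Omega a ->
  a (x + ivec n) = a x.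
Proof.
move=> OT pa.
have stepn (i : 'I_d) (k : nat) y : a (y + k%:R *: e_ i) = a y.
  elim: k y => [|k IH] y; first by rewrite scale0r addr0.
  by rewrite -natr1 scalerDl scale1r addrA (pa OT) IH.
have stepz (i : 'I_d) (z : int) y : a (y + z%:~R *: e_ i) = a y.
  case: z => k; first exact: stepn.
  rewrite NegzE mulrNz scaleNr -[in RHS](subrK (k.+1%:~R *: e_ i) y).
  by rewrite (stepn i k.+1).
have -> : @ivec R d n = \sum_i (n ord0 i)%:~R *: e_ i.
  by rewrite [LHS]row_sum_delta; apply: eq_bigr => i _; rewrite mxE.
elim: (index_enum _) x => [|i s IH] x; first by rewrite big_nil addr0.
by rewrite big_cons addrA IH stepz.
Qed.

Lemma ball_cell (x : rV) : x \in @cell R d Torus -> `|x| <= 1.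
Proof.
rewrite inE => xc; apply: norm_rV_le => // i; have /andP[x0 x1] := xc i.
by rewrite ger0_norm// ltW.
Qed.

Lemma measurable_to_domain (Phi : rV -> R) : csmooth Phi -> measurable_fun setT (to_domain Phi).
Proof.
move=> bP; apply: continuous_measurable_rV; apply: smooth_continuous.
by case: (admissible_to_domain bP).
Qed.

(** Translates of the cell tile the space and the periodic [a] takes the same values on each of
    them, so the sum over translates can be moved from the domain of integration onto [Phi]. *)
Lemma Pe_unfold (a : rV -> R) (Phi : rV -> R) : csmooth Phi -> measurable_fun setT a ->
  function_on Omega a -> mu.-integrable setT (EFin \o (fun x => a x * Phi x)) ->
  \int[mc]_x (a x * to_domain Phi x) = \int[mu]_x (a x * Phi x).
Proof.
move=> bP ma pa ia.
have mPe := measurable_to_domain bP.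
move: pa mPe (@function_on_ivec a).
rewrite /to_domain; case: Omega => pa mPe pv; last first.
  rewrite integral_mc; last exact: measurable_funM.
  by apply: eq_Rintegral => x _; rewrite indicE /= mem_set ?mulr1.
have [sP [M MP]] := bP.
pose k := (Num.truncn (M + 1)).+1; have Mk : M + 1 <= k%:R by exact/ltW/truncnS_gt.
have sf x : M < `|x| -> a x * Phi x = 0 by move=> Mx; rewrite MP ?mulr0.
have [it ->] := tile ia sf Mk.
(* The translated pieces are known to be integrable for [n] in the box only; [F] is 0 elsewhere, so
   that it is integrable for every index. *)
pose F n x := if n \in box k then a (x + ivec n) * Phi (x + ivec n) else 0.
have iF n : (@cell_measure R d Torus).-integrable setT (EFin \o F n).
  rewrite (_ : F n = if n \in box k then fun x => a (x + ivec n) * Phi (x + ivec n) else fun=> 0).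
    by case: ifP => [nk|_]; [exact: it | exact: integrable0].
  by apply/funext => x; rewrite /F; case: ifP.
rewrite big_seq; under eq_bigr => n nk.
  rewrite (_ : \int[_]_x _ = \int[@cell_measure R d Torus]_x F n x); first over.
  by apply: eq_Rintegral => x _; rewrite /F nk.
rewrite -big_seq -Rintegral_sum//.
have iS : (@cell_measure R d Torus).-integrable setT (EFin \o (fun x => \sum_(n <- box k) F n x)).
  exact: integrable_sumR.
rewrite integral_mc; last exact: measurable_funM.
rewrite [RHS]integral_mc; last exact: integrable_mble iS.
apply: eq_Rintegral => x _; rewrite indicE; have [xc|_] := boolP (x \in _); last by rewrite !mulr0.
rewrite !mulr1 (perE MP Mk (ball_cell xc)) mulr_sumr big_seq [RHS]big_seq.
by apply: eq_bigr => n nk; rewrite /F nk pv.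
Qed.

Lemma admissible_derive (Th : rV -> R) i : admissible Th -> admissible (fun x => 'D_(e_ i) Th x).
Proof.
rewrite /admissible; case: Omega => -[sT pT [M MT]]; split.
- exact: smooth_derive.
- move=> _ x j; rewrite -derive_shift//; congr ('D_(e_ i) _ x).
  by apply/funext => y; exact: pT.
- by exists 0.
- exact: smooth_derive.
- by [].
- have [_ [N HN]] : csmooth (fun x => 'D_(e_ i) Th x).
    by apply: csmooth_derive; split => //; exists M; exact: MT.
  by exists N.
Qed.

Lemma admissibleD (f g : rV -> R) : admissible f -> admissible g -> admissible (fun x => f x + g x).
Proof.
move=> [sf pf [M fM]] [sg pg [N gN]]; split; first exact: smoothD.
  by move=> OT x i; rewrite pf// pg.
exists (Num.max M N) => OW x; rewrite gt_max => /andP[Mx Nx].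
by rewrite (fM OW)// (gN OW)// addr0.
Qed.

Lemma admissible0 : admissible (fun=> 0).
Proof. by split => //; [exact: smooth_cst | exists 0]. Qed.

Lemma admissible_sum (s : seq 'I_d) (F : 'I_d -> rV -> R) : (forall i, admissible (F i)) ->
  admissible (fun x => \sum_(i <- s) F i x).
Proof.
move=> oF; elim: s => [|i s IH].
  by rewrite (_ : (fun _ => _) = fun=> 0); [exact: admissible0 | apply/funext => x; rewrite big_nil].
rewrite (_ : (fun _ => _) = fun x => F i x + \sum_(i <- s) F i x); first exact: admissibleD.
by apply/funext => x; rewrite big_cons.
Qed.

Lemma admissible_bound (Th : rV -> R) : admissible Th -> measurable_fun setT Th /\ exists C M, 0 <= C /\
  forall x, x \in cell Omega -> `|Th x| <= C * \1_(cball M) x.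
Proof.
move=> [sT pT [M MT]]; have mT := continuous_measurable_rV (smooth_continuous sT).
split => //; move: MT; case: Omega => MT; last first.
  have [_ [L [C HC]]] : kern Th by apply: kern_csmooth; split => //; exists M; exact: MT.
  exists `|C|, L; split => // x _; apply: le_trans (HC x) _.
  by rewrite ler_wpM2r ?ler_norm// indicE.
have ne : @cball R d 1 !=set0 by exists (0 : rV); rewrite /cball /= normr0.
have cn : {within @cball R d 1, continuous (fun x => `|Th x|)}.
  apply: continuous_subspaceT => x; apply: (@continuous_comp _ _ _ Th Num.norm).
    exact: (smooth_continuous sT).
  exact: norm_continuous.
have [c _ Hc] := compact_EVT_max ne (@compact_cball R d 1) cn.
exists `|Th c|, 1; split => // x xc; have x1 : x \in cball 1 by rewrite inE; exact: ball_cell.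
by rewrite indicE x1 mulr1; exact: Hc.
Qed.

(** Here the pressure leaves the argument: linearity is the only property of [pi] involved, and it
    is available on test functions only, so every partial sum has to be admissible. *)
Lemma pressure_sum (pi : (R * rV -> R) -> R) (psi : R -> R) (F : 'I_d -> rV -> R) :
  0 < T -> distribution_on Omega T pi -> test_function_line `]0, T[ psi -> (forall i, admissible (F i)) ->
  (forall x, \sum_i F i x = 0) ->
  \sum_i pi (fun z => psi z.1 * F i z.2) = 0.
Proof.
move=> T0 [lin _] tp oF F0.
have S s : pi (fun z => psi z.1 * \sum_(i <- s) F i z.2) = \sum_(i <- s) pi (fun z => psi z.1 * F i z.2).
  elim: s => [|i s IH].
    (* Linearity at the zero test function reads pi 0 = pi 0 + pi 0. *)
    have := lin 1 _ _ (test_prod T0 tp admissible0) (test_prod T0 tp admissible0).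
    rewrite (_ : (fun z : R * rV => 1 * _ + _) = (fun z => psi z.1 * 0)); last first.
      by apply/funext => z; rewrite mulr0 mul1r addr0.
    rewrite mul1r => /eqP; rewrite -subr_eq0 opprD addrA subrr add0r oppr_eq0 => /eqP E.
    by rewrite big_nil; under [X in pi X]eq_fun do rewrite big_nil.
  rewrite big_cons -IH -[pi _ in RHS]mul1r.
  rewrite -(lin 1 _ _ (test_prod T0 tp (oF i)) (test_prod T0 tp (admissible_sum s oF))).
  by congr pi; apply/funext => z; rewrite big_cons mulrDr mul1r.
have := S [::]; rewrite big_nil => E; rewrite -S -[RHS]E; congr pi.
by apply/funext => z; rewrite F0 big_nil.
Qed.

End test_functions.

(** * From space-time distributions to time slices *)

Section slicing.
Context {R : realType} {d : nat} (Omega : spatial_domain) (T : R).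
Variables (v : R -> 'rV[R]_d -> 'rV[R]_d) (G : set R).
Notation rV := 'rV[R]_d.
Notation mu := (@lebesgue_rV R d).
Notation mc := (@cell_measure R d Omega).
Notation leb := (@lebesgue_measure R).

Lemma integrable_mc (f : rV -> R) : mc.-integrable setT (EFin \o f) ->
  mu.-integrable setT (EFin \o (fun x => f x * \1_(cell Omega) x)).
Proof.
move=> iF; have mf := integrable_mble iF; have /integrableP[mE fin] := iF.
have mi : measurable_fun setT (\1_(cell Omega) : rV -> R).
  by apply: measurable_indic; exact: measurable_cell.
apply/integrableP; split; first by apply/measurable_EFinP; exact: measurable_funM.
have mN : measurable_fun setT (fun x => `|(EFin \o f) x|%E) by exact: measurableT_comp.
move: fin; rewrite (integral_mrestr mu (measurable_cell Omega) mN).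
rewrite (integral_mkcond (cell Omega)); congr (_ < _)%E.
apply: eq_integral => x _; rewrite patchE /= indicE.
by case: ifP => _; rewrite ?mulr1// mulr0 normr0.
Qed.

(** Zero at the discarded times, so that bounds on slices hold at every time and not merely almost
    everywhere. *)
Definition masked (t : R) : rV -> rV := if t \in G then v t else fun=> 0.
Notation u := masked.

Hypothesis T0 : 0 < T.
Hypothesis mG : measurable G.
Hypothesis GT : G `<=` [set` `]0, T[].
Hypothesis nG : leb ([set` `]0, T[] `\` G) = 0%E.
Hypothesis mu_ : forall i, measurable_fun setT (fun z : measurableTypeR R * rV => u z.1 z.2 ord0 i).
Hypothesis i2 : forall t, mc.-integrable setT (EFin \o (fun x => sqn (u t x))).
Hypothesis iN2 : leb.-integrable setT (EFin \o (fun t => \int[mc]_x sqn (u t x))).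

Let mi : measurable_fun setT (\1_(cell Omega) : rV -> R).
Proof. by apply: measurable_indic; exact: measurable_cell. Qed.

Let msq : measurable_fun setT (fun z : measurableTypeR R * rV => sqn (u z.1 z.2)).
Proof. by apply: measurable_sum => i; apply: measurable_funX; exact: mu_. Qed.

Variables (f : R * rV -> R) (g : R -> rV -> R) (psi : R -> R) (Th : rV -> R) (c C C' M : R).
Hypothesis mf : measurable_fun ([set` `]0, T[] `*` setT) (f : measurableTypeR R * rV -> R).
Hypothesis mg : measurable_fun setT (fun z : measurableTypeR R * rV => g z.1 z.2).
Hypothesis fg : forall t x, t \in G -> f (t, x) = g t x.
Hypothesis g0 : forall t x, t \notin G -> g t x = 0.
Hypothesis c0 : 0 <= c.
Hypothesis gb : forall t x, `|g t x| <= c + sqn (u t x).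
Hypothesis mpsi : measurable_fun setT psi.
Hypothesis C0 : 0 <= C.
Hypothesis psib : forall t, `|psi t| <= C * \1_([set` `]0, T[]) t.
Hypothesis mTh : measurable_fun setT Th.
Hypothesis C'0 : 0 <= C'.
Hypothesis Thb : forall x, x \in cell Omega -> `|Th x| <= C' * \1_(cball M) x.

Let H (z : measurableTypeR R * rV) := g z.1 z.2 * Th z.2 * \1_(cell Omega) z.2 * psi z.1.

Let mH : measurable_fun setT H.
Proof.
apply: measurable_funM; last exact: (measurableT_comp mpsi measurable_fst).
apply: measurable_funM; last exact: (measurableT_comp mi measurable_snd).
by apply: measurable_funM => //; exact: (measurableT_comp mTh measurable_snd).
Qed.

Let innerb t x : `|g t x * Th x * \1_(cell Omega) x| <=
  C' * (c * \1_(cball M) x + sqn (u t x) * \1_(cell Omega) x).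
Proof.
have [xc|xc] := boolP (x \in cell Omega); last first.
  by rewrite [\1_(cell Omega) x]indicE (negPf xc) !mulr0 normr0 addr0 !mulr_ge0// indicE.
rewrite [\1_(cell Omega) x]indicE xc !mulr1 normrM mulrC.
apply: (@le_trans _ _ ((C' * \1_(cball M) x) * (c + sqn (u t x)))); first by apply: ler_pM => //; exact: Thb.
rewrite -mulrA ler_wpM2l// mulrDr mulrC lerD2l ler_piMl ?sqn_ge0// indicE.
Qed.

Let i_inner t : mu.-integrable setT (EFin \o (fun x => g t x * Th x * \1_(cell Omega) x)).
Proof.
apply: integrable_dom (innerb t) _.
  by do 2! apply: measurable_funM => //; exact: (measurableT_comp mg (measurable_pair1 t)).
apply: integrable_scaleR; apply: integrable_addR; last exact: integrable_mc.
by apply: integrable_scaleR; exact: integrable_cball.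
Qed.

Let iH : (leb \x mu)%E.-integrable setT (EFin \o H).
Proof.
have [_ iT] := Rintegral_indic_itv T0.
have I1 := @integrable_prod _ _ (measurableTypeR R) rV R leb mu _ _ iT (integrable_cball M).
have I2 : (leb \x mu)%E.-integrable setT
    (EFin \o (fun z : measurableTypeR R * rV => sqn (u z.1 z.2) * \1_(cell Omega) z.2)).
  apply: (@integrable_tonelli _ _ (measurableTypeR R) rV R leb mu).
  - by apply: measurable_funM => //; exact: (measurableT_comp mi measurable_snd).
  - by move=> z; rewrite mulr_ge0 ?sqn_ge0// indicE.
  - by move=> t; exact: integrable_mc (i2 t).
  - move: iN2; congr (_.-integrable _ _); apply/funext => t /=; congr EFin.
    by rewrite integral_mc//; exact: integrable_mble (i2 t).
have I3 : (leb \x mu)%E.-integrable setT (EFin \o (fun z : measurableTypeR R * rV =>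
    C' * C * (c * ((\1_`]0, T[ z.1 : R) * \1_(cball M) z.2) + sqn (u z.1 z.2) * \1_(cell Omega) z.2))).
  by apply: integrable_scaleR; apply: integrable_addR => //; exact: integrable_scaleR.
apply: integrable_dom mH _ I3 => z; rewrite /H normrM.
apply: le_trans (ler_pM _ _ (innerb z.1 z.2) (psib z.1)) _ => //.
rewrite mulrACA -!mulrA ler_wpM2l// ler_wpM2l//.
have i01 : 0 <= (\1_`]0, T[ z.1 : R) <= 1 by rewrite indicE; case: (_ \in _); rewrite ?lexx ?ler01.
have /andP[i0 i1] := i01.
rewrite mulrDl mulrA mulrAC -mulrA lerD ?lexx//.
by rewrite ler_piMr// mulr_ge0 ?sqn_ge0// indicE.
Qed.

(** Fubini splits the space-time integral of [distr_of] into slices; replacing [f] by 0 at the times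
    outside [G] affects a null set of the product. *)
Lemma distr_of_slices :
  leb.-integrable setT (EFin \o (fun t => (\int[mc]_x (g t x * Th x)) * psi t)) /\
  distr_of Omega T f (fun z => psi z.1 * Th z.2) = \int[leb]_t ((\int[mc]_x (g t x * Th x)) * psi t).
Proof.
have E t : \int[mu]_x H (t, x) = (\int[mc]_x (g t x * Th x)) * psi t.
  rewrite /H /= RintegralZr//; congr (_ * _).
  rewrite integral_mc//; apply: measurable_funM => //.
  exact: (measurableT_comp mg (measurable_pair1 t)).
split.
  have := @integrable_Rintegral1 _ _ (measurableTypeR R) rV R leb mu H iH.
  by congr (_.-integrable _ _); apply/funext => t /=; rewrite E.
have -> : \int[leb]_t ((\int[mc]_x (g t x * Th x)) * psi t) = \int[leb]_t (\int[mu]_x H (t, x)).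
  by apply: eq_Rintegral => t _; rewrite E.
rewrite (@Rintegral12 _ _ (measurableTypeR R) rV R leb mu H iH).
rewrite /distr_of Rintegral_mkcond.
have mT : measurable [set` `]0, T[] by exact: measurable_itv.
have mTc : measurable ([set` `]0, T[] `*` @cell R d Omega : set (measurableTypeR R * rV)).
  by apply: measurableX => //; exact: measurable_cell.
apply: (@ae_eq_Rintegral _ (measurableTypeR R * rV)%type R (leb \x mu)%E).
- apply/(measurable_restrictT _ mTc); apply: measurable_funM.
    by apply: measurable_funS mf => //; [exact: measurableX | move=> z [? _]; split].
  apply: measurable_funTS; apply: measurable_funM.
    exact: (measurableT_comp mpsi measurable_fst).
  exact: (measurableT_comp mTh measurable_snd).
- exact: mH.
- exists (([set` `]0, T[] `\` G) `*` setT); split.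
  + by apply: measurableX => //; exact: measurableD.
  + have := @product_measure1E _ _ (measurableTypeR R) rV R leb mu _ _ (measurableD mT mG) measurableT.
    move=> P; apply: (etrans P).
    exact: (etrans (congr1 (fun x => x * mu setT)%E nG) (mul0e _)).
  + move=> z; apply: contra_notP => /= nz; rewrite patchE /H.
    have [zG|zG] := boolP (z.1 \in G); last first.
      rewrite g0// !mul0r; case: ifP => //; rewrite inE => -[zT _]; exfalso.
      by apply: nz; split => //; split => // zG'; move/negP: zG; apply; rewrite inE.
    rewrite indicE; case: ifP => [/set_mem[_ zc]|/negP nz'].
      rewrite mem_set//= mulr1 -fg// -surjective_pairing.
      by rewrite -[in RHS]mulrA [Th _ * _]mulrC.
    rewrite memNset ?mulr0 ?mul0r// => zc; apply: nz'; rewrite inE; split => //.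
    by apply: GT; rewrite inE in zG.
Qed.

End slicing.

(** * The normalised solution *)

Section reduction.
Context {R : realType} {d : nat} (Omega : spatial_domain) (T : R).
Variables (v : R -> 'rV[R]_d -> 'rV[R]_d) (G : set R).
Notation rV := 'rV[R]_d.
Notation mu := (@lebesgue_rV R d).
Notation mc := (@cell_measure R d Omega).
Notation leb := (@lebesgue_measure R).
Notation e_ i := (delta_mx ord0 i : rV).
Notation u := (masked v G).
Notation U := (vel u).
Notation UU := (velM u).
Notation admissible := (@admissible R d Omega).

Hypothesis T0 : 0 < T.
Hypothesis mG : measurable G.
Hypothesis GT : G `<=` [set` `]0, T[].
Hypothesis nG : leb ([set` `]0, T[] `\` G) = 0%E.
Hypothesis pv : forall t, 0 < t < T -> function_on Omega (v t).
Hypothesis mv : measurable_fun ([set` `]0, T[] `*` setT)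
        (fun z : R * 'rV[R]_d => v z.1 z.2 : 'rV[R]_d).
Hypothesis we : weak_euler Omega T v.
Hypothesis i2 : forall t, mc.-integrable setT (EFin \o (fun x => sqn (u t x))).
Hypothesis i3 : forall t, mc.-integrable setT (EFin \o (fun x => euclid (u t x) ^+ 3)).
Hypothesis iN2 : leb.-integrable setT (EFin \o nrm2 Omega u).
Hypothesis iN3 : leb.-integrable setT (EFin \o nrm3 Omega u).

Lemma masked_in t : t \in G -> u t = v t. Proof. by rewrite /masked => ->. Qed.
Lemma masked_out t : t \notin G -> u t = fun=> 0. Proof. by rewrite /masked => /negPf ->. Qed.

Let mvi i : measurable_fun ([set` `]0, T[] `*` setT)
  ((fun z => v z.1 z.2 ord0 i) : measurableTypeR R * rV -> R).
Proof. exact: (measurableT_comp (measurable_coord i) mv). Qed.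

Lemma measurable_masked i : measurable_fun setT (fun z : measurableTypeR R * rV => U i z.1 z.2).
Proof.
have mGT : measurable (G `*` setT : set (measurableTypeR R * rV)) by exact: measurableX.
rewrite (_ : (fun _ => _) = ((fun z => v z.1 z.2 ord0 i) \_ (G `*` setT))).
  apply/(measurable_restrictT _ mGT); apply: measurable_funS (mvi i) => //.
    by apply: measurableX => //; exact: measurable_itv.
  by move=> z [zG _]; split => //; exact: GT.
apply/funext => z; rewrite patchE /vel; have [zG|zG] := boolP (z.1 \in G).
  by rewrite masked_in// mem_set//; split => //; rewrite inE in zG.
by rewrite masked_out// memNset ?mxE// => -[zG' _]; move/negP: zG; apply; rewrite inE.
Qed.

Let mU := measurable_masked.
Let mUU i k : measurable_fun setT (fun z : measurableTypeR R * rV => UU i k z.1 z.2).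
Proof. by apply: measurable_funM; exact: mU. Qed.

Let test_ind psi : test_function_line `]0, T[ psi -> measurable_fun setT psi /\
  exists2 C : R, 0 <= C & forall t, `|psi t| <= C * \1_([set` `]0, T[]) t.
Proof.
move=> tp; have [mp [C C0 HC]] := test_bounded T0 tp; split => //; exists C => // t.
rewrite indicE; have [tT|tT] := boolP (t \in [set` `]0, T[]); first by rewrite mulr1.
rewrite (test_out tp) ?normr0 ?mulr0//; apply/negP => tT'; move/negP: tT; apply.
by rewrite inE /= in_itv.
Qed.

Let slU i psi Th : test_function_line `]0, T[ psi -> admissible Th ->
  leb.-integrable setT (EFin \o (fun t => (\int[mc]_x (U i t x * Th x)) * psi t)) /\
  distr_of Omega T (fun z => v z.1 z.2 ord0 i) (fun z => psi z.1 * Th z.2) =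
    \int[leb]_t ((\int[mc]_x (U i t x * Th x)) * psi t).
Proof.
move=> tp oT; have [mp [C C0 pC]] := test_ind tp; have [mT [C' [M [C'0 TC]]]] := admissible_bound oT.
apply: (distr_of_slices T0 mG GT nG mU i2 iN2 (mvi i) (mU i) _ _ ler01 _ mp C0 pC mT C'0 TC).
- by move=> t x tG; rewrite /vel masked_in.
- by move=> t x tG; rewrite /vel masked_out// mxE.
- by move=> t x; exact: U_le.
Qed.

Let slUU i k psi Th : test_function_line `]0, T[ psi -> admissible Th ->
  leb.-integrable setT (EFin \o (fun t => (\int[mc]_x (UU i k t x * Th x)) * psi t)) /\
  distr_of Omega T (fun z => v z.1 z.2 ord0 i * v z.1 z.2 ord0 k) (fun z => psi z.1 * Th z.2) =
    \int[leb]_t ((\int[mc]_x (UU i k t x * Th x)) * psi t).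
Proof.
move=> tp oT; have [mp [C C0 pC]] := test_ind tp; have [mT [C' [M [C'0 TC]]]] := admissible_bound oT.
apply: (distr_of_slices T0 mG GT nG mU i2 iN2 _ (mUU i k) _ _ (lexx 0) _ mp C0 pC mT C'0 TC).
- by apply: measurable_funM; exact: mvi.
- by move=> t x tG; rewrite /velM /vel masked_in.
- by move=> t x tG; rewrite /velM /vel masked_out// mxE mul0r.
- by move=> t x; rewrite add0r; exact: UU_le.
Qed.

Let Rsum (I : finType) (F : I -> R -> R) :
  (forall i, leb.-integrable setT (EFin \o F i)) ->
  \int[leb]_t (\sum_i F i t) = \sum_i \int[leb]_t F i t.
Proof. exact: (@Rintegral_sum _ (measurableTypeR R) R leb). Qed.

Let isum (I : finType) (F : I -> R -> R) :
  (forall i, leb.-integrable setT (EFin \o F i)) ->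
  leb.-integrable setT (EFin \o (fun t => \sum_i F i t)).
Proof. exact: (@integrable_sumR _ (measurableTypeR R) R leb). Qed.

(** The equations for the components are added. The pressure is then tested with a field of zero
    divergence, and [pressure_sum] removes it. *)
Lemma weak_masked (Th : 'I_d -> rV -> R) psi : (forall i, admissible (Th i)) ->
  (forall x, \sum_i 'D_(e_ i) (Th i) x = 0) -> test_function_line `]0, T[ psi ->
  \int[leb]_t ((\sum_i \int[mc]_x (U i t x * Th i x)) * 'D_1 psi t) =
  - \int[leb]_t ((\sum_i \sum_k \int[mc]_x (UU i k t x * 'D_(e_ k) (Th i) x)) * psi t).
Proof.
move=> oT T_div tp; have tp' := test_derive tp; have [[pi dpi HW] _] := we.
have oD i k := admissible_derive k (oT i).
have SU i := slU i tp' (oT i); have SV i k := slUU i k tp (oD i k).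
under eq_Rintegral => t _ do rewrite mulr_suml.
rewrite Rsum; last by move=> i; case: (SU i).
under [X in _ = - X]eq_Rintegral => t _.
  rewrite mulr_suml; under eq_bigr => i _ do rewrite mulr_suml; over.
rewrite Rsum; last by move=> i; apply: isum => k; case: (SV i k).
apply/eqP; rewrite -subr_eq0 opprK -big_split /=; apply/eqP.
transitivity (- \sum_i pi (fun z => psi z.1 * 'D_(e_ i) (Th i) z.2)); last first.
  by rewrite (pressure_sum T0 dpi tp (fun i => oD i i) T_div) oppr0.
rewrite -sumrN.
apply: eq_bigr => i _.
rewrite Rsum; last by move=> k; case: (SV i k).
have sp : smooth psi by case: tp.
have sT k : smooth (Th k) by case: (oT k).
have := HW i _ (test_prod T0 tp (oT i)); rewrite /distr_deriv.
rewrite (funext (fun z => derive_prod_t (Th i) z sp)) (SU i).2.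
under eq_bigr => k _ do rewrite (funext (fun z => derive_prod_x psi k z (sT i))) (SV i k).2.
rewrite (funext (fun z => derive_prod_x psi i z (sT i))) sumrN.
by move: (\int[_]_t _) (\sum_k _) (pi _) => x y z; lra.
Qed.

Lemma div_masked (Th : rV -> R) psi : admissible Th -> test_function_line `]0, T[ psi ->
  \int[leb]_t ((\sum_k \int[mc]_x (U k t x * 'D_(e_ k) Th x)) * psi t) = 0.
Proof.
move=> oT tp; have [_ HD] := we; have oD k := admissible_derive k oT.
have SU i := slU i tp (oD i); have sT : smooth Th by case: oT.
under eq_Rintegral => t _ do rewrite mulr_suml.
rewrite Rsum; last by move=> i; case: (SU i).
have := HD _ (test_prod T0 tp oT); rewrite /distr_deriv.
under eq_bigr => k _ do rewrite (funext (fun z => derive_prod_x psi k z sT)) (SU k).2.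
by rewrite sumrN => /eqP; rewrite oppr_eq0 => /eqP.
Qed.

(** A constant field is an admissible test field on the torus and has no derivatives, so the mean
    velocity is constant in time in the weak sense. *)
Lemma mean_masked i psi : Omega = Torus -> test_function_line `]0, T[ psi ->
  \int[leb]_t ((\int[mc]_x U i t x) * 'D_1 psi t) = 0.
Proof.
move=> OT tp.
have oc j : admissible (fun=> (i == j)%:R).
  by split; [exact: smooth_cst | | exists 0; rewrite OT].
have D0 j k (x : rV) : 'D_(e_ k) (fun=> (i == j)%:R : R) x = 0 by rewrite derive_cst.
have TD x : \sum_j 'D_(e_ j) (fun=> (i == j)%:R : R) x = 0 by rewrite big1.
have := weak_masked oc TD tp.
rewrite [X in - X](_ : _ = 0); last first.
  rewrite -[RHS](@Rintegral0 _ (measurableTypeR R) R leb); apply: eq_Rintegral => t _.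
  rewrite big1 ?mul0r// => j _; rewrite big1// => k _.
  under eq_Rintegral => x _ do rewrite D0 mulr0.
  exact: Rintegral0.
rewrite oppr0 => <-; apply: eq_Rintegral => t _; congr (_ * _).
rewrite (bigD1 i)//= big1 ?addr0; first by under [RHS]eq_Rintegral => x _ do rewrite eqxx mulr1.
move=> j ji; under eq_Rintegral => x _ do rewrite eq_sym (negPf ji) mulr0.
exact: Rintegral0.
Qed.

Lemma masked_periodic t : function_on Omega (u t).
Proof.
have [tG|tG] := boolP (t \in G); last by rewrite masked_out.
rewrite masked_in//; apply: pv; rewrite inE in tG; have := GT tG.
by rewrite /= in_itv.
Qed.

Lemma flow_masked : flow Omega T u.
Proof.
have pU i t : function_on Omega (U i t) by move=> OT x j; rewrite /vel (masked_periodic _ OT).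
have pUU i k t : function_on Omega (UU i k t) by move=> OT x j; rewrite /velM !pU.
have mUt i t : measurable_fun setT (U i t) := measurableT_comp (mU i) (measurable_pair1 t).
have mUUt i k t : measurable_fun setT (UU i k t) := measurableT_comp (mUU i k) (measurable_pair1 t).
have psq t : function_on Omega (fun x => sqn (u t x)) by move=> OT x j; rewrite (masked_periodic _ OT).
have unU i t k Phi : csmooth Phi ->
    \int[mc]_x (U i t x * to_domain Omega Phi x) = \int[mu]_x (U i t x * Phi x) /\
    \int[mc]_x (UU i k t x * to_domain Omega Phi x) = \int[mu]_x (UU i k t x * Phi x).
  move=> bP; have [C C0 HC] := cv_bound Omega (kern_csmooth bP).
  have sq0 x : 0 <= sqn (u t x) by exact: sqn_ge0.
  have [I1 _] := HC _ _ 1 (mUt i t) ler01 sq0 (psq t) (i2 t) (fun x => U_le _ _ _ _) 0.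
  have UU0 x : `|UU i k t x| <= 0 + sqn (u t x) by rewrite add0r UU_le.
  have [I2 _] := HC _ _ 0 (mUUt i k t) (lexx 0) sq0 (psq t) (i2 t) UU0 0.
  split; apply: Pe_unfold => //.
    by move: I1; congr (_.-integrable _ _); apply/funext => x /=; rewrite add0r.
  by move: I2; congr (_.-integrable _ _); apply/funext => x /=; rewrite add0r.
split => //.
- move=> t tT; apply: masked_out; apply/negP => tG; move/negP: tT; apply.
  by rewrite inE in tG; have := GT tG; rewrite /= in_itv.
- exact: masked_periodic.
- move=> Phi bP P_div psi tp; have oP i := admissible_to_domain Omega (bP i).
  have P_div' x : \sum_i 'D_(e_ i) (to_domain Omega (Phi i)) x = 0.
    under eq_bigr => i _ do rewrite derive_to_domain//.
    rewrite /to_domain; case: Omega => //.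
    have /choice[M HM] i : exists M, forall y : rV, M < `|y| -> dx i (Phi i) y = 0.
      by have [_ H] := csmooth_dx i (bP i).
    (* A common radius for all the components, so that the periodizations are sums over the same box
       and the sums over components and translates can be exchanged. *)
    pose N := \sum_i `|M i|; pose k := (Num.truncn (N + `|x|)).+1.
    have Nk : N + `|x| <= k%:R by exact/ltW/truncnS_gt.
    have HN i y : N < `|y| -> dx i (Phi i) y = 0.
      move=> Ny; apply: HM; apply: le_lt_trans Ny; apply: le_trans (ler_norm _) _.
      by rewrite /N (bigD1 i)//= lerDl sumr_ge0.
    under eq_bigr => i _ do rewrite (perE (HN i) Nk (lexx _)).
    by rewrite exchange_big big1//= => n _; exact: P_div.
  have := weak_masked oP P_div' tp.
  under eq_Rintegral => t _ do (under eq_bigr => i _ do rewrite (unU i t i (Phi i) (bP i)).1).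
  move=> ->; congr (- _); apply: eq_Rintegral => t _; congr (_ * _).
  apply: eq_bigr => i _; apply: eq_bigr => k _.
  by under eq_Rintegral => x _ do rewrite derive_to_domain//; rewrite (unU i t k _ (csmooth_dx k (bP i))).2.
- move=> Phi bP psi tp; have := div_masked (admissible_to_domain Omega bP) tp.
  move=> E; rewrite -[RHS]E; apply: eq_Rintegral => t _; congr (_ * _); apply: eq_bigr => k _.
  by under [RHS]eq_Rintegral => x _ do rewrite derive_to_domain//; rewrite (unU k t k _ (csmooth_dx k bP)).1.
Qed.

End reduction.

(** * Besov slices *)

Section besov.
Context {R : realType} {d : nat} (Omega : spatial_domain).
Notation rV := 'rV[R]_d.
Notation mu := (@lebesgue_rV R d).
Notation mc := (@cell_measure R d Omega).
Implicit Types (f : rV -> rV).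

Lemma Lq_norm_ge0 q f : (0 <= Lq_norm Omega q f)%E.
Proof. exact: Lnorm_ge0. Qed.

Lemma Lq_norm_le (q : nat) f (c : R) : (0 < q)%N ->
  (forall i, measurable_fun setT (fun x => f x ord0 i)) -> 0 <= c ->
  (Lq_norm Omega (q%:R)%:E f <= c%:E)%E ->
  mc.-integrable setT (EFin \o (fun x => euclid (f x) ^+ q)) /\
  \int[mc]_x euclid (f x) ^+ q <= c ^+ q.
Proof.
move=> q0 mf c0 fc; have q0' : (q%:R : R) != 0 by rewrite pnatr_eq0 -lt0n.
have me : measurable_fun setT (fun x => euclid (f x) ^+ q).
  by apply: measurable_funX; exact: measurable_euclid.
have mE : measurable_fun setT (EFin \o (fun x => euclid (f x) ^+ q)) by exact/measurable_EFinP.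
have e0 x : 0 <= euclid (f x) ^+ q by rewrite exprn_ge0 ?euclid_ge0.
have H : (\int[mc]_x (euclid (f x) ^+ q)%:E <= (c ^+ q)%:E)%E.
  have -> : (\int[mc]_x (euclid (f x) ^+ q)%:E = Lq_norm Omega (q%:R)%:E f `^ q%:R)%E.
    rewrite /Lq_norm poweR_Lnorm// ge0_integral_cellE// (integral_mkcond (cell Omega)).
    apply: eq_integral => x _; rewrite !patchE; case: ifP => _ /=.
      by rewrite ger0_norm ?euclid_ge0// powR_mulrn ?euclid_ge0.
    by rewrite normr0 powR0.
  rewrite -powR_mulrn// -poweR_EFin.
  by apply: gt0_ler_poweR => //; rewrite in_itv/= ?leey ?andbT ?Lq_norm_ge0 ?lee_fin.
have iF : mc.-integrable setT (EFin \o (fun x => euclid (f x) ^+ q)).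
  apply/integrableP; split => //; apply: le_lt_trans (ltry (c ^+ q)); apply: le_trans H.
  by under eq_integral => x _ do rewrite /= ger0_norm//.
by split => //; rewrite -lee_fin /Rintegral fineK//; exact: integrable_fin_num.
Qed.

Lemma besov_le (q : nat) (s : R) f : (0 < q)%N -> (0 < d)%N ->
  (forall i, measurable_fun setT (fun x => f x ord0 i)) ->
  (besov_norm Omega s (q%:R)%:E f < +oo)%E ->
  let b := fine (besov_norm Omega s (q%:R)%:E f) in
  [/\ 0 <= b, mc.-integrable setT (EFin \o (fun x => euclid (f x) ^+ q)),
      \int[mc]_x euclid (f x) ^+ q <= b ^+ q &
      forall h, mc.-integrable setT (EFin \o (fun x => euclid (f (x + h) - f x) ^+ q)) /\
        \int[mc]_x euclid (f (x + h) - f x) ^+ q <= b ^+ q * euclid h `^ (q%:R * s)].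
Proof.
move=> q0 d0 mf Boo b.
have L0 := Lq_norm_ge0 (q%:R)%:E f.
have sup_ub h : h != 0 -> (Lq_norm Omega (q%:R)%:E (fun x => (f (x + h) - f x)%R) *
    ((euclid h `^ s)^-1)%:E <= besov_seminorm Omega s (q%:R)%:E f)%E.
  by move=> h0; apply: ereal_sup_ubound; exists h.
(* The supremum runs over nonzero increments; a positive dimension guarantees that there is one, as
   the supremum of the empty set is -oo. *)
have S0 : (0 <= besov_seminorm Omega s (q%:R)%:E f)%E.
  have h0 : delta_mx ord0 (Ordinal d0) != 0 :> rV.
    apply/eqP => /rowP/(_ (Ordinal d0)); rewrite !mxE !eqxx => /eqP.
    by rewrite oner_eq0.
  apply: le_trans (sup_ub _ h0); apply: mule_ge0; first exact: Lq_norm_ge0.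
  by rewrite lee_fin invr_ge0 powR_ge0.
have BE : besov_norm Omega s (q%:R)%:E f = b%:E.
  by rewrite /b fineK// ge0_fin_numE// adde_ge0.
have b0 : 0 <= b by rewrite -lee_fin -BE adde_ge0.
have Lb : (Lq_norm Omega (q%:R)%:E f <= b%:E)%E by rewrite -BE leeDl.
have Sb : (besov_seminorm Omega s (q%:R)%:E f <= b%:E)%E by rewrite -BE leeDr.
have [I1 B1] := Lq_norm_le q0 mf b0 Lb.
(* The seminorm says nothing about h = 0, where the increment vanishes identically. *)
split => // h; have [->|h0] := eqVneq h 0.
  have E x : euclid (f (x + 0) - f x) ^+ q = 0.
    rewrite addr0 subrr /euclid (eq_bigr (fun=> 0)) ?big1// ?sqrtr0 ?expr0n ?gtn_eqF//.
    by move=> i _; rewrite mxE expr0n.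
  split.
    by rewrite (_ : _ \o _ = cst 0%E); [exact: integrable0 | apply/funext => x /=; rewrite E].
  under eq_Rintegral => x _ do rewrite E.
  by rewrite Rintegral0 mulr_ge0 ?exprn_ge0 ?powR_ge0.
have eh : 0 < euclid h.
  rewrite lt0r euclid_ge0 andbT; apply: contra h0 => /eqP e0; apply/eqP/rowP => i; rewrite mxE.
  by apply/eqP; rewrite -normr_eq0 eq_le normr_ge0 andbT -e0 coord_euclid.
have ps : 0 < euclid h `^ s by exact: powR_gt0.
have mfh i : measurable_fun setT (fun x : rV => (f (x + h) - f x) ord0 i).
  under eq_fun do rewrite !mxE; apply: measurable_funB => //.
  by apply: (measurableT_comp (mf i)); apply: measurable_shift_rV.
have c0 : 0 <= b * euclid h `^ s by rewrite mulr_ge0 ?powR_ge0.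
have Lh : (Lq_norm Omega (q%:R)%:E (fun x => (f (x + h) - f x)%R) <= (b * euclid h `^ s)%:E)%E.
  have := le_trans (sup_ub h h0) Sb; rewrite EFinM.
  by rewrite lee_pdivrMr.
have [I2 B2] := Lq_norm_le q0 mfh c0 Lh; split => //; apply: le_trans B2 _.
by rewrite exprMn -[X in _ * X <= _]powR_mulrn ?powR_ge0// -powRrM mulrC [s * _]mulrC mulrC.
Qed.

End besov.

(** * Integrability in time *)

Section time.
Context {R : realType}.
Notation leb := (@lebesgue_measure R).

(** A function with finite p-th moment is finite almost everywhere; [G] is the set of times where
    this happens, and elsewhere [fine] gives 0, which leaves the moment of [b] finite. *)
Lemma Lp_time (T p : R) (B : R -> \bar R) : 0 < p ->
  measurable_fun [set` `]0, T[] B -> (forall t, 0 < t < T -> (0 <= B t)%E) ->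
  (Lnorm leb p%:E (B \_ `]0%R, T[) < +oo)%E ->
  let b t := if (0 < t < T) then fine (B t) else 0 in
  [/\ forall t, 0 <= b t, measurable_fun setT b,
      leb.-integrable setT (EFin \o (fun t => b t `^ p)) &
      exists G, [/\ measurable G, G `<=` [set` `]0, T[],
        leb ([set` `]0, T[] `\` G) = 0%E & forall t, G t -> (B t < +oo)%E]].
Proof.
move=> p0 mB B0 Lf b; have p0' : p != 0 by rewrite gt_eqF.
have mT : measurable [set` `]0, T[] by exact: measurable_itv.
have mP : measurable_fun setT (B \_ `]0%R, T[) by exact/(measurable_restrictT _ mT).
have PE t : (B \_ `]0%R, T[) t = if 0 < t < T then B t else 0%E.
  by rewrite patchE mem_setE in_itv.
have bE t : b t = fine ((B \_ `]0%R, T[) t) by rewrite PE /b; case: ifP.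
have b0 t : 0 <= b t by rewrite /b; case: ifP => // /B0 ?; exact: fine_ge0.
have mb : measurable_fun setT b.
  by rewrite (funext bE); exact: measurableT_comp.
have fin : (\int[leb]_t (`|(B \_ `]0%R, T[) t| `^ p) < +oo)%E.
  by rewrite -poweR_Lnorm// poweR_lty.
have mpw : measurable_fun setT (fun t => (`|(B \_ `]0%R, T[) t| `^ p)%E).
  by apply: (measurableT_comp (measurable_poweR p)); exact: measurableT_comp.
have iP : leb.-integrable setT (fun t => (`|(B \_ `]0%R, T[) t| `^ p)%E).
  apply/integrableP; split => //; move: fin; congr (_ < _)%E; apply: eq_integral => t _.
  by rewrite [RHS]gee0_abs ?poweR_ge0.
split => //.
- apply: (@le_integrable _ (measurableTypeR R) R leb setT measurableT _ _ _ _ iP).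
    by apply/measurable_EFinP; apply: (measurableT_comp (measurable_powR p)).
  move=> t _ /=; rewrite ger0_norm ?powR_ge0// bE.
  rewrite PE; case: ifP => [tT|_]; last by rewrite [fine _]/= powR0// abse_ge0.
  have := B0 _ tT; case: (B t) => [r|//|//]; last by rewrite [fine _]/= powR0// abse_ge0.
  by rewrite lee_fin => r0; rewrite /= ger0_norm// ger0_norm ?powR_ge0.
- exists ([set` `]0, T[] `&` [set t | (B t < +oo)%E]); split.
  + exact: emeasurable_fun_infty_o.
  + by move=> t [].
  + have /integrable_ae := iP => /(_ measurableT) [N [mN N0 sN]].
    apply/eqP; rewrite eq_le measure_ge0 andbT -N0; apply: le_measure; rewrite ?inE//.
      by apply: measurableD => //; exact: emeasurable_fun_infty_o.
    move=> t [tT Bt]; apply: sN => /(_ I); rewrite PE; move: tT; rewrite /= in_itv /= => tT; rewrite tT.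
    have := B0 _ tT; case E : (B t) => [r| |] // _; last by rewrite poweRyr.
    by move=> _; apply: Bt; rewrite /= in_itv /= tT E ltry.
  + by move=> t [].
Qed.

End time.

(* [b3] and [b2] play the roles of the cube of the B^th_{3,oo} seminorm and the
   square of the B^be_{2,oo} one, and [q] that of p / 3. *)
Record besov_flow (R : realType) (d : nat) (Omega : spatial_domain) (T th be q : R)
    (u : R -> 'rV[R]_d -> 'rV[R]_d) (b3 b2 : R -> R) : Prop := BesovFlow {
  bf_flow : flow Omega T u;
  bf_mean : Omega = Torus -> forall i psi, test_function_line `]0, T[ psi ->
    \int[@lebesgue_measure R]_t ((\int[@cell_measure R d Omega]_x vel u i t x) * 'D_1 psi t) = 0;
  bf_b3 : forall t, 0 <= b3 t;
  bf_b2 : forall t, 0 <= b2 t;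
  bf_i3q : (@lebesgue_measure R).-integrable setT (EFin \o (fun t => b3 t `^ q));
  bf_i2q : (@lebesgue_measure R).-integrable setT (EFin \o (fun t => b2 t `^ q));
  bf_i3 : (@lebesgue_measure R).-integrable setT (EFin \o b3);
  bf_i2 : (@lebesgue_measure R).-integrable setT (EFin \o b2);
  bf_d3 : forall t h,
    (@cell_measure R d Omega).-integrable setT (EFin \o (fun x => euclid (incr u t (x, h)) ^+ 3)) /\
    \int[@cell_measure R d Omega]_x euclid (incr u t (x, h)) ^+ 3 <= b3 t * euclid h `^ (3 * th);
  bf_d2 : forall t h,
    (@cell_measure R d Omega).-integrable setT (EFin \o (fun x => sqn (incr u t (x, h)))) /\
    \int[@cell_measure R d Omega]_x sqn (incr u t (x, h)) <= b2 t * euclid h `^ (2 * be) }.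

Section reduction.
Context {R : realType} {d : nat} (Omega : spatial_domain) (T p th be : R).
Variable v : R -> 'rV[R]_d -> 'rV[R]_d.
Notation rV := 'rV[R]_d.
Notation mu := (@lebesgue_rV R d).
Notation mc := (@cell_measure R d Omega).
Notation leb := (@lebesgue_measure R).
Hypotheses (d0 : (0 < d)%N) (T0 : 0 < T) (p3 : 3 <= p).
Hypothesis (pv : forall t, 0 < t < T -> function_on Omega (v t)).
Hypothesis (mv : measurable_fun ([set` `]0, T[] `*` setT)
        (fun z : R * rV => v z.1 z.2 : rV)).
Hypothesis (we : weak_euler Omega T v).

Definition besov_bound (q : nat) (s : R) (f : rV -> rV) (b : R) : Prop :=
  [/\ 0 <= b, mc.-integrable setT (EFin \o (fun x => euclid (f x) ^+ q)),
      \int[mc]_x euclid (f x) ^+ q <= b ^+ q &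
      forall h, mc.-integrable setT (EFin \o (fun x => euclid (f (x + h) - f x) ^+ q)) /\
        \int[mc]_x euclid (f (x + h) - f x) ^+ q <= b ^+ q * euclid h `^ (q%:R * s)].

Variables B3 B2 : R -> \bar R.
Hypothesis B30 : forall t, 0 < t < T -> (0 <= B3 t)%E.
Hypothesis B20 : forall t, 0 < t < T -> (0 <= B2 t)%E.
Hypothesis mB3 : measurable_fun [set` `]0, T[] B3.
Hypothesis mB2 : measurable_fun [set` `]0, T[] B2.
Hypothesis L3 : (Lnorm leb p%:E (B3 \_ `]0%R, T[) < +oo)%E.
Hypothesis L2 : (Lnorm leb (2 * p / 3)%:E (B2 \_ `]0%R, T[) < +oo)%E.
Hypothesis V3 : forall t, 0 < t < T -> (B3 t < +oo)%E -> besov_bound 3 th (v t) (fine (B3 t)).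
Hypothesis V2 : forall t, 0 < t < T -> (B2 t < +oo)%E -> besov_bound 2 be (v t) (fine (B2 t)).

Let besov_bound0 q s : (0 < q)%N -> besov_bound q s (fun=> 0) 0.
Proof.
move=> q0; have E : (fun x : rV => euclid (0 : rV) ^+ q) = fun=> 0.
  apply/funext => x; rewrite /euclid big1 ?sqrtr0 ?expr0n ?gtn_eqF// => i _.
  by rewrite mxE expr0n.
split => // [||h].
- by rewrite E; exact: integrable0.
- by rewrite E Rintegral0 expr0n gtn_eqF.
- by rewrite subr0 E Rintegral0 expr0n gtn_eqF// mul0r; split => //; exact: integrable0.
Qed.

Let pow_le (y : R) : 0 <= y -> y <= 1 + y `^ (p / 3).
Proof.
move=> y0; have p3' := p3; have [y1|y1] := leP y 1; first by have := powR_ge0 y (p / 3); lra.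
have : y `^ 1 <= y `^ (p / 3) by rewrite ler_powR//; [exact: ltW | lra].
by rewrite powRr1//; lra.
Qed.

(** Used with (n, r) = (3, p) and (2, 2p/3): with these time exponents the cube of the first norm
    and the square of the second lie in the same L^(p/3), hence also in L^1 on the bounded interval
    since p >= 3. *)
Let int_pow (G : set R) (F : R -> R) (n : nat) (r : R) : measurable G -> G `<=` [set` `]0, T[] ->
  (0 < n)%N -> n%:R * (p / 3) = r -> (forall t, 0 <= F t) ->
  measurable_fun setT F -> leb.-integrable setT (EFin \o (fun t => F t `^ r)) ->
  let c t := F t * \1_G t in
  [/\ leb.-integrable setT (EFin \o (fun t => (c t ^+ n) `^ (p / 3))) &
      leb.-integrable setT (EFin \o (fun t => c t ^+ n))].
Proof.
move=> mG GT n0 nr F0 mF iF c; have p3' := p3; have r0 : 0 < r.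
  by rewrite -nr mulr_gt0 ?ltr0n//; lra.
have c0 t : 0 <= c t by rewrite mulr_ge0// indicE.
have mn : measurable_fun setT (fun t => c t ^+ n).
  by apply: measurable_funX; apply: measurable_funM => //; exact: measurable_indic.
have i1 : leb.-integrable setT (EFin \o (fun t => (c t ^+ n) `^ (p / 3))).
  apply: integrable_domR iF; first exact: (measurableT_comp (measurable_powR _) mn).
  move=> t; rewrite ger0_norm ?powR_ge0// -powR_mulrn// -powRrM nr /c indicE.
  by case: (_ \in _); rewrite ?mulr1// mulr0 powR0 ?powR_ge0// gt_eqF.
have [_ iT] := Rintegral_indic_itv T0.
split => //.
apply: integrable_domR mn _ (@integrable_addR _ (measurableTypeR R) R leb _ _ iT i1) => t.
rewrite ger0_norm ?exprn_ge0// indicE.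
have [tT|tT] := boolP (t \in [set` `]0, T[]); first by apply: pow_le; rewrite exprn_ge0.
rewrite [c t](_ : _ = 0) ?expr0n ?gtn_eqF// ?add0r ?powR_ge0//.
rewrite /c indicE memNset ?mulr0// => /GT tT'; move/negP: tT; apply.
by rewrite inE.
Qed.

Lemma masked_besov : exists u b3 b2, besov_flow Omega T th be (p / 3) u b3 b2 /\
  {ae leb, forall t, 0 < t < T -> u t = v t}.
Proof.
have p3' := p3; have p0 : 0 < p by lra.
have p20 : 0 < 2 * p / 3 by lra.
have [f30 mf3 if3 [G3 [mG3 G3T nG3 G3f]]] := Lp_time p0 mB3 B30 L3.
have [f20 mf2 if2 [G2 [mG2 G2T nG2 G2f]]] := Lp_time p20 mB2 B20 L2.
have mG : measurable (G3 `&` G2) by exact: measurableI.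
have GT : (G3 `&` G2) `<=` [set` `]0, T[] by move=> t [/G3T].
have mT : measurable [set` `]0, T[] by exact: measurable_itv.
have nG : leb ([set` `]0, T[] `\` (G3 `&` G2)) = 0%E.
  by rewrite setDIr measureU0//; exact: measurableD.
have fin t : t \in G3 `&` G2 -> [/\ 0 < t < T, (B3 t < +oo)%E & (B2 t < +oo)%E].
  rewrite inE => tG; have := GT _ tG; rewrite /= in_itv /= => tT.
  by case: tG => /G3f ? /G2f ?; split.
move: (G3 `&` G2) mG GT nG fin => G mG GT nG fin {G3 G2 mG3 mG2 nG3 nG2 G3f G2f G3T G2T}.
pose u := masked v G.
pose F3 t := if 0 < t < T then fine (B3 t) else 0.
pose F2 t := if 0 < t < T then fine (B2 t) else 0.
pose c3 t := F3 t * \1_G t; pose c2 t := F2 t * \1_G t.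
have e3 : 3%:R * (p / 3) = p by field.
have e2 : 2%:R * (p / 3) = 2 * p / 3 by field.
have [i3q i3] := int_pow mG GT (isT : (0 < 3)%N) e3 f30 mf3 if3.
have [i2q i2] := int_pow mG GT (isT : (0 < 2)%N) e2 f20 mf2 if2.
have S3 t : besov_bound 3 th (u t) (c3 t).
  rewrite /u /masked /c3 /F3 indicE; case: ifPn => tG; last by rewrite mulr0; exact: besov_bound0.
  by have [tT ? _] := fin t tG; rewrite tT mulr1; exact: V3.
have S2 t : besov_bound 2 be (u t) (c2 t).
  rewrite /u /masked /c2 /F2 indicE; case: ifPn => tG; last by rewrite mulr0; exact: besov_bound0.
  by have [tT _ ?] := fin t tG; rewrite tT mulr1; exact: V2.
have E2 (f : rV -> rV) : (fun x => euclid (f x) ^+ 2) = fun x => sqn (f x).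
  by apply/funext => x; rewrite euclid2.
have j2 t : mc.-integrable setT (EFin \o (fun x => sqn (u t x))).
  by have [_ + _ _] := S2 t; rewrite E2.
have j3 t : mc.-integrable setT (EFin \o (fun x => euclid (u t x) ^+ 3)) by case: (S3 t).
have mU := measurable_masked mG GT mv.
have mu2 : measurable_fun setT (nrm2 Omega u).
  apply: (@measurable_Rintegral _ _ (measurableTypeR R) rV R mc (fun z => sqn (u z.1 z.2))).
  by apply: measurable_sum => i; apply: measurable_funX; exact: mU.
have mu3 : measurable_fun setT (nrm3 Omega u).
  apply: (@measurable_Rintegral _ _ (measurableTypeR R) rV R mc (fun z => euclid (u z.1 z.2) ^+ 3)).
  by apply: measurable_funX; apply: measurable_euclid => i; exact: mU.
have k2 : leb.-integrable setT (EFin \o nrm2 Omega u).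
  apply: integrable_domR mu2 _ i2 => t; have [_ _ + _] := S2 t; rewrite E2.
  by rewrite ger0_norm//; apply: Rintegral_ge0 => x _; exact: sqn_ge0.
have k3 : leb.-integrable setT (EFin \o nrm3 Omega u).
  apply: integrable_domR mu3 _ i3 => t; have [_ _ + _] := S3 t.
  by rewrite ger0_norm//; apply: Rintegral_ge0 => x _; rewrite exprn_ge0 ?euclid_ge0.
exists u, (fun t => c3 t ^+ 3), (fun t => c2 t ^+ 2); split; last first.
  exists ([set` `]0, T[] `\` G); split => //; first exact: measurableD.
  move=> t; apply: contra_notP => nt tT; rewrite /u /masked mem_set//.
  by apply: contrapT => tG; apply: nt; split => //; rewrite /= in_itv.
split => //.
- exact: (flow_masked T0 mG GT nG pv mv we j2 j3 k2 k3).
- by move=> OT i psi tp; exact: (mean_masked T0 mG GT nG mv we j2 k2 i OT tp).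
- by move=> t; apply: exprn_ge0; case: (S3 t).
- by move=> t; apply: exprn_ge0; case: (S2 t).
- by move=> t h; have [_ _ _ /(_ h)] := S3 t.
- move=> t h; have [_ _ _ /(_ h)] := S2 t.
  by rewrite (E2 (fun x => u t (x + h) - u t x)).
Qed.

End reduction.

Lemma reduction (R : realType) (d : nat) (Omega : spatial_domain) (T p th be : R)
    (v : R -> 'rV[R]_d -> 'rV[R]_d) : (0 < d)%N -> 0 < T -> 3 <= p ->
  Lp_besov Omega T p%:E th 3%:E v -> Lp_besov Omega T (2 * p / 3)%:E be 2%:E v ->
  weak_euler Omega T v ->
  exists u b3 b2, besov_flow Omega T th be (p / 3) u b3 b2 /\
    {ae @lebesgue_measure R, forall t, 0 < t < T -> u t = v t}.
Proof.
move=> d0 T0 p3 [pv mv mB3 L3] [_ _ mB2 L2] we.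
have B0 (q s t : R) : (0 <= besov_norm Omega s q%:E (v t))%E.
  apply: adde_ge0; first exact: Lq_norm_ge0.
  have h0 : delta_mx ord0 (Ordinal d0) != 0 :> 'rV[R]_d.
    apply/eqP => /rowP/(_ (Ordinal d0)); rewrite !mxE !eqxx => /eqP.
    by rewrite oner_eq0.
  pose X h := (Lq_norm Omega q%:E (fun x => (v t (x + h) - v t x)%R) * ((euclid h `^ s)^-1)%:E)%E.
  apply: (@le_trans _ _ (X (delta_mx ord0 (Ordinal d0)))).
    by rewrite mule_ge0 ?Lq_norm_ge0// lee_fin invr_ge0 powR_ge0.
  by apply: ereal_sup_ubound; exists (delta_mx ord0 (Ordinal d0)).
have vm t : 0 < t < T -> forall i, measurable_fun setT (fun x => v t x ord0 i).
  move=> tT i; have H := measurableT_comp (measurable_coord i) mv.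
  move=> _ Y mY; rewrite setTI.
  have mD : measurable ([set` `]0, T[] `*` setT : set (R * 'rV[R]_d)) by exact: measurableX.
  have := measurable_pair1 t measurableT (H mD Y mY); rewrite setTI.
  congr measurable; apply/seteqP; split => x /=; first by case.
  by move=> Yx; split => //; split => //; rewrite in_itv.
apply: (masked_besov T0 p3 pv mv we _ _ mB3 mB2 L3 L2).
- by move=> t _; exact: B0.
- by move=> t _; exact: B0.
- by move=> t tT; exact: (besov_le (isT : (0 < 3)%N) d0 (vm t tT)).
- by move=> t tT; exact: (besov_le (isT : (0 < 2)%N) d0 (vm t tT)).
Qed.

(** [i1] and [i0] indicate that an end of the increment lies outside a ball, [j] that the increment
    is short. If an end is far, Young's inequality with weight eta puts the large factor on the
    tail; if both ends are in the ball, the increment is short and the small kernel will be used. *)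
Lemma young_cases (R : realType) (eta a b s1 s0 i1 i0 j : R) : 0 < eta ->
  a ^+ 2 <= s1 -> b ^+ 2 <= s0 -> 0 <= s1 -> 0 <= s0 -> 0 <= i1 -> 0 <= i0 -> 0 <= j ->
  [\/ i1 = 1, i0 = 1 | j = 1] ->
  `|a * b| <= eta * s1 + eta^-1 * (s1 * i1) + (eta * s0 + eta^-1 * (s0 * i0)) + (s1 + s0) * j.
Proof.
move=> e0 a2 b2 s10 s00 i10 i00 j0 H.
have young (x y : R) : `|x * y| <= eta * x ^+ 2 + eta^-1 * y ^+ 2.
  have := sqr_ge0 (eta * `|x| - `|y|); rewrite normrM -(real_normK (num_real x)) -(real_normK (num_real y)).
  have := normr_ge0 x; have := normr_ge0 y; move: `|x| `|y| => X Y Y0 X0 S.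
  rewrite -(ler_pM2l e0) mulrDr mulrA [eta * (eta^-1 * _)]mulrA mulfV ?gt_eqF// mul1r.
  by have := mulr_ge0 (ltW e0) (mulr_ge0 X0 Y0); nra.
have v0 : 0 <= eta^-1 by rewrite invr_ge0 ltW.
have Yab : `|a * b| <= eta * s1 + eta^-1 * s0.
  by apply: le_trans (young a b) _; rewrite lerD// ler_wpM2l// ltW.
have Yba : `|a * b| <= eta * s0 + eta^-1 * s1.
  by rewrite mulrC; apply: le_trans (young b a) _; rewrite lerD// ler_wpM2l// ltW.
have Y2 : `|a * b| <= s1 + s0.
  rewrite normrM; move: a2 b2; rewrite -(real_normK (num_real a)) -(real_normK (num_real b)).
  by move: `|a| `|b| => X Y; have := sqr_ge0 (X - Y); nra.
have p1 : 0 <= eta * s1 by rewrite mulr_ge0 ?(ltW e0).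
have p2 : 0 <= eta * s0 by rewrite mulr_ge0 ?(ltW e0).
have p3 : 0 <= eta^-1 * (s1 * i1) by rewrite !mulr_ge0.
have p4 : 0 <= eta^-1 * (s0 * i0) by rewrite !mulr_ge0.
have p5 : 0 <= (s1 + s0) * j by rewrite !mulr_ge0// addr_ge0.
by case: H => E; rewrite E ?mulr1 in p3 p4 p5 *; lra.
Qed.

(** * Large scales *)

Section pairing_lemmas.
Context {R : realType} {d : nat} (Omega : spatial_domain) (T : R).
Variable u : R -> 'rV[R]_d -> 'rV[R]_d.
Notation rV := 'rV[R]_d.
Notation mu := (@lebesgue_rV R d).
Notation mc := (@cell_measure R d Omega).
Notation leb := (@lebesgue_measure R).
Notation U := (vel u).
Notation n2 := (nrm2 Omega u).
Notation pp := (@pairing R d Omega).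
Hypothesis fl : flow Omega T u.

Let i2 t : mc.-integrable setT (EFin \o (fun x => sqn (u t x))) := fl_2 fl t.

Definition energy_at (L t : R) : R := 2^-1 * \sum_j pp (Kr L) (U j t) (U j t).

Notation El := energy_at.

Lemma int_UU i t k : kern k -> (mc \x mu)%E.-integrable setT
  (EFin \o (fun z : rV * rV => U i t (z.1 + z.2) * U i t z.1 * k z.2)).
Proof.
move=> kk.
exact: (integrable_pp kk (mU fl i t) (mU fl i t) (i2 t) (i2 t) (psqn fl t) (fun x y => UU_sq _ _ _ _ _ _ _)).
Qed.

Lemma El_bound (k : rV -> R) j t : kern k -> `|pp k (U j t) (U j t)| <= 2 * n2 t * \int[mu]_h `|k h|.
Proof.
move=> kk; rewrite mulr_natl mulr2n.
exact: (pp_bound kk (mU fl j t) (mU fl j t) (i2 t) (i2 t) (psqn fl t) (fun x y => UU_sq _ _ _ _ _ _ _)).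
Qed.

Lemma Ek_Nf (a b t : R) : 0 < a -> a <= b -> Ek Omega u (@Nf R d a b) t = El a t - El b t.
Proof.
move=> a0 ab; have b0 : 0 < b := lt_le_trans a0 ab.
rewrite /Ek /El -mulrBr -sumrB; congr (_ * _); apply: eq_bigr => j _.
rewrite Kd_Nf /pairing -RintegralB//; [|exact: int_UU (kern_csmooth (csmooth_Kr a0))|exact: int_UU (kern_csmooth (csmooth_Kr b0))].
by apply: eq_Rintegral => z _; rewrite mulrBr.
Qed.

Lemma mEl (L : R) : 0 < L -> measurable_fun setT (El L).
Proof.
move=> L0; have kK := kern_csmooth (@csmooth_Kr R d L L0).
rewrite (_ : El L = fun t => 2^-1 * \sum_j \int[mc]_x (cv (Kr L) (U j t) x * U j t x)).
  apply: measurable_funM => //; apply: measurable_sum => j.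
  apply: (@measurable_Rintegral _ _ (measurableTypeR R) rV R mc
    (fun z => cv (Kr L) (U j z.1) z.2 * U j z.1 z.2)).
  by apply: measurable_funM; [exact: (mcvU fl j kK) | exact: (fl_m fl j)].
apply/funext => t; congr (_ * _); apply: eq_bigr => j _.
by have [_] := pp_UU fl j t j t kK.
Qed.

Lemma Kr_int : exists2 C : R, 0 <= C & forall r : R, 0 < r -> \int[mu]_h `|Kr r h| <= C.
Proof.
have [C C0 HC] := @Kr_moment R d 0 (lexx 0); exists C => // r r0.
have [_] := HC r r0; rewrite powRr0 mulr1; congr (_ <= _).
by apply: eq_Rintegral => h _; rewrite powRr0 mulr1.
Qed.

Lemma norm_El_le : exists2 C : R, 0 <= C & forall L t, 0 < L -> `|El L t| <= C * n2 t.
Proof.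
have [C C0 HC] := Kr_int; exists (d%:R * C); first by rewrite mulr_ge0.
move=> L t L0; have n0 := n2_ge0 Omega u t.
have S : `|\sum_j pp (Kr L) (U j t) (U j t)| <= \sum_(j < d) 2 * n2 t * C.
  apply: le_trans (ler_norm_sum _ _ _) _; apply: ler_sum => j _.
  apply: le_trans (El_bound j t (kern_csmooth (csmooth_Kr L0))) _.
  by rewrite ler_wpM2l ?mulr_ge0// HC.
rewrite /El normrM ger0_norm// ler_pdivrMl//; apply: le_trans S _.
rewrite sumr_const card_ord -[X in X <= _]mulr_natl.
by rewrite le_eqVlt; apply/orP; left; apply/eqP; ring.
Qed.

Lemma int_El (L : R) : 0 < L -> leb.-integrable setT (EFin \o El L).
Proof.
move=> L0; have [C C0 HC] := norm_El_le.
have iG : leb.-integrable setT (EFin \o (fun t => C * n2 t)).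
  exact: (@integrable_scaleR _ (measurableTypeR R) R leb _ _ (fl_i2 fl)).
apply: integrable_domR iG; first exact: (mEl L0).
by move=> t; exact: HC.
Qed.

Definition tail (r t : R) : R := \int[mc]_x (sqn (u t x) * \1_(~` cball r) x).

Let mtail (r : R) : measurable_fun setT (\1_(~` cball r) : rV -> R).
Proof. by apply: measurable_indic; apply: measurableC; exact: measurable_cball. Qed.

Let itail r t : mc.-integrable setT (EFin \o (fun x => sqn (u t x) * \1_(~` cball r) x)).
Proof.
apply: integrable_dom (i2 t).
  by apply: measurable_funM => //; exact: integrable_mble (i2 t).
by move=> x; rewrite ger0_norm ?mulr_ge0 ?sqn_ge0 ?indicE// ler_piMr ?sqn_ge0//; case: (_ \in _).
Qed.

Lemma tail_cvg t : (tail n%:R t) @[n --> \oo] --> (0 : R).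
Proof.
rewrite -[X in _ --> X](Rintegral0 mc).
apply: (@Rintegral_dominated _ _ _ mc _ _ (fun x => sqn (u t x))) => //.
- by move=> n; exact: integrable_mble (itail _ _).
- move=> x; apply: cvg_near_cst; exists (Num.truncn `|x|).+1 => // n /= xn.
  rewrite indicE memNset ?mulr0// => /= H; apply: H; rewrite /cball /=.
  apply: ltW; apply: lt_le_trans (truncnS_gt `|x|) _; rewrite ler_nat//.
- move=> n x; rewrite ger0_norm ?mulr_ge0 ?sqn_ge0 ?indicE// ler_piMr ?sqn_ge0//; by case: (_ \in _).
Qed.

(** The three terms come from the three cases of [young_cases]: eta weighs the full norm, its
    inverse weighs the part outside the ball of radius [r], and increments shorter than 2 r see a
    kernel of height L^-d on a volume of order r^d. *)
Lemma pp_tail : Omega = WholeSpace -> exists2 C : R, 0 <= C &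
  forall (eta r L t : R) j, 0 < eta -> 0 < r -> 0 < L ->
  `|pp (Kr L) (U j t) (U j t)| <=
    C * (eta * n2 t + eta^-1 * tail r t + n2 t * (r / L) ^+ d).
Proof.
move=> OW; have [C1 C10 HC1] := Kr_int; have [C2 C20 HC2] := @Kr_bound R d.
(* The ball of radius 2 r has measure at most (4 r)^d, and the factor 2 counts the two ends of the
   increment. *)
exists (2 * (C1 + C2 * 4 ^+ d)); first by rewrite mulr_ge0// addr_ge0// mulr_ge0// ?exprn_ge0// ltW.
move=> eta r L t j e0 r0 L0; have kK := kern_csmooth (@csmooth_Kr R d L L0).
pose s x := sqn (u t x); pose A x := eta * s x + eta^-1 * (s x * \1_(~` cball r) x).
pose K1 (h : rV) := Kr L h * \1_(cball (2 * r)) h.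
have K0 (h : rV) : 0 <= Kr L h := Kr_ge0 h L0.
have kK1 : kern K1.
  case: kK => mK [M [C HC]]; split.
    by apply: measurable_funM => //; apply: measurable_indic; exact: measurable_cball.
  exists M, C => h; apply: le_trans (HC h); rewrite /K1 normrM ler_piMr// indicE.
  by case: (_ \in _); rewrite ?normr1 ?normr0.
have s0 x : 0 <= s x by exact: sqn_ge0.
have i01 (B : set rV) x : 0 <= (\1_B x : R) by rewrite indicE.
have A0 x : 0 <= A x by rewrite addr_ge0// mulr_ge0 ?invr_ge0 ?(ltW e0)// mulr_ge0.
have iA : mc.-integrable setT (EFin \o A).
  by apply: integrable_addR; apply: integrable_scaleR; [exact: i2 | exact: itail].
have mA := integrable_mble iA; have ms := integrable_mble (i2 t).
have pW (f : rV -> R) : @function_on R d Omega _ f by move=> OT; move: OT; rewrite OW.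
have nA (f : rV -> R) (f0 : forall x, 0 <= f x) x : `|f x| <= f x by rewrite ger0_norm.
have [I1 I2 E1 E2] := pp_shift_prod kK mA (pW _) iA (nA A A0).
have [I3 I4 E3 E4] := pp_shift_prod kK1 ms (pW _) (i2 t) (nA s s0).
pose G z := (A (z.1 + z.2) * Kr L z.2 + A z.1 * Kr L z.2) + (s (z.1 + z.2) * K1 z.2 + s z.1 * K1 z.2).
have I12 := integrable_addR I1 I2; have I34 := integrable_addR I3 I4.
have iG : (mc \x mu)%E.-integrable setT (EFin \o G) := integrable_addR I12 I34.
have IG : \int[(mc \x mu)%E]_z G z =
    2 * (\int[mc]_x A x * \int[mu]_h Kr L h + n2 t * \int[mu]_h K1 h).
  rewrite /G (RintegralD _ I12 I34)// (RintegralD _ I1 I2)// (RintegralD _ I3 I4)//.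
  rewrite E1 E2 E3 E4 -/(n2 t).
  by move: (\int[mc]_x A x) (\int[mu]_h Kr L h) (n2 t) (\int[mu]_h K1 h) => *; ring.
have PG : `|pp (Kr L) (U j t) (U j t)| <= \int[(mc \x mu)%E]_z G z.
  apply: le_norm_Rintegral => //; first exact: integrable_mble (int_UU j t kK).
  move=> z; set a := U j t (z.1 + z.2); set b := U j t z.1.
  have a2 : a ^+ 2 <= s (z.1 + z.2) by exact: sqU_le.
  have b2 : b ^+ 2 <= s z.1 by exact: sqU_le.
  have -> : G z = (A (z.1 + z.2) + A z.1 + (s (z.1 + z.2) + s z.1) * \1_(cball (2 * r)) z.2) * Kr L z.2.
    rewrite /G /K1; move: (A _) (A _) (s _) (s _) (Kr _ _) (\1__ _) => *; ring.
  rewrite normrM [`|Kr _ _|]ger0_norm//; apply: ler_wpM2r => //.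
  rewrite /A; apply: (young_cases e0 a2 b2 (s0 _) (s0 _) (i01 _ _) (i01 _ _) (i01 _ _)).
  have [xr|xr] := boolP (z.1 \in cball r); last first.
    apply: Or32; rewrite indicE mem_set//= => zr; move/negP: xr; apply; by rewrite inE.
  have [yr|yr] := boolP (z.1 + z.2 \in cball r); last first.
    apply: Or31; rewrite indicE mem_set//= => zr; move/negP: yr; apply; by rewrite inE.
  apply: Or33; rewrite indicE mem_set//; move: xr yr; rewrite !inE /cball /= => xr yr.
  have -> : z.2 = (z.1 + z.2) - z.1 by rewrite addrC addKr.
  by apply: le_trans (ler_normB _ _) _; lra.
apply: le_trans PG _; rewrite IG -mulrA ler_wpM2l//.
have IA : \int[mc]_x A x = eta * n2 t + eta^-1 * tail r t.
  have iX := integrable_scaleR eta (i2 t); have iY := integrable_scaleR eta^-1 (itail r t).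
  rewrite /A (RintegralD _ iX iY)//; by congr (_ + _); rewrite RintegralZl//.
have t0 : 0 <= tail r t by apply: Rintegral_ge0 => x _; rewrite mulr_ge0// ?sqn_ge0// indicE.
have n0 : 0 <= n2 t by exact: n2_ge0.
have IK : \int[mu]_h Kr L h <= C1.
  by apply: le_trans (HC1 L L0); apply: le_trans (ler_norm _) _; apply: le_norm_Rintegral => //;
    [case: kK | exact: integrable_norm (kern_integrable kK)].
have IK1 : \int[mu]_h K1 h <= C2 * 4 ^+ d * (r / L) ^+ d.
  have iB := @integrable_cball R d (2 * r).
  apply: (@le_trans _ _ (\int[mu]_h (C2 * L ^- d * \1_(cball (2 * r)) h))).
    apply: le_Rintegral => //; [exact: kern_integrable|exact: integrable_scaleR|].
    by move=> h _; rewrite ler_wpM2r// HC2.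
  rewrite RintegralZl//.
  have -> : C2 * 4 ^+ d * (r / L) ^+ d = C2 * L ^- d * (4 * r) ^+ d.
    by rewrite expr_div_n exprMn; move: (4 ^+ d) (r ^+ d) (L ^- d) => *; ring.
  rewrite ler_wpM2l ?mulr_ge0 ?invr_ge0 ?exprn_ge0 ?(ltW C20) ?(ltW L0)//.
  have E : (\int[mu]_h ((\1_(cball (2 * r)) h : R)%:E) = mu (cball (2 * r)))%E.
    by have := @integral_indic _ _ R mu setT measurableT _ (@measurable_cball R d (2 * r)); rewrite setIT.
  have := @lebesgue_cball R d (2 * r) (mulr_ge0 (ler0n _ 2) (ltW r0)); rewrite -E mulrA -natrM => H.
  rewrite /Rintegral -lee_fin fineK// ge0_fin_numE ?integral_ge0//.
  exact: le_lt_trans H (ltry _).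
rewrite IA; set X := eta * _ + _; have X0 : 0 <= X.
  by rewrite addr_ge0// mulr_ge0 ?invr_ge0// ltW.
have r0' : 0 <= (r / L) ^+ d by rewrite exprn_ge0// divr_ge0// ltW.
apply: (@le_trans _ _ (X * C1 + n2 t * (C2 * 4 ^+ d * (r / L) ^+ d))).
  by rewrite lerD// ler_wpM2l.
have q0 : 0 <= C2 * 4 ^+ d by rewrite mulr_ge0 ?exprn_ge0// ltW.
move: (C2 * 4 ^+ d) q0 ((r / L) ^+ d) r0' (n2 t) n0 => Q Q0 rho rho0 n n0.
have := mulr_ge0 C10 (mulr_ge0 n0 rho0); have := mulr_ge0 Q0 X0.
by rewrite mulrDl !mulrDr => *; nra.
Qed.

(** The three terms of [pp_tail] are made small in the order eta, then r, then L, each below a third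
    of the tolerance. *)
Lemma El_cvg_whole : Omega = WholeSpace -> (0 < d)%N -> forall t, (El n.+1%:R t) @[n --> \oo] --> (0 : R).
Proof.
move=> OW d0 t; have [C C0 HC] := pp_tail OW.
have n0 := n2_ge0 Omega u t; have tc := tail_cvg t.
apply/cvgrPdist_le => e e0.
pose D := d%:R * C + 1; have D0 : 0 < D by rewrite ltr_wpDl// mulr_ge0.
pose eta := e / (3 * D * (n2 t + 1)).
have n1 : 0 < n2 t + 1 by rewrite ltr_wpDl.
have eta0 : 0 < eta by rewrite divr_gt0// !mulr_gt0.
have te : 0 < e * eta / (3 * D) by apply: divr_gt0; [exact: mulr_gt0 | rewrite mulr_gt0].
have /cvgrPdist_le /(_ _ te) [m _ Hm] := tc.
pose r : R := m.+1%:R; have r0 : 0 < r by rewrite ltr0n.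
have tr : tail r t <= e * eta / (3 * D).
  by have := Hm m.+1 (leqnSn m); rewrite /= sub0r normrN; exact: le_trans (ler_norm _).
exists ((Num.truncn (3 * D * (n2 t + 1) * r / e)).+1 + m)%N => // n /= Nn.
have nr : 3 * D * (n2 t + 1) * r / e <= n.+1%:R.
  by apply: ltW; apply: lt_le_trans (truncnS_gt _) _; rewrite ler_nat ltnW// ltnS (leq_trans (leq_addr m _)).
have L0 : 0 < n.+1%:R :> R by rewrite ltr0n.
have rL : n2 t * (r / n.+1%:R) ^+ d <= e / (3 * D).
  have rl : r / n.+1%:R <= e / (3 * D * (n2 t + 1)).
    rewrite ler_pdivrMr// mulrAC ler_pdivlMr ?mulr_gt0// mulrC.
    by move: nr; rewrite ler_pdivrMr// [e * _]mulrC.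
  have rl1 : r / n.+1%:R <= 1.
    rewrite ler_pdivrMr// mul1r ler_nat ltnS; exact: leq_trans (leq_addl _ _) Nn.
  apply: (@le_trans _ _ (n2 t * (r / n.+1%:R))).
    rewrite ler_wpM2l// -(prednK d0) exprS ler_piMr ?divr_ge0 ?(ltW r0) ?(ltW L0)//.
    by rewrite exprn_ile1// divr_ge0 ?(ltW r0) ?(ltW L0).
  apply: (@le_trans _ _ ((n2 t + 1) * (e / (3 * D * (n2 t + 1))))).
    by apply: ler_pM => //; [rewrite divr_ge0 ?(ltW r0) ?(ltW L0) | rewrite lerDl].
  rewrite le_eqVlt; apply/orP; left; apply/eqP; field.
  by rewrite !gt_eqF.
rewrite sub0r normrN /El normrM ger0_norm//.
apply: (@le_trans _ _ (\sum_j `|pp (Kr n.+1%:R) (U j t) (U j t)|)).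
  apply: (@le_trans _ _ `|\sum_j pp (Kr n.+1%:R) (U j t) (U j t)|); last exact: ler_norm_sum.
  by rewrite ler_piMl// invf_le1// ler1n.
apply: (@le_trans _ _ (\sum_(j < d) C * (e / D))).
  apply: ler_sum => j _; apply: le_trans (HC _ _ _ _ _ eta0 r0 L0) _; rewrite ler_wpM2l//.
  have e1 : eta * n2 t <= e / (3 * D).
    rewrite /eta mulrAC ler_pdivrMr ?mulr_gt0//.
    have -> : e / (3 * D) * (3 * D * (n2 t + 1)) = e * (n2 t + 1).
      by field; rewrite gt_eqF.
    by rewrite ler_pM2l// lerDl.
  have e2 : eta^-1 * tail r t <= e / (3 * D).
    by rewrite ler_pdivrMl// mulrA [eta * e]mulrC.
  have -> : e / D = e / (3 * D) + e / (3 * D) + e / (3 * D) by field; rewrite gt_eqF.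
  by rewrite !lerD.
rewrite sumr_const card_ord -[X in X <= _]mulr_natl.
rewrite !mulrA ler_pdivrMr// /D mulrDr mulr1 [e * _]mulrC; lra.
Qed.

End pairing_lemmas.

Lemma Rintegral_cell_shift (R : realType) (d : nat) (Omega : spatial_domain) (h : 'rV[R]_d) (f : 'rV[R]_d -> R) :
  measurable_fun setT f -> function_on Omega f ->
  \int[@cell_measure R d Omega]_x f (x + h) = \int[@cell_measure R d Omega]_x f x.
Proof.
move=> mf pf; have mE : measurable_fun setT (EFin \o f) by exact/measurable_EFinP.
rewrite /Rintegral integralE [in RHS]integralE; congr (fine (_ - _)).
  have -> : (fun x => (f (x + h))%:E)^\+%E = (fun x => (EFin \o f)^\+%E (x + h)).
    exact: (funepos_comp (EFin \o f) (fun x => x + h)).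
  apply: ge0_integral_cell_shift; first exact: measurable_funepos.
    by move=> x; exact: funepos_ge0.
  by move=> OT x i; rewrite unlock /= pf.
have -> : (fun x => (f (x + h))%:E)^\-%E = (fun x => (EFin \o f)^\-%E (x + h)).
  exact: (funeneg_comp (EFin \o f) (fun x => x + h)).
apply: ge0_integral_cell_shift; first exact: measurable_funeneg.
  by move=> x; exact: funeneg_ge0.
by move=> OT x i; rewrite unlock /= pf.
Qed.

(** * Large scales on the torus *)

Section torus.
Context {R : realType} {d : nat} (T : R).
Variable u : R -> 'rV[R]_d -> 'rV[R]_d.
Notation rV := 'rV[R]_d.
Notation mu := (@lebesgue_rV R d).
Notation mc := (@cell_measure R d Torus).
Notation leb := (@lebesgue_measure R).
Notation U := (vel u).
Notation n2 := (nrm2 Torus u).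
Notation pp := (@pairing R d Torus).

Lemma mc_torus1 : mc setT = 1%E.
Proof.
have -> : mc setT = mu (@cell R d Torus) by rewrite -[X in mu X]setTI.
have -> : @cell R d Torus = [set x : rV | forall i, `[0%R, 1%R[%classic (x ord0 i)].
  by apply/seteqP; split => x /= H i; have := H i; rewrite /= in_itv.
rewrite (lebesgue_rV_box (fun i => measurable_itv _)) big1// => i _.
by rewrite lebesgue_measure_itv /= lte_fin ltr01 -EFinB subr0.
Qed.

Lemma integrable_cst_torus (c : R) : mc.-integrable setT (EFin \o (fun=> c)) /\ \int[mc]_x c = c.
Proof.
have E (r : R) : (\int[mc]_x r%:E = r%:E)%E.
  by rewrite integral_cst//; exact: (etrans (congr1 (mule r%:E) mc_torus1) (mule1 _)).
split; last by rewrite /Rintegral E.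
apply/integrableP; split; first exact/measurable_EFinP.
by rewrite (eq_integral (cst `|c|%:E))// E ltry.
Qed.

Lemma size_box k : size (@box d k) = ((2 * k).+1 ^ d)%N.
Proof. by rewrite size_map -cardE card_ffun !card_ord. Qed.

(** Both points may be taken in the unit ball by periodicity. About L^d translates of the kernel are
    then relevant, and each varies by at most a multiple of L^(-d-1) there. *)
Lemma per_oscillation : exists2 C : R, 0 <= C & forall (L : R) (z z' : rV), 1 <= L ->
  `|periodize (Kr L) z - periodize (Kr L) z'| <= C / L :> R.
Proof.
have [C C0 HC] := @dKr_bound R d.
exists (C * 2 * 9 ^+ d); first by rewrite !mulr_ge0 ?exprn_ge0// ltW.
move=> L z z' L1; have L0 : 0 < L by lra.
have red (x : rV) : exists2 y : rV, `|y| <= 1 & periodize (Kr L) x = periodize (Kr L) y.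
  pose n : 'rV[int]_d := \row_i Num.floor (x ord0 i).
  have yc : x - ivec n \in @cell R d Torus by apply/cell_floor.
  exists (x - ivec n); first exact: ball_cell.
  rewrite -(@function_on_ivec R d Torus _ n (x - ivec n) erefl (per_periodic (Kr L))).
  by rewrite subrK.
have [y y1 ->] := red z; have [y' y1' ->] := red z'.
pose k := (Num.truncn (L + 1)).+1.
have Lk : L + 1 <= k%:R by exact/ltW/truncnS_gt.
have kL : k%:R <= L + 2.
  rewrite /k -[_.+1%:R]natr1; have : (Num.truncn (L + 1))%:R <= L + 1 by rewrite truncn_le//; lra.
  lra.
have sK (x : rV) : L < `|x| -> Kr L x = 0 by exact: Kr_supp.
rewrite (perE sK Lk y1) (perE sK Lk y1') -sumrB.
apply: le_trans (ler_norm_sum _ _ _) _.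
apply: (@le_trans _ _ (\sum_(n <- box k) C * L ^- d.+1 * 2)).
  apply: ler_sum => n _.
  have [s s01 E] := MVT_segment_smooth (y' + ivec n) (y - y') (@smooth_Kr R d L) ltr01.
  rewrite scale1r addrA subrK mul1r in E; rewrite E.
  apply: le_trans (HC _ _ _ L0) _; rewrite ler_wpM2l ?mulr_ge0 ?invr_ge0 ?exprn_ge0 ?(ltW C0) ?(ltW L0)//.
  by apply: le_trans (ler_normB _ _) _; exact: (lerD y1 y1').
rewrite big_const_seq count_predT size_box iter_addr_0 -[X in X <= _]mulr_natr natrX.
(* From k <= L + 2, the side 2k + 1 of the box is at most 2L + 5, which is below 9L as L >= 1. *)
have k9 : (2 * k).+1%:R <= 9 * L by rewrite -natr1 natrM; lra.
apply: (@le_trans _ _ (C * L ^- d.+1 * 2 * (9 * L) ^+ d)).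
  rewrite ler_wpM2l ?mulr_ge0 ?invr_ge0 ?exprn_ge0 ?(ltW C0) ?(ltW L0)//.
  by rewrite lerXn2r ?nnegrE// mulr_ge0// ltW.
rewrite exprMn exprS le_eqVlt; apply/orP; left; apply/eqP.
have : L ^+ d != 0 by rewrite expf_neq0// gt_eqF.
move: (L ^+ d) (9 ^+ d) => X Y X0; field.
by rewrite X0 gt_eqF.
Qed.

(** The cell has mass 1, so a function of oscillation at most [b] differs from its mean by at most
    [b] everywhere. *)
Lemma oscillation_mean (a P : rV -> R) (b : R) : measurable_fun setT P ->
  mc.-integrable setT (EFin \o a) -> (forall z w, `|P z - P w| <= b) ->
  `|\int[mc]_z (a z * P z) - (\int[mc]_z P z) * \int[mc]_z a z| <= b * \int[mc]_z `|a z|.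
Proof.
move=> mP ia HP; have ma := integrable_mble ia; have [ib Ib] := integrable_cst_torus b.
have iPz z : mc.-integrable setT (EFin \o (fun w => P z - P w)).
  exact: (integrable_dom (measurable_funB (measurable_cst _) mP) (HP z) ib).
have [i0 I0] := integrable_cst_torus (P 0).
have iP : mc.-integrable setT (EFin \o P).
  have := integrable_subR i0 (iPz 0); congr (_.-integrable _ _); apply/funext => w /=.
  by rewrite opprB addrC subrK.
set m := \int[mc]_z P z.
have osc z : `|P z - m| <= b.
  have [iz Iz] := integrable_cst_torus (P z).
  have -> : P z - m = \int[mc]_w (P z - P w) by rewrite (RintegralB _ iz iP)// Iz.
  rewrite -[X in _ <= X]Ib; exact: (le_norm_Rintegral (integrable_mble (iPz z)) (HP z) ib).
have dom z : `|a z * P z - m * a z| <= b * `|a z|.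
  by rewrite [m * _]mulrC -mulrBr normrM mulrC ler_wpM2r.
have iN : mc.-integrable setT (EFin \o (fun z => b * `|a z|)).
  by apply: integrable_scaleR; exact: integrable_norm.
have mD : measurable_fun setT (fun z => a z * P z - m * a z).
  by apply: measurable_funB; apply: measurable_funM.
have iD := integrable_dom mD dom iN.
have im := integrable_scaleR m ia.
have iaP : mc.-integrable setT (EFin \o (fun z => a z * P z)).
  have := integrable_addR iD im; congr (_.-integrable _ _); apply/funext => z /=.
  by rewrite subrK.
have -> : m * \int[mc]_z a z = \int[mc]_z (m * a z) by rewrite RintegralZl.
rewrite -(RintegralB _ iaP im)//.
apply: le_trans (le_norm_Rintegral mD dom iN) _.
by rewrite RintegralZl//; exact: integrable_norm.
Qed.

(** At a large scale the periodized kernel is nearly constant, so mollifying amounts to taking the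
    mean times the mass of the kernel. *)
Lemma torus_cv : exists2 C : R, 0 <= C & forall (L : R) (a : rV -> R) (x : rV), 1 <= L ->
  measurable_fun setT a -> @function_on R d Torus _ a -> mc.-integrable setT (EFin \o a) ->
  mu.-integrable setT (EFin \o (fun h => a (x + h) * Kr L h)) ->
  `|cv (Kr L) a x - (\int[mu]_h Kr L h) * \int[mc]_x a x| <= C / L * \int[mc]_x `|a x|.
Proof.
have [C C0 HC] := per_oscillation; exists C => // L a x L1 ma pa ia iaK.
have L0 : 0 < L by lra.
have bK := @csmooth_Kr R d L L0; have mP := @measurable_to_domain R d Torus _ bK.
have oP := @admissible_to_domain R d Torus _ bK.
have max : measurable_fun setT (fun z => a (x + z)) by exact: measurable_addl.
have pax : @function_on R d Torus _ (fun z => a (x + z)) by move=> OT z i; rewrite addrA pa.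
have iax : mc.-integrable setT (EFin \o (fun z => a (x + z))).
  apply/integrableP; split; first exact/measurable_EFinP.
  have /integrableP[_] := ia; congr (_ < _)%E; apply/esym.
  rewrite -[RHS](ge0_integral_cell_shift x)//.
  - by apply: eq_integral => z _; rewrite /= addrC.
  - by apply: measurableT_comp => //; exact/measurable_EFinP.
  - by move=> OT z i; rewrite /= pa.
have -> : cv (Kr L) a x = \int[mc]_z (a (x + z) * periodize (Kr L) z).
  by rewrite /cv -(@Pe_unfold R d Torus _ _ bK max pax iaK).
have [i1 I1] := integrable_cst_torus 1.
have K1 : mu.-integrable setT (EFin \o (fun h => 1 * Kr L h)).
  by apply: integrable_scaleR; exact: kern_integrable (kern_csmooth bK).
have M : \int[mu]_h Kr L h = \int[mc]_z periodize (Kr L) z.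
  have := @Pe_unfold R d Torus (fun=> 1) _ bK (measurable_cst _) (fun _ _ _ => erefl) K1.
  under eq_Rintegral => z _ do rewrite mul1r.
  by under [X in _ = X -> _]eq_Rintegral => z _ do rewrite mul1r.
have -> : \int[mc]_x a x = \int[mc]_z a (x + z).
  by rewrite -(Rintegral_cell_shift x ma pa); apply: eq_Rintegral => z _; rewrite addrC.
have -> : \int[mc]_x `|a x| = \int[mc]_z `|a (x + z)|.
  rewrite -(@Rintegral_cell_shift R d Torus x (fun z => `|a z|))//.
  - by apply: eq_Rintegral => z _; rewrite addrC.
  - exact: measurableT_comp.
  - by move=> OT z i; rewrite pa.
have mPer : measurable_fun setT (periodize (Kr L) : rV -> R) := mP.
rewrite M; apply: oscillation_mean => //.
by move=> z w; exact: (HC L z w L1).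
Qed.

Hypothesis fl : flow Torus T u.

Lemma int_U_torus j t : mc.-integrable setT (EFin \o U j t).
Proof.
have [i1 _] := integrable_cst_torus 1.
exact: integrable_dom (mU fl j t) (fun x => U_le _ _ _ _) (integrable_addR i1 (fl_2 fl t)).
Qed.

Lemma pp_torus : exists2 C : R, 0 <= C & forall (L : R) j t, 1 <= L ->
  `|pp (Kr L) (U j t) (U j t) - (\int[mu]_h Kr L h) * (\int[mc]_x U j t x) ^+ 2| <= C / L * n2 t.
Proof.
have [C C0 HC] := torus_cv; exists C => // L j t L1; have L0 : 0 < L by lra.
have kK := kern_csmooth (@csmooth_Kr R d L L0).
have [icv ->] := pp_UU fl j t j t kK.
have iUt := int_U_torus j t; have iN := integrable_norm iUt.
set m := \int[mc]_x U j t x; set M := \int[mu]_h Kr L h; set c := \int[mc]_x `|U j t x|.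
have c0 : 0 <= c by apply: Rintegral_ge0.
have iMm := integrable_scaleR (M * m) iUt.
have -> : M * m ^+ 2 = \int[mc]_x (M * m * U j t x) by rewrite RintegralZl// expr2 mulrA.
rewrite -(RintegralB _ icv iMm)//.
have dom x : `|cv (Kr L) (U j t) x * U j t x - M * m * U j t x| <= C / L * c * `|U j t x|.
  rewrite -mulrBl normrM ler_wpM2r//; apply: HC => //; [exact: (mU fl)|exact: (pU fl)|].
  exact: (iU fl).
have iG := integrable_scaleR (C / L * c) iN.
apply: le_trans (le_norm_Rintegral (integrable_mble (integrable_subR icv iMm)) dom iG) _.
rewrite RintegralZl// -mulrA ler_wpM2l ?divr_ge0 ?(ltW L0)//.
have iS : mc.-integrable setT (EFin \o (fun x => U j t x ^+ 2)).
  apply: integrable_dom (fl_2 fl t); first by apply: measurable_funX; exact: (mU fl).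
  by move=> x; rewrite ger0_norm ?sqr_ge0// sqU_le.
apply: (@le_trans _ _ (\int[mc]_x (U j t x ^+ 2))); last first.
  by apply: le_Rintegral => //; [exact: (fl_2 fl t) | move=> x _; exact: sqU_le].
have [ic Ic] := integrable_cst_torus (c ^+ 2).
have i2c := integrable_scaleR (2 * c) iN.
(* Jensen's inequality: the square of the mean of |U| is at most the mean of its square on a cell of
   mass 1. *)
have : 0 <= \int[mc]_x (U j t x ^+ 2 - 2 * c * `|U j t x| + c ^+ 2).
  apply: Rintegral_ge0 => x _; rewrite -(real_normK (num_real (U j t x))).
  by have := sqr_ge0 (`|U j t x| - c); move: `|U j t x| => y; nra.
rewrite (RintegralD _ (integrable_subR iS i2c) ic)// (RintegralB _ iS i2c)//.
rewrite RintegralZl// Ic -/c.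
have eqn (X y : R) : 0 <= X - 2 * y * y + y ^+ 2 -> y * y <= X by nra.
exact: eqn.
Qed.

Hypothesis mean : forall i psi, test_function_line `]0, T[ psi ->
  \int[leb]_t ((\int[mc]_x U i t x) * 'D_1 psi t) = 0.

Lemma mean_const j : exists c, {ae leb, forall t,
  \int[mc]_x U j t x = c * \1_([set` `]0, T[]) t}.
Proof.
have T0 := fl_T fl; have [_ iT] := Rintegral_indic_itv T0; have [i1 I1] := integrable_cst_torus 1.
have mM : measurable_fun setT (fun t => \int[mc]_x U j t x).
  exact: (@measurable_Rintegral _ _ (measurableTypeR R) rV R mc (fun z => U j z.1 z.2) (fl_m fl j)).
have out t : t \notin [set` `]0, T[] -> \int[mc]_x U j t x = 0.
  move=> tT; rewrite -[RHS](Rintegral0 mc); apply: eq_Rintegral => x _; apply: (U_out fl).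
  by apply/negP => tT'; move/negP: tT; apply; rewrite inE /= in_itv.
have iM : leb.-integrable setT (EFin \o (fun t => \int[mc]_x U j t x)).
  apply: integrable_domR mM _ (@integrable_addR _ (measurableTypeR R) R leb _ _ iT (fl_i2 fl)) => t.
  rewrite indicE; have [tT|tT] := boolP (t \in [set` `]0, T[]); last first.
    by rewrite out// normr0 add0r n2_ge0.
  have := le_norm_Rintegral (mU fl j t) (fun x => U_le u j t x) (integrable_addR i1 (fl_2 fl t)).
  by rewrite (RintegralD _ i1 (fl_2 fl t))// I1.
have i0 : leb.-integrable setT (EFin \o (fun _ : R => 0 : R)) by exact: integrable0.
have H psi : test_function_line `]0, T[ psi ->
    \int[leb]_t ((\int[mc]_x U j t x) * 'D_1 psi t) = - \int[leb]_t (0 * psi t).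
  move=> tp; rewrite mean//; under [in RHS]eq_Rintegral => t _ do rewrite mul0r.
  by rewrite (@Rintegral0 _ (measurableTypeR R) R leb) oppr0.
have [c [A [mA A0 sA]]] := weak_ode iM i0 H.
exists c; exists A; split => // t; apply: contra_notP => nA.
rewrite /= indicE; have [tT|tT] := boolP (t \in [set` `]0, T[]); last by rewrite out// mulr0.
have tT' : 0 < t < T by move: tT; rewrite inE /= in_itv.
have -> : \int[mc]_x U j t x = c + prim (fun=> 0) t.
  by apply: contrapT => E; apply: nA; apply: sA => /= /(_ tT').
rewrite mulr1 /prim; under eq_Rintegral => s _ do rewrite mul0r.
by rewrite (@Rintegral0 _ (measurableTypeR R) R leb) addr0.
Qed.

(** [energy_at] is within a multiple of n2(t) / L of [kap], which does not depend on time since the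
    mean velocity is constant; the derivative of a test function integrates to 0 against it. *)
Lemma large_torus psi : test_function_line `]0, T[ psi -> exists2 C : R, 0 <= C &
  forall L : R, 1 <= L -> `|\int[leb]_t (energy_at Torus u L t * 'D_1 psi t)| <= C / L.
Proof.
move=> tp; have T0 := fl_T fl; have tp' := test_derive tp.
have [mp [B B0 HB]] := test_bounded T0 tp'.
have [C C0 HC] := pp_torus; have /choice[c Hc] := mean_const.
have N0 : 0 <= \int[leb]_t n2 t.
  by apply: (@Rintegral_ge0 _ (measurableTypeR R) R leb) => t _; exact: n2_ge0.
exists (d%:R * C * B * \int[leb]_t n2 t); first by rewrite !mulr_ge0.
move=> L L1; have L0 : 0 < L by lra.
pose kap := 2^-1 * \sum_j (\int[mu]_h Kr L h * c j ^+ 2).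
have ip : leb.-integrable setT (EFin \o (fun t => kap * 'D_1 psi t)).
  apply: (@integrable_scaleR _ (measurableTypeR R) R leb); exact: (test_integrable tp').
have iE : leb.-integrable setT (EFin \o (fun t => energy_at Torus u L t * 'D_1 psi t)).
  exact: (int_test T0 (int_El fl L0) tp').
have -> : \int[leb]_t (energy_at Torus u L t * 'D_1 psi t) =
    \int[leb]_t (energy_at Torus u L t * 'D_1 psi t - kap * 'D_1 psi t).
  rewrite (@RintegralB _ (measurableTypeR R) R leb setT _ _ measurableT iE ip).
  rewrite (@RintegralZl _ (measurableTypeR R) R leb)//; last exact: (test_integrable tp').
  by rewrite (test_int0 T0 tp) mulr0 subr0.
have iG : leb.-integrable setT (EFin \o (fun t => d%:R * C * B / L * n2 t)).
  exact: (@integrable_scaleR _ (measurableTypeR R) R leb _ _ (fl_i2 fl)).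
have -> : d%:R * C * B * (\int[leb]_t n2 t) / L = \int[leb]_t (d%:R * C * B / L * n2 t).
  by rewrite (@RintegralZl _ (measurableTypeR R) R leb)//; [rewrite mulrAC | exact: (fl_i2 fl)].
apply: (@le_norm_Rintegral_ae _ (measurableTypeR R) R leb).
- exact: (@integrable_mble _ (measurableTypeR R) R leb _ (@integrable_subR _ (measurableTypeR R) R leb _ _ iE ip)).
- by move=> t; rewrite !mulr_ge0 ?n2_ge0 ?invr_ge0// ltW.
- have [A [mA A0 sA]] := ae_ord Hc.
  exists A; split => // t; apply: contra_notP => nA /=.
  have {nA}mt j : \int[mc]_x U j t x = c j * \1_([set` `]0, T[]) t.
    by apply: contrapT => E; apply: nA; apply: sA => /= /(_ j).
  have [tT|tT] := boolP (0 < t < T); last first.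
    by rewrite (test_out tp' tT) !mulr0 subr0 normr0 !mulr_ge0 ?n2_ge0 ?invr_ge0// ltW.
  rewrite -mulrBl normrM.
  have -> : d%:R * C * B / L * n2 t = d%:R * (C / L * n2 t) * B by ring.
  apply: ler_pM => //; rewrite /energy_at /kap -mulrBr normrM ger0_norm// -sumrB.
  rewrite -[X in _ <= X]mul1r; apply: ler_pM => //; first by rewrite invf_le1// ler1n.
  apply: le_trans (ler_norm_sum _ _ _) _.
  apply: (@le_trans _ _ (\sum_(j < d) C / L * n2 t)); last by rewrite sumr_const card_ord mulr_natl.
  apply: ler_sum => j _; have := HC L j t L1; rewrite mt indicE mem_set ?mulr1//=.
- exact: iG.
Qed.

End torus.

Section large_scale.
Context {R : realType} {d : nat} (Omega : spatial_domain) (T : R).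
Variable u : R -> 'rV[R]_d -> 'rV[R]_d.
Notation rV := 'rV[R]_d.
Notation mu := (@lebesgue_rV R d).
Notation mc := (@cell_measure R d Omega).
Notation leb := (@lebesgue_measure R).
Notation El := (energy_at Omega u).
Notation n2 := (nrm2 Omega u).
Hypothesis fl : flow Omega T u.
Hypothesis d0 : (0 < d)%N.
Hypothesis mean : Omega = Torus -> forall i psi, test_function_line `]0, T[ psi ->
  \int[leb]_t ((\int[mc]_x vel u i t x) * 'D_1 psi t) = 0.

(** Dominated convergence along integer scales on the whole space, a rate 1/L on the torus; only the
    existence of arbitrarily large scales with a small contribution is common to both. *)
Lemma large_scale psi : test_function_line `]0, T[ psi -> forall M e : R, 0 < e ->
  exists L, [/\ M <= L, 1 <= L & `|\int[leb]_t (El L t * 'D_1 psi t)| <= e].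
Proof.
move=> tp M e e0; have T0 := fl_T fl; have tp' := test_derive tp.
have [mp [B B0 HB]] := test_bounded T0 tp'.
pose N := (Num.truncn `|M|).+1.
have MN n : (N <= n)%N -> M <= n.+1%:R.
  move=> Nn; apply: le_trans (ler_norm M) _; apply: ltW; apply: lt_le_trans (truncnS_gt _) _.
  by rewrite ler_nat ltnW// ltnS.
have [OT|OW] : Omega = Torus \/ Omega = WholeSpace by case: Omega; [left|right].
- move: fl mean; rewrite OT => flT /(_ erefl) mn.
  have [C C0 HC] := large_torus flT mn tp.
  pose L := Num.max 1 (Num.max M (C / e)).
  have [L1 LM LC] : [/\ 1 <= L, M <= L & C / e <= L] by rewrite /L !le_max !lexx ?orbT.
  exists L; split => //; apply: le_trans (HC L L1) _.
  by rewrite ler_pdivrMr ?(lt_le_trans ltr01 L1)// mulrC -ler_pdivrMr.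
- have mEp n : measurable_fun setT (fun t => El n.+1%:R t * 'D_1 psi t).
    by apply: measurable_funM => //; exact: (@integrable_mble _ (measurableTypeR R) R leb _ (int_El fl (ltr0Sn R n))).
  have [C C0 HC] := norm_El_le fl.
  have iG : leb.-integrable setT (EFin \o (fun t => C * n2 t * B)).
    rewrite (_ : (fun t => _) = fun t => C * B * n2 t); last by apply/funext => t; rewrite mulrAC.
    exact: (@integrable_scaleR _ (measurableTypeR R) R leb _ _ (fl_i2 fl)).
  have cvE t : (El n.+1%:R t * 'D_1 psi t) @[n --> \oo] --> (0 : R).
    rewrite -[X in _ --> X](mul0r ('D_1 psi t)); apply: cvgM; last exact: cvg_cst.
    exact: (El_cvg_whole fl OW d0).
  have := @Rintegral_dominated _ (measurableTypeR R) R leb _ _ _ mEp cvE iG _.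
  rewrite (@Rintegral0 _ (measurableTypeR R) R leb) => /(_ _)/cvgrPdist_le H.
  have {}H : \forall n \near \oo, `|0 - \int[leb]_t (El n.+1%:R t * 'D_1 psi t)| <= e.
    by apply: H => // n t; rewrite normrM ler_pM// HC.
  have [m _ Hm] := H.
  exists (maxn N m).+1%:R; split; first by apply: MN; rewrite leq_maxl.
    by rewrite ler1n.
  by have := Hm (maxn N m) (leq_maxr _ _); rewrite /= sub0r normrN.
Qed.

End large_scale.

(** * The local energy estimate *)

Section local_energy.
Context {R : realType} {d : nat} (Omega : spatial_domain) (T th be q : R).
Variables (u : R -> 'rV[R]_d -> 'rV[R]_d) (b3 b2 : R -> R).
Notation rV := 'rV[R]_d.
Notation mu := (@lebesgue_rV R d).
Notation mc := (@cell_measure R d Omega).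
Notation leb := (@lebesgue_measure R).
Notation El := (energy_at Omega u).
Notation n2 := (nrm2 Omega u).
Hypothesis bf : besov_flow Omega T th be q u b3 b2.
Hypotheses (d0 : (0 < d)%N) (th0 : 0 < th) (th1 : th < 1 / 3) (be0 : 0 < be).

Let fl : flow Omega T u := bf_flow bf.

Let mw (s : R) : measurable_fun setT (fun h : rV => euclid h `^ s).
Proof.
by apply: (measurableT_comp (measurable_powR s)); apply: measurable_euclid => i; exact: measurable_coord.
Qed.

(** The kernel of the flux is the difference of the kernels at scales [a] and [b], and both
    first-derivative moments of order 3 th are controlled by the smaller scale. *)
Lemma flux_decay : exists2 C : R, 0 <= C & forall a b : R, 0 < a -> a <= b ->
  {ae leb, forall t, `|Bk Omega u (@Nf R d a b) t| <= C * a `^ (3 * th - 1) * b3 t}.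
Proof.
have t0 := th0; have t1 := th1; have q0 : 0 <= 3 * th by lra.
have [C C0 HC] := @dKr_moment R d _ q0.
exists (d%:R * (d%:R * (2 * C))); first by rewrite !mulr_ge0.
move=> a b a0 ab; have b0 : 0 < b := lt_le_trans a0 ab.
have bN i := @csmooth_Nf R d a b i a0 ab.
have ev (h : rV) : Kd (@Nf R d a b) (- h) = Kd (@Nf R d a b) h by rewrite Kd_Nf !KrN.
have [A [mA A0 sA]] := dv_ae fl (csmooth_Kd bN).
exists A; split => // t; apply: contra_notP => nA /=.
have dv0 : {ae mc, forall x, dv u (Kd (@Nf R d a b)) t x = 0}.
  by apply: contrapT => H; apply: nA; apply: sA.
have dE k h : dx k (Kd (@Nf R d a b)) h = dx k (Kr a) h - dx k (Kr b) h.
  rewrite Kd_Nf dxD ?dxN//; [exact: csmooth_Kr|exact: csmooth_Kr|exact: csmoothN (csmooth_Kr b0)].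
(* The exponent is negative because th < 1/3, so the larger scale has the smaller power. *)
have pb : b `^ (3 * th - 1) <= a `^ (3 * th - 1).
  have -> : 3 * th - 1 = - (1 - 3 * th) by ring.
  rewrite !powRN lef_pV2 ?posrE ?powR_gt0//; apply: ge0_ler_powR; rewrite ?nnegrE//; try exact: ltW.
  lra.
have dom k h : `| `|dx k (Kd (@Nf R d a b)) h| * euclid h `^ (3 * th) | <=
    `|dx k (Kr a) h| * euclid h `^ (3 * th) + `|dx k (Kr b) h| * euclid h `^ (3 * th).
  by rewrite ger0_norm ?mulr_ge0 ?powR_ge0// -mulrDl ler_wpM2r ?powR_ge0// dE ler_normB.
have iK k : mu.-integrable setT (EFin \o (fun h => `|dx k (Kr a) h| * euclid h `^ (3 * th) + `|dx k (Kr b) h| * euclid h `^ (3 * th))).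
  by apply: integrable_addR; [have [] := HC a a0 k | have [] := HC b b0 k].
have mK k : measurable_fun setT (fun h => `|dx k (Kd (@Nf R d a b)) h| * euclid h `^ (3 * th)).
  apply: measurable_funM => //; apply: measurableT_comp => //.
  by case: (kern_csmooth (csmooth_dx k (csmooth_Kd bN))).
have iw k := integrable_dom (mK k) (dom k) (iK k).
apply: le_trans (flux_bound fl (bf_b3 bf t) (fun h => powR_ge0 _ _) (mw (3 * th)) bN ev dv0 (bf_d3 bf t) iw) _.
have B k : \int[mu]_h (`|dx k (Kd (@Nf R d a b)) h| * euclid h `^ (3 * th)) <= 2 * C * a `^ (3 * th - 1).
  apply: le_trans (ler_norm _) _; apply: le_trans (le_norm_Rintegral (mK k) (dom k) (iK k)) _.
  have [Ia Ba] := HC a a0 k; have [Ib Bb] := HC b b0 k.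
  rewrite (RintegralD _ Ia Ib)//; apply: le_trans (lerD Ba Bb) _.
  by rewrite -mulrA [X in _ <= X]mulr_natl mulr2n lerD// ler_wpM2l.
apply: (@le_trans _ _ (d%:R * b3 t * \sum_(k < d) (2 * C * a `^ (3 * th - 1)))).
  by rewrite ler_wpM2l ?mulr_ge0 ?(bf_b3 bf)//; apply: ler_sum => k _; exact: B.
rewrite sumr_const card_ord -[X in _ * X <= _]mulr_natl le_eqVlt; apply/orP; left; apply/eqP.
by move: (_ `^ _) (b3 t) => X Y; ring.
Qed.

(** The energy times the mass of the kernel is compared with the mollified energy, at a cost in
    squared increments against the derivative of [psi]; the mollified energy then contributes a flux
    against [psi] itself. The mass is bounded below uniformly in the scale and can be divided
    out. *)
Lemma local_energy : exists2 C : R, 0 <= C & forall (e : R) psi, 0 < e -> e <= 1 ->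
  test_function_line `]0, T[ psi ->
  `|\int[leb]_t (n2 t * 'D_1 psi t)| <=
    C * (e `^ (2 * be) * \int[leb]_t (b2 t * `|'D_1 psi t|) +
         e `^ (3 * th - 1) * \int[leb]_t (b3 t * `|psi t|)).
Proof.
have [C1 C10 HC1] := flux_decay.
have b0 := be0; have q0 : 0 <= 2 * be by lra.
have [C2 C20 HC2] := @Kr_moment R d _ q0.
have [m m0 Hm] := @Kr_mass R d d0.
exists (m^-1 * (C2 + 2 * C1)); first by rewrite mulr_ge0 ?invr_ge0 ?(ltW m0)// addr_ge0// mulr_ge0.
move=> e psi e0 e1 tp; have T0 := fl_T fl; have tp' := test_derive tp.
have [mp _] := test_bounded T0 tp; have [mp' _] := test_bounded T0 tp'.
have kK := kern_csmooth (@csmooth_Kr R d e e0).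
have [I2 M2] := HC2 e e0.
set K := \int[mu]_h Kr e h; have mK : m <= K := Hm e e0.
have mass t : `|K * n2 t - 2 * El e t| <= C2 * e `^ (2 * be) * b2 t.
  have := mass_bound fl (bf_b2 bf t) (fun h => powR_ge0 _ _) (mw (2 * be)) kK (bf_d2 bf t) I2.
  rewrite -/K /energy_at mulrA mulfV ?pnatr_eq0// mul1r => H; apply: le_trans H _.
  by rewrite [b2 t * _]mulrC ler_wpM2r// (bf_b2 bf).
have iE L (L0 : 0 < L) := int_test T0 (int_El fl L0) tp'.
have iN := int_test T0 (fl_i2 fl) tp'.
have abs_test (b p : R -> R) : leb.-integrable setT (EFin \o b) -> (forall t, 0 <= b t) ->
    test_function_line `]0, T[ p -> leb.-integrable setT (EFin \o (fun t => b t * `|p t|)).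
  move=> ib bb tpp; have H := integrable_norm (int_test T0 ib tpp).
  by move: H; congr (_.-integrable _ _); apply/funext => t /=; rewrite normrM ger0_norm.
have iB2 := abs_test _ _ (bf_i2 bf) (bf_b2 bf) tp'.
have iB3 := abs_test _ _ (bf_i3 bf) (bf_b3 bf) tp.
have zl (c : R) (f : R -> R) : leb.-integrable setT (EFin \o f) ->
    c * \int[leb]_t f t = \int[leb]_t (c * f t).
  by move=> H; rewrite (@RintegralZl _ (measurableTypeR R) R leb).
set J2 := \int[leb]_t (b2 t * _); set J3 := \int[leb]_t (b3 t * _).
have X1 : `|K * \int[leb]_t (n2 t * 'D_1 psi t) - 2 * \int[leb]_t (El e t * 'D_1 psi t)| <=
    C2 * e `^ (2 * be) * J2.
  have iKN := @integrable_scaleR _ (measurableTypeR R) R leb K _ iN.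
  have i2E := @integrable_scaleR _ (measurableTypeR R) R leb 2 _ (iE e e0).
  rewrite (zl _ _ iN) (zl _ _ (iE e e0)).
  rewrite -(@RintegralB _ (measurableTypeR R) R leb setT _ _ measurableT iKN i2E).
  rewrite /J2 (zl _ _ iB2).
  apply: (@le_norm_Rintegral _ (measurableTypeR R) R leb).
  - exact: (@integrable_mble _ (measurableTypeR R) R leb _ (@integrable_subR _ (measurableTypeR R) R leb _ _ iKN i2E)).
  - move=> t; rewrite (mulrA K) (mulrA 2) -mulrBl normrM (mulrA (C2 * _)).
    by apply: ler_wpM2r => //; exact: mass.
  - exact: (@integrable_scaleR _ (measurableTypeR R) R leb).
have X2 : `|\int[leb]_t (El e t * 'D_1 psi t)| <= C1 * e `^ (3 * th - 1) * J3.
  (* The scale [L] depends on the tolerance [r], but the bound of [flux_decay] does not depend on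
     [L], so that [L] disappears in the limit. *)
  apply/ler_addgt0Pr => r r0.
  have [L [_ L1 HL]] := large_scale fl d0 (bf_mean bf) tp 1 r0.
  have L0 : 0 < L by lra.
  have eL : e <= L by lra.
  have bN i := @csmooth_Nf R d e L i e0 eL.
  have ev (h : rV) : Kd (@Nf R d e L) (- h) = Kd (@Nf R d e L) h by rewrite Kd_Nf !KrN.
  have W := energy_weak fl bN (@sym_Nf R d e L) ev tp.
  have WE : \int[leb]_t (Ek Omega u (@Nf R d e L) t * 'D_1 psi t) =
      \int[leb]_t (El e t * 'D_1 psi t) - \int[leb]_t (El L t * 'D_1 psi t).
    rewrite -(@RintegralB _ (measurableTypeR R) R leb setT _ _ measurableT (iE e e0) (iE L L0)).
    by apply: eq_Rintegral => t _; rewrite (Ek_Nf fl t e0 eL) mulrBl.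
  have BB : `|\int[leb]_t (Bk Omega u (@Nf R d e L) t * psi t)| <= C1 * e `^ (3 * th - 1) * J3.
    have iBk := int_test T0 (int_Bk fl bN) tp.
    rewrite /J3 (zl _ _ iB3).
    apply: (@le_norm_Rintegral_ae _ (measurableTypeR R) R leb).
    - exact: (@integrable_mble _ (measurableTypeR R) R leb _ iBk).
    - by move=> t; rewrite !mulr_ge0 ?powR_ge0// (bf_b3 bf).
    - have [A [mA A0 sA]] := HC1 e L e0 eL; exists A; split => // t; apply: contra_notP => nA /=.
      rewrite normrM !mulrA; apply: ler_wpM2r => //.
      by apply: contrapT => H; apply: nA; apply: sA.
    - exact: (@integrable_scaleR _ (measurableTypeR R) R leb).
  move: W; rewrite WE => /eqP; rewrite subr_eq => /eqP ->.
  by apply: le_trans (ler_normD _ _) _; rewrite normrN lerD.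
have K0 : 0 < K by lra.
have J20 : 0 <= J2.
  by apply: (@Rintegral_ge0 _ (measurableTypeR R) R leb) => t _; rewrite mulr_ge0// (bf_b2 bf).
have J30 : 0 <= J3.
  by apply: (@Rintegral_ge0 _ (measurableTypeR R) R leb) => t _; rewrite mulr_ge0// (bf_b3 bf).
move: X1 X2 J20 J30; move: J2 J3 (\int[leb]_t (El e t * _)) (\int[leb]_t (n2 t * _)) => J2 J3 E N X1 X2 J20 J30.
have p2 := powR_ge0 e (2 * be); have p3 := powR_ge0 e (3 * th - 1).
have X3 : `|K * N| <= C2 * e `^ (2 * be) * J2 + 2 * (C1 * e `^ (3 * th - 1) * J3).
  rewrite -(subrK (2 * E) (K * N)); apply: le_trans (ler_normD _ _) _; rewrite lerD//.
  by rewrite normrM ger0_norm// ler_wpM2l.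
rewrite -mulrA ler_pdivlMl//.
apply: (@le_trans _ _ `|K * N|); first by rewrite normrM [`|K|]gtr0_norm// ler_wpM2r.
apply: le_trans X3 _.
move: p2 p3; move: (e `^ _) (e `^ _) => P Q P0 Q0.
have := mulr_ge0 C20 (mulr_ge0 Q0 J30); have := mulr_ge0 C10 (mulr_ge0 P0 J20).
by rewrite mulrDl !mulrDr !mulrA; lra.
Qed.

End local_energy.

(** * Cutoffs near a set of small dimension *)

Section cutoff.
Context {R : realType}.
Implicit Types (S : set R) (dl t x : R).

Definition hat (k : nat) x : R := step (x + 1 - k%:R) - step (x - k%:R).
(** In units of [dl], the threshold 2 is the half-width 1 of a hat plus the distance 1 from [S]
    within which [chi] must equal 1. The support of [chi] then stays within distance 3 = 1 + 2 of
    [S]. *)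
Definition near_cells S dl (Q : nat) : seq nat :=
  [seq k <- iota 0 Q.+1 | `[< exists2 s, S s & `|s / dl - k%:R| <= 2 >]].
(* A smooth partition of unity on the grid [dl N], restricted to the cells
   close to [S]. *)
Definition chi S dl (Q : nat) t : R := \sum_(k <- near_cells S dl Q) hat k (t / dl).

Lemma smooth_hat k (dl : R) : smooth (fun t : R => hat k (t / dl)).
Proof.
apply: smoothB.
  rewrite (_ : (fun _ => _) = fun t => step (dl^-1 * t + (1 - k%:R))); first exact/smooth_scale/smooth_step.
  by apply/funext => t; rewrite addrA mulrC.
rewrite (_ : (fun _ => _) = fun t => step (dl^-1 * t + (- k%:R))); first exact/smooth_scale/smooth_step.
by apply/funext => t; rewrite mulrC.
Qed.

Lemma smooth_chi S dl Q : smooth (chi S dl Q).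
Proof. by apply: smooth_sum => k _; exact: smooth_hat. Qed.

Lemma hat_ge0 k x : 0 <= hat k x.
Proof. by rewrite subr_ge0; apply: step_homo; rewrite lerD2r lerDl. Qed.

Lemma hat_eq0 k x : 1 <= `|x - k%:R| -> hat k x = 0.
Proof.
rewrite /hat ler_normr => /orP[H|H].
  have H1 : 1 <= x + 1 - k%:R by lra.
  by rewrite (step_ge1 H) (step_ge1 H1) subrr.
have [H1 H2] : x - k%:R <= 0 /\ x + 1 - k%:R <= 0 by lra.
by rewrite (step_le0 H1) (step_le0 H2) subrr.
Qed.

(** Consecutive hats telescope; the value is 1 for 0 <= x <= n. *)
Lemma sum_hat x (n : nat) : \sum_(k <- iota 0 n.+1) hat k x = step (x + 1) - step (x - n%:R).
Proof.
elim: n => [|n IH]; first by rewrite /= big_seq1 /hat !subr0.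
rewrite -addn1 iotaD big_cat /= add0n IH big_seq1 /hat -natr1.
have -> : x + 1 - (n%:R + 1) = x - n%:R by rewrite opprD addrACA subrr addr0.
have eqn (a b c : R) : a - b + (b - c) = a - c by rewrite addrA subrK.
exact: eqn.
Qed.

Definition dhat (k : nat) x : R := dstep (x + 1 - k%:R) - dstep (x - k%:R).

Lemma dhat_eq0 k x : 1 <= `|x - k%:R| -> dhat k x = 0.
Proof.
rewrite /dhat ler_normr => /orP[H|H].
  have H1 : 1 <= x + 1 - k%:R by lra.
  by rewrite (dstep_eq0 (or_intror H)) (dstep_eq0 (or_intror H1)) subrr.
have [H1 H2] : x - k%:R <= 0 /\ x + 1 - k%:R <= 0 by lra.
by rewrite (dstep_eq0 (or_introl H1)) (dstep_eq0 (or_introl H2)) subrr.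
Qed.

Lemma is_derive_hat k dl t : is_derive t (1 : R) (fun t : R => hat k (t / dl)) (dl^-1 * dhat k (t / dl)).
Proof.
have D (c : R) : is_derive t (1 : R) (fun t : R => step (t / dl + c)) (dl^-1 * dstep (t / dl + c)).
  have ds : derivable (@step R) (dl^-1 * t + c) 1 by exact: smooth_derivable smooth_step.
  have -> : (fun t : R => step (t / dl + c)) = fun t => step (dl^-1 * t + c).
    by apply/funext => x; rewrite mulrC.
  by rewrite [t / dl]mulrC; exact: derive_scale.
have E (x : R) : x / dl + 1 - k%:R = x / dl + (1 - k%:R) by rewrite addrA.
have [d1 e1] := is_deriveB (D (1 - k%:R)) (D (- k%:R)).
have -> : (fun t => hat k (t / dl)) =
    (fun t => step (t / dl + (1 - k%:R))) - (fun t => step (t / dl - k%:R)).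
  by apply/funext => x; rewrite /hat E.
by split => //; rewrite e1 /dhat E mulrBr.
Qed.

Lemma derive_chi S dl Q t : 'D_1 (chi S dl Q) t = \sum_(k <- near_cells S dl Q) dl^-1 * dhat k (t / dl).
Proof.
rewrite /chi; elim: (near_cells S dl Q) => [|k s IH].
  rewrite big_nil (_ : (fun _ => _) = cst 0) ?derive_cst//.
  by apply/funext => x; rewrite big_nil.
rewrite big_cons -IH.
have sS : smooth (fun t : R => \sum_(j <- s) hat j (t / dl)) by apply: smooth_sum => j _; exact: smooth_hat.
rewrite (_ : (fun t => _) = (fun t : R => hat k (t / dl)) \+ fun t => \sum_(j <- s) hat j (t / dl)).
  by have [_ ->] := is_deriveD (is_derive_hat k dl t) (is_derive_smooth t (1 : R) sS).
by apply/funext => x; rewrite big_cons.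
Qed.

Section bounds.
Variables (S : set R) (dl : R) (Q : nat).
Hypothesis dl0 : 0 < dl.

Lemma chi_le1 t : 0 <= chi S dl Q t <= 1.
Proof.
apply/andP; split; first by apply: sumr_ge0 => k _; exact: hat_ge0.
rewrite /chi /near_cells big_filter.
apply: (@le_trans _ _ (\sum_(k <- iota 0 Q.+1) hat k (t / dl))).
  rewrite big_mkcond /=; apply: ler_sum => k _; case: ifP => // _; exact: hat_ge0.
rewrite sum_hat; apply: le_trans (step_le1 (t / dl + 1)).
by rewrite gerBl; exact: step_ge0.
Qed.

(** A hat that does not vanish at [t] has its centre within 2 of s / dl, so no discarded cell
    contributes and the full telescoping sum remains; the bounds on [t] place it between the two
    ends of the grid. *)
Lemma chi_eq1 t s : 0 <= t -> t <= Q%:R * dl -> S s -> `|t - s| <= dl -> chi S dl Q t = 1.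
Proof.
move=> t0 tQ Ss ts; rewrite /chi /near_cells big_filter.
have E : \sum_(k <- iota 0 Q.+1 | `[< exists2 s, S s & `|s / dl - k%:R| <= 2 >]) hat k (t / dl) =
    \sum_(k <- iota 0 Q.+1) hat k (t / dl).
  rewrite big_mkcond /=; apply: eq_bigr => k _; case: ifPn => // /asboolPn nk.
  apply/esym/hat_eq0; rewrite leNgt; apply/negP => tk; apply: nk; exists s => //.
  have -> : s / dl - k%:R = (t / dl - k%:R) - (t - s) / dl by rewrite mulrBl; lra.
  apply: le_trans (ler_normB _ _) _; rewrite normrM [`|dl^-1|]gtr0_norm ?invr_gt0//.
  have : `|t - s| / dl <= 1 by rewrite ler_pdivrMr// mul1r.
  by lra.
rewrite E sum_hat step_ge1 ?step_le0 ?subr0//.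
  by rewrite subr_le0 ler_pdivrMr.
by rewrite lerDr divr_ge0// ltW.
Qed.

Lemma near_cell_dist k t : k \in near_cells S dl Q -> `|t / dl - k%:R| <= 1 ->
  exists2 s, S s & `|t - s| <= 3 * dl.
Proof.
rewrite mem_filter => /andP[/asboolP[s Ss sk] _] tk; exists s => //.
rewrite -ler_pdivrMr// -[X in _ / X](gtr0_norm dl0) -normf_div mulrBl.
have -> : t / dl - s / dl = (t / dl - k%:R) - (s / dl - k%:R) by lra.
by apply: le_trans (ler_normB _ _) _; lra.
Qed.

Lemma chi_supp t : (forall s, S s -> 3 * dl < `|t - s|) ->
  chi S dl Q t = 0 /\ 'D_1 (chi S dl Q) t = 0.
Proof.
move=> far.
have F k : k \in near_cells S dl Q -> 1 < `|t / dl - k%:R|.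
  move=> kn; rewrite ltNge; apply/negP => tk; have [s Ss] := near_cell_dist kn tk.
  by rewrite leNgt far.
split; first by rewrite /chi big_seq big1// => k kn; apply: hat_eq0; exact/ltW/F.
rewrite (derive_chi _ _) big_seq big1// => k kn.
by rewrite dhat_eq0 ?mulr0//; exact/ltW/F.
Qed.

(** The bound is independent of the number of cells: the integer translates of [dstep] have
    essentially disjoint supports, so their sum is at most one maximum, and a derivative of a hat
    involves two such families. *)
Lemma chi_deriv_bound : exists2 C : R, 0 <= C & forall (S : set R) Q dl t, 0 < dl ->
  `|'D_1 (chi S dl Q) t| <= C / dl.
Proof.
have [C C0 HC] := @dstep_bounded R; exists (2 * C); first by rewrite mulr_ge0// ltW.
have S1 (y : R) n : \sum_(k <- iota 0 n) dstep (y - k%:R) <= C.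
  elim: n => [|n IH]; first by rewrite big_nil ltW.
  rewrite -addn1 iotaD big_cat /= add0n big_seq1.
  have [yn|yn] := leP (y - n%:R) 0; first by rewrite (dstep_eq0 (or_introl yn)) addr0.
  rewrite big_seq big1 ?add0r; first exact: HC.
  move=> k; rewrite mem_iota add0n => /= kn; apply: dstep_eq0; right.
  by have : k%:R + 1 <= n%:R :> R; [rewrite natr1 ler_nat | lra].
have nb (a b : R) : 0 <= a -> 0 <= b -> `|a - b| <= a + b.
  by move=> a0 b0; rewrite ler_norml; lra.
move=> S' Q' e t e0; rewrite derive_chi.
apply: le_trans (ler_norm_sum _ _ _) _; rewrite /near_cells big_filter.
apply: (@le_trans _ _ (\sum_(k <- iota 0 Q'.+1) e^-1 * (dstep (t / e + 1 - k%:R) + dstep (t / e - k%:R)))).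
  rewrite big_mkcond; apply: ler_sum => k _.
  have p1 := dstep_ge0 (t / e + 1 - k%:R); have p2 := dstep_ge0 (t / e - k%:R).
  have D : `|e^-1 * dhat k (t / e)| <= e^-1 * (dstep (t / e + 1 - k%:R) + dstep (t / e - k%:R)).
    rewrite normrM gtr0_norm ?invr_gt0// ler_wpM2l ?invr_ge0 ?(ltW e0)//.
    rewrite /dhat; exact: nb p1 p2.
  have e' : 0 <= e^-1 by rewrite invr_ge0 ltW.
  by case: ifP => _; [exact: D | exact: mulr_ge0 e' (addr_ge0 p1 p2)].
rewrite -mulr_sumr big_split /= mulrC ler_pM2r ?invr_gt0//.
have -> : 2 * C = C + C by rewrite mulr_natl mulr2n.
exact: (lerD (S1 _ Q'.+1) (S1 _ Q'.+1)).
Qed.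

End bounds.

End cutoff.

(** * Small sets of times and the Minkowski dimension *)

Section small_sets.
Context {R : realType}.
Notation leb := (@lebesgue_measure R).

(** Hoelder's inequality, obtained by cutting [b] at the level L = X^(-1/q): below the level it
    contributes at most L X, above it b <= L^(1-q) b^q. Both L X and L^(1-q) equal X^(1 - 1/q). *)
Lemma Rintegral_small_set (b : R -> R) (D : set R) (X q : R) : 1 <= q -> 0 < X ->
  measurable D -> (leb D <= X%:E)%E -> (forall t, 0 <= b t) ->
  leb.-integrable setT (EFin \o b) -> leb.-integrable setT (EFin \o (fun t => b t `^ q)) ->
  \int[leb]_t (b t * \1_D t) <= X `^ (1 - q^-1) * (1 + \int[leb]_t (b t `^ q)).
Proof.
move=> q1 X0 mD DX b0 ib iq; have q0 : 0 < q by lra.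
pose L := X `^ (- q^-1); have L0 : 0 < L by exact: powR_gt0.
have iD : leb.-integrable setT (EFin \o (\1_D : R -> R)).
  apply/integrableP; split; first exact/measurable_EFinP/measurable_indic.
  have -> : (\int[leb]_x `|(EFin \o (\1_D : R -> R)) x| = leb D)%E.
    have := @integral_indic _ _ R leb setT measurableT D mD; rewrite setIT => <-.
    by apply: eq_integral => x _; rewrite /= ger0_norm// indicE.
  exact: le_lt_trans DX (ltry _).
have I : \int[leb]_t (\1_D t : R) <= X.
  have E : (\int[leb]_t ((\1_D t : R)%:E) = leb D)%E.
    by have := @integral_indic _ _ R leb setT measurableT D mD; rewrite setIT.
  rewrite /Rintegral E -lee_fin fineK// ge0_fin_numE//.
  exact: le_lt_trans DX (ltry _).
have i1 := @integrable_scaleR _ (measurableTypeR R) R leb L _ iD.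
have i2 := @integrable_scaleR _ (measurableTypeR R) R leb (L `^ (1 - q)) _ iq.
have dom t : `|b t * \1_D t| <= L * \1_D t + L `^ (1 - q) * b t `^ q.
  have p0 : 0 <= L `^ (1 - q) * b t `^ q by rewrite mulr_ge0 ?powR_ge0.
  rewrite indicE; case: (t \in D); last by rewrite !mulr0 normr0 add0r.
  rewrite !mulr1 ger0_norm//; have [bL|Lb] := leP (b t) L; first by rewrite ler_wpDr.
  apply: ler_wpDl; first exact: ltW.
  have bt : 0 < b t by exact: lt_trans Lb.
  have -> : 1 - q = - (q - 1) by ring.
  rewrite powRN mulrC ler_pdivlMr ?powR_gt0//.
  apply: (@le_trans _ _ (b t * b t `^ (q - 1))).
    rewrite ler_wpM2l//; apply: ge0_ler_powR; rewrite ?nnegrE ?(ltW L0)//; first lra.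
    exact: ltW.
  rewrite -{1}(powRr1 (b0 t)) -powRD; last by rewrite (gt_eqF bt) implybT.
  by rewrite addrC subrK.
apply: (@le_trans _ _ (\int[leb]_t (L * \1_D t + L `^ (1 - q) * b t `^ q))).
  apply: le_trans (ler_norm _) _; apply: (@le_norm_Rintegral _ (measurableTypeR R) R leb) => //.
    exact: (@integrable_mble _ (measurableTypeR R) R leb _ (integrable_indicR mD ib)).
  exact: (@integrable_addR _ (measurableTypeR R) R leb).
rewrite (@RintegralD _ (measurableTypeR R) R leb setT _ _ measurableT i1 i2).
rewrite !(@RintegralZl _ (measurableTypeR R) R leb)//.
have E1 : L * X = X `^ (1 - q^-1).
  rewrite /L -{2}(powRr1 (ltW X0)) -powRD; last by rewrite (gt_eqF X0) implybT.
  by rewrite addrC.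
have E2 : L `^ (1 - q) = X `^ (1 - q^-1).
  rewrite /L -powRrM; congr (_ `^ _); by field; rewrite gt_eqF.
by rewrite E2 mulrDr mulr1 lerD// -E1 ler_wpM2l// ltW.
Qed.

Lemma powR_le1 (x a b : R) : 0 < x -> x <= 1 -> a <= b -> x `^ b <= x `^ a.
Proof.
move=> x0 x1 ab; rewrite /powR gt_eqF// ler_expR ler_wnM2r// ln_le0//.
Qed.

Definition thick (S : set R) (r : R) : set R := [set t | (edist_inf S t <= r%:E)%E].

Lemma measurable_thick (S : set R) r : measurable (thick S r).
Proof.
apply: closed_measurable.
rewrite (_ : thick S r = edist_inf S @^-1` [set y | (y <= r%:E)%E])//.
apply: closed_comp; last exact: closed_ereal_ge_ereal.
by move=> t _; exact: edist_inf_continuous.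
Qed.

Lemma thickP (S : set R) (r t s : R) : S s -> `|t - s| <= r -> thick S r t.
Proof.
move=> Ss ts; rewrite /thick /=; apply/lee_addgt0Pr => e e0.
apply: (@le_trans _ _ (edist (t, s))); first by apply: ereal_inf_lbound; exists s.
apply: edist_fin; first by have := normr_ge0 (t - s); lra.
by rewrite /ball /=; lra.
Qed.

Lemma minkowski_cover (S : set R) (gamma s1 : R) : upper_minkowski_dim S = gamma%:E ->
  gamma < s1 -> exists2 r0 : R, 0 < r0 & forall r, 0 < r -> r < r0 -> r <= 1 ->
  (leb (thick S r) <= (r `^ (1 - s1))%:E)%E.
Proof.
move=> dimS gs.
have /ereal_inf_lt[_ [s [s0 lim0] <-] ss] : (upper_minkowski_dim S < s1%:E)%E by rewrite dimS lte_fin.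
have : (limf_esup (fun delta : R => (delta `^ (s - 1))%:E * leb (thick S delta))%E 0^'+ < 1%:E)%E.
  by rewrite lim0 lte_fin.
rewrite limf_esupE => /ereal_inf_lt[_ [V nV <-] sV].
have [r0 /= r00 H] := (nbhs_ballP _ _).1 nV.
exists r0 => // r rp rr0 r1.
have Vr : V r.
  by apply: H => //; rewrite /ball /= sub0r normrN gtr0_norm.
have : ((r `^ (s - 1))%:E * leb (thick S r) < 1%:E)%E.
  by apply: le_lt_trans sV; apply: ereal_sup_ubound; exists r.
have p0 : 0 < r `^ (s - 1) by exact: powR_gt0.
have m0 : (0 <= leb (thick S r))%E by exact: measure_ge0.
move: m0; case: (leb (thick S r)) => [x| |] // x0; last by rewrite gt0_muley// lte_fin.
rewrite -EFinM lte_fin lee_fin => H1.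
apply: (@le_trans _ _ (r `^ (1 - s))); last first.
  by apply: powR_le1 => //; rewrite lerD2l lerN2; apply: ltW; rewrite lte_fin in ss.
have -> : 1 - s = - (s - 1) by ring.
by rewrite powRN -[X in _ <= X]mulr1 ler_pdivlMl// ltW.
Qed.

End small_sets.

(** * Conservation *)

Section conclusion.
Context {R : realType} {d : nat} (Omega : spatial_domain) (T : R).
Notation rV := 'rV[R]_d.
Notation mu := (@lebesgue_rV R d).
Notation mc := (@cell_measure R d Omega).
Notation leb := (@lebesgue_measure R).

Lemma kinetic_energy_weak (v u : R -> rV -> rV) psi :
  measurable_fun ([set` `]0, T[] `*` setT) (fun z : R * rV => v z.1 z.2 : rV) ->
  flow Omega T u -> {ae leb, forall t, 0 < t < T -> u t = v t} ->
  test_function_line `]0, T[ psi ->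
  \int[leb]_(t in [set` `]0, T[]) (kinetic_energy Omega v t * 'D_1 psi t) =
  2^-1 * \int[leb]_t (nrm2 Omega u t * 'D_1 psi t).
Proof.
move=> mv fl uv tp; have T0 := fl_T fl; have tp' := test_derive tp.
have [mp' _] := test_bounded T0 tp'.
have mT : measurable [set` `]0, T[] by exact: measurable_itv.
(* Extension of [v] by 0 outside ]0, T[, which makes its energy a measurable function on the whole
   line. *)
pose w := masked v [set` `]0, T[].
have mw i := measurable_masked mT (@subset_refl _ _) mv i.
pose kap t := 2^-1 * \int[mc]_x sqn (w t x).
have mk : measurable_fun setT kap.
  apply: measurable_funM => //.
  apply: (@measurable_Rintegral _ _ (measurableTypeR R) rV R mc (fun z => sqn (w z.1 z.2))).
  by apply: measurable_sum => i; apply: measurable_funX; exact: mw.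
have win t : 0 < t < T -> w t = v t.
  by move=> tT; rewrite /w masked_in// inE /= in_itv.
have iN := int_test T0 (fl_i2 fl) tp'.
have -> : 2^-1 * \int[leb]_t (nrm2 Omega u t * 'D_1 psi t) = \int[leb]_t (2^-1 * (nrm2 Omega u t * 'D_1 psi t)).
  by rewrite (@RintegralZl _ (measurableTypeR R) R leb).
rewrite Rintegral_mkcond.
have -> : \int[leb]_t ((fun t => kinetic_energy Omega v t * 'D_1 psi t) \_ `]0, T[) t =
    \int[leb]_t (kap t * 'D_1 psi t).
  apply: eq_Rintegral => t _; rewrite patchE mem_setE in_itv /=.
  case: ifPn => tT; last by rewrite (test_out tp' tT) mulr0.
  congr (_ * _); rewrite /kap /kinetic_energy win//; congr (_ * _).
  have ms : measurable_fun setT (EFin \o (fun x => sqn (v t x))).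
    apply/measurable_EFinP; rewrite -win//; apply: measurable_sum => i; apply: measurable_funX.
    exact: (measurableT_comp (mw i) (measurable_pair1 t)).
  rewrite /Rintegral (integral_mrestr mu (measurable_cell Omega) ms); congr fine.
  by apply: eq_integral => x _; rewrite /= euclid2.
apply: (@ae_eq_Rintegral _ (measurableTypeR R) R leb).
- exact: measurable_funM.
- exact: (@integrable_mble _ (measurableTypeR R) R leb _ (@integrable_scaleR _ (measurableTypeR R) R leb _ _ iN)).
case: uv => A [mA A0 sA]; exists A; split => // t; apply: contra_notP => nA /=.
have [tT|tT] := boolP (0 < t < T); last by rewrite (test_out tp' tT) !mulr0.
have -> : kap t = 2^-1 * nrm2 Omega u t; last by rewrite mulrA.
rewrite /kap win// /nrm2 -[v t](_ : u t = v t)//.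
by apply: contrapT => E; apply: nA; apply: sA => /= /(_ tT).
Qed.

Lemma test_chi (S : set R) dl Q phi : test_function_line `]0, T[ phi ->
  test_function_line `]0, T[ (fun t => phi t * chi S dl Q t).
Proof.
move=> [sp [K [cK KT K0]]]; split; first exact: smoothM sp (smooth_chi _ _ _).
by exists K; split => // t tK; rewrite K0// mul0r.
Qed.

(** Since [chi] is 1 within [dl] of [S], the product vanishes there. What remains of the support of
    [phi] is its intersection with the closed set of times at distance at least [dl] from each point
    of [S]. *)
Lemma test_off_chi (S : set R) dl Q phi : 0 < dl -> T <= Q%:R * dl ->
  test_function_line `]0, T[ phi ->
  test_function_line (`]0, T[ `\` S) (fun t => phi t * (1 - chi S dl Q t)).
Proof.
move=> dl0 TQ [sp [K [cK KT K0]]]; split.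
  by apply: smoothM => //; apply: smoothB; [exact: smooth_cst | exact: smooth_chi].
exists (K `&` [set t | forall s, S s -> dl <= `|t - s|]); split.
- apply: compact_closedI => //.
  rewrite (_ : mkset _ = \bigcap_(s in S) [set t | dl <= `|t - s|]); last first.
    by apply/seteqP; split => t H s; exact: H.
  apply: closed_bigI => s _.
  rewrite (_ : mkset _ = (fun t : R => `|t - s|) @^-1` [set y | dl <= y])//.
  apply: closed_comp; last exact: closed_ge.
  move=> t _; apply: (@continuous_comp _ _ _ (fun t : R => t - s) Num.norm); last exact: norm_continuous.
  by apply: continuousB; [exact: cvg_id | exact: cvg_cst].
- move=> t [/KT tT H]; split => // St; have := H t St.
  by rewrite subrr normr0 leNgt dl0.
- move=> t tK; have [Kt|Kt] := pselect (K t); last by rewrite K0 ?mul0r.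
  have [s Ss sd] : exists2 s, S s & `|t - s| < dl.
    apply: contrapT => H; apply: tK; split => // s Ss; rewrite leNgt; apply/negP => sd.
    by apply: H; exists s.
  have := KT _ Kt; rewrite /= in_itv /= => /andP[t0 t1].
  rewrite (chi_eq1 dl0 (ltW t0) _ Ss (ltW sd)) ?subrr ?mulr0//.
  by apply: le_trans (ltW t1) TQ.
Qed.

(** For y = 3 th, z = 2 be and eps = r^x, it says that eps^(2 be) / r and eps^(3 th - 1) are the
    same power of r. *)
Lemma exponent_balance (x y z : R) : x * (1 - y + z) = 1 -> x * z - 1 = - ((1 - y) * x).
Proof. by move=> E; lra. Qed.

Lemma vanishing_power (X C s r0 : R) : 0 < s -> 0 < r0 -> 0 <= X -> 0 <= C ->
  (forall r, 0 < r -> r < r0 -> X <= C * r `^ s) -> X = 0.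
Proof.
move=> s0 r00 X0 C0 H; apply/eqP; rewrite eq_le X0 andbT leNgt; apply/negP => Xp.
have C1 : 0 < C + 1 by rewrite ltr_wpDl.
pose y := X / (2 * (C + 1)); have y0 : 0 < y by rewrite divr_gt0// mulr_gt0.
pose r := Num.min (r0 / 2) (y `^ s^-1).
have rp : 0 < r by rewrite lt_min divr_gt0//= powR_gt0.
have rr0 : r < r0 by rewrite /r gt_min; apply/orP; left; lra.
have ry : r `^ s <= y.
  have -> : y = (y `^ s^-1) `^ s by rewrite -powRrM mulVf ?gt_eqF// powRr1// ltW.
  by apply: ge0_ler_powR; rewrite ?nnegrE ?powR_ge0 ?(ltW s0) ?(ltW rp)// /r ge_min lexx orbT.
have := le_trans (H r rp rr0) (ler_wpM2l C0 ry).
have : y * (2 * (C + 1)) = X by rewrite /y divfK// mulf_neq0 ?pnatr_eq0// gt_eqF.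
move: y y0 {ry r rp rr0} => y y0; have := mulr_ge0 C0 (ltW y0); nra.
Qed.

Section conservation.
Variables (th be q gamma : R) (u : R -> rV -> rV) (b3 b2 : R -> R) (S : set R).
Hypothesis bf : besov_flow Omega T th be q u b3 b2.
Hypotheses (d0 : (0 < d)%N) (q1 : 1 <= q) (th0 : 0 < th) (th1 : th < 1 / 3) (be0 : 0 < be).
Hypothesis dimS : upper_minkowski_dim S = gamma%:E.
Hypothesis gamma1 : gamma < 1.
Hypothesis expo : 1 - (1 - q^-1) * (1 - gamma) < 2 * be / (1 - 3 * th + 2 * be).
Hypothesis cons : forall psi, test_function_line (`]0, T[ `\` S) psi ->
  test_function_line `]0, T[ psi -> \int[leb]_t (nrm2 Omega u t * 'D_1 psi t) = 0.

Let fl : flow Omega T u := bf_flow bf.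

Lemma energy_conserved phi : test_function_line `]0, T[ phi ->
  \int[leb]_t (nrm2 Omega u t * 'D_1 phi t) = 0.
Proof.
move=> tp; have T0 := fl_T fl; have tp' := test_derive tp.
have t0 := th0; have t1 := th1; have b0 := be0; have q1' := q1; have g1 := gamma1.
have q0 : 0 < q by lra.
have qi : q^-1 <= 1 by rewrite invf_le1.
have den : 0 < 1 - 3 * th + 2 * be by lra.
pose a := (1 - 3 * th + 2 * be)^-1; have a0 : 0 < a by rewrite invr_gt0.
pose kap := 1 - q^-1; have kap0 : 0 <= kap by rewrite subr_ge0.
have aE : a * (1 - 3 * th + 2 * be) = 1 by rewrite mulVf// gt_eqF.
have aE2 : a * (2 * be) - 1 = - ((1 - 3 * th) * a) := exponent_balance aE.
have ex : 1 - kap * (1 - gamma) < 2 * be * a := expo.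
(* By the choice of [a], 1 - 2 be a = (1 - 3 th) a, so the hypothesis on exponents is this strict
   inequality with gamma in place of [s1]. Raising gamma by a small m loses at most m, as kap <=
   1. *)
have [s1 [gs s11 es]] : exists s1, [/\ gamma < s1, s1 < 1 & 0 < kap * (1 - s1) - (1 - 3 * th) * a].
  pose g := kap * (1 - gamma) - (1 - 3 * th) * a; have gp : 0 < g by rewrite /g; lra.
  exists (gamma + Num.min ((1 - gamma) / 2) (g / 2)).
  have m1 : Num.min ((1 - gamma) / 2) (g / 2) <= (1 - gamma) / 2 by rewrite ge_min lexx.
  have m2 : Num.min ((1 - gamma) / 2) (g / 2) <= g / 2 by rewrite ge_min lexx orbT.
  have m0 : 0 < Num.min ((1 - gamma) / 2) (g / 2) by rewrite lt_min; apply/andP; split; lra.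
  have qn : 0 <= q^-1 by rewrite invr_ge0 ltW.
  move: (Num.min _ _) m0 m1 m2 => m m0 m1 m2; split; [lra|lra|].
  have -> : kap * (1 - (gamma + m)) - (1 - 3 * th) * a = g - kap * m by rewrite /g; ring.
  have k1 : kap <= 1 by rewrite /kap; lra.
  have : kap * m <= m := ler_piMl (ltW m0) k1.
  by lra.
pose eta := kap * (1 - s1) - (1 - 3 * th) * a.
have [r0 r00 cover] := minkowski_cover dimS gs.
have [C C0 HC] := local_energy bf d0 th0 th1 be0.
have [_ [B B0 HB]] := test_bounded T0 tp; have [_ [B' B'0 HB']] := test_bounded T0 tp'.
have [Cx Cx0 HCx] := @chi_deriv_bound R.
pose N2 := 1 + \int[leb]_t (b2 t `^ q); pose N3 := 1 + \int[leb]_t (b3 t `^ q).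
have N20 : 0 <= N2.
  by rewrite addr_ge0//; apply: (@Rintegral_ge0 _ (measurableTypeR R) R leb) => t _; exact: powR_ge0.
have N30 : 0 <= N3.
  by rewrite addr_ge0//; apply: (@Rintegral_ge0 _ (measurableTypeR R) R leb) => t _; exact: powR_ge0.
(* (B' + B Cx) / r bounds the derivative of phi chi, whose factor 1 / r comes from the cutoff; the
   power of 3 comes from the 3 r-neighbourhood that contains the support of chi. *)
pose K := C * ((B' + B * Cx) * N2 + B * N3) * 3 `^ (kap * (1 - s1)).
have K0 : 0 <= K.
  apply: mulr_ge0; last exact: powR_ge0.
  apply: mulr_ge0 => //; apply: addr_ge0; last exact: mulr_ge0.
  by apply: mulr_ge0 => //; apply: addr_ge0 => //; exact: mulr_ge0.
(* The covering estimate is applied at radius 3 r, which must be at most 1 and below [r0]. *)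
pose r1 := Num.min 3^-1 (r0 / 3).
have r10 : 0 < r1 by rewrite lt_min invr_gt0 ltr0n divr_gt0.
apply/eqP; rewrite -normr_eq0; apply/eqP; apply: (@vanishing_power _ K eta r1) => // r rp rr1.
have [r3 rr0] : r <= 3^-1 /\ r < r0 / 3.
  by move: rr1; rewrite lt_min => /andP[h1 h2]; split => //; exact: ltW.
have r1' : r <= 1 by apply: le_trans r3 _; rewrite invf_le1// ler1n.
have [r3p r3r0 r3le] : [/\ 0 < 3 * r, 3 * r < r0 & 3 * r <= 1].
  by rewrite mulr_gt0// mulrC -ltr_pdivlMr// -ler_pdivlMr// mul1r.
(* Enough cells for the grid of step [r] to reach [T], as [chi] equals 1 near [S] only inside the
   grid. *)
pose Q := (Num.truncn (T / r)).+1.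
have TQ : T <= Q%:R * r by rewrite -ler_pdivrMr//; exact/ltW/truncnS_gt.
pose psi t := phi t * chi S r Q t.
have tpsi : test_function_line `]0, T[ psi := test_chi S r Q tp.
have toff := test_off_chi S rp TQ tp.
have toffT : test_function_line `]0, T[ (fun t => phi t * (1 - chi S r Q t)).
  case: toff => so [Ko [cKo KoT Ko0]]; split => //; exists Ko; split => // t Kt.
  by have [] := KoT t Kt.
have sphi : smooth phi by case: tp.
have schi := smooth_chi S r Q.
have dpsi t : 'D_1 psi t = 'D_1 phi t * chi S r Q t + phi t * 'D_1 (chi S r Q) t.
  have [_ ->] := is_deriveM (is_derive_smooth t (1 : R) sphi) (is_derive_smooth t (1 : R) schi).
  by rewrite addrC /GRing.scale /= [chi S r Q t * _]mulrC.
have split_phi t : 'D_1 phi t = 'D_1 psi t + 'D_1 (fun t => phi t * (1 - chi S r Q t)) t.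
  have so : smooth (fun t => phi t * (1 - chi S r Q t)) by case: toffT.
  have sps : smooth psi by case: tpsi.
  have [_ <-] := is_deriveD (is_derive_smooth t (1 : R) sps) (is_derive_smooth t (1 : R) so).
  congr ('D_1 _ t); apply/funext => y.
  have eqn (A D : R) : A = A * D + A * (1 - D) by ring.
  exact: eqn.
have -> : \int[leb]_t (nrm2 Omega u t * 'D_1 phi t) = \int[leb]_t (nrm2 Omega u t * 'D_1 psi t).
  have j1 := int_test T0 (fl_i2 fl) (test_derive tpsi).
  have j2 := int_test T0 (fl_i2 fl) (test_derive toffT).
  under eq_Rintegral => t _ do rewrite split_phi mulrDr.
  by rewrite (@RintegralD _ (measurableTypeR R) R leb setT _ _ measurableT j1 j2) (cons toff toffT) addr0.
pose D := thick S (3 * r); have mD : measurable D := measurable_thick _ _.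
have far t : t \notin D -> chi S r Q t = 0 /\ 'D_1 (chi S r Q) t = 0.
  move=> tD; apply: chi_supp => // s Ss; rewrite ltNge; apply/negP => ts.
  by move/negP: tD; apply; rewrite inE; exact: thickP Ss ts.
have psiD t : `|psi t| <= B * \1_D t.
  rewrite indicE; have [tD|tD] := boolP (t \in D).
    have /andP[c0 c1] := chi_le1 S r Q t.
    by rewrite mulr1 normrM [X in _ * X]ger0_norm//; apply: le_trans (HB t); rewrite ler_piMr.
  by have [z _] := far t tD; rewrite /psi z mulr0 normr0 mulr0.
have dpsiD t : `|'D_1 psi t| <= (B' + B * Cx) / r * \1_D t.
  rewrite dpsi indicE; have [tD|tD] := boolP (t \in D); last first.
    by have [z z'] := far t tD; rewrite z z' !mulr0 addr0 normr0.
  have /andP[c0 c1] := chi_le1 S r Q t.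
  rewrite mulr1; apply: le_trans (ler_normD _ _) _; rewrite mulrDl; apply: lerD.
    rewrite normrM [X in _ * X]ger0_norm//; apply: (@le_trans _ _ B').
      by apply: le_trans (HB' t); rewrite ler_piMr.
    by rewrite ler_peMr// invf_ge1.
  by rewrite normrM -mulrA ler_pM// HCx.
have cov : (leb D <= ((3 * r) `^ (1 - s1))%:E)%E by exact: cover r3p r3r0 r3le.
have X0 : 0 < (3 * r) `^ (1 - s1) by rewrite powR_gt0// mulr_gt0.
have small (b : R -> R) : (forall t, 0 <= b t) -> leb.-integrable setT (EFin \o b) ->
    leb.-integrable setT (EFin \o (fun t => b t `^ q)) -> forall (c : R) (w : R -> R), 0 <= c ->
    leb.-integrable setT (EFin \o (fun t => b t * `|w t|)) ->
    (forall t, `|w t| <= c * \1_D t) ->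
    \int[leb]_t (b t * `|w t|) <= c * ((3 * r) `^ (kap * (1 - s1)) * (1 + \int[leb]_t (b t `^ q))).
  move=> bb ib iq c w c0 iw wc.
  have H := Rintegral_small_set q1 X0 mD cov bb ib iq.
  rewrite -powRrM [(1 - s1) * _]mulrC in H.
  apply: le_trans (ler_wpM2l c0 H).
  have iD := integrable_indicR mD ib.
  have -> : c * \int[leb]_t (b t * \1_D t) = \int[leb]_t (c * (b t * \1_D t)).
    by rewrite (@RintegralZl _ (measurableTypeR R) R leb).
  apply: (@le_Rintegral _ (measurableTypeR R) R leb) => //.
    exact: (@integrable_scaleR _ (measurableTypeR R) R leb _ _ iD).
  by move=> t _; rewrite mulrCA ler_wpM2l.
have abs_test (b p : R -> R) : leb.-integrable setT (EFin \o b) -> (forall t, 0 <= b t) ->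
    test_function_line `]0, T[ p -> leb.-integrable setT (EFin \o (fun t => b t * `|p t|)).
  move=> ib bb tpp; have H := integrable_norm (int_test T0 ib tpp).
  by move: H; congr (_.-integrable _ _); apply/funext => t /=; rewrite normrM ger0_norm.
have J2 : \int[leb]_t (b2 t * `|'D_1 psi t|) <= (B' + B * Cx) / r * ((3 * r) `^ (kap * (1 - s1)) * N2).
  apply: (small b2 (bf_b2 bf) (bf_i2 bf) (bf_i2q bf) _ (fun t => 'D_1 psi t)) => //.
    by rewrite divr_ge0 ?(ltW rp)// addr_ge0// mulr_ge0.
  exact: abs_test (bf_i2 bf) (bf_b2 bf) (test_derive tpsi).
have J3 : \int[leb]_t (b3 t * `|psi t|) <= B * ((3 * r) `^ (kap * (1 - s1)) * N3).
  apply: (small b3 (bf_b3 bf) (bf_i3 bf) (bf_i3q bf)) => //.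
  exact: abs_test (bf_i3 bf) (bf_b3 bf) tpsi.
have ep : 0 < r `^ a by exact: powR_gt0.
have e1 : r `^ a <= 1 by rewrite -(powRr0 r); apply: powR_le1 => //; exact: ltW.
apply: le_trans (HC _ _ ep e1 tpsi) _.
(* With eps = r^a, the mass term, with the 1 / r of the cutoff, and the flux term carry the same
   negative power of r; the measure of the neighbourhood compensates it, with [eta] > 0 to spare. *)
have P2 : (r `^ a) `^ (2 * be) / r = r `^ (- ((1 - 3 * th) * a)).
  rewrite -powRrM -{2}(powRr1 (ltW rp)) -powRN -powRD; last by rewrite (gt_eqF rp) implybT.
  by rewrite aE2.
have P3 : (r `^ a) `^ (3 * th - 1) = r `^ (- ((1 - 3 * th) * a)).
  by rewrite -powRrM; congr (_ `^ _); ring.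
have PK : r `^ (- ((1 - 3 * th) * a)) * (3 * r) `^ (kap * (1 - s1)) = 3 `^ (kap * (1 - s1)) * r `^ eta.
  rewrite powRM ?(ltW rp)// mulrCA -powRD; last by rewrite (gt_eqF rp) implybT.
  by congr (_ * (_ `^ _)); rewrite /eta addrC.
have F2 : (r `^ a) `^ (2 * be) * \int[leb]_t (b2 t * `|'D_1 psi t|) <=
    (B' + B * Cx) * N2 * (3 `^ (kap * (1 - s1)) * r `^ eta).
  apply: le_trans (ler_wpM2l (powR_ge0 _ _) J2) _.
  rewrite -PK -P2 le_eqVlt; apply/orP; left; apply/eqP.
  by move: (_ `^ _) (_ `^ _) (B' + _) => x y z; ring.
have F3 : (r `^ a) `^ (3 * th - 1) * \int[leb]_t (b3 t * `|psi t|) <=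
    B * N3 * (3 `^ (kap * (1 - s1)) * r `^ eta).
  apply: le_trans (ler_wpM2l (powR_ge0 _ _) J3) _.
  rewrite -PK -P3 le_eqVlt; apply/orP; left; apply/eqP.
  by move: (_ `^ _) (_ `^ _) => x y; ring.
apply: le_trans (ler_wpM2l C0 (lerD F2 F3)) _.
rewrite /K le_eqVlt; apply/orP; left; apply/eqP.
by move: (3 `^ _) (r `^ _) (B' + _) => x y z; ring.
Qed.

End conservation.

End conclusion.

Theorem theorem2p3 (R : realType) (d : nat) (Omega : spatial_domain)
    (T p theta beta gamma : R) (v : R -> 'rV[R]_d -> 'rV[R]_d) (S : set R)
    (d_ge2 : (2 <= d)%N) (T_gt0 : 0 < T) (p_ge3 : 3 <= p)
    (theta_bnd : 0 < theta < 1 / 3) (beta_bnd : 0 < beta < 1)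
    (v_L3 : Lp_besov Omega T p%:E theta 3%:E v)
    (v_L2 : Lp_besov Omega T (2 * p / 3)%:E beta 2%:E v)
    (v_euler : weak_euler Omega T v)
    (S_sub : S `<=` `]0, T[)
    (S_closed : exists2 F : set R, closed F & S = F `&` `]0, T[)
    (S_dim : upper_minkowski_dim S = gamma%:E) (gamma_lt1 : gamma < 1)
    (S_cons : conservative_on Omega T (`]0, T[ `\` S) v)
    (exponents : 2 * beta / (1 - 3 * theta + 2 * beta)
                 > 1 - (p - 3) / p * (1 - gamma)) :
  conserves_kinetic_energy Omega T v.
Proof.
have [th0 th1] := andP theta_bnd; have [be0 _] := andP beta_bnd.
have d0 : (0 < d)%N := ltnW d_ge2.
have [u [b3 [b2 [bf uv]]]] := reduction d0 T_gt0 p_ge3 v_L3 v_L2 v_euler.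
have [_ mv _ _] := v_L3; have fl := bf_flow bf.
have q1 : 1 <= p / 3 by lra.
(* Both quantities are integrable in time to the power q = p/3, and the Hoelder exponent 1 - 1/q is
   the factor (p - 3)/p of the statement. *)
have expo : 1 - (1 - (p / 3)^-1) * (1 - gamma) < 2 * beta / (1 - 3 * theta + 2 * beta).
  have -> : 1 - (p / 3)^-1 = (p - 3) / p by field; rewrite gt_eqF//; lra.
  exact: exponents.
have cons psi : test_function_line (`]0, T[ `\` S) psi -> test_function_line `]0, T[ psi ->
    \int[@lebesgue_measure R]_t (nrm2 Omega u t * 'D_1 psi t) = 0.
  move=> tS tT; have := S_cons psi tS; rewrite /distr_deriv (kinetic_energy_weak mv fl uv tT).
  by move/eqP; rewrite oppr_eq0 mulf_eq0 invr_eq0 pnatr_eq0 /= => /eqP.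
move=> phi tp; rewrite /distr_deriv (kinetic_energy_weak mv fl uv tp).
by rewrite (energy_conserved bf d0 q1 th0 th1 be0 S_dim gamma_lt1 expo cons tp) mulr0 oppr0.
Qed.
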